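(* Let $A$ be an $n\times n$ expansive matrix with rational entries. Then, for some $L\in\mathbb{N}$, there exists an orthonormal wavelet $\Psi=\{\psi^1,\ldots,\psi^L\}$ (with respect to the dilation $A$ and the lattice $\mathbb{Z}^n$) consisting of Schwartz class functions, which is associated with an $(A,\Gamma)$-MRA $\{V_j\}_{j\in\mathbb{Z}}$, $\Gamma=A\mathbb{Z}^n+\mathbb{Z}^n$, of some multiplicity $N\in\mathbb{N}$, whose scaling functions $\varphi^1,\ldots,\varphi^N$ are in the Schwartz class with each $\widehat{\varphi^i}$ a $C^\infty$ real-valued function with compact support. Moreover, each $\widehat{\psi^i}$ is a $C^\infty$ function with compact support.
   Context: A real $n\times n$ matrix $A$ is expansive if all its eigenvalues $\lambda$ satisfy $|\lambda|>1$. Let $T_yf(x)=f(x-y)$, $D_Pf(x)=|\det P|^{1/2}f(Px)$ for $P\in GL_n(\mathbb{R})$, and $\widehat f(\xi)=\int_{\mathbb{R}^n} f(x)e^{-2\pi i\langle x,\xi\rangle}dx$. For a lattice $\Gamma$ and a finite $\Phi\subset L^2(\mathbb{R}^n)$ put $E^\Gamma(\Phi)=\{T_\gamma\varphi:\gamma\in\Gamma,\ \varphi\in\Phi\}$. A finite collection $\Psi=\{\psi^1,\ldots,\psi^L\}\subset L^2(\mathbb{R}^n)$ is an orthonormal wavelet (for the dilation $A$ and lattice $\mathbb{Z}^n$) if $\{D_{A^j}T_k\psi^l: j\in\mathbb{Z},\ k\in\mathbb{Z}^n,\ l=1,\ldots,L\}$ is an orthonormal basis of $L^2(\mathbb{R}^n)$.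 For a full rank lattice $\Gamma\subset\mathbb{R}^n$, an $(A,\Gamma)$-MRA of multiplicity $N$ is a sequence $\{V_j\}_{j\in\mathbb{Z}}$ of closed subspaces of $L^2(\mathbb{R}^n)$ such that: (M1) $V_j\subset V_{j+1}$ for all $j$; (M2) $\bigcap_jV_j=\{0\}$; (M3) $\overline{\bigcup_jV_j}=L^2(\mathbb{R}^n)$; (M4) $f\in V_0\iff f(A^j\cdot)\in V_j$ for all $j\in\mathbb{Z}$; (M5) there exists $\Phi=\{\varphi^1,\ldots,\varphi^N\}\subset V_0$ (the scaling functions) such that $E^\Gamma(\Phi)$ is an orthonormal basis of $V_0$. The wavelet $\Psi$ is associated with the MRA $\{V_j\}$ if $E^{\mathbb{Z}^n}(\Psi)$ is an orthonormal basis of $V_1\ominus V_0$, the orthogonal complement of $V_0$ in $V_1$. *)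

(* Defs.v *)
From HB Require Import structures.
From mathcomp Require Import all_boot all_order all_algebra.
From mathcomp Require Import complex.
From mathcomp Require Import all_classical all_reals all_analysis.

Set Implicit Arguments.
Unset Strict Implicit.
Unset Printing Implicit Defensive.

Import Order.TTheory GRing.Theory Num.Theory.
Import numFieldNormedType.Exports.

Local Open Scope classical_set_scope.
Local Open Scope ring_scope.
Local Open Scope complex_scope.

(* Column vectors carry the product sigma-algebra, generated by the coordinate
   projections (the Borel sets of R^n). *)
Section measurable_cV.
Context {R : realType} (n : nat).

Let coord (i : 'I_n) (x : 'cV[R]_n) : measurableTypeR R := x i 0.

Let cV_set0 : g_sigma_preimage coord set0.
Proof. exact: sigma_algebra0. Qed.

Let cV_setC B : g_sigma_preimage coord B -> g_sigma_preimage coord (~` B).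
Proof. exact: sigma_algebraC. Qed.

Let cV_bigcup (F : _^nat) : (forall i, g_sigma_preimage coord (F i)) ->
  g_sigma_preimage coord (\bigcup_i (F i)).
Proof. exact: sigma_algebra_bigcup. Qed.

HB.instance Definition _ := @isMeasurable.Build
  (measure_tuple_display (R.-ocitv.-measurable).-sigma)
  'cV[R]_n (g_sigma_preimage coord) cV_set0 cV_setC cV_bigcup.
End measurable_cV.

Section lebesgue_cV.
Context {R : realType}.

Lemma measurable_coord n (i : 'I_n) :
  measurable_fun [set: 'cV[R]_n] (fun x : 'cV[R]_n => x i 0).
Proof.
move=> _ Y mY; rewrite setTI; apply: sub_sigma_algebra => /=.
rewrite -bigcup_seq/=; exists i => /=; first by rewrite mem_index_enum.
by exists Y => //; rewrite setTI.
Qed.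

Lemma measurable_fun_cV d (T : measurableType d) n (f : T -> 'cV[R]_n) :
  (forall i, measurable_fun [set: T] (fun t => f t i 0)) ->
  measurable_fun [set: T] f.
Proof.
move=> mf; apply: (@measurability _ _ _ _ setT f
  (\big[setU/set0]_(i < n) preimage_set_system setT
     (fun x : 'cV[R]_n => x i 0) measurable)) => //.
move=> _ [B + <-]; rewrite -bigcup_seq/= => -[i _ [C mC <-]].
by rewrite setTI -comp_preimage; apply: mf.
Qed.

Definition cons_cV (n : nat) (p : R * 'cV[R]_n) : 'cV[R]_n.+1 :=
  col_mx (const_mx p.1 : 'cV[R]_1) p.2.

Definition uncons_cV (n : nat) (v : 'cV[R]_n.+1) : R * 'cV[R]_n :=
  (v 0 0, dsubmx (v : 'cV[R]_(1 + n))).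

Lemma cons_cVK n : cancel (@cons_cV n) (@uncons_cV n).
Proof.
move=> [x y]; rewrite /uncons_cV /cons_cV col_mxKd/=; congr (_, _).
have -> : (0 : 'I_n.+1) = lshift n (0 : 'I_1) by apply: ord_inj.
by rewrite (@col_mxEu _ 1 n 1) mxE.
Qed.

Lemma measurable_cons_cV n : measurable_fun setT (@cons_cV n).
Proof.
apply: measurable_fun_cV => i; rewrite /cons_cV.
have [j ->|j ->] := split_ordP (i : 'I_(1 + n)).
- rewrite (_ : (fun t => _) = fst); first exact: measurable_fst.
  by apply/funext => t; rewrite (@col_mxEu _ 1 n 1) mxE.
- rewrite (_ : (fun t => _) = (fun x : 'cV[R]_n => x j 0) \o snd).
    by apply: measurableT_comp; [exact: measurable_coord|exact: measurable_snd].
  by apply/funext => t; rewrite (@col_mxEd _ 1 n 1).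
Qed.

Lemma measurable_uncons_cV n : measurable_fun setT (@uncons_cV n).
Proof.
apply/measurable_fun_pairP; split; first exact: measurable_coord.
apply: measurable_fun_cV => i; rewrite [X in measurable_fun _ X](_ : _ =
  (fun x : 'cV[R]_n.+1 => x (rshift 1 i) 0)); first exact: measurable_coord.
by apply/funext => t; rewrite /= mxE.
Qed.

Section step.
Variables (n : nat) (mu : {sigma_finite_measure set 'cV[R]_n -> \bar R}).

Definition lebesgue_cV_step : set 'cV[R]_n.+1 -> \bar R :=
  pushforward (@lebesgue_measure R \x mu)%E (@cons_cV n).

HB.instance Definition _ := Measure.copy lebesgue_cV_step
  (measure_function_pushforward__canonical__measure_function_Measure
    (@lebesgue_measure R \x mu)%E (@measurable_cons_cV n)).

Let step_sigma_finite : sigma_finite setT lebesgue_cV_step.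
Proof.
have /sigma_finiteP[G [GT Gnd Goo]] := sigma_finiteT mu.
have /sigma_finiteP[F [FT Fnd Foo]] := sigma_finiteT (@lebesgue_measure R).
exists (fun k => @uncons_cV n @^-1` (F k `*` G k)).
  rewrite -preimage_bigcup (_ : \bigcup_k _ = setT) ?preimage_setT//.
  rewrite -subTset => -[x y] _.
  have [k _ Fk] : (\bigcup_k F k) x by rewrite -FT.
  have [l _ Gl] : (\bigcup_k G k) y by rewrite -GT.
  exists (maxn k l) => //; split => /=.
  - by move: x Fk; exact/subsetPset/Fnd/leq_maxl.
  - by move: y Gl; exact/subsetPset/Gnd/leq_maxr.
move=> k; have [mF Fk] := Foo k; have [mG Gk] := Goo k; split.
  rewrite -[X in measurable X]setTI.
  by apply: measurable_uncons_cV => //; exact: measurableX.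
rewrite /lebesgue_cV_step /pushforward -comp_preimage.
rewrite (_ : _ \o _ = id); last by apply/funext => x /=; rewrite cons_cVK.
rewrite preimage_id product_measure1E// lte_mul_pinfty//.
by rewrite ge0_fin_numE.
Qed.

HB.instance Definition _ := @Measure_isSigmaFinite.Build _ _ _
  lebesgue_cV_step step_sigma_finite.

End step.

(* Lebesgue measure on R^n, as the n-fold product of [lebesgue_measure] through
   the identification R * R^n = R^(n+1). *)
Fixpoint lebesgue_cV n : {sigma_finite_measure set 'cV[R]_n -> \bar R} :=
  if n is n'.+1 then lebesgue_cV_step (lebesgue_cV n')
  else @dirac _ 'cV[R]_0 0 R.

End lebesgue_cV.

Section euclidean_L2.
Context {R : realType} (n : nat).
Local Notation Re := (@complex.Re R).
Local Notation Im := (@complex.Im R).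
Local Notation normc := (@Normc.normc R).
Implicit Types (f g : 'cV[R]_n -> R[i]) (V S : set ('cV[R]_n -> R[i])).

(* Meaningful for integrable f only: [\int] over the reals is total. *)
Definition cintegral f : R[i] :=
  (\int[lebesgue_cV n]_x Re (f x))
  +i* (\int[lebesgue_cV n]_x Im (f x)).

Definition L2norm f : \bar R :=
  'N[lebesgue_cV n]_2%:E[EFin \o (normc \o f)]%E.

(* L^2 is represented by genuine functions, not by classes: subsets of L^2
   that are closed in the sense of [L2_closure] are automatically saturated
   for almost everywhere equality. *)
Definition L2 : set ('cV[R]_n -> R[i]) :=
  [set f : 'cV[R]_n -> R[i] | [/\ measurable_fun setT (Re \o f),
               measurable_fun setT (Im \o f) &
               (L2norm f < +oo)%E]].

Definition inner f g : R[i] := cintegral (fun x => f x * conjc (g x)).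

Definition L2_closure S : set ('cV[R]_n -> R[i]) :=
  [set f : 'cV[R]_n -> R[i] | L2 f /\ forall e : R, 0 < e ->
     exists2 g, S g & (L2norm (fun x => f x - g x)%R < e%:E)%E].

Definition closed_subspace V :=
  [/\ V `<=` L2, V (fun=> 0),
      forall (a : R[i]) f g, V f -> V g -> V (fun x => a * f x + g x) &
      L2_closure V `<=` V].

Definition orthocompl V S := [set f : 'cV[R]_n -> R[i] | V f /\ forall g, S g -> inner f g = 0].

(* Families are indexed by the elements of D: orthonormality is that of the
   family, so distinct indices give distinct (orthogonal) vectors. *)
Section families.
Variables (I : Type) (D : set I) (e : I -> 'cV[R]_n -> R[i]).

Definition lin_span : set ('cV[R]_n -> R[i]) :=
  [set f : 'cV[R]_n -> R[i] | exists m (i : 'I_m -> I) (c : 'I_m -> R[i]),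
     (forall k, D (i k)) /\ f = (fun x => \sum_k c k * e (i k) x)].

Definition orthonormal_basis V :=
  [/\ forall i, D i -> V (e i),
      forall i, D i -> inner (e i) (e i) = 1,
      forall i j, D i -> D j -> i <> j -> inner (e i) (e j) = 0 &
      V `<=` L2_closure lin_span].

End families.

(* C^infinity means that the iterated partial derivatives of all orders, in any
   order of the variables, exist everywhere and are continuous; for complex
   functions this is required of the real and imaginary parts. *)
Definition partial (i : 'I_n) (f : 'cV[R]_n -> R) (x : 'cV[R]_n) : R :=
  'D_(delta_mx i 0 : 'cV[R]_n) f x.

Definition partials (s : seq 'I_n) (f : 'cV[R]_n -> R) : 'cV[R]_n -> R :=
  foldr partial f s.

Definition rsmooth (f : 'cV[R]_n -> R) := forall s : seq 'I_n,
  continuous (partials s f) /\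
  forall i x, derivable (partials s f) x (delta_mx i 0 : 'cV[R]_n).

Definition smooth f := rsmooth (Re \o f) /\ rsmooth (Im \o f).

Definition cpartials (s : seq 'I_n) f (x : 'cV[R]_n) : R[i] :=
  partials s (Re \o f) x +i* partials s (Im \o f) x.

Definition schwartz f := smooth f /\
  forall (a : 'I_n -> nat) (s : seq 'I_n), exists C : R, forall x : 'cV[R]_n,
    `|\prod_i x i 0 ^+ a i| * normc (cpartials s f x) <= C.

Definition real_valued f := forall x, Im (f x) = 0.

Definition compact_support f := compact (closure [set x | f x != 0]).

Definition dot (x y : 'cV[R]_n) : R := \sum_i x i 0 * y i 0.

Definition expi (t : R) : R[i] := cos t +i* sin t.

Definition fourier f (xi : 'cV[R]_n) : R[i] :=
  cintegral (fun x => f x * expi (- (2 * pi * dot x xi))).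

Definition translate (y : 'cV[R]_n) f : 'cV[R]_n -> R[i] :=
  fun x => f (x - y).

Definition dilate (P : 'M[R]_n) f : 'cV[R]_n -> R[i] :=
  fun x => (Num.sqrt `|\det P|)%:C * f (P *m x).

Definition expansive (A : 'M[R]_n) :=
  forall l : R[i], eigenvalue (map_mx (fun a : R => a%:C) A) l -> 1 < `|l|.

Definition int_lattice : set 'cV[R]_n :=
  [set map_mx intr k | k in [set: 'cV[int]_n]].

Definition full_rank_lattice (G : set 'cV[R]_n) :=
  exists2 P : 'M[R]_n, P \in unitmx & G = [set P *m k | k in int_lattice].

Definition translates_onb (G : set 'cV[R]_n) (N : nat)
    (phi : 'I_N -> 'cV[R]_n -> R[i]) V :=
  orthonormal_basis [set p : 'cV[R]_n * 'I_N | G p.1]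
    (fun p => translate p.1 (phi p.2)) V.

Definition scaling_functions (G : set 'cV[R]_n) (N : nat)
    (phi : 'I_N -> 'cV[R]_n -> R[i]) V :=
  (forall i, V (phi i)) /\ translates_onb G phi V.

Definition associated (L : nat) (psi : 'I_L -> 'cV[R]_n -> R[i])
    (V : int -> set ('cV[R]_n -> R[i])) :=
  translates_onb int_lattice psi (orthocompl (V 1) (V 0)).

End euclidean_L2.

Arguments L2 {R n}.
Arguments int_lattice {R n}.

(* The dimension is written n.+1 so that square matrices form a unit ring and
   the power A ^ j makes sense for j : int. In dimension 0 the system
   D_{A^j} T_k psi is never an orthonormal basis. *)
Section wavelets.
Context {R : realType} (n : nat).
Implicit Types (A : 'M[R]_n.+1).

Definition orthonormal_wavelet A (L : nat)
    (psi : 'I_L -> 'cV[R]_n.+1 -> R[i]) :=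
  orthonormal_basis
    [set p : int * 'cV[R]_n.+1 * 'I_L | int_lattice p.1.2]
    (fun p => dilate (A ^ p.1.1) (translate p.1.2 (psi p.2)))
    L2.

Definition dilation_lattice A : set 'cV[R]_n.+1 :=
  [set A *m k + l | k in int_lattice & l in int_lattice].

Record is_MRA A (G : set 'cV[R]_n.+1) (N : nat)
    (V : int -> set ('cV[R]_n.+1 -> R[i])) : Prop := {
  mra_lattice : full_rank_lattice G ;
  mra_subspace : forall j, closed_subspace (V j) ;
  mra_nested : forall j : int, V j `<=` V (j + 1) ;
  mra_cap : \bigcap_j V j =
    [set f : 'cV[R]_n.+1 -> R[i] | L2 f /\ {ae lebesgue_cV n.+1, forall x, f x = 0}] ;
  mra_dense : L2_closure (\bigcup_j V j) = L2 ;
  mra_dilation : forall (j : int) f,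
    V 0 f <-> V j (fun x => f (A ^ j *m x)) ;
  mra_scaling : exists phi : 'I_N -> 'cV[R]_n.+1 -> R[i],
    scaling_functions G phi (V 0)
}.

End wavelets.

(* Main.v *)
(* Everything happens on the Fourier side.  Put B = A^T.  Since A is rational and expansive there
   are an integer matrix P, with B P integral too, and a quadratic form Q, diagonal in the
   coordinates P^-1 xi, that B^-1 contracts by a factor rho < 1.  Tensor products of Meyer-type
   Wilson functions, composed with P^-1, are smooth compactly supported functions u_m, each
   concentrated near the points of two opposite centres in every coordinate, whose modulates by
   P^-T Z^n form an orthonormal system.  V_0 is spanned by the u_m with centre in a large ellipsoid:
   it contains every function with spectrum in {Q <= r_in} and all its spectra lie in
   {Q <= r_out}; as rho r_out < r_in, the dilates of V_0 are nested.  The u_m come in pairs, and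
   rotating the pairs gives real generators over A Z^n + Z^n.  Over Z^n both V_0 and V_1 have finite
   orthonormal systems of generators phi and chi, with phi = S chi for a smooth periodic matrix S
   such that S S^* = 1.  When many rows are missing, a unit row depending smoothly on a point of the
   torus misses a constant direction, so Householder reflections complete S to a smooth unitary
   matrix; the additional rows, applied to chi, are the wavelets. *)
Require Import Defs.
From mathcomp Require Import all_boot all_order all_algebra.
From mathcomp Require Import complex.
From mathcomp Require Import all_classical all_reals all_analysis.
From mathcomp Require Import measurable_realfun ring lra zify.

Set Implicit Arguments.
Unset Strict Implicit.
Unset Printing Implicit Defensive.

Import Order.TTheory GRing.Theory Num.Theory.
Import numFieldNormedType.Exports.

Local Open Scope classical_set_scope.
Local Open Scope ring_scope.

(** * Complex-valued integrals *)

Section complex_integral.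
Context d (T : measurableType d) (R : realType).
Variable mu : {measure set T -> \bar R}.
Local Notation Re := (@complex.Re R).
Local Notation Im := (@complex.Im R).
Local Notation normc := (@Normc.normc R).
Implicit Types (f g : T -> R[i]).

(** Two opposite centres are needed because of the Balian-Low obstruction: no single smooth window
    of compact support has modulates and lattice shifts that form an orthonormal basis. Wilson's
    alternating signs avoid it. The factor rho may be close to 1, while cutting the system off at an
    ellipsoid blurs its boundary. The blur has bounded width in the coordinates P^-1 xi, so a large
    ellipsoid brings r_out / r_in as close to 1 as nesting requires. The form is diagonalised over
    the rationals, without square roots, so P and A^T P can be made integral together; then Z^n and
    A Z^n + Z^n both lie in P^-T Z^n with finite index, and coset representatives turn one system
    into a finite one over either lattice. The completion wants more missing rows than the torus has
    dimensions. Their number is a multiple of the number of windows, which is made large; it is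
    positive because at some frequency all generators of V_0 vanish and one of V_1 does not. That a
    smooth row misses a direction is a pigeonhole count for Lipschitz functions, in the role of
    Sard's theorem. *)

Lemma normcE (z : R[i]) : normc z = Num.sqrt (Re z ^+ 2 + Im z ^+ 2).
Proof. by case: z. Qed.

Lemma sqr_normcE (z : R[i]) : normc z ^+ 2 = Re z ^+ 2 + Im z ^+ 2.
Proof. by rewrite normcE sqr_sqrtr // addr_ge0 ?sqr_ge0. Qed.

Lemma normc_ge0 (z : R[i]) : 0 <= normc z.
Proof. by rewrite normcE sqrtr_ge0. Qed.

Lemma normc_Re (z : R[i]) : `|Re z| <= normc z.
Proof. by rewrite normcE -sqrtr_sqr ler_wsqrtr // lerDl sqr_ge0. Qed.

Lemma normc_Im (z : R[i]) : `|Im z| <= normc z.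
Proof. by rewrite normcE -sqrtr_sqr ler_wsqrtr // lerDr sqr_ge0. Qed.

Lemma normc_le (z : R[i]) : normc z <= `|Re z| + `|Im z|.
Proof.
rewrite -(ler_pXn2r (_ : 0 < 2)%N) ?nnegrE ?normc_ge0 ?addr_ge0 //.
rewrite sqr_normcE sqrrD !real_normK ?num_real //.
by rewrite -addrA lerD2l lerDr mulrn_wge0 // mulr_ge0.
Qed.

Lemma normc_conjc (z : R[i]) : normc (conjc z) = normc z.
Proof. by case: z => a b; rewrite !normcE /= sqrrN. Qed.

Lemma normc_real (a : R) : normc (a%:C)%C = `|a|.
Proof. by rewrite normcE /= expr0n addr0 sqrtr_sqr. Qed.

Lemma normc_normr (z : R[i]) : `|z| = (normc z)%:C%C.
Proof. by rewrite normc_def normcE. Qed.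

Lemma mulc_conj (z : R[i]) : z * conjc z = (normc z ^+ 2)%:C%C.
Proof. by rewrite -sqr_normc normc_normr rmorphXn. Qed.

Lemma normc_distC (x y : R[i]) : normc (x - y) = normc (y - x).
Proof. by rewrite -normcN opprB. Qed.

Lemma normc_sum I (r : seq I) (P : pred I) (F : I -> R[i]) :
  normc (\sum_(i <- r | P i) F i) <= \sum_(i <- r | P i) normc (F i).
Proof.
elim/big_rec2: _ => [|i y1 y2 _ h]; first by rewrite Normc.normc0.
by rewrite (le_trans (le_normcD _ _)) // lerD2l.
Qed.

Lemma sqr_normcD (x y : R[i]) :
  normc (x + y) ^+ 2 <= 2 * normc x ^+ 2 + 2 * normc y ^+ 2.
Proof.
rewrite !sqr_normcE /=; case: x => a b; case: y => c e /=.
by have := sqr_ge0 (a - c); have := sqr_ge0 (b - e); nra.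
Qed.

Definition cmeas f :=
  measurable_fun setT (Re \o f) /\ measurable_fun setT (Im \o f).

Lemma cmeasD f g : cmeas f -> cmeas g -> cmeas (fun x => f x + g x).
Proof.
move=> [f1 f2] [g1 g2]; split.
  rewrite (_ : _ \o _ = (Re \o f) \+ (Re \o g)); first exact: measurable_funD.
  by apply/funext => x /=; case: (f x); case: (g x).
rewrite (_ : _ \o _ = (Im \o f) \+ (Im \o g)); first exact: measurable_funD.
by apply/funext => x /=; case: (f x); case: (g x).
Qed.

Lemma cmeasM f g : cmeas f -> cmeas g -> cmeas (fun x => f x * g x).
Proof.
move=> [f1 f2] [g1 g2]; split.
  rewrite (_ : _ \o _ = ((Re \o f) \* (Re \o g)) \- ((Im \o f) \* (Im \o g))).
    by apply: measurable_funB; exact: measurable_funM.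
  by apply/funext => x /=; case: (f x); case: (g x).
rewrite (_ : _ \o _ = ((Re \o f) \* (Im \o g)) \+ ((Im \o f) \* (Re \o g))).
  by apply: measurable_funD; exact: measurable_funM.
by apply/funext => x /=; case: (f x) => a b; case: (g x).
Qed.

Lemma cmeas_conj f : cmeas f -> cmeas (fun x => conjc (f x)).
Proof.
move=> [f1 f2]; split.
  by rewrite (_ : _ \o _ = Re \o f) //; apply/funext => x /=; case: (f x).
rewrite (_ : _ \o _ = \- (Im \o f)); first exact: measurable_funN.
by apply/funext => x /=; case: (f x).
Qed.

Lemma cmeas_cst (z : R[i]) : cmeas (fun=> z).
Proof. by split; exact: measurable_cst. Qed.

Lemma cmeas_real (u : T -> R) : measurable_fun setT u ->
  cmeas (fun x => (u x)%:C%C).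
Proof. by move=> mu_; split=> //; exact: measurable_cst. Qed.

Lemma cmeasN f : cmeas f -> cmeas (fun x => - f x).
Proof.
move=> mf; rewrite (_ : (fun x => _) = (fun x => (-1) * f x)).
  by apply: cmeasM => //; exact: cmeas_cst.
by apply/funext => x; rewrite mulN1r.
Qed.

Lemma cmeasB f g : cmeas f -> cmeas g -> cmeas (fun x => f x - g x).
Proof. by move=> mf mg; apply: cmeasD => //; exact: cmeasN. Qed.

Lemma measurable_normc f : cmeas f -> measurable_fun setT (normc \o f).
Proof.
move=> [f1 f2].
rewrite (_ : _ \o _ = (fun x => Num.sqrt (Re (f x) ^+ 2 + Im (f x) ^+ 2))).
  apply: (measurableT_comp (continuous_measurable_fun (@sqrt_continuous R))).
  apply: measurable_funD.
    exact: (@measurable_funX _ _ _ _ (Re \o f) 2).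
  exact: (@measurable_funX _ _ _ _ (Im \o f) 2).
by apply/funext => x /=; rewrite normcE.
Qed.

(** [cintegral] over an arbitrary measure, as Fubini and the one-dimensional factors require; over
    [lebesgue_cV] the two are convertible. *)
Definition cint f : R[i] :=
  ((\int[mu]_x Re (f x)) +i* (\int[mu]_x Im (f x)))%C.

Definition cintegrable f :=
  mu.-integrable setT (EFin \o (Re \o f)) /\
  mu.-integrable setT (EFin \o (Im \o f)).

Lemma cintegrable_cmeas f : cintegrable f -> cmeas f.
Proof.
by move=> [/integrableP[/measurable_EFinP ? _]]
  /integrableP[/measurable_EFinP ? _].
Qed.

Lemma cintegrable_le f (g : T -> R) : cmeas f ->
  mu.-integrable setT (EFin \o g) -> (forall x, normc (f x) <= g x) ->
  cintegrable f.
Proof.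
move=> [f1 f2] ig fg; split; apply: le_integrable ig => //=;
  try exact/measurable_EFinP.
  move=> x _; rewrite lee_fin (le_trans (normc_Re _)) //.
  exact: le_trans (fg x) (ler_norm _).
move=> x _; rewrite lee_fin (le_trans (normc_Im _)) //.
exact: le_trans (fg x) (ler_norm _).
Qed.

Lemma cintegrable_normc f : cintegrable f ->
  mu.-integrable setT (EFin \o (normc \o f)).
Proof.
move=> intf; have mf := cintegrable_cmeas intf; case: intf => i1 i2.
have i12 := integrableD measurableT (integrable_abse i1) (integrable_abse i2).
apply: (le_integrable _ _ _ i12) => //=.
  by apply/measurable_EFinP; exact: measurable_normc.
move=> x _; rewrite ger0_norm ?normc_ge0 // ger0_norm ?addr_ge0 //.
by rewrite lee_fin normc_le.
Qed.

Lemma cintegrableP f : cmeas f ->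
  cintegrable f <-> mu.-integrable setT (EFin \o (normc \o f)).
Proof.
move=> mf; split; first exact: cintegrable_normc.
by move=> i; apply: (cintegrable_le mf i).
Qed.

Lemma cintegrable_norm_lty f : cmeas f ->
  cintegrable f <-> (\int[mu]_x (normc (f x))%:E < +oo)%E.
Proof.
move=> mf; rewrite cintegrableP //; split.
  move=> /integrableP[_]; congr (_ < _)%E; apply: eq_integral => x _ /=.
  by rewrite ger0_norm ?normc_ge0.
move=> h; apply/integrableP; split.
  by apply/measurable_EFinP; exact: measurable_normc.
rewrite (le_lt_trans _ h) // le_eqVlt; apply/orP; left; apply/eqP.
by apply: eq_integral => x _ /=; rewrite ger0_norm ?normc_ge0.
Qed.

Lemma cintegrableD f g : cintegrable f -> cintegrable g ->
  cintegrable (fun x => f x + g x).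
Proof.
move=> fi gi; have [f1 f2] := fi; have [g1 g2] := gi.
have mfg := cmeasD (cintegrable_cmeas fi) (cintegrable_cmeas gi).
have i12 := integrableD measurableT (cintegrable_normc fi) (cintegrable_normc gi).
by apply: (@cintegrable_le _ (fun x => normc (f x) + normc (g x))) => // x;
  exact: le_normcD.
Qed.

Lemma cintegrableZ (z : R[i]) f : cintegrable f ->
  cintegrable (fun x => z * f x).
Proof.
move=> fi; have i := integrableZl measurableT (normc z) (cintegrable_normc fi).
apply: (@cintegrable_le _ (fun x => normc z * normc (f x))).
- by apply: cmeasM; [exact: cmeas_cst|exact: cintegrable_cmeas].
- by apply: eq_integrable i => // x _ /=; rewrite EFinM.
- by move=> x; rewrite Normc.normcM.
Qed.

Lemma cintegrable0 : cintegrable (fun=> 0).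
Proof. by split; exact: integrable0. Qed.

Lemma cintegrableN f : cintegrable f -> cintegrable (fun x => - f x).
Proof.
move=> /(cintegrableZ (-1)); congr cintegrable; apply/funext => x.
by rewrite mulN1r.
Qed.

Lemma cintegrableB f g : cintegrable f -> cintegrable g ->
  cintegrable (fun x => f x - g x).
Proof. by move=> fi gi; apply: cintegrableD => //; exact: cintegrableN. Qed.

Lemma cintegrable_conj f : cintegrable f -> cintegrable (fun x => conjc (f x)).
Proof.
move=> fi; apply: (@cintegrable_le _ (normc \o f)).
- exact/cmeas_conj/cintegrable_cmeas.
- exact: cintegrable_normc.
- by move=> x; rewrite normc_conjc.
Qed.

Lemma cintegrable_sum I (r : seq I) (P : pred I) (F : I -> T -> R[i]) :
  (forall i, cintegrable (F i)) ->
  cintegrable (fun x => \sum_(i <- r | P i) F i x).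
Proof.
move=> iF; elim: r => [|i r ih].
  rewrite (_ : (fun x => _) = (fun=> 0)); first exact: cintegrable0.
  by apply/funext => x; rewrite big_nil.
rewrite (_ : (fun x => _) = (fun x => (if P i then F i x else 0) +
   \sum_(j <- r | P j) F j x)).
  by apply: cintegrableD => //; case: (P i) => //; exact: cintegrable0.
by apply/funext => x; rewrite big_cons; case: (P i); rewrite ?add0r.
Qed.

Lemma cintD f g : cintegrable f -> cintegrable g ->
  cint (fun x => f x + g x) = cint f + cint g.
Proof.
move=> [f1 f2] [g1 g2]; rewrite /cint; simpc; congr (_ +i* _)%C.
  rewrite -RintegralD //; apply: eq_Rintegral => x _.
  by case: (f x); case: (g x).
rewrite -RintegralD //; apply: eq_Rintegral => x _.
by case: (f x); case: (g x).
Qed.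

Lemma cint0 : cint (fun=> 0) = 0.
Proof. by rewrite /cint /= /Rintegral integral0. Qed.

Lemma cintZ (z : R[i]) f : cintegrable f ->
  cint (fun x => z * f x) = z * cint f.
Proof.
move=> [f1 f2]; rewrite /cint; case: z => a b; simpc; congr (_ +i* _)%C.
  transitivity (\int[mu]_x (a * Re (f x) - b * Im (f x))).
    by apply: eq_Rintegral => x _; case: (f x).
  rewrite RintegralB //; last 2 first.
  - by apply: eq_integrable (integrableZl measurableT a f1) => // x _ /=; rewrite EFinM.
  - by apply: eq_integrable (integrableZl measurableT b f2) => // x _ /=; rewrite EFinM.
  by rewrite !RintegralZl.
transitivity (\int[mu]_x (a * Im (f x) + b * Re (f x))).
  by apply: eq_Rintegral => x _; case: (f x).
rewrite RintegralD //; last 2 first.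
- by apply: eq_integrable (integrableZl measurableT a f2) => // x _ /=; rewrite EFinM.
- by apply: eq_integrable (integrableZl measurableT b f1) => // x _ /=; rewrite EFinM.
by rewrite !RintegralZl.
Qed.

Lemma cintN f : cintegrable f -> cint (fun x => - f x) = - cint f.
Proof.
by move=> fi; rewrite -mulN1r -cintZ //; congr cint; apply/funext => x; rewrite mulN1r.
Qed.

Lemma cintB f g : cintegrable f -> cintegrable g ->
  cint (fun x => f x - g x) = cint f - cint g.
Proof. by move=> fi gi; rewrite cintD ?cintN //; exact: cintegrableN. Qed.

Lemma cint_sum I (r : seq I) (P : pred I) (F : I -> T -> R[i]) :
  (forall i, cintegrable (F i)) ->
  cint (fun x => \sum_(i <- r | P i) F i x) = \sum_(i <- r | P i) cint (F i).
Proof.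
move=> iF; elim: r => [|i r ih].
  by rewrite big_nil -[RHS]cint0; congr cint; apply/funext => x; rewrite big_nil.
rewrite big_cons; case: ifPn => Pi.
  rewrite -ih -cintD //; last exact: cintegrable_sum.
  by congr cint; apply/funext => x; rewrite big_cons Pi.
by rewrite -ih; congr cint; apply/funext => x; rewrite big_cons (negbTE Pi).
Qed.

(** Negation exchanges positive and negative part, which reverses a difference of extended reals;
    [fine] sends both infinite outcomes to 0, so non-integrable functions are covered. This makes
    [cint_conj], and with it [innerC], hold for the total integral. *)
Lemma Rintegral_opp (u : T -> R) : \int[mu]_x (- u x) = - \int[mu]_x u x.
Proof.
rewrite /Rintegral.
under eq_integral do rewrite EFinN.
rewrite integralE [in RHS]integralE.
have := funeposN (EFin \o u); have := funenegN (EFin \o u); rewrite /comp => -> ->.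
set A := (\int[mu]_x _)%E; set B := (\int[mu]_x _)%E.
have A0 : (0 <= A)%E by apply: integral_ge0 => x _; rewrite funeneg_ge0.
have B0 : (0 <= B)%E by apply: integral_ge0 => x _; rewrite funepos_ge0.
by move: A0 B0; case: A => [a| |]; case: B => [b| |] //= _ _; rewrite ?opprB ?oppr0.
Qed.

Lemma cint_conj f : cint (fun x => conjc (f x)) = conjc (cint f).
Proof.
rewrite /cint /=; congr (_ +i* _)%C.
  by apply: eq_Rintegral => x _; case: (f x).
by rewrite -Rintegral_opp; apply: eq_Rintegral => x _; case: (f x).
Qed.

Lemma cint_real (u : T -> R) : cint (fun x => (u x)%:C%C) = (\int[mu]_x u x)%:C%C.
Proof. by rewrite /cint /= /Rintegral integral0. Qed.

(* The constant 2 comes from bounding the two components separately. *)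
Lemma normc_cint_le f : cintegrable f ->
  normc (cint f) <= 2 * \int[mu]_x normc (f x).
Proof.
move=> fi; have [f1 f2] := fi; have fn := cintegrable_normc fi.
apply: le_trans (normc_le _) _; rewrite mulr_natl mulr2n /=.
apply: lerD; apply: le_trans (le_normr_Rintegral _ _) _ => //.
  apply: le_Rintegral => //; last by move=> x _; exact: normc_Re.
  exact: (integrable_abse f1).
apply: le_Rintegral => //; last by move=> x _; exact: normc_Im.
exact: (integrable_abse f2).
Qed.

(** Dominated convergence for the two components. Convergence of complex numbers is stated through
    the modulus of the difference, so that only limits of real sequences occur. *)
Lemma cint_dct (F : nat -> T -> R[i]) f (g : T -> R) :
  (forall k, cmeas (F k)) -> cmeas f ->
  (forall x, (fun k => normc (F k x - f x)) @ \oo --> 0) ->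
  mu.-integrable setT (EFin \o g) ->
  (forall k x, normc (F k x) <= g x) ->
  cintegrable f /\ (fun k => normc (cint (F k) - cint f)) @ \oo --> 0.
Proof.
move=> mF mf Ff ig Fg.
(* Used for the real and the imaginary part: additivity and [|p z| <= |z|] are all that the argument
   takes from [p]. *)
have cvg_part (p : R[i] -> R) : (forall z, `|p z| <= normc z) ->
   (forall y z, p (y - z) = p y - p z) ->
   (forall k, measurable_fun setT (p \o F k)) -> measurable_fun setT (p \o f) ->
   mu.-integrable setT (EFin \o (p \o f)) /\
   (fun k => \int[mu]_x p (F k x) - \int[mu]_x p (f x)) @ \oo --> 0.
  move=> pn pB mpF mpf.
  have [] := @dominated_convergence _ _ _ mu setT measurableT
    (fun k => EFin \o (p \o F k)) (EFin \o (p \o f)) (EFin \o g).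
  - by move=> k; exact/measurable_EFinP.
  - exact/measurable_EFinP.
  - apply: aeW => x _ /=; apply: cvg_EFin; first exact: nearW.
    have /cvgrPdist_lt fx := Ff x; apply/cvgrPdist_lt => e /fx.
    apply: filterS => k; rewrite sub0r normrN => h.
    rewrite distrC; apply: le_lt_trans h.
    by rewrite /= -pB (le_trans (pn _)) ?ler_norm.
  - exact: ig.
  - apply: aeW => x k _ /=; rewrite lee_fin (le_trans (pn _)) //; exact: Fg.
  move=> ipf _ cv; split => //.
  have fin k : mu.-integrable setT (EFin \o (p \o F k)).
    apply: le_integrable ig => //; first exact/measurable_EFinP.
    move=> x _ /=; rewrite lee_fin (le_trans (pn _)) // (le_trans (Fg _ _)) //.
    exact: ler_norm.
  have -> : (0 : R) = \int[mu]_x p (f x) - \int[mu]_x p (f x) by rewrite subrr.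
  apply: cvgB; last exact: cvg_cst.
  rewrite /Rintegral; apply: fine_cvg; rewrite fineK; last exact: integrable_fin_num.
  exact: cv.
have [iRe cRe] : _ := cvg_part Re normc_Re (fun y z => ltac:(by case: y; case: z))
  (fun k => (mF k).1) mf.1.
have [iIm cIm] : _ := cvg_part Im normc_Im (fun y z => ltac:(by case: y; case: z))
  (fun k => (mF k).2) mf.2.
split => //; apply/cvgrPdist_lt => e e0.
have e2 : 0 < e / 2 by rewrite divr_gt0.
move/cvgrPdist_lt : cRe => /(_ _ e2) cRe.
move/cvgrPdist_lt : cIm => /(_ _ e2) cIm.
near=> k; rewrite sub0r normrN ger0_norm ?normc_ge0 //.
rewrite (le_lt_trans (normc_le _)) // [ltRHS]splitr.
have h1 : `|Re (cint (F k) - cint f)| < e / 2.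
  by near: k; apply: filterS cRe => k; rewrite sub0r normrN.
have h2 : `|Im (cint (F k) - cint f)| < e / 2.
  by near: k; apply: filterS cIm => k; rewrite sub0r normrN.
exact: ltrD.
Unshelve. all: by end_near. Qed.

End complex_integral.

(** * Linear change of variables *)

Section affine1.
Context (R : realType).
Local Notation leb := (@lebesgue_measure R).

Let aff (a b : R) : measurableTypeR R -> measurableTypeR R := fun t => a * t + b.

Let maff a b : measurable_fun setT (aff a b).
Proof.
apply: measurable_funD; last exact: measurable_cst.
by apply: measurable_funM => //; exact: measurable_cst.
Qed.

Let aff_itv (a b u v : R) : a != 0 ->
  aff a b @^-1` [set` `]u, v]] =
  if 0 < a then [set` `](u - b) / a, (v - b) / a]]
  else [set` `[(v - b) / a, (u - b) / a[].
Proof.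
move=> a0; apply/seteqP; split => t; case: ifPn => [ap|];
  rewrite /aff /= !in_itv /=.
- by rewrite ltr_pdivrMr // ler_pdivlMr // ltrBlDr lerBrDr mulrC.
- move=> ap; have an : a < 0 by rewrite lt_neqAle a0 leNgt.
  by rewrite ltr_ndivlMr // ler_ndivrMr // ltrBlDr lerBrDr mulrC andbC.
- by rewrite ltr_pdivrMr // ler_pdivlMr // ltrBlDr lerBrDr mulrC.
- move=> ap; have an : a < 0 by rewrite lt_neqAle a0 leNgt.
  by rewrite ltr_ndivlMr // ler_ndivrMr // ltrBlDr lerBrDr mulrC andbC.
Qed.

(** The image of Lebesgue measure under [t -> a t + b], multiplied by [|a|], gives every half-open
    interval its length, hence is Lebesgue measure; the formula is then the one for image
    measures. *)
Lemma ge0_integral_affine1 (a b : R) (f : R -> \bar R) : a != 0 ->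
  measurable_fun setT f -> (forall x, 0 <= f x)%E ->
  (\int[leb]_t f (a * t + b)%R = (`|a|^-1)%:E * \int[leb]_t f t)%E.
Proof.
move=> a0 mf f0; have na : 0 < `|a| by rewrite normr_gt0.
pose nu := mscale (NngNum (normr_ge0 a))
  (measure_function_pushforward__canonical__measure_function_Measure leb (maff a b)).
have nuE A : measurable A -> leb A = nu A.
  apply: (lebesgue_measure_unique (mu := nu)) => X [[u v] _ <-] /=.
  rewrite /nu /= /mscale /= /pushforward aff_itv //.
  rewrite [LHS]lebesgue_measure_itv /= lte_fin.
  have [ap|an|a00] := ltgtP 0 a; last by rewrite -a00 eqxx in a0.
    rewrite lebesgue_measure_itv /= lte_fin.
    rewrite ltr_pM2r ?invr_gt0 // ltrD2r.
    case: ifPn => uv; last by rewrite mule0.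
    by rewrite -!EFinB -EFinM gtr0_norm //; congr (_%:E); field.
  rewrite lebesgue_measure_itv /= lte_fin.
  rewrite ltr_nM2r ?invr_lt0 // ltrD2r.
  case: ifPn => uv; last by rewrite mule0.
  by rewrite -!EFinB -EFinM ltr0_norm //; congr (_%:E); field.
rewrite (@eq_measure_integral _ _ _ setT nu leb f); last first.
  by move=> A mA _; exact: nuE.
rewrite ge0_integral_mscale //.
rewrite (ge0_integral_pushforward (maff a b)) //.
rewrite preimage_setT muleA -EFinM mulVf ?mul1e //.
by rewrite gt_eqF.
Qed.

End affine1.

Section change_of_variables.
Context (R : realType).
Local Notation leb := (@lebesgue_measure R).

Lemma measurable_mulmx n m (P : 'M[R]_(m, n)) :
  measurable_fun setT (fun x : 'cV[R]_n => P *m x).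
Proof.
apply: measurable_fun_cV => i.
rewrite (_ : (fun t => _) = fun t : 'cV[R]_n => \sum_j P i j * t j 0); last first.
  by apply/funext => t; rewrite mxE.
apply: measurable_sum => j; apply: measurable_funM; first exact: measurable_cst.
exact: measurable_coord.
Qed.

Lemma measurable_addv n (a : 'cV[R]_n) :
  measurable_fun setT (fun x : 'cV[R]_n => x + a).
Proof.
apply: measurable_fun_cV => i.
rewrite (_ : (fun t => _) = fun t : 'cV[R]_n => t i 0 + a i 0); last first.
  by apply/funext => t; rewrite mxE.
by apply: measurable_funD; [exact: measurable_coord|exact: measurable_cst].
Qed.

Lemma ge0_integral_cVS n (f : 'cV[R]_n.+1 -> \bar R) :
  measurable_fun setT f -> (forall x, 0 <= f x)%E ->
  (\int[lebesgue_cV n.+1]_x f x =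
   \int[leb]_t \int[lebesgue_cV n]_y f (cons_cV (t, y)))%E.
Proof.
move=> mf f0; have mfc : measurable_fun setT (f \o @cons_cV R n).
  by apply: measurableT_comp => //; exact: measurable_cons_cV.
have mc : measurable_fun setT
  (@cons_cV R n : measurableTypeR R * 'cV[R]_n -> 'cV[R]_n.+1).
  exact: measurable_cons_cV.
have h := ge0_integral_pushforward mc (leb \x lebesgue_cV n)%E measurableT mf (fun y _ => f0 y).
rewrite preimage_setT in h.
have h2 := fubini_tonelli1 (m1 := leb) (m2 := lebesgue_cV n) _ mfc (fun p => f0 _).
rewrite -[RHS]h2 -h.
by apply: eq_measure_integral => A mA _.
Qed.

Lemma ge0_integral_cVS' n (f : 'cV[R]_n.+1 -> \bar R) :
  measurable_fun setT f -> (forall x, 0 <= f x)%E ->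
  (\int[lebesgue_cV n.+1]_x f x =
   \int[lebesgue_cV n]_y \int[leb]_t f (cons_cV (t, y)))%E.
Proof.
move=> mf f0; have mfc : measurable_fun setT (f \o @cons_cV R n).
  by apply: measurableT_comp => //; exact: measurable_cons_cV.
rewrite ge0_integral_cVS //.
exact: (fubini_tonelli (m1 := leb) (m2 := lebesgue_cV n) _ mfc (fun p => f0 _)).
Qed.

Lemma integral_cV0 (f : 'cV[R]_0 -> \bar R) : measurable_fun setT f ->
  (\int[lebesgue_cV 0]_x f x = f (0%R : 'cV[R]_0))%E.
Proof. by move=> mf; rewrite /= integral_dirac // diracT mul1e. Qed.

Lemma cons_cVD n (s t : R) (x y : 'cV[R]_n) :
  cons_cV (s, x) + cons_cV (t, y) = cons_cV (s + t, x + y).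
Proof.
apply: etrans; first exact: (@add_col_mx _ 1 n 1).
by apply: (f_equal2 (@col_mx R 1 n 1)) => //; apply/matrixP => i j; rewrite !mxE. Qed.

Lemma measurable_cons_l n (f : 'cV[R]_n.+1 -> \bar R) y :
  measurable_fun setT f -> measurable_fun setT (fun t : R => f (cons_cV (t, y))).
Proof.
move=> mf; apply: (measurableT_comp (measurableT_comp mf (@measurable_cons_cV R n))).
exact: pair2_measurable.
Qed.

Lemma measurable_cons_r n (f : 'cV[R]_n.+1 -> \bar R) t :
  measurable_fun setT f -> measurable_fun setT (fun y : 'cV[R]_n => f (cons_cV (t, y))).
Proof.
move=> mf; apply: (measurableT_comp (measurableT_comp mf (@measurable_cons_cV R n))).
exact: pair1_measurable.
Qed.

Lemma cons_cV_ex n (x : 'cV[R]_n.+1) : exists t y, x = cons_cV (t, y).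
Proof.
exists (x 0 0), (dsubmx (x : 'cV[R]_(1 + n))).
transitivity (col_mx (usubmx (x : 'cV[R]_(1 + n))) (dsubmx (x : 'cV[R]_(1 + n)))).
  by rewrite vsubmxK.
apply: (f_equal2 (@col_mx R 1 n 1)) => //.
apply/matrixP => i j; rewrite !ord1 !mxE; congr (x _ _).
exact: ord_inj.
Qed.

Lemma ge0_integral_addv n (a : 'cV[R]_n) (f : 'cV[R]_n -> \bar R) :
  measurable_fun setT f -> (forall x, 0 <= f x)%E ->
  (\int[lebesgue_cV n]_x f (x + a)%R = \int[lebesgue_cV n]_x f x)%E.
Proof.
elim: n a f => [|n ih] a f mf f0.
  by apply: eq_integral => x _; congr f; apply/matrixP => -[].
have mfa : measurable_fun setT (fun x : 'cV[R]_n.+1 => f (x + a)).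
  by apply: measurableT_comp => //; exact: measurable_addv.
rewrite [LHS]ge0_integral_cVS // [RHS]ge0_integral_cVS //.
have [t0 [y0 ->]] := cons_cV_ex a.
under eq_integral => t _.
  under eq_integral => y _ do rewrite cons_cVD.
  rewrite (ih y0 (fun y => f (cons_cV (t + t0, y)))) //; last exact: measurable_cons_r.
  over.
have := @ge0_integral_affine1 R 1 t0
  (fun t => \int[lebesgue_cV n]_y f (cons_cV (t, y)))%E (oner_neq0 _).
rewrite normr1 invr1 mul1e => <-.
- by apply: eq_integral => t _; rewrite mul1r.
- apply: (measurable_fun_fubini_tonelli_F (m2 := lebesgue_cV n) (f \o @cons_cV R n) _ (fun p => f0 _)).
  by apply: measurableT_comp => //; exact: measurable_cons_cV.
- by move=> t; apply: integral_ge0.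
Qed.

Definition linear_integral n (P : 'M[R]_n) := forall f : 'cV[R]_n -> \bar R,
  measurable_fun setT f -> (forall x, 0 <= f x)%E ->
  (\int[lebesgue_cV n]_x f (P *m x)%R =
   (`|\det P|^-1)%:E * \int[lebesgue_cV n]_x f x)%E.

Lemma linear_integralM n (P Q : 'M[R]_n) : linear_integral P ->
  linear_integral Q -> linear_integral (P *m Q).
Proof.
move=> hP hQ f mf f0.
under eq_integral do rewrite -mulmxA.
have mP : measurable_fun setT (fun x : 'cV[R]_n => f (P *m x)).
  by apply: measurableT_comp => //; exact: measurable_mulmx.
rewrite (hQ (fun x => f (P *m x))) // hP // muleA -EFinM; congr (_%:E * _)%E.
by rewrite det_mulmx normrM invfM mulrC.
Qed.

Lemma block_mul_cons n (a : R) (b : 'rV[R]_n) (c : 'cV[R]_n) (D : 'M[R]_n) t y :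
  (block_mx a%:M b c D : 'M[R]_(1 + n)) *m cons_cV (t, y) =
  cons_cV (a * t + (b *m y) 0 0, D *m y + t *: c).
Proof.
rewrite /cons_cV /= mul_block_col; congr col_mx.
  apply/matrixP => i j; rewrite !ord1 !mxE big_ord1 !mxE mulr1n; congr (_ + _).
rewrite addrC; congr (_ + _); apply/matrixP => i j; rewrite !mxE big_ord1 !mxE.
by rewrite (ord1 j) mulrC.
Qed.

Lemma linear_integral_row n (a : R) (b : 'rV[R]_n) : a != 0 ->
  linear_integral (block_mx a%:M b 0 1%:M : 'M[R]_(1 + n)).
Proof.
move=> a0 f mf f0; set P := block_mx _ _ _ _.
have mfP : measurable_fun setT (fun x : 'cV[R]_n.+1 => f (P *m x)).
  by apply: measurableT_comp => //; exact: measurable_mulmx.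
rewrite [LHS]ge0_integral_cVS' // [in RHS]ge0_integral_cVS' //.
rewrite (det_ublock a%:M b) det1 mulr1 det_scalar expr1.
under eq_integral => y _.
  under eq_integral => t _ do rewrite block_mul_cons mul1mx scaler0 addr0.
  rewrite (@ge0_integral_affine1 R a _ (fun t => f (cons_cV (t, y)))) //; last exact: measurable_cons_l.
  over.
rewrite ge0_integralZl //.
- apply: (measurable_fun_fubini_tonelli_G (m1 := leb) (f \o @cons_cV R n) _ (fun p => f0 _)).
  by apply: measurableT_comp => //; exact: measurable_cons_cV.
- by move=> t _; apply: integral_ge0.
Qed.

Lemma linear_integral_col n (c : 'cV[R]_n) :
  linear_integral (block_mx 1%:M 0 c 1%:M : 'M[R]_(1 + n)).
Proof.
move=> f mf f0; set P := block_mx _ _ _ _.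
have mfP : measurable_fun setT (fun x : 'cV[R]_n.+1 => f (P *m x)).
  by apply: measurableT_comp => //; exact: measurable_mulmx.
rewrite [LHS]ge0_integral_cVS // [in RHS]ge0_integral_cVS //.
rewrite (det_lblock 1%:M c) !det1 mulr1 normr1 invr1 mul1e.
apply: eq_integral => t _.
under eq_integral => y _ do rewrite block_mul_cons mul0mx mxE addr0 mul1r mul1mx.
by rewrite (ge0_integral_addv (t *: c) (f := fun y => f (cons_cV (t, y)))) //; exact: measurable_cons_r.
Qed.

Lemma linear_integral_diag n (D : 'M[R]_n) : linear_integral D ->
  linear_integral (block_mx 1%:M 0 0 D : 'M[R]_(1 + n)).
Proof.
move=> hD f mf f0; set P := block_mx _ _ _ _.
have mfP : measurable_fun setT (fun x : 'cV[R]_n.+1 => f (P *m x)).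
  by apply: measurableT_comp => //; exact: measurable_mulmx.
rewrite [LHS]ge0_integral_cVS // [in RHS]ge0_integral_cVS //.
rewrite (det_ublock 1%:M 0) !det1 mul1r.
under eq_integral => t _.
  under eq_integral => y _ do rewrite block_mul_cons mul0mx mxE addr0 mul1r scaler0 addr0.
  rewrite (hD (fun y => f (cons_cV (t, y)))) //; last exact: measurable_cons_r.
  over.
rewrite ge0_integralZl //.
- apply: (measurable_fun_fubini_tonelli_F (m2 := lebesgue_cV n) (f \o @cons_cV R n) _ (fun p => f0 _)).
  by apply: measurableT_comp => //; exact: measurable_cons_cV.
- by move=> t _; apply: integral_ge0.
Qed.

(* Induction on the dimension: a matrix with nonzero corner entry is a product
   of block matrices of the three types above, and a shear makes the corner
   entry of an invertible matrix nonzero. *)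
Lemma linear_integral_unit n (P : 'M[R]_n) : P \in unitmx -> linear_integral P.
Proof.
elim: n P => [|n ih] P uP.
  move=> f mf f0; rewrite det_mx00 normr1 invr1 mul1e.
  by apply: eq_integral => x _; congr f; apply/matrixP => -[].
have corner (Q : 'M[R]_(1 + n)) : Q \in unitmx -> Q 0 0 != 0 -> linear_integral Q.
  move=> uQ Q0; set a := Q 0 0 in Q0 *.
  set b := ursubmx Q; set c := dlsubmx Q; set D := drsubmx Q.
  have QE : Q = block_mx a%:M b c D.
    rewrite -[LHS]submxK; congr block_mx; apply/matrixP => i j.
    by rewrite !ord1 !mxE mulr1n; congr (Q _ _); exact: ord_inj.
  (* The Schur complement of the corner entry, invertible because [det Q = a * det S]. *)
  pose S := D - a^-1 *: (c *m b).
  have QE' : Q = block_mx 1%:M 0 (a^-1 *: c) 1%:M *m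
      (block_mx 1%:M 0 0 S *m block_mx a%:M b 0 1%:M).
    rewrite !mulmx_block QE !mul1mx !mul0mx !mulmx1 !mulmx0 !addr0 !add0r.
    congr block_mx; rewrite /S.
      by rewrite mul_mx_scalar scalerA divff // scale1r.
    by rewrite -scalemxAl addrC subrK.
  rewrite QE'; apply: linear_integralM; first exact: linear_integral_col.
  apply: linear_integralM; last exact: linear_integral_row.
  apply/linear_integral_diag/ih.
  move: uQ; rewrite !unitmxE QE' !det_mulmx (det_lblock 1%:M) (det_lblock 1%:M).
  by rewrite !det1 !mul1r unitrM => /andP[].
have [P0|P0] := eqVneq (P 0 0) 0; last exact: corner.
have [i Pi0] : exists i, P i 0 != 0.
  apply/existsP; apply: contraTT uP => /existsPn h.
  rewrite unitmxE unitfE negbK (expand_det_col P 0) big1 // => i _.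
  by have := h i; rewrite negbK => /eqP ->; rewrite mul0r.
have [j ij] : exists j : 'I_n, i = rshift 1 j.
  have := split_ordP (i : 'I_(1 + n)); case=> j ij; last by exists j.
  exfalso; move: Pi0; rewrite ij (_ : lshift n j = 0) ?P0 ?eqxx //.
  by apply: ord_inj; rewrite ord1.
pose E (s : R) : 'M[R]_(1 + n) := block_mx 1%:M (s *: delta_mx 0 j) 0 1%:M.
have EE : E (-1) *m E 1 = 1%:M.
  rewrite /E mulmx_block !mul1mx !mul0mx !mulmx1 !mulmx0 !addr0 !add0r.
  by rewrite scale1r scaleN1r subrr -scalar_mx_block.
have -> : P = E (-1) *m (E 1 *m P) by rewrite mulmxA EE mul1mx.
apply: linear_integralM; first by apply: linear_integral_row; exact: oner_neq0.
apply: corner.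
  rewrite unitmx_mul uP andbT; have [] := mulmx1_unit EE; done.
rewrite (_ : (E 1 *m P) 0 0 = P i 0) //.
rewrite mxE (bigD1 (0 : 'I_(1 + n))) //= P0 mulr0 add0r.
rewrite (bigD1 i) /=; last by rewrite ij.
rewrite big1 ?addr0.
  rewrite ij (_ : (0 : 'I_(1 + n)) = lshift n 0); last exact: ord_inj.
  by rewrite /E block_mxEur !mxE !eqxx mulr1 mul1r.
move=> k /andP[k0 ki]; have [k' kk|k' kk] := split_ordP (k : 'I_(1 + n)).
  by move: k0; rewrite kk (_ : lshift n k' = 0) ?eqxx //; apply: ord_inj; rewrite ord1.
rewrite {1}(_ : (0 : 'I_(1 + n)) = lshift n 0); last exact: ord_inj.
have kj : (k' == j) = false.
  by apply: contraNF ki => /eqP kj; apply/eqP; rewrite kk ij kj.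
by rewrite kk /E block_mxEur !mxE eqxx /= kj mulr0 mul0r.
Qed.

End change_of_variables.

(** * Norm, compactness and measurability in spaces of column vectors *)

Section topology_cV.
Context (R : realType).

Lemma normed_cvgP (V W : normedModType R) (f : V -> W) x :
  f y @[y --> x] --> f x <-> forall e : R, 0 < e ->
    exists2 d : R, 0 < d & forall y, `|x - y| < d -> `|f x - f y| <= e.
Proof.
split=> [/cvgrPdist_le h e /h /nbhs_normP[d d0 hd]|h].
  by exists d => // y; exact: hd.
apply/cvgrPdist_le => e /h [d d0 hd]; apply/nbhs_normP; exists d => // y; exact: hd.
Qed.

Lemma norm_cV_le n (x : 'cV[R]_n) (e : R) : 0 <= e ->
  (forall i, `|x i 0| <= e) -> `|x| <= e.
Proof.
move=> e0 h; rewrite /Num.norm /= mx_normrE; apply: bigmax_le => //.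
by move=> [i j] _ /=; rewrite ord1.
Qed.

Lemma coord_le_norm n (x : 'cV[R]_n) i : `|x i 0| <= `|x|.
Proof. by rewrite {2}/Num.norm /= mx_normrE (le_bigmax_cond _ (fun ij => `|x ij.1 ij.2|) (j := (i, 0))). Qed.

Lemma norm_mulmx_le m n (P : 'M[R]_(m, n)) :
  exists2 C : R, 0 < C & forall x : 'cV[R]_n, `|P *m x| <= C * `|x|.
Proof.
exists (1 + \sum_i \sum_j `|P i j|).
  by rewrite ltr_wpDr // sumr_ge0 // => i _; rewrite sumr_ge0.
move=> x; apply: norm_cV_le => [|i].
  by rewrite mulr_ge0 // addr_ge0 // sumr_ge0 // => i _; rewrite sumr_ge0.
rewrite mxE (le_trans (ler_norm_sum _ _ _)) // mulrDl mul1r.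
rewrite (bigD1 i) //= mulrDl addrCA mulr_suml.
rewrite -[leLHS]addr0 lerD //.
  by apply: ler_sum => j _; rewrite normrM ler_wpM2l // coord_le_norm.
by rewrite addr_ge0 // mulr_ge0 // sumr_ge0 // => k _; rewrite sumr_ge0.
Qed.

Lemma continuous_mulmx m n (P : 'M[R]_(m, n)) :
  continuous (fun x : 'cV[R]_n => P *m x).
Proof.
have [C C0 hC] := norm_mulmx_le P.
move=> x; apply/normed_cvgP => e e0; exists (e / C); first by rewrite divr_gt0.
by move=> y yx; rewrite -mulmxBr (le_trans (hC _)) // mulrC -ler_pdivlMr // ltW.
Qed.

Lemma compact_ball_cV n (M : R) : compact [set x : 'cV[R]_n | `|x| <= M].
Proof.
rewrite (_ : [set x | _] = trmx @` [set x : 'rV[R]_n | `|x| <= M]).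
  apply: continuous_compact.
    apply: continuous_subspaceT => x; apply/normed_cvgP => e e0; exists e => // y xy.
    apply: norm_cV_le => [|i]; first exact: ltW.
    rewrite [X in `|X|](_ : _ = (x - y) 0 i); last by rewrite !mxE.
    apply/ltW/(le_lt_trans _ xy); rewrite {2}/Num.norm /= mx_normrE.
    exact: (le_bigmax_cond _ (fun ij => `|(x - y) ij.1 ij.2|) (j := (0, i))).
  apply: bounded_closed_compact.
    exists `|M|; split; first exact: num_real.
    by move=> N MN x /= xM; rewrite (le_trans xM) // (le_trans (ler_norm _)) // ltW.
  apply: (closed_comp (f := fun x : 'rV[R]_n => `|x|) (D := [set y | y <= M])).
    by move=> x _; exact: norm_continuous.
  exact: closed_le.
apply/seteqP; split => x /=.
  move=> xM; exists x^T; last by rewrite trmxK.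
  apply: (le_trans _ xM); rewrite {1}/Num.norm /= mx_normrE.
  apply: bigmax_le => [|[i j] _ /=]; first exact: (normr_ge0 x).
  by rewrite mxE ord1 coord_le_norm.
move=> [y yM <-]; apply: norm_cV_le => [|i]; first exact: le_trans yM.
rewrite mxE (le_trans _ yM) // /Num.norm /= mx_normrE.
exact: (le_bigmax_cond _ (fun ij => `|y ij.1 ij.2|) (j := (0, i))).
Unshelve. all: by end_near. Qed.

Lemma continuous_bounded_ball n (f : 'cV[R]_n -> R) (M : R) : continuous f ->
  exists2 C : R, 0 < C & forall x, `|x| <= M -> `|f x| <= C.
Proof.
move=> cf; have : compact (f @` [set x : 'cV[R]_n | `|x| <= M]).
  by apply: continuous_compact; [exact: continuous_subspaceT|exact: compact_ball_cV].
move=> /compact_bounded /ex_strict_bound_gt0[C C0 h].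
by exists C => // x xM; apply/ltW/h; exists x.
Qed.

Let fl (M : nat) n (x : 'cV[R]_n) : 'cV[int]_n :=
  map_mx (fun t : R => Num.floor (M.+1%:R * t)) x.
Let unfl (M : nat) n (k : 'cV[int]_n) : 'cV[R]_n :=
  map_mx (fun z : int => z%:~R / M.+1%:R) k.

(** The sigma-algebra is the product one, so continuity alone does not give measurability by
    definition. Rounding each coordinate down to a multiple of 1/(M+1) makes [f] constant on
    countably many measurable boxes, and these roundings converge to [f] pointwise. *)
Lemma continuous_cV_measurable n (f : 'cV[R]_n -> R) : continuous f ->
  measurable_fun setT f.
Proof.
move=> cf; apply: (measurable_fun_cvg (h := fun M x => f (unfl M (fl M x)))).
  move=> M _ Y mY; rewrite setTI.
  rewrite (_ : _ @^-1` _ = \bigcup_(k : 'cV[int]_n)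
      (if f (unfl M k) \in Y then \bigcap_(i in [set: 'I_n])
       [set x : 'cV[R]_n | x i 0 \in `[(k i 0)%:~R / M.+1%:R, ((k i 0)%:~R + 1) / M.+1%:R[] else set0)).
    apply: countable_bigcupT_measurable => [|k]; first exact: countableP.
    case: ifPn => _ //.
    apply: fin_bigcap_measurable => // i _.
    rewrite -[X in measurable X]setTI.
    exact: (measurable_coord i measurableT (measurable_itv _)).
  have flE (k : 'cV[int]_n) (x : 'cV[R]_n) i :
      (x i 0 \in `[(k i 0)%:~R / M.+1%:R, ((k i 0)%:~R + 1) / M.+1%:R[) =
      (Num.floor (M.+1%:R * x i 0) == k i 0).
    rewrite in_itv /= ler_pdivrMr // ltr_pdivlMr // ![x i 0 * _]mulrC.
    rewrite -[X in X && _]mul1r; apply/idP/idP.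
      by rewrite mul1r => h; apply/eqP/floor_def; rewrite intrD1.
    by rewrite mul1r => /eqP <-; rewrite ge_floor -intrD1 floorD1_gt.
  apply/seteqP; split => x /=.
    move=> Yx; exists (fl M x) => //; rewrite mem_set // => i _ /=.
    by rewrite flE mxE.
  move=> [k _]; case: ifPn => // /set_mem kY h.
  suff -> : fl M x = k by [].
  by apply/matrixP => i j; rewrite ord1 mxE; apply/eqP; rewrite -flE; exact: h.
move=> x _; apply: continuous_cvg; first exact: cf.
apply/cvgrPdist_le => e e0; near=> M.
apply: norm_cV_le => [|i]; first exact: ltW.
rewrite !mxE; set z := M.+1%:R * x i 0.
have -> : x i 0 - (Num.floor z)%:~R / M.+1%:R = (z - (Num.floor z)%:~R) / M.+1%:R.
  by rewrite /z; field.
rewrite normrM ger0_norm ?subr_ge0 ?ge_floor // ger0_norm //.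
rewrite ler_pdivrMr // (@le_trans _ _ 1) //.
  by rewrite lerBlDr addrC -intrD1 ltW // floorD1_gt.
rewrite -ler_pdivrMl // mulr1 -natr1 (le_trans (_ : _ <= M%:R)) ?lerDl //.
near: M; exact: nbhs_infty_ger.
Unshelve. all: by end_near. Qed.

Definition ccontinuous n (f : 'cV[R]_n -> R[i]) :=
  continuous (@complex.Re R \o f) /\ continuous (@complex.Im R \o f).

Lemma ccontinuous_cmeas n (f : 'cV[R]_n -> R[i]) : ccontinuous f -> cmeas f.
Proof. by move=> [? ?]; split; exact: continuous_cV_measurable. Qed.

Lemma compact_support_bounded n (f : 'cV[R]_n -> R[i]) (M : R) :
  (forall x, M < `|x| -> f x = 0) -> compact_support f.
Proof.
move=> h; apply: (subclosed_compact (@closed_closure _ _) (@compact_ball_cV n M)).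
rewrite [X in _ `<=` X](closure_id _).1; last first.
  apply: (closed_comp (f := fun x : 'cV[R]_n => `|x|) (D := [set y | y <= M])).
    by move=> x _; exact: norm_continuous.
  exact: closed_le.
apply: closure_subset => x /=; apply: contraNT.
by rewrite -ltNge => /h ->.
Qed.

End topology_cV.

(** * Change of variables and Fubini for complex-valued functions *)

Section complex_change.
Context d1 d2 (T1 : measurableType d1) (T2 : measurableType d2) (R : realType).
Variables (m1 : {measure set T1 -> \bar R}) (m2 : {measure set T2 -> \bar R}).

(** The formula for non-negative functions is applied to the modulus, for integrability, and then to
    the positive and negative parts of both components. *)
Lemma cint_change (phi : T1 -> T2) (c : R) (f : T2 -> R[i]) :
  measurable_fun setT phi -> 0 < c ->
  (forall g : T2 -> \bar R, measurable_fun setT g -> (forall x, 0 <= g x)%E ->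
    (\int[m1]_x g (phi x) = c%:E * \int[m2]_x g x)%E) ->
  cintegrable m2 f ->
  cintegrable m1 (f \o phi) /\ cint m1 (f \o phi) = (c%:C)%C * cint m2 f.
Proof.
move=> mphi c0 H fi; have mf := cintegrable_cmeas fi.
have mfp : cmeas (f \o phi) by case: mf => f1 f2; split; [exact: (measurableT_comp f1)|exact: (measurableT_comp f2)].
have ip : cintegrable m1 (f \o phi).
  apply/(cintegrable_norm_lty m1 mfp).
  rewrite (H (fun x => (Normc.normc (f x))%:E)) //.
  - rewrite lte_mul_pinfty //; first by rewrite lee_fin ltW.
    exact/(cintegrable_norm_lty m2 mf).
  - by apply/measurable_EFinP; exact: measurable_normc.
  - by move=> x; rewrite lee_fin normc_ge0.
split=> //.
have key (u : T2 -> R) : m2.-integrable setT (EFin \o u) ->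
    \int[m1]_x u (phi x) = c * \int[m2]_x u x.
  move=> iu; have mu := measurable_int _ iu.
  rewrite /Rintegral integralE [in RHS]integralE.
  have -> : (fun x => (u (phi x))%:E)^\+%E = (fun x => (EFin \o u)^\+%E (phi x)).
    by apply/funext => x; rewrite !funeposE.
  have -> : (fun x => (u (phi x))%:E)^\-%E = (fun x => (EFin \o u)^\-%E (phi x)).
    by apply/funext => x; rewrite !funenegE.
  rewrite (H (EFin \o u)^\+%E) ?(H (EFin \o u)^\-%E) //.
  - have p1 : (\int[m2]_x (EFin \o u)^\+%E x)%E \is a fin_num.
      apply: (integrable_fin_num measurableT).
      exact: (integrable_funepos measurableT iu).
    have p2 : (\int[m2]_x (EFin \o u)^\-%E x)%E \is a fin_num.
      apply: (integrable_fin_num measurableT).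
      exact: (integrable_funeneg measurableT iu).
    by rewrite -(fineK p1) -(fineK p2) -!EFinM -!EFinB /= mulrBr.
  - exact: measurable_funeneg.
  - exact: measurable_funepos.
case: fi => f1 f2; rewrite /cint; simpc.
by rewrite -!key //.
Qed.

End complex_change.

Section complex_fubini.
Context d1 d2 (T1 : measurableType d1) (T2 : measurableType d2) (R : realType).
Variables (m1 : {sigma_finite_measure set T1 -> \bar R})
          (m2 : {sigma_finite_measure set T2 -> \bar R}).
Local Notation normc := (@Normc.normc R).

(** Sections are required to be integrable at every point, not almost every point, so that both
    iterated integrals are integrals of honest functions and no null set has to be carried along. *)
Lemma cint_fubini (f : T1 * T2 -> R[i]) :
  cmeas f ->
  (\int[m1]_x \int[m2]_y (normc (f (x, y)))%:E < +oo)%E ->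
  (forall x, cintegrable m2 (fun y => f (x, y))) ->
  (forall y, cintegrable m1 (fun x => f (x, y))) ->
  [/\ cintegrable (m1 \x m2)%E f,
      cint (m1 \x m2)%E f = cint m1 (fun x => cint m2 (fun y => f (x, y))) &
      cint m1 (fun x => cint m2 (fun y => f (x, y))) =
      cint m2 (fun y => cint m1 (fun x => f (x, y)))].
Proof.
move=> mf foo f1 f2.
have fi : cintegrable (m1 \x m2)%E f.
  apply: (cintegrable_norm_lty (m1 \x m2)%E mf).2.
  rewrite (fubini_tonelli1 (m1 := m1) (m2 := m2)) //.
    by apply/measurable_EFinP; exact: measurable_normc.
  by move=> x; rewrite lee_fin normc_ge0.
have key (u : T1 * T2 -> R) : (m1 \x m2)%E.-integrable setT (EFin \o u) ->
    (forall x, m2.-integrable setT (fun y => (u (x, y))%:E)) ->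
    (forall y, m1.-integrable setT (fun x => (u (x, y))%:E)) ->
    \int[(m1 \x m2)%E]_p u p = \int[m1]_x \int[m2]_y u (x, y) /\
    \int[m1]_x \int[m2]_y u (x, y) = \int[m2]_y \int[m1]_x u (x, y).
  move=> iu u1 u2; rewrite /Rintegral.
  have E1 : (\int[m1]_x (fine (\int[m2]_y (u (x, y))%:E))%:E =
      \int[m1]_x \int[m2]_y (u (x, y))%:E)%E.
    by apply: eq_integral => x _; rewrite fineK //; exact: integrable_fin_num.
  have E2 : (\int[m2]_y (fine (\int[m1]_x (u (x, y))%:E))%:E =
      \int[m2]_y \int[m1]_x (u (x, y))%:E)%E.
    by apply: eq_integral => x _; rewrite fineK //; exact: integrable_fin_num.
  rewrite E1 E2; split; congr fine; last exact: (Fubini iu).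
  by rewrite -(integral12_prod_meas1 iu).
split => //; rewrite /cint /=.
  case: fi => i1 i2; congr (_ +i* _)%C.
    exact: (key _ i1 (fun x => (f1 x).1) (fun y => (f2 y).1)).1.
  exact: (key _ i2 (fun x => (f1 x).2) (fun y => (f2 y).2)).1.
case: fi => i1 i2; congr (_ +i* _)%C.
  exact: (key _ i1 (fun x => (f1 x).1) (fun y => (f2 y).1)).2.
exact: (key _ i2 (fun x => (f1 x).2) (fun y => (f2 y).2)).2.
Qed.

End complex_fubini.

(** * Integration over column vectors, one coordinate at a time *)

Section integrals_cV.
Context (R : realType).
Local Notation leb := (@lebesgue_measure R).
Local Notation lam n := (@lebesgue_cV R n).
Local Notation normc := (@Normc.normc R).

Lemma cint_addv n (a : 'cV[R]_n) (f : 'cV[R]_n -> R[i]) : cintegrable (lam n) f ->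
  cintegrable (lam n) (fun x => f (x + a)) /\
  cint (lam n) (fun x => f (x + a)) = cint (lam n) f.
Proof.
move=> fi; have [] := @cint_change _ _ _ _ R (lam n) (lam n) (fun x => x + a) 1 f
  (measurable_addv a) ltr01 _ fi; last by rewrite mul1r.
by move=> g mg g0; rewrite ge0_integral_addv // mul1e.
Qed.

Lemma cint_mulmx n (P : 'M[R]_n) (f : 'cV[R]_n -> R[i]) : P \in unitmx ->
  cintegrable (lam n) f ->
  cintegrable (lam n) (fun x => f (P *m x)) /\
  cint (lam n) (fun x => f (P *m x)) = (`|\det P|^-1)%:C%C * cint (lam n) f.
Proof.
move=> uP fi; apply: (cint_change (measurable_mulmx P)) => //.
  by rewrite invr_gt0 normr_gt0 -unitfE -unitmxE.
by move=> g mg g0; rewrite linear_integral_unit.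
Qed.

Lemma ge0_integral_cons n (g : 'cV[R]_n.+1 -> \bar R) :
  measurable_fun setT g -> (forall x, 0 <= g x)%E ->
  (\int[(leb \x lam n)%E]_p g (cons_cV p) = \int[lam n.+1]_x g x)%E.
Proof.
move=> mg g0; have mgc : measurable_fun setT (g \o @cons_cV R n).
  by apply: measurableT_comp => //; exact: measurable_cons_cV.
have h2 := fubini_tonelli1 (m1 := leb) (m2 := lam n) _ mgc (fun p => g0 _).
by rewrite ge0_integral_cVS // -[RHS]h2.
Qed.

Lemma cint_cVS n (f : 'cV[R]_n.+1 -> R[i]) : cintegrable (lam n.+1) f ->
  (forall t, cintegrable (lam n) (fun y => f (cons_cV (t, y)))) ->
  (forall y, cintegrable leb (fun t => f (cons_cV (t, y)))) ->
  cint (lam n.+1) f = cint leb (fun t => cint (lam n) (fun y => f (cons_cV (t, y)))).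
Proof.
move=> fi f1 f2.
have mc : measurable_fun setT
    (@cons_cV R n : measurableTypeR R * 'cV[R]_n -> 'cV[R]_n.+1).
  exact: measurable_cons_cV.
have [ip] := @cint_change _ _ _ _ R (leb \x lam n)%E (lam n.+1) _ 1 f mc ltr01
  (fun g mg g0 => etrans (ge0_integral_cons mg g0) (esym (mul1e _))) fi.
rewrite mul1r => <-.
have [|_ -> _] := @cint_fubini _ _ _ _ R leb (lam n) _ (cintegrable_cmeas ip) _ f1 f2; last by [].
have := (cintegrable_norm_lty _ (cintegrable_cmeas fi)).1 fi.
rewrite ge0_integral_cVS //.
- by apply/measurable_EFinP; exact: measurable_normc (cintegrable_cmeas fi).
- by move=> x; rewrite lee_fin normc_ge0.
Qed.

Lemma cons_cV_0 n (t : R) (y : 'cV[R]_n) : cons_cV (t, y) ord0 0 = t.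
Proof.
rewrite /cons_cV (_ : ord0 = lshift n (0 : 'I_1)); last exact: ord_inj.
by rewrite (@col_mxEu _ 1 n 1) mxE.
Qed.

Lemma cons_cV_lift n (t : R) (y : 'cV[R]_n) i : cons_cV (t, y) (lift ord0 i) 0 = y i 0.
Proof.
rewrite /cons_cV (_ : lift ord0 i = rshift 1 i); last exact: ord_inj.
by rewrite (@col_mxEd _ 1 n 1).
Qed.

Lemma measurable_prod_coord n (k : 'I_n -> R -> R) :
  (forall i, measurable_fun setT (k i)) ->
  measurable_fun setT (fun x : 'cV[R]_n => \prod_i k i (x i 0)).
Proof.
move=> mk; apply: measurable_prod => i _.
apply: (measurableT_comp (mk i)); exact: measurable_coord.
Qed.

Lemma ge0_integral_prod n (k : 'I_n -> R -> R) (a : 'I_n -> R) :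
  (forall i, measurable_fun setT (k i)) -> (forall i t, 0 <= k i t) ->
  (forall i, \int[leb]_t (k i t)%:E = (a i)%:E)%E ->
  (\int[lam n]_x (\prod_i k i (x i 0%R))%:E = (\prod_i a i)%:E)%E.
Proof.
elim: n k a => [|n ih] k a mk k0 ka.
  rewrite integral_cV0 ?big_ord0 //; apply/measurable_EFinP.
  exact: measurable_prod_coord.
rewrite ge0_integral_cVS; last 2 first.
- by apply/measurable_EFinP; exact: measurable_prod_coord.
- by move=> x; rewrite lee_fin prodr_ge0.
under eq_integral => t _.
  under eq_integral => y _.
    rewrite big_ord_recl cons_cV_0.
    under eq_bigr do rewrite cons_cV_lift.
    rewrite EFinM; over.
  rewrite ge0_integralZl //; last 3 first.
  - by apply/measurable_EFinP; exact: (@measurable_prod_coord n (fun i => k (lift ord0 i))).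
  - by move=> y _; rewrite lee_fin prodr_ge0.
  - by rewrite lee_fin.
  rewrite (ih (fun i => k (lift ord0 i)) (fun i => a (lift ord0 i))) //.
  over.
rewrite ge0_integralZr //.
- by rewrite ka big_ord_recl EFinM.
- by apply/measurable_EFinP; exact: mk.
- by move=> y _; rewrite lee_fin.
- rewrite lee_fin prodr_ge0 // => i _; rewrite -lee_fin -ka.
  by apply: integral_ge0 => t _; rewrite lee_fin.
Qed.

Lemma integrable_prod n (k : 'I_n -> R -> R) :
  (forall i t, 0 <= k i t) ->
  (forall i, leb.-integrable setT (EFin \o k i)) ->
  (lam n).-integrable setT (EFin \o (fun x : 'cV[R]_n => \prod_i k i (x i 0))).
Proof.
move=> k0 ik.
have mk i : measurable_fun setT (k i) by apply/measurable_EFinP; exact: measurable_int (ik i).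
apply/integrableP; split.
  by apply/measurable_EFinP; exact: measurable_prod_coord.
under eq_integral => x _.
  rewrite /= ger0_norm; last by rewrite prodr_ge0.
  over.
rewrite (@ge0_integral_prod n k (fun i => \int[leb]_t k i t)) ?ltry //.
by move=> i; rewrite /Rintegral fineK //; exact: (integrable_fin_num measurableT (ik i)).
Qed.

Lemma normc_prod I (r : seq I) (P : pred I) (F : I -> R[i]) :
  normc (\prod_(i <- r | P i) F i) = \prod_(i <- r | P i) normc (F i).
Proof. by elim/big_rec2: _ => [|i y1 y2 _ <-]; rewrite ?Normc.normc1 ?Normc.normcM. Qed.

Lemma cmeas_comp d1 d2 (T1 : measurableType d1) (T2 : measurableType d2)
  (f : T2 -> R[i]) (g : T1 -> T2) : cmeas f -> measurable_fun setT g ->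
  cmeas (fun x => f (g x)).
Proof.
by move=> [f1 f2] mg; split; [exact: (measurableT_comp f1)|exact: (measurableT_comp f2)].
Qed.

Lemma cmeas_prod d (T : measurableType d) I (r : seq I) (P : pred I) (F : I -> T -> R[i]) :
  (forall i, cmeas (F i)) -> cmeas (fun x => \prod_(i <- r | P i) F i x).
Proof.
move=> mF; elim: r => [|i r ih].
  rewrite (_ : (fun x => _) = (fun=> 1)); first exact: cmeas_cst.
  by apply/funext => x; rewrite big_nil.
rewrite (_ : (fun x => _) = (fun x => (if P i then F i x else 1) *
   \prod_(j <- r | P j) F j x)).
  by apply: cmeasM => //; case: (P i) => //; exact: cmeas_cst.
by apply/funext => x; rewrite big_cons; case: (P i); rewrite ?mul1r.
Qed.

Lemma cintegrable_prod n (k : 'I_n -> R -> R[i]) :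
  (forall i, cintegrable leb (k i)) ->
  cintegrable (lam n) (fun x => \prod_i k i (x i 0)).
Proof.
move=> ik; apply: (@cintegrable_le _ _ _ _ _ (fun x : 'cV[R]_n => \prod_i normc (k i (x i 0)))).
- apply: cmeas_prod => i; apply: cmeas_comp (measurable_coord i).
  exact: cintegrable_cmeas (ik i).
- apply: (@integrable_prod n (fun i t => normc (k i t))) => i.
    by move=> t; exact: normc_ge0.
  exact: cintegrable_normc.
- by move=> x; rewrite normc_prod.
Qed.

Lemma cint_prod n (k : 'I_n -> R -> R[i]) :
  (forall i, cintegrable leb (k i)) ->
  cint (lam n) (fun x => \prod_i k i (x i 0)) = \prod_i cint leb (k i).
Proof.
elim: n k => [|n ih] k ik.
  rewrite big_ord0 /cint.
  rewrite (_ : (fun x => _) = (fun=> 1)); last by apply/funext => x; rewrite big_ord0.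
  rewrite (_ : (fun x => complex.Im _) = (fun=> 0)); last by apply/funext => x; rewrite big_ord0.
  by rewrite /Rintegral !integral_cV0 //=; exact: measurable_cst.
have consE t (y : 'cV[R]_n) : \prod_i k i (cons_cV (t, y) i 0) =
    k ord0 t * \prod_i k (lift ord0 i) (y i 0).
  by rewrite big_ord_recl cons_cV_0; congr (_ * _); apply: eq_bigr => i _; rewrite cons_cV_lift.
have ip := @cintegrable_prod n (fun i => k (lift ord0 i)) (fun i => ik _).
rewrite cint_cVS; first last.
- move=> y; under eq_fun do rewrite consE mulrC.
  exact: cintegrableZ.
- move=> t; under eq_fun do rewrite consE.
  exact: cintegrableZ.
- exact: cintegrable_prod.
under eq_fun => t.
  under eq_fun do rewrite consE.
  rewrite cintZ // mulrC; over.
by rewrite cintZ // big_ord_recl mulrC (ih (fun i => k (lift ord0 i))) .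
Qed.

(** The indicator of the cube of half-side [M]; it serves as integrable majorant for bounded
    functions of bounded support. *)
Definition boxfun n (M : R) (x : 'cV[R]_n) : R := \prod_i \1_(`[-M, M]) (x i 0).

Lemma boxfun_ge0 n M (x : 'cV[R]_n) : 0 <= boxfun M x.
Proof. by rewrite prodr_ge0 // => i _; rewrite indicE. Qed.

Lemma boxfun1 n M (x : 'cV[R]_n) : `|x| <= M -> boxfun M x = 1.
Proof.
move=> xM; rewrite /boxfun big1 // => i _; rewrite indicE mem_set //=.
by rewrite in_itv /= -ler_norml (le_trans (coord_le_norm _ _)).
Qed.

Lemma boxfun0 n M (x : 'cV[R]_n) : 0 <= M -> M < `|x| -> boxfun M x = 0.
Proof.
move=> M0; have [/existsP[i h] _|/existsPn h] := boolP [exists i, x i 0 \notin `[-M, M]].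
  by rewrite /boxfun (bigD1 i) //= indicE memNset ?mul0r //=; exact/negP.
rewrite ltNge norm_cV_le // => i; have := h i.
by rewrite negbK in_itv /= -ler_norml.
Qed.

Lemma integrable_boxfun n M : (lam n).-integrable setT (EFin \o @boxfun n M).
Proof.
apply: (@integrable_prod n (fun _ => \1_(`[-M, M]))).
  by move=> i t; rewrite indicE.
move=> i; exact: integrable_indic_itv.
Qed.

Lemma cintegrable_bounded n (f : 'cV[R]_n -> R[i]) (C M : R) : cmeas f ->
  (forall x, normc (f x) <= C) -> (forall x, M < `|x| -> f x = 0) ->
  cintegrable (lam n) f.
Proof.
move=> mf fC fM; apply: (@cintegrable_le _ _ _ _ _ (fun x => C * boxfun M x)) => //.
  have := integrableZl measurableT C (integrable_boxfun n M).
  by apply: eq_integrable => // x _ /=; rewrite EFinM.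
move=> x; have [xM|xM] := leP `|x| M; first by rewrite boxfun1 // mulr1.
rewrite fM // Normc.normc0 mulr_ge0 ?boxfun_ge0 //.
by rewrite (le_trans (normc_ge0 (f 0))).
Qed.

(** Bounded instead of compact support: no closure is taken, so sums, products and substitutions are
    immediate. [compact_support_bounded] leads back to the topological notion. *)
Definition bsupp n (f : 'cV[R]_n -> R[i]) := exists M : R, forall x, M < `|x| -> f x = 0.

Lemma ccontinuous_bounded n (f : 'cV[R]_n -> R[i]) : ccontinuous f -> bsupp f ->
  exists2 C : R, 0 < C & forall x, normc (f x) <= C.
Proof.
move=> [f1 f2] [M fM].
have [C1 C10 h1] := continuous_bounded_ball M f1.
have [C2 C20 h2] := continuous_bounded_ball M f2.
exists (C1 + C2); first exact: addr_gt0.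
move=> x; have [xM|xM] := leP `|x| M.
  by rewrite (le_trans (normc_le _)) // lerD //; [exact: h1|exact: h2].
by rewrite fM // Normc.normc0 addr_ge0 // ltW.
Qed.

Lemma cintegrable_cc n (f : 'cV[R]_n -> R[i]) : ccontinuous f -> bsupp f ->
  cintegrable (lam n) f.
Proof.
move=> cf sf; have [C _ hC] := ccontinuous_bounded cf sf.
have [M hM] := sf; apply: (cintegrable_bounded (C := C) (M := M)) => //.
exact: ccontinuous_cmeas.
Qed.

End integrals_cV.

(** * Smooth functions *)

Section smooth_functions.
Context (R : realType).

(* Derivatives are required in all directions, not only along the coordinate
   axes, so that the class is stable under linear substitutions without
   appealing to total differentiability. *)
Fixpoint dC (V : normedModType R) (k : nat) (f : V -> R) : Prop :=
  continuous f /\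
  (if k is k'.+1 then
     forall v, (forall x, derivable f x v) /\ dC k' (fun x => 'D_v f x)
   else True).

Definition dsmooth (V : normedModType R) (f : V -> R) := forall k, dC k f.

Section gen.
Context (V : normedModType R).
Implicit Types f g : V -> R.

Lemma dCW k f : dC k.+1 f -> dC k f.
Proof.
elim: k f => [|k ih] f [cf df]; first by split.
by split=> // v; have [d1 d2] := df v; split => //; exact: ih.
Qed.

Lemma dsmooth_continuous f : dsmooth f -> continuous f.
Proof. by move=> /(_ 0%N) []. Qed.

Lemma dsmooth_derivable f x v : dsmooth f -> derivable f x v.
Proof. by move=> /(_ 1%N) [_ /(_ v) []]. Qed.

Lemma dsmooth_derive f v : dsmooth f -> dsmooth (fun x => 'D_v f x).
Proof. by move=> df k; have [_ /(_ v) []] := df k.+1. Qed.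

Lemma dC_isd k f (df : V -> V -> R) : continuous f ->
  (forall v x, is_derive x v f (df v x)) -> (forall v, dC k (df v)) -> dC k.+1 f.
Proof.
move=> cf dfE dk; split => // v; split => [x|].
  by have [] := dfE v x.
rewrite (_ : (fun x => _) = df v) //; apply/funext => x.
by have [] := dfE v x.
Qed.

Lemma dC_is_derive k f x v : dC k.+1 f -> is_derive x v f ('D_v f x).
Proof. by move=> [_ /(_ v) [d1 _]]; split. Qed.

Lemma dC_cst k (c : R) : dC k (fun _ : V => c).
Proof.
elim: k c => [|k ih] c; first by split=> //; exact: cst_continuous.
apply: (@dC_isd _ _ (fun _ _ => 0)) => //; exact: cst_continuous.
Qed.

Lemma dCD k f g : dC k f -> dC k g -> dC k (fun x => f x + g x).
Proof.
elim: k f g => [|k ih] f g hf hg.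
  split=> // x; apply: cvgD; [exact: hf.1|exact: hg.1].
apply: (@dC_isd _ _ (fun v x => 'D_v f x + 'D_v g x)).
- move=> x; apply: cvgD; [exact: hf.1|exact: hg.1].
- move=> v x; exact: is_deriveD (dC_is_derive x v hf) (dC_is_derive x v hg).
- by move=> v; apply: ih; [exact: (hf.2 v).2|exact: (hg.2 v).2].
Qed.

Lemma dCM k f g : dC k f -> dC k g -> dC k (fun x => f x * g x).
Proof.
elim: k f g => [|k ih] f g hf hg.
  split=> // x; apply: cvgM; [exact: hf.1|exact: hg.1].
apply: (@dC_isd _ _ (fun v x => f x * 'D_v g x + g x * 'D_v f x)).
- move=> x; apply: cvgM; [exact: hf.1|exact: hg.1].
- move=> v x; exact: is_deriveM (dC_is_derive x v hf) (dC_is_derive x v hg).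
- by move=> v; apply: dCD; apply: ih; (exact: dCW || exact: (hf.2 v).2 || exact: (hg.2 v).2).
Qed.

Lemma dsmooth_cst (c : R) : dsmooth (fun _ : V => c).
Proof. by move=> k; exact: dC_cst. Qed.

Lemma dsmoothD f g : dsmooth f -> dsmooth g -> dsmooth (fun x => f x + g x).
Proof. by move=> hf hg k; exact: dCD. Qed.

Lemma dsmoothM f g : dsmooth f -> dsmooth g -> dsmooth (fun x => f x * g x).
Proof. by move=> hf hg k; exact: dCM. Qed.

Lemma dsmoothN f : dsmooth f -> dsmooth (fun x => - f x).
Proof.
move=> hf; have := dsmoothM (dsmooth_cst (-1)) hf.
by congr dsmooth; apply/funext => x; rewrite mulN1r.
Qed.

Lemma dsmoothB f g : dsmooth f -> dsmooth g -> dsmooth (fun x => f x - g x).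
Proof. by move=> hf hg; apply: dsmoothD => //; exact: dsmoothN. Qed.

Lemma dsmooth_sum I (r : seq I) (P : pred I) (F : I -> V -> R) :
  (forall i, dsmooth (F i)) -> dsmooth (fun x => \sum_(i <- r | P i) F i x).
Proof.
move=> hF; elim: r => [|i r ih].
  under eq_fun do rewrite big_nil; exact: dsmooth_cst.
under eq_fun do rewrite big_cons.
by case: (P i) => //; exact: dsmoothD.
Qed.

Lemma dsmooth_prod I (r : seq I) (P : pred I) (F : I -> V -> R) :
  (forall i, dsmooth (F i)) -> dsmooth (fun x => \prod_(i <- r | P i) F i x).
Proof.
move=> hF; elim: r => [|i r ih].
  under eq_fun do rewrite big_nil; exact: dsmooth_cst.
under eq_fun do rewrite big_cons.
by case: (P i) => //; exact: dsmoothM.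
Qed.

Lemma dC_inv k f : (forall x, f x != 0) -> dC k f -> dC k (fun x => (f x)^-1).
Proof.
move=> f0; elim: k => [|k ih] hf.
  by split=> // x; apply: cvgV; [exact: f0|exact: hf.1].
apply: (@dC_isd _ _ (fun v x => (- ((f x)^-1 * (f x)^-1)) * 'D_v f x)).
- by move=> x; apply: cvgV; [exact: f0|exact: hf.1].
- move=> v x; have [d1 d2] := dC_is_derive x v hf; split.
    exact: derivableV.
  by rewrite deriveV // -expr2 exprVn.
- move=> v; apply: dCM; last exact: (hf.2 v).2.
  have hi := ih (dCW hf).
  have := dCM (dC_cst k (-1)) (dCM hi hi).
  by congr dC; apply/funext => x; rewrite mulN1r.
Qed.

Lemma dsmoothV f : (forall x, f x != 0) -> dsmooth f -> dsmooth (fun x => (f x)^-1).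
Proof. by move=> f0 hf k; exact: dC_inv. Qed.

(** Used for periodizations, which are finite sums only in a neighbourhood of each point. *)
Lemma dsmooth_local f :
  (forall x : V, exists2 g, dsmooth g & \forall y \near x, f y = g y) -> dsmooth f.
Proof.
move=> h k; elim: k f h => [|k ih] f h.
  split => // x; have [g hg fg] := h x.
  rewrite /continuous_at (nbhs_singleton fg).
  apply: (@cvg_trans _ (g @ x)); last exact: dsmooth_continuous.
  by apply: near_eq_cvg; apply: filterS fg => y ->.
split => [x|v].
  have [g hg fg] := h x; rewrite /continuous_at (nbhs_singleton fg).
  apply: (@cvg_trans _ (g @ x)); last exact: dsmooth_continuous.
  by apply: near_eq_cvg; apply: filterS fg => y ->.
split => [x|].
  have [g hg fg] := h x.
  apply: (@near_eq_derivable _ _ _ g f); last exact: dsmooth_derivable.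
  by apply: filterS fg => y ->.
apply: ih => x; have [g hg fg] := h x.
exists (fun x => 'D_v g x); first exact: dsmooth_derive.
have := near_join fg; apply: filterS => y fy; exact: near_eq_derive.
Qed.

(** A derivative along [v] at [x] is the derivative at 0 of the function [F] of one real variable,
    so the chain rule on the line suffices. *)
Lemma is_derive_compR f (phi : R -> R) x v df dphi : is_derive x v f df ->
  is_derive (f x : R) 1 phi dphi -> is_derive x v (fun y => phi (f y)) (dphi * df).
Proof.
move=> [d1 d2] [e1 e2].
pose F (t : R) := f (t *: v + x).
have FE (g : V -> R) : (fun h : R => h^-1 *: ((g \o shift x) (h *: v) - g x)) =
    (fun h : R => h^-1 *: (((fun t : R => g (t *: v + x)) \o shift 0) (h *: 1) -
       (fun t : R => g (t *: v + x)) 0)).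
  by apply/funext => h /=; rewrite addr0 scale0r add0r [h *: 1]mulr1.
have dF : is_derive (0 : R) 1 F df.
  by split; [move: d1; rewrite /derivable FE|rewrite -d2 /derive FE].
have dp : is_derive (F 0 : R) 1 phi dphi by split; rewrite /F scale0r add0r.
have [c1 c2] : is_derive (0 : R) 1 (phi \o F) (dphi * df).
  by have := @is_derive1_comp R phi F 0 dphi df dp dF.
by split; [rewrite /derivable FE|rewrite -c2 /derive FE].
Qed.

(** The induction on the order runs over the whole family at once: each derivative is a finite
    combination of members. It covers sine and cosine, and the functions [flat k]. *)
Lemma dC_family (I : Type) (h : I -> R -> R) (d : I -> seq (R * I)) :
  (forall i (t : R), is_derive t 1 (h i) (\sum_(p <- d i) p.1 * h p.2 t)) ->
  forall k i f, dC k f -> dC k (fun x => h i (f x)).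
Proof.
move=> hd; have ch i : continuous (h i).
  by move=> t; apply/differentiable_continuous/derivable1_diffP; have [] := hd i t.
elim=> [|k ih] i f hf.
  by split=> // x; apply: continuous_comp; [exact: hf.1|exact: ch].
apply: (@dC_isd _ _ (fun v x => (\sum_(p <- d i) p.1 * h p.2 (f x)) * 'D_v f x)).
- by move=> x; apply: continuous_comp; [exact: hf.1|exact: ch].
- by move=> v x; apply: is_derive_compR (dC_is_derive x v hf) _.
- move=> v; apply: dCM; last exact: (hf.2 v).2.
  elim: (d i) => [|p r ihr].
    under eq_fun do rewrite big_nil; exact: dC_cst.
  under eq_fun do rewrite big_cons.
  by apply: dCD => //; apply: dCM; [exact: dC_cst|apply: ih; exact: dCW].
Qed.

Lemma dsmooth_family (I : Type) (h : I -> R -> R) (d : I -> seq (R * I)) i f :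
  (forall i (t : R), is_derive t 1 (h i) (\sum_(p <- d i) p.1 * h p.2 t)) ->
  dsmooth f -> dsmooth (fun x => h i (f x)).
Proof. by move=> hd hf k; apply: dC_family hd _ _ _ (hf k). Qed.

Let trig (b : bool) : R -> R := if b then @cos R else @sin R.

Let trigP b (t : R) : is_derive t 1 (trig b)
  (\sum_(p <- [:: ((if b then -1 else 1 : R), ~~ b)]) p.1 * trig p.2 t).
Proof.
rewrite big_cons big_nil addr0 /=; case: b => /=.
  by rewrite mulN1r; exact: is_derive_cos.
by rewrite mul1r; exact: is_derive_sin.
Qed.

Lemma dsmooth_cos f : dsmooth f -> dsmooth (fun x => cos (f x)).
Proof. exact: (dsmooth_family true trigP). Qed.

Lemma dsmooth_sin f : dsmooth f -> dsmooth (fun x => sin (f x)).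
Proof. exact: (dsmooth_family false trigP). Qed.

(* The functions exp(-1/t)/t^k (t > 0), extended by 0, form a family closed
   under differentiation. *)
Definition flat (k : nat) (t : R) : R :=
  if 0 < t then expR (- t^-1) * (t^-1) ^+ k else 0.

(** With [m = k + 2], the exponential of [1/t] is at least [(1/(t m))^m]; this yields a quadratic
    bound, which gives derivative 0 at the origin. *)
Lemma flat_le k t : 0 <= flat k t <= k.+2%:R ^+ k.+2 * t ^+ 2.
Proof.
rewrite /flat; case: ifPn => t0; last first.
  by apply/andP; split => //; rewrite mulr_ge0 ?sqr_ge0 ?exprn_ge0 ?ler0n.
rewrite mulr_ge0 ?expR_ge0 ?exprn_ge0 ?invr_ge0 ?(ltW t0) //=.
set m := k.+2; have m0 : 0 < m%:R :> R by rewrite ltr0n.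
have : (t^-1 / m%:R) ^+ m <= expR (t^-1).
  rewrite -[X in expR X](divfK (lt0r_neq0 m0)) expRM_natr.
  rewrite lerXn2r ?nnegrE ?expR_ge0 ?divr_ge0 ?invr_ge0 ?(ltW t0) //.
  by rewrite (le_trans _ (expR_ge1Dx _)) // lerDr.
rewrite expr_div_n ler_pdivrMr ?exprn_gt0 // => h.
rewrite expRN mulrC ler_pdivrMr ?expR_gt0 //.
have -> : t^-1 ^+ k = t ^+ 2 * t^-1 ^+ m by rewrite /m !exprS expr0; field; rewrite gt_eqF.
rewrite (le_trans (ler_wpM2l (sqr_ge0 t) h)) // le_eqVlt; apply/orP; left.
by apply/eqP; ring.
Qed.

Lemma flatP k (t : R) : is_derive t 1 (flat k)
  (\sum_(p <- [:: (1, k.+2); (- k%:R, k.+1)]) p.1 * flat p.2 t).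
Proof.
rewrite !big_cons big_nil addr0 /= mul1r.
have [t0|t0|->] := ltgtP t 0.
- rewrite /flat ltNge (ltW t0) /= mulr0 addr0.
  apply: (@near_eq_is_derive _ _ _ (fun _ => 0)).
    near=> s; rewrite ltNge (_ : s <= 0) //.
    by apply/ltW; near: s; exact: lt_nbhsl.
- rewrite /flat t0.
  have tn0 : t != 0 by rewrite gt_eqF.
  apply: (@near_eq_is_derive _ _ _ (fun s : R => expR (- s^-1) * (s^-1) ^+ k)).
    near=> s; rewrite (_ : 0 < s) //.
    by near: s; exact: lt_nbhsr.
  have dV : is_derive t 1 (fun s : R => s^-1) (- (t ^- 2)).
    split; first by apply: derivableV.
    by rewrite deriveV // derive_id [LHS]mulr1.
  have dE : is_derive t 1 (fun s : R => expR (- s^-1)) (expR (- t^-1) * t ^- 2).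
    apply: (@is_derive1_comp R expR (fun s => - s^-1) t (expR (- t^-1)) (t ^- 2)).
    by have := is_deriveN dV; rewrite opprK.
  have dX : is_derive t 1 (fun s : R => (s^-1) ^+ k) (k%:R * (t^-1) ^+ k.-1 * - (t ^- 2)).
    by have := @is_deriveX _ _ _ k t 1 _ dV; rewrite exprfctE.
  have dM := is_deriveM dE dX.
  apply: (is_derive_eq dM).
  rewrite /GRing.scale /=.
  have -> : t ^- 2 = t^-1 * t^-1 by rewrite -exprVn expr2.
  case: k {dX dM} => [|k] /=; first by rewrite !exprS expr0; ring.
  by rewrite !exprS; ring.
- rewrite /flat ltxx mulr0 addr0.
  (* By [flat_le] the difference quotient at 0 is at most a constant times [|h|]. *)
  have cv : (fun h : R => h^-1 *: ((flat k \o shift 0) (h *: 1) - flat k 0)) @ 0^' --> 0.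
    apply/cvgrPdist_le => e e0.
    have C0 : 0 < k.+2%:R ^+ k.+2 :> R by rewrite exprn_gt0.
    near=> h; rewrite sub0r normrN /= addr0 [h *: 1]mulr1 {2}/flat ltxx subr0.
    rewrite -[h^-1 *: _]/(h^-1 * _) normrM normfV.
    have h0 : h != 0 by near: h; exact: nbhs_dnbhs_neq.
    rewrite mulrC ler_pdivrMr ?normr_gt0 //.
    have /andP[f0 f1] := flat_le k h.
    rewrite ger0_norm // (le_trans f1) // -real_normK ?num_real // expr2 mulrA.
    rewrite ler_wpM2r // mulrC -ler_pdivlMr //.
    by near: h; apply: dnbhs0_le; rewrite divr_gt0.
  split; first by apply/cvg_ex; exists 0.
  exact: cvg_lim.
Unshelve. all: by end_near. Qed.

Lemma dsmooth_flat k f : dsmooth f -> dsmooth (fun x => flat k (f x)).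
Proof. exact: (dsmooth_family k flatP). Qed.

End gen.

Lemma dsmooth_affine (V W : normedModType R) (L L0 : V -> W) (f : W -> R) :
  continuous L -> (forall x v h, L (h *: v + x) = h *: L0 v + L x) ->
  dsmooth f -> dsmooth (fun x => f (L x)).
Proof.
move=> cL LE hf k; elim: k f hf => [|k ih] f hf.
  split=> // x; apply: continuous_comp; [exact: cL|exact: dsmooth_continuous].
have E (v x : V) : (fun h : R => h^-1 *: (((fun x => f (L x)) \o shift x) (h *: v) - f (L x))) =
    (fun h : R => h^-1 *: ((f \o shift (L x)) (h *: L0 v) - f (L x))).
  by apply/funext => h /=; rewrite LE.
apply: (@dC_isd _ _ _ (fun v x => 'D_(L0 v) f (L x))).
- move=> x; apply: continuous_comp; [exact: cL|exact: dsmooth_continuous].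
- move=> v x; have d : derivable f (L x) (L0 v) by exact: dsmooth_derivable.
  by split; [rewrite /derivable E|rewrite /derive E].
- by move=> v; exact: (ih _ (dsmooth_derive (L0 v) hf)).
Qed.

Lemma dsmooth_coord n (i : 'I_n) : dsmooth (fun x : 'cV[R]_n => x i 0).
Proof.
case=> [|k]; first by split => //; exact: coord_continuous.
apply: (@dC_isd 'cV[R]_n k (fun x : 'cV[R]_n => x i 0) (fun v _ => v i 0)).
- exact: coord_continuous.
- move=> v x.
  have E : (fun h : R => h^-1 *: (((fun x : 'cV[R]_n => x i 0) \o shift x) (h *: v) - x i 0)) @ 0^' --> v i 0.
    apply/cvgrPdist_le => e e0; near=> h.
    rewrite /= !mxE addrK -[h^-1 *: _]/(h^-1 * _) mulKf ?subrr ?normr0 ?ltW //.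
    by near: h; exact: nbhs_dnbhs_neq.
  by split; [apply/cvg_ex; exists (v i 0)|exact: cvg_lim].
- by move=> v; exact: dC_cst.
Unshelve. all: by end_near. Qed.

Lemma dsmooth_rsmooth n (f : 'cV[R]_n -> R) : dsmooth f -> rsmooth f.
Proof.
move=> hf s; have hs : dsmooth (partials s f).
  elim: s => //= i s ih; exact: (dsmooth_derive (delta_mx i 0) ih).
by split; [exact: dsmooth_continuous|move=> i x; exact: dsmooth_derivable].
Qed.

End smooth_functions.

(** * Complex-valued smooth functions and test functions *)

Section complex_smooth.
Context (R : realType).
Local Notation Re := (@complex.Re R).
Local Notation Im := (@complex.Im R).
Local Notation normc := (@Normc.normc R).
Local Notation lam n := (@lebesgue_cV R n).

Lemma cReM (x y : R[i]) : Re (x * y) = Re x * Re y - Im x * Im y.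
Proof. by case: x; case: y. Qed.
Lemma cImM (x y : R[i]) : Im (x * y) = Re x * Im y + Im x * Re y.
Proof. by case: x => a b; case: y => c d /=. Qed.
Lemma cReD (x y : R[i]) : Re (x + y) = Re x + Re y.
Proof. by case: x; case: y. Qed.
Lemma cImD (x y : R[i]) : Im (x + y) = Im x + Im y.
Proof. by case: x; case: y. Qed.
Lemma cReN (x : R[i]) : Re (- x) = - Re x.
Proof. by case: x. Qed.
Lemma cImN (x : R[i]) : Im (- x) = - Im x.
Proof. by case: x. Qed.
Lemma cRe_conj (x : R[i]) : Re (conjc x) = Re x.
Proof. by case: x. Qed.
Lemma cIm_conj (x : R[i]) : Im (conjc x) = - Im x.
Proof. by case: x. Qed.
Lemma ReIm_eq (x y : R[i]) : Re x = Re y -> Im x = Im y -> x = y.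
Proof. by case: x => a b; case: y => c d /= -> ->. Qed.

Lemma cjM (x y : R[i]) : conjc (x * y) = conjc x * conjc y.
Proof. by apply: ReIm_eq; rewrite ?(cReM, cImM, cRe_conj, cIm_conj); ring. Qed.
Lemma cjD (x y : R[i]) : conjc (x + y) = conjc x + conjc y.
Proof. by apply: ReIm_eq; rewrite ?(cReD, cImD, cRe_conj, cIm_conj); ring. Qed.
Lemma cjN (x : R[i]) : conjc (- x) = - conjc x.
Proof. by apply: ReIm_eq; rewrite ?(cReN, cImN, cRe_conj, cIm_conj). Qed.
Lemma cj_sum I (r : seq I) (P : pred I) (F : I -> R[i]) :
  conjc (\sum_(i <- r | P i) F i) = \sum_(i <- r | P i) conjc (F i).
Proof. by rewrite (big_morph conjc cjD (conjc0 R)). Qed.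

Definition csmooth n (f : 'cV[R]_n -> R[i]) := dsmooth (Re \o f) /\ dsmooth (Im \o f).

Section closure.
Variable n : nat.
Implicit Types f g : 'cV[R]_n -> R[i].

Lemma csmooth_cst (c : R[i]) : csmooth (fun _ : 'cV[R]_n => c).
Proof. by split; exact: dsmooth_cst. Qed.

Lemma csmoothD f g : csmooth f -> csmooth g -> csmooth (fun x => f x + g x).
Proof.
move=> [f1 f2] [g1 g2]; split.
  rewrite (_ : _ \o _ = fun x => (Re \o f) x + (Re \o g) x); first exact: dsmoothD.
  by apply/funext => x /=; rewrite cReD.
rewrite (_ : _ \o _ = fun x => (Im \o f) x + (Im \o g) x); first exact: dsmoothD.
by apply/funext => x /=; rewrite cImD.
Qed.

Lemma csmoothM f g : csmooth f -> csmooth g -> csmooth (fun x => f x * g x).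
Proof.
move=> [f1 f2] [g1 g2]; split.
  rewrite (_ : _ \o _ = fun x => (Re \o f) x * (Re \o g) x - (Im \o f) x * (Im \o g) x).
    by apply: dsmoothB; exact: dsmoothM.
  by apply/funext => x /=; rewrite cReM.
rewrite (_ : _ \o _ = fun x => (Re \o f) x * (Im \o g) x + (Im \o f) x * (Re \o g) x).
  by apply: dsmoothD; exact: dsmoothM.
by apply/funext => x /=; rewrite cImM.
Qed.

Lemma csmoothN f : csmooth f -> csmooth (fun x => - f x).
Proof.
move=> /(csmoothM (csmooth_cst (-1))); congr csmooth.
by apply/funext => x; rewrite mulN1r.
Qed.

Lemma csmoothB f g : csmooth f -> csmooth g -> csmooth (fun x => f x - g x).
Proof. by move=> hf hg; apply: csmoothD => //; exact: csmoothN. Qed.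

Lemma csmooth_conj f : csmooth f -> csmooth (fun x => conjc (f x)).
Proof.
move=> [f1 f2]; split.
  by rewrite (_ : _ \o _ = Re \o f) //; apply/funext => x /=; rewrite cRe_conj.
rewrite (_ : _ \o _ = fun x => - (Im \o f) x); first exact: dsmoothN.
by apply/funext => x /=; rewrite cIm_conj.
Qed.

Lemma csmooth_real (u : 'cV[R]_n -> R) : dsmooth u -> csmooth (fun x => (u x)%:C%C).
Proof. by move=> hu; split => //; exact: dsmooth_cst. Qed.

Lemma csmooth_sum I (r : seq I) (P : pred I) (F : I -> 'cV[R]_n -> R[i]) :
  (forall i, csmooth (F i)) -> csmooth (fun x => \sum_(i <- r | P i) F i x).
Proof.
move=> hF; elim: r => [|i r ih].
  under eq_fun do rewrite big_nil; exact: csmooth_cst.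
under eq_fun do rewrite big_cons.
by case: (P i) => //; exact: csmoothD.
Qed.

Lemma csmoothV f : (forall x, f x != 0) -> csmooth f -> csmooth (fun x => (f x)^-1).
Proof.
move=> f0 hf; have nf x : normc (f x) ^+ 2 != 0.
  by rewrite sqrf_eq0; apply: contra (f0 x) => /eqP /Normc.eq0_normc ->.
have -> : (fun x => (f x)^-1) = fun x => ((normc (f x) ^+ 2)^-1)%:C%C * conjc (f x).
  apply/funext => x; have fx := f0 x.
  apply: (mulfI fx); rewrite divff // mulrCA mulc_conj -rmorphM mulVf //.
apply: csmoothM; last exact: csmooth_conj.
apply: csmooth_real; apply: dsmoothV => //.
case: hf => f1 f2.
rewrite (_ : (fun x => _) = fun x => (Re \o f) x * (Re \o f) x + (Im \o f) x * (Im \o f) x).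
  by apply: dsmoothD; exact: dsmoothM.
by apply/funext => x; rewrite sqr_normcE !expr2.
Qed.

Lemma csmooth_local f : (forall x : 'cV[R]_n,
  exists2 g, csmooth g & \forall y \near x, f y = g y) -> csmooth f.
Proof.
move=> h; split; apply: dsmooth_local => x; have [g [g1 g2] fg] := h x.
  by exists (Re \o g) => //; apply: filterS fg => y /= ->.
by exists (Im \o g) => //; apply: filterS fg => y /= ->.
Qed.

Lemma csmooth_ccontinuous f : csmooth f -> ccontinuous f.
Proof. by move=> [f1 f2]; split; exact: dsmooth_continuous. Qed.

Lemma csmooth_smooth f : csmooth f -> smooth f.
Proof. by move=> [f1 f2]; split; exact: dsmooth_rsmooth. Qed.

Lemma bsuppMl f g : bsupp f -> bsupp (fun x => f x * g x).
Proof. by move=> [M h]; exists M => x /h ->; rewrite mul0r. Qed.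

Lemma bsuppMr f g : bsupp g -> bsupp (fun x => f x * g x).
Proof. by move=> [M h]; exists M => x /h ->; rewrite mulr0. Qed.

Lemma bsuppD f g : bsupp f -> bsupp g -> bsupp (fun x => f x + g x).
Proof.
move=> [M h] [N k]; exists (Num.max M N) => x.
by rewrite gt_max => /andP[/h -> /k ->]; rewrite addr0.
Qed.

Lemma bsupp_sum I (r : seq I) (P : pred I) (F : I -> 'cV[R]_n -> R[i]) :
  (forall i, bsupp (F i)) -> bsupp (fun x => \sum_(i <- r | P i) F i x).
Proof.
move=> hF; elim: r => [|i r ih].
  by exists 0 => x _; rewrite big_nil.
under eq_fun do rewrite big_cons.
by case: (P i) => //; exact: bsuppD.
Qed.

(** The space of smooth functions of compact support; every generator of the construction lives here
    on the frequency side. *)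
Definition test f := csmooth f /\ bsupp f.

Lemma testMl f g : csmooth f -> test g -> test (fun x => f x * g x).
Proof. by move=> hf [h1 h2]; split; [exact: csmoothM|exact: bsuppMr]. Qed.

Lemma testMr f g : test f -> csmooth g -> test (fun x => f x * g x).
Proof. by move=> [h1 h2] hg; split; [exact: csmoothM|exact: bsuppMl]. Qed.

Lemma testD f g : test f -> test g -> test (fun x => f x + g x).
Proof. by move=> [? ?] [? ?]; split; [exact: csmoothD|exact: bsuppD]. Qed.

Lemma test_sum I (r : seq I) (P : pred I) (F : I -> 'cV[R]_n -> R[i]) :
  (forall i, test (F i)) -> test (fun x => \sum_(i <- r | P i) F i x).
Proof.
by move=> h; split; [apply: csmooth_sum|apply: bsupp_sum] => i; case: (h i).
Qed.

Lemma testZ (c : R[i]) f : test f -> test (fun x => c * f x).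
Proof. by move=> hf; apply: testMl => //; exact: csmooth_cst. Qed.

Lemma testN f : test f -> test (fun x => - f x).
Proof. by move=> /(testZ (-1)); congr test; apply/funext => x; rewrite mulN1r. Qed.

Lemma testB f g : test f -> test g -> test (fun x => f x - g x).
Proof. by move=> hf hg; apply: testD => //; exact: testN. Qed.

Lemma test0 : test (fun=> 0).
Proof. by split; [exact: csmooth_cst|exists 0]. Qed.

Lemma test_cintegrable f : test f -> cintegrable (lam n) f.
Proof. by move=> [h1 h2]; apply: cintegrable_cc => //; exact: csmooth_ccontinuous. Qed.

Lemma test_bounded f : test f -> exists2 C : R, 0 < C & forall x, normc (f x) <= C.
Proof. by move=> [h1 h2]; apply: ccontinuous_bounded => //; exact: csmooth_ccontinuous. Qed.

Definition cD (v : 'cV[R]_n) f : 'cV[R]_n -> R[i] :=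
  fun x => (('D_v (Re \o f) x) +i* ('D_v (Im \o f) x))%C.

Lemma csmooth_cD v f : csmooth f -> csmooth (cD v f).
Proof. by move=> [f1 f2]; split; exact: dsmooth_derive. Qed.

Lemma test_cD v f : test f -> test (cD v f).
Proof.
move=> [h1 [M h2]]; split; first exact: csmooth_cD.
exists M => x Mx.
have nz : \forall y \near x, f y = 0.
  apply/nbhs_normP; exists (`|x| - M); rewrite /= ?subr_gt0 // => y xy; apply: h2.
  rewrite -ltrN2 -(ltrD2l `|x|) (le_lt_trans _ xy) //; exact: lerB_dist.
rewrite /cD (@near_eq_derive _ _ _ (Re \o f) (fun=> 0)); last first.
  by apply: filterS nz => y /= ->.
rewrite (@near_eq_derive _ _ _ (Im \o f) (fun=> 0)); last first.
  by apply: filterS nz => y /= ->.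
by rewrite !derive_cst.
Qed.

Lemma cD_M v f g x : csmooth f -> csmooth g ->
  cD v (fun x => f x * g x) x = cD v f x * g x + f x * cD v g x.
Proof.
move=> [f1 f2] [g1 g2].
have isd (u : 'cV[R]_n -> R) : dsmooth u -> is_derive x v u ('D_v u x).
  by move=> hu; split => //; exact: dsmooth_derivable.
have [rf jf rg jg] := And4 (isd _ f1) (isd _ f2) (isd _ g1) (isd _ g2).
apply: ReIm_eq => /=.
  rewrite (_ : _ \o _ = (Re \o f) * (Re \o g) - (Im \o f) * (Im \o g)); last first.
    by apply/funext => y /=; rewrite cReM.
  have [_ ->] := is_deriveB (is_deriveM rf rg) (is_deriveM jf jg).
  rewrite cReD !cReM /GRing.scale /=; ring.
rewrite (_ : _ \o _ = (Re \o f) * (Im \o g) + (Im \o f) * (Re \o g)); last first.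
  by apply/funext => y /=; rewrite cImM.
have [_ ->] := is_deriveD (is_deriveM rf jg) (is_deriveM jf rg).
rewrite cImD !cImM /GRing.scale /=; ring.
Qed.

Lemma csmooth_affine (L L0 : 'cV[R]_n -> 'cV[R]_n) f :
  continuous L -> (forall x v h, L (h *: v + x) = h *: L0 v + L x) ->
  csmooth f -> csmooth (fun x => f (L x)).
Proof.
move=> cL LE [f1 f2]; split.
  exact: (@dsmooth_affine _ _ _ L L0 (Re \o f)).
exact: (@dsmooth_affine _ _ _ L L0 (Im \o f)).
Qed.

Lemma csmooth_addv (a : 'cV[R]_n) f : csmooth f -> csmooth (fun x => f (x + a)).
Proof.
apply: (@csmooth_affine (fun x => x + a) id) => [x|x v h]; last by rewrite addrA.
apply/normed_cvgP => e e0; exists e => // y /ltW.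
by rewrite opprD addrACA subrr addr0.
Qed.

Lemma csmooth_mulmx (P : 'M[R]_n) f : csmooth f -> csmooth (fun x => f (P *m x)).
Proof.
apply: (@csmooth_affine (mulmx P) (mulmx P)) => [|x v h].
  exact: continuous_mulmx.
by rewrite mulmxDr scalemxAr.
Qed.

Lemma bsupp_addv (a : 'cV[R]_n) f : bsupp f -> bsupp (fun x => f (x + a)).
Proof.
move=> [M h]; exists (M + `|a|) => x xM; apply: h.
rewrite -(ltrD2r `|a|) (lt_le_trans xM) // -{1}(addrK a x).
by rewrite (le_trans (ler_normB _ _)).
Qed.

Lemma bsupp_mulmx (P : 'M[R]_n) f : P \in unitmx -> bsupp f -> bsupp (fun x => f (P *m x)).
Proof.
move=> uP [M h]; have [C C0 hC] := norm_mulmx_le (invmx P).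
exists (C * M) => x xM; apply: h; rewrite -(ltr_pM2l C0) (lt_le_trans xM) //.
by rewrite -{1}(mulKmx uP x) hC.
Qed.

Lemma test_addv (a : 'cV[R]_n) f : test f -> test (fun x => f (x + a)).
Proof. by move=> [? ?]; split; [exact: csmooth_addv|exact: bsupp_addv]. Qed.

Lemma test_mulmx (P : 'M[R]_n) f : P \in unitmx -> test f -> test (fun x => f (P *m x)).
Proof. by move=> ? [? ?]; split; [exact: csmooth_mulmx|exact: bsupp_mulmx]. Qed.

Lemma mvt_le (f df : R -> R) (b K : R) :
  (forall t : R, is_derive t 1 f (df t)) -> (forall t, `|t| <= `|b| -> `|df t| <= K) ->
  `|f b - f 0| <= K * `|b|.
Proof.
move=> fdf dK.
have cf : continuous f.
  by move=> t; apply/differentiable_continuous/derivable1_diffP; have [] := fdf t.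
have [b0|b0] := leP 0 b.
  have [c /[!in_itv]/= /andP[c0 cb] ->] := @MVT_segment R f df 0 b b0 (fun x _ => fdf x)
    (continuous_subspaceT cf).
  by rewrite subr0 normrM ler_wpM2r // dK // !ger0_norm.
have [c /[!in_itv]/= /andP[c0 cb] h] := @MVT_segment R f df b 0 (ltW b0) (fun x _ => fdf x)
    (continuous_subspaceT cf).
rewrite distrC h sub0r normrM normrN ler_wpM2r // dK //.
by rewrite !ler0_norm ?lerN2 // ltW.
Qed.

Lemma derivable_line (f : 'cV[R]_n -> R) (x v : 'cV[R]_n) : dsmooth f ->
  forall t : R, is_derive t 1 (fun s : R => f (s *: v + x)) ('D_v f (t *: v + x)).
Proof.
move=> hf t; have E : (fun h : R => h^-1 *: (((fun s : R => f (s *: v + x)) \o shift t) (h *: 1) -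
     f (t *: v + x))) =
   (fun h : R => h^-1 *: ((f \o shift (t *: v + x)) (h *: v) - f (t *: v + x))).
  apply/funext => h /=; rewrite [h *: 1]mulr1 scalerDl addrA //.
have d : derivable f (t *: v + x) v by exact: dsmooth_derivable.
by split; [rewrite /derivable E|rewrite /derive E].
Qed.

(** The difference quotients integrate to 0 by translation invariance, and they converge dominatedly
    to the derivative. *)
Lemma cint_cD v f : test f -> cint (lam n) (cD v f) = 0.
Proof.
move=> tf; have tD := test_cD v tf; have [C C0 hC] := test_bounded tD.
have fi := test_cintegrable tf.
have [[f1 f2] [M hM]] := tf.
pose t (k : nat) : R := k.+1%:R^-1.
have t0 k : 0 < t k by rewrite invr_gt0.
pose F k x := (t k)^-1%:C%C * (f (x + t k *: v) - f x).
have F0 k : cint (lam n) (F k) = 0.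
  have [i1 e1] := cint_addv (t k *: v) fi.
  by rewrite /F cintZ ?cintB ?e1 ?subrr ?mulr0 //; exact: cintegrableB.
have FE k x : F k x = ((t k)^-1 * (Re (f (x + t k *: v)) - Re (f x)) +i*
     ((t k)^-1 * (Im (f (x + t k *: v)) - Im (f x))))%C.
  by apply: ReIm_eq; rewrite ?cReM ?cImM cReD cImD cReN cImN /=; ring.
have Fb k x : normc (F k x) <= C + C.
  rewrite FE (le_trans (normc_le _)) //=.
  have bnd (p : R[i] -> R) : dsmooth (p \o f) -> (forall y, `|'D_v (p \o f) y| <= C) ->
      `|(t k)^-1 * (p (f (x + t k *: v)) - p (f x))| <= C.
    move=> pf hp; rewrite normrM [X in X * _]gtr0_norm ?invr_gt0 // ler_pdivrMl // mulrC.
    have := @mvt_le _ _ (t k) C (derivable_line x v pf) (fun s _ => hp _).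
    by rewrite scale0r add0r (gtr0_norm (t0 k)) [t k *: v + x]addrC.
  apply: lerD; apply: bnd => // y; apply: le_trans (hC y).
    exact: (le_trans _ (normc_Re _)).
  exact: (le_trans _ (normc_Im _)).
have tcv : t @ \oo --> (0 : R)^'.
  move=> A A0; have h : \forall k \near \oo, (t k != 0 -> A (t k)) := @cvg_harmonic R _ A0.
  change (\forall k \near \oo, A (t k)); apply: filterS h => k h; apply: h.
  exact: lt0r_neq0.
have dq (u : 'cV[R]_n -> R) x : dsmooth u ->
    (fun k => (t k)^-1 * (u (x + t k *: v) - u x)) @ \oo --> 'D_v u x.
  move=> hu; have d : derivable u x v by exact: dsmooth_derivable.
  have h := cvg_comp t (fun h : R => h^-1 *: ((u \o shift x) (h *: v) - u x)) tcv d.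
  rewrite (_ : (fun k => _) = (fun h : R => h^-1 *: ((u \o shift x) (h *: v) - u x)) \o t) //.
  by apply/funext => k /=; rewrite [x + _]addrC.
have cf := csmooth_ccontinuous (conj f1 f2).
have mF k : cmeas (F k).
  apply: cmeasM; first exact: cmeas_cst.
  apply: cmeasB; last exact: ccontinuous_cmeas.
  exact: cmeas_comp (ccontinuous_cmeas cf) (measurable_addv _).
have mD : cmeas (cD v f) by apply: ccontinuous_cmeas; apply: csmooth_ccontinuous; case: tD.
(* The majorant: each component of the quotient is at most [C] by the mean value theorem, and the
   steps [t k <= 1] keep all supports in the ball of radius [|M| + |v|]. *)
have [|||_] := @cint_dct _ _ _ (lam n) F (cD v f) (fun x => (C + C) * boxfun (`|M| + `|v|) x) mF mD.
- move=> x; apply/cvgrPdist_le => e e0.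
  have e2 : 0 < e / 2 by rewrite divr_gt0.
  have /cvgrPdist_le /(_ _ e2) c1 := dq _ x f1.
  have /cvgrPdist_le /(_ _ e2) c2 := dq _ x f2.
  near=> k; rewrite sub0r normrN ger0_norm ?normc_ge0 //.
  rewrite normc_distC (le_trans (normc_le _)) // [leRHS]splitr cReD cImD cReN cImN.
  rewrite FE /=; apply: lerD; near: k.
    exact: c1.
  exact: c2.
- have := integrableZl measurableT (C + C) (@integrable_boxfun R n (`|M| + `|v|)).
  by apply: eq_integrable => // x _ /=; rewrite EFinM.
- move=> k x; have [xM|xM] := leP `|x| (`|M| + `|v|); first by rewrite boxfun1 // mulr1.
  rewrite boxfun0 ?addr_ge0 // mulr0 /F.
  have xM' : M < `|x| by rewrite (le_lt_trans (ler_norm _)) // (le_lt_trans _ xM) // lerDl.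
  rewrite !hM ?subrr ?mulr0 ?Normc.normc0 //.
  rewrite (le_lt_trans (ler_norm _)) // -(ltrD2r `|v|) (lt_le_trans xM) //.
  rewrite -{1}(addrK (t k *: v) x) (le_trans (ler_normB _ _)) // lerD2l normrZ.
  by rewrite ler_piMl // gtr0_norm // invf_le1 // ler1n.
move=> h; apply: Normc.eq0_normc.
have : (fun k : nat => normc (cint (lam n) (F k) - cint (lam n) (cD v f))) @ \oo -->
    normc (cint (lam n) (cD v f)).
  by under eq_fun do rewrite F0 sub0r normcN; exact: cvg_cst.
by move/cvg_unique; apply.
Unshelve. all: by end_near. Qed.

End closure.
End complex_smooth.

(** * Fourier integrals of test functions *)

Section fourier_test.
Context (R : realType).
Local Notation Re := (@complex.Re R).
Local Notation Im := (@complex.Im R).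
Local Notation normc := (@Normc.normc R).
Local Notation lam n := (@lebesgue_cV R n).
Local Notation leb := (@lebesgue_measure R).

Lemma expiD (a b : R) : expi (a + b) = expi a * expi b.
Proof. by apply: ReIm_eq; rewrite ?cReM ?cImM /= ?cosD ?sinD; ring. Qed.

Lemma expiN (a : R) : expi (- a) = conjc (expi a).
Proof. by rewrite /expi cosN sinN. Qed.

Lemma expi0 : expi 0 = 1 :> R[i].
Proof. by rewrite /expi cos0 sin0. Qed.

Lemma normc_expi (a : R) : normc (expi a) = 1.
Proof. by rewrite normcE /= cos2Dsin2 sqrtr1. Qed.

Lemma expi_nat (k : nat) : expi (2 * pi * k%:R) = 1 :> R[i].
Proof.
elim: k => [|k ih]; first by rewrite mulr0 expi0.
rewrite -[k.+1]addn1 natrD mulrDr expiD ih mul1r mulr1 /expi mulr_natl cos2pi sin2pi //.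
Qed.

Lemma expi_int (k : int) : expi (2 * pi * k%:~R) = 1 :> R[i].
Proof.
case: k => k; first exact: expi_nat.
by rewrite NegzE mulrNz mulrN expiN expi_nat conjc1.
Qed.

Lemma dotC n (x y : 'cV[R]_n) : dot x y = dot y x.
Proof. by apply: eq_bigr => i _; rewrite mulrC. Qed.

Lemma dotDl n (x y z : 'cV[R]_n) : dot (x + y) z = dot x z + dot y z.
Proof. by rewrite -big_split; apply: eq_bigr => i _; rewrite mxE mulrDl. Qed.

Lemma dotZl n (a : R) (x z : 'cV[R]_n) : dot (a *: x) z = a * dot x z.
Proof. by rewrite mulr_sumr; apply: eq_bigr => i _; rewrite mxE mulrA. Qed.

Lemma dotNl n (x z : 'cV[R]_n) : dot (- x) z = - dot x z.
Proof. by rewrite -scaleN1r dotZl mulN1r. Qed.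

Lemma dotDr n (x y z : 'cV[R]_n) : dot x (y + z) = dot x y + dot x z.
Proof. by rewrite dotC dotDl !(dotC x). Qed.

Lemma dotZr n (a : R) (x z : 'cV[R]_n) : dot x (a *: z) = a * dot x z.
Proof. by rewrite dotC dotZl dotC. Qed.

Lemma dotNr n (x z : 'cV[R]_n) : dot x (- z) = - dot x z.
Proof. by rewrite dotC dotNl dotC. Qed.

Lemma dotE n (x y : 'cV[R]_n) : dot x y = (x^T *m y) 0 0.
Proof. by rewrite mxE; apply: eq_bigr => i _; rewrite mxE. Qed.

Lemma dot_mulmx n (P : 'M[R]_n) (x y : 'cV[R]_n) : dot x (P *m y) = dot (P^T *m x) y.
Proof. by rewrite !dotE trmx_mul trmxK mulmxA. Qed.

Lemma dot_le n (x y : 'cV[R]_n) : `|dot x y| <= n%:R * (`|x| * `|y|).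
Proof.
rewrite (le_trans (ler_norm_sum _ _ _)) // -[n in n%:R]card_ord -sum1_card natr_sum mulr_suml.
by apply: ler_sum => i _; rewrite mul1r normrM ler_pM // coord_le_norm.
Qed.

Lemma is_derive_lin (V : normedModType R) (L : V -> R) (x v : V) :
  (forall (h : R), L (h *: v + x) = h * L v + L x) -> is_derive x v L (L v).
Proof.
move=> LE.
have E : (fun h : R => h^-1 *: ((L \o shift x) (h *: v) - L x)) @ 0^' --> L v.
  apply/cvgrPdist_le => e e0; near=> h.
  rewrite /= LE addrK -[h^-1 *: _]/(h^-1 * _) mulKf ?subrr ?normr0 ?ltW //.
  by near: h; exact: nbhs_dnbhs_neq.
by split; [apply/cvg_ex; exists (L v)|exact: cvg_lim].
Unshelve. all: by end_near. Qed.

Lemma dsmooth_dot n (a : 'cV[R]_n) : dsmooth (dot a).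
Proof.
apply: dsmooth_sum => i; apply: dsmoothM; first exact: dsmooth_cst.
exact: dsmooth_coord.
Qed.

Lemma csmooth_expi n (u : 'cV[R]_n -> R) : dsmooth u -> csmooth (fun x => expi (u x)).
Proof. by move=> hu; split; [exact: dsmooth_cos|exact: dsmooth_sin]. Qed.

Definition ew n (x xi : 'cV[R]_n) : R[i] := expi (2 * pi * dot x xi).

Lemma csmooth_ew n (x : 'cV[R]_n) : csmooth (ew x).
Proof.
apply: csmooth_expi; apply: dsmoothM; [exact: dsmooth_cst|exact: dsmooth_dot].
Qed.

Lemma normc_ew n (x xi : 'cV[R]_n) : normc (ew x xi) = 1.
Proof. exact: normc_expi. Qed.

Lemma ewDl n (x y xi : 'cV[R]_n) : ew (x + y) xi = ew x xi * ew y xi.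
Proof. by rewrite /ew dotDl mulrDr expiD. Qed.

Lemma ewDr n (x xi eta : 'cV[R]_n) : ew x (xi + eta) = ew x xi * ew x eta.
Proof. by rewrite /ew dotDr mulrDr expiD. Qed.

Lemma ewNl n (x xi : 'cV[R]_n) : ew (- x) xi = conjc (ew x xi).
Proof. by rewrite /ew dotNl mulrN expiN. Qed.

Lemma ewNr n (x xi : 'cV[R]_n) : ew x (- xi) = conjc (ew x xi).
Proof. by rewrite /ew dotNr mulrN expiN. Qed.

Lemma ewC n (x xi : 'cV[R]_n) : ew x xi = ew xi x.
Proof. by rewrite /ew dotC. Qed.

Lemma ew0 n (xi : 'cV[R]_n) : ew 0 xi = 1.
Proof. by rewrite /ew -(scale0r 0) dotZl mul0r mulr0 expi0. Qed.

Lemma cD_ew n (x v xi : 'cV[R]_n) :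
  cD v (ew x) xi = (0 +i* (2 * pi * dot x v))%C * ew x xi.
Proof.
have dl : is_derive xi v (fun y => 2 * pi * dot x y) (2 * pi * dot x v).
  by apply: is_derive_lin => h; rewrite dotDr dotZr; ring.
have [_ c] := is_derive_compR dl (is_derive_cos (2 * pi * dot x xi)).
have [_ s] := is_derive_compR dl (is_derive_sin (2 * pi * dot x xi)).
by apply: ReIm_eq; rewrite ?cReM ?cImM /= ?c ?s; ring.
Qed.

(** The inverse Fourier integral. As [fourier f xi] is [ift f (- xi)], one operator serves for both
    directions. *)
Definition ift n (g : 'cV[R]_n -> R[i]) (x : 'cV[R]_n) : R[i] :=
  cint (lam n) (fun xi => g xi * ew x xi).

Section fixed_dim.
Variable n : nat.
Implicit Types f g : 'cV[R]_n -> R[i].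

Lemma fourierE f (xi : 'cV[R]_n) : fourier f xi = ift f (- xi).
Proof.
by congr cint; apply/funext => x; rewrite /ew dotNl mulrN dotC.
Qed.

Lemma cmeas_ew (x : 'cV[R]_n) : cmeas (ew x).
Proof. exact/ccontinuous_cmeas/csmooth_ccontinuous/csmooth_ew. Qed.

Lemma cintegrable_ew g (x : 'cV[R]_n) : cintegrable (lam n) g ->
  cintegrable (lam n) (fun xi => g xi * ew x xi).
Proof.
move=> ig; apply: (@cintegrable_le _ _ _ _ _ (normc \o g)).
- by apply: cmeasM; [exact: cintegrable_cmeas ig|exact: cmeas_ew].
- exact: cintegrable_normc.
- by move=> xi; rewrite Normc.normcM normc_ew mulr1.
Qed.

Lemma iftD f g x : cintegrable (lam n) f -> cintegrable (lam n) g ->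
  ift (fun xi => f xi + g xi) x = ift f x + ift g x.
Proof.
move=> hf hg; rewrite /ift -cintD; try exact: cintegrable_ew.
by congr cint; apply/funext => xi; rewrite mulrDl.
Qed.

Lemma iftZ c g x : cintegrable (lam n) g -> ift (fun xi => c * g xi) x = c * ift g x.
Proof.
move=> hg; rewrite /ift -cintZ; last exact: cintegrable_ew.
by congr cint; apply/funext => xi; rewrite mulrA.
Qed.

Lemma normc_ift g x : cintegrable (lam n) g ->
  normc (ift g x) <= 2 * \int[lam n]_xi normc (g xi).
Proof.
move=> hg; apply: (le_trans (normc_cint_le (cintegrable_ew x hg))).
rewrite ler_wpM2l // le_eqVlt; apply/orP; left; apply/eqP.
by apply: eq_Rintegral => xi _; rewrite Normc.normcM normc_ew mulr1.
Qed.

Let sin_le (b : R) : `|sin b| <= `|b|.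
Proof.
have := @mvt_le R sin cos b 1 (fun t => is_derive_sin t).
rewrite sin0 subr0 mul1r; apply => t _; rewrite ler_norml cos_geN1 cos_le1 //.
Qed.

Let cos_le (b : R) : `|cos b - 1| <= `|b|.
Proof.
have := @mvt_le R cos (fun t => - sin t) b 1 (fun t => is_derive_cos t).
rewrite cos0 mul1r; apply => t _; rewrite normrN ler_norml sin_geN1 sin_le1 //.
Qed.

Lemma expi_lip (b : R) : normc (expi b - 1) <= 2 * `|b|.
Proof.
rewrite (le_trans (normc_le _)) // cReD cImD cReN cImN /= subr0 mulr_natl mulr2n.
by rewrite lerD ?cos_le ?sin_le.
Qed.

Lemma expi_taylor (b : R) : normc (expi b - 1 - (0 +i* b)%C) <= 2 * b ^+ 2.
Proof.
rewrite (le_trans (normc_le _)) // !cReD !cImD !cReN !cImN /= !subr0.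
rewrite mulr_natl mulr2n -real_normK ?num_real // expr2 lerD //.
  have := @mvt_le R cos (fun t => - sin t) b `|b| (fun t => is_derive_cos t).
  rewrite cos0; apply => t tb; rewrite normrN; exact: le_trans (sin_le _) tb.
have dS (t : R) : is_derive t 1 (fun s => sin s - s) (cos t - 1).
  exact: (is_deriveB (is_derive_sin t) (is_derive_id t 1)).
have := @mvt_le R _ _ b `|b| dS (fun t tb => le_trans (cos_le t) tb).
by rewrite sin0 !subr0.
Qed.

Lemma test_mulr_real g (u : 'cV[R]_n -> R) : dsmooth u -> test g ->
  test (fun xi => (u xi)%:C%C * g xi).
Proof. by move=> hu; apply: testMl; exact: csmooth_real. Qed.

(** Multiplication by 2 pi i <v, xi>, the symbol of the derivative along [v]. *)
Definition mulD (v : 'cV[R]_n) g : 'cV[R]_n -> R[i] :=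
  fun xi => (0 +i* (2 * pi * dot v xi))%C * g xi.

Lemma test_mulD v g : test g -> test (mulD v g).
Proof.
apply: testMl; split => /=; first exact: dsmooth_cst.
by apply: dsmoothM; [exact: dsmooth_cst|exact: dsmooth_dot].
Qed.

(** Differentiation under the integral sign with an explicit error: the second-order Taylor
    remainder of the exponential is at most [h^2] times a polynomial in [xi], which is integrable
    against the test function. *)
Lemma ift_diff_le g v x : test g -> exists2 K : R, 0 <= K & forall h : R,
  normc (ift g (h *: v + x) - ift g x - h%:C%C * ift (mulD v g) x) <= K * h ^+ 2.
Proof.
move=> tg; have ig := test_cintegrable tg.
have iDg := test_cintegrable (test_mulD v tg).
pose u xi := 2 * (2 * pi * dot v xi) ^+ 2.
have su : dsmooth u.
  rewrite /u; under eq_fun do rewrite expr2.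
  apply: dsmoothM; first exact: dsmooth_cst.
  by apply: dsmoothM; (apply: dsmoothM; [exact: dsmooth_cst|exact: dsmooth_dot]).
have ig2 := test_cintegrable (test_mulr_real su tg).
have in2 := cintegrable_normc ig2.
exists (2 * \int[lam n]_xi normc ((u xi)%:C%C * g xi)).
  by rewrite mulr_ge0 // Rintegral_ge0 // => y _; exact: normc_ge0.
move=> h; pose E xi := expi (h * (2 * pi * dot v xi)) - 1 - (0 +i* (h * (2 * pi * dot v xi)))%C.
have -> : ift g (h *: v + x) - ift g x - h%:C%C * ift (mulD v g) x =
    cint (lam n) (fun xi => g xi * ew x xi * E xi).
  rewrite /ift -cintZ; last exact: cintegrable_ew.
  rewrite -cintB; try exact: cintegrable_ew.
  rewrite -cintB; last 2 first.
  - by apply: cintegrableB; exact: cintegrable_ew.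
  - by apply: cintegrableZ; exact: cintegrable_ew.
  congr cint; apply/funext => xi; rewrite ewDl /mulD /E /ew dotZl.
  rewrite (_ : 2 * pi * (h * dot v xi) = h * (2 * pi * dot v xi)); last by ring.
  have -> : (0 +i* (h * (2 * pi * dot v xi)))%C = h%:C%C * (0 +i* (2 * pi * dot v xi))%C.
    by apply: ReIm_eq; rewrite ?cReM ?cImM /=; ring.
  ring.
have sE : csmooth E.
  apply: csmoothB; first apply: csmoothB; last 2 first.
  - exact: csmooth_cst.
  - split; first exact: dsmooth_cst.
    apply: dsmoothM; first exact: dsmooth_cst.
    by apply: dsmoothM; [exact: dsmooth_cst|exact: dsmooth_dot].
  apply: csmooth_expi; apply: dsmoothM; first exact: dsmooth_cst.
  by apply: dsmoothM; [exact: dsmooth_cst|exact: dsmooth_dot].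
have tE : test (fun xi => g xi * ew x xi * E xi).
  by apply: testMr => //; apply: testMr => //; exact: csmooth_ew.
rewrite (le_trans (normc_cint_le (test_cintegrable tE))) // -mulrA ler_wpM2l //.
rewrite mulrC -RintegralZl //; apply: le_Rintegral => //.
- exact: cintegrable_normc (test_cintegrable tE).
- by have := integrableZl measurableT (h ^+ 2) in2; apply: eq_integrable => // y _ /=; rewrite EFinM.
move=> xi _; rewrite !Normc.normcM normc_ew mulr1 mulrA mulrC ler_wpM2r ?normc_ge0 //.
rewrite (le_trans (expi_taylor _)) // normc_real ger0_norm; last first.
  by rewrite mulr_ge0 ?sqr_ge0.
by rewrite /u exprMn le_eqVlt; apply/orP; left; apply/eqP; ring.
Qed.

Lemma is_derive_ift g v x : test g ->
  is_derive x v (Re \o ift g) (Re (ift (mulD v g) x)) /\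
  is_derive x v (Im \o ift g) (Im (ift (mulD v g) x)).
Proof.
move=> tg; have [K K0 hK] := ift_diff_le v x tg.
have key (p : R[i] -> R) : (forall z, `|p z| <= normc z) ->
    (forall y z, p (y - z) = p y - p z) -> (forall (h : R) z, p (h%:C%C * z) = h * p z) ->
    is_derive x v (p \o ift g) (p (ift (mulD v g) x)).
  move=> pn pB pZ.
  have E : (fun h : R => h^-1 *: (((p \o ift g) \o shift x) (h *: v) - (p \o ift g) x)) @ 0^' -->
      p (ift (mulD v g) x).
    apply/cvgrPdist_le => e e0; near=> h.
    have h0 : h != 0 by near: h; exact: nbhs_dnbhs_neq.
    rewrite /= -[h^-1 *: _]/(h^-1 * _) distrC.
    rewrite (_ : _ - _ = h^-1 * p (ift g (h *: v + x) - ift g x - h%:C%C * ift (mulD v g) x)); last first.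
      by rewrite !pB pZ [RHS]mulrBr mulKf.
    rewrite normrM normfV ler_pdivrMl ?normr_gt0 //.
    rewrite (le_trans (pn _)) // (le_trans (hK h)) // -real_normK ?num_real // expr2.
    rewrite mulrCA ler_wpM2l // (@le_trans _ _ ((K + 1) * `|h|)) //.
      by rewrite ler_wpM2r // lerDl.
    rewrite mulrC -ler_pdivlMr ?ltr_wpDl //.
    by near: h; apply: dnbhs0_le; rewrite divr_gt0 // ltr_wpDl.
  by split; [apply/cvg_ex; exists (p (ift (mulD v g) x))|exact: cvg_lim].
split; apply: key; [exact: normc_Re| | |exact: normc_Im| |].
- by move=> y z; rewrite cReD cReN.
- by move=> h z; rewrite cReM /= mul0r subr0.
- by move=> y z; rewrite cImD cImN.
- by move=> h z; rewrite cImM /= mul0r addr0.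
Unshelve. all: by end_near. Qed.

Lemma ift_lipschitz g : test g -> exists2 K : R, 0 < K &
  forall x y, normc (ift g x - ift g y) <= K * `|x - y|.
Proof.
move=> tg; have ig := test_cintegrable tg; have [_ [M hM]] := tg.
pose K := 4 * pi * n%:R * `|M|.
have K0 : 0 <= K by rewrite !mulr_ge0 // ?pi_ge0.
have I0 : 0 <= \int[lam n]_xi normc (g xi).
  by apply: Rintegral_ge0 => y _; exact: normc_ge0.
exists (2 * (K * \int[lam n]_xi normc (g xi)) + 1).
  by rewrite ltr_wpDl // mulr_ge0 // mulr_ge0.
move=> x y.
have dE xi : g xi * ew x xi - g xi * ew y xi = g xi * ew y xi * (ew (x - y) xi - 1).
  by have -> : ew x xi = ew (x - y) xi * ew y xi; [rewrite -ewDl subrK|ring].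
rewrite /ift -cintB; try exact: cintegrable_ew.
have iB : cintegrable (lam n) (fun xi => g xi * ew x xi - g xi * ew y xi).
  by apply: cintegrableB; exact: cintegrable_ew.
rewrite (le_trans (normc_cint_le iB)) //.
rewrite [leRHS](_ : _ = 2 * (K * \int[lam n]_xi normc (g xi)) * `|x - y| + `|x - y|); last by ring.
apply: (@le_trans _ _ (2 * (K * \int[lam n]_xi normc (g xi)) * `|x - y|)); last by rewrite lerDl.
rewrite -mulrA ler_wpM2l // mulrAC -RintegralZl //; last exact: cintegrable_normc.
apply: le_Rintegral => //; first exact: cintegrable_normc.
  by have := integrableZl measurableT (K * `|x - y|) (cintegrable_normc ig); apply: eq_integrable => // z _ /=; rewrite EFinM.
move=> xi _; rewrite dE !Normc.normcM normc_ew mulr1 mulrC.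
have [xiM|xiM] := leP `|xi| M; last by rewrite hM // Normc.normc0 !mulr0.
rewrite ler_wpM2r ?normc_ge0 // (le_trans (expi_lip _)) //.
rewrite !normrM ger0_norm // [`|pi|]ger0_norm ?pi_ge0 //.
rewrite (_ : K * _ = 2 * (2 * pi * (n%:R * (`|x - y| * `|M|)))); last by rewrite /K; ring.
rewrite !ler_wpM2l ?mulr_ge0 ?pi_ge0 // (le_trans (dot_le _ _)) // !ler_wpM2l //.
by rewrite (le_trans xiM) // ler_norm.
Qed.

Lemma ccontinuous_ift g : test g -> ccontinuous (ift g).
Proof.
move=> tg; have [K K0 hK] := ift_lipschitz tg.
have key (p : R[i] -> R) : (forall z, `|p z| <= normc z) ->
    (forall y z, p (y - z) = p y - p z) -> continuous (p \o ift g).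
  move=> pn pB x; apply/normed_cvgP => e e0; exists (e / K); first by rewrite divr_gt0.
  move=> y; rewrite ltr_pdivlMr // mulrC => xy; rewrite /= -pB.
  by rewrite (le_trans (pn _)) // (le_trans (hK _ _)) // ltW.
split; apply: key; [exact: normc_Re| |exact: normc_Im|].
  by move=> y z; rewrite cReD cReN.
by move=> y z; rewrite cImD cImN.
Qed.

Lemma csmooth_ift g : test g -> csmooth (ift g).
Proof.
move=> tg; suff h k : forall g, test g -> dC k (Re \o ift g) /\ dC k (Im \o ift g).
  by split=> k; have [] := h k g tg.
elim: k => [|k ih] {tg}g tg; have [c1 c2] := ccontinuous_ift tg; first by split.
split.
  apply: (@dC_isd _ _ _ _ (fun v x => Re (ift (mulD v g) x))) => //.
    by move=> v x; have [] := is_derive_ift v x tg.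
  by move=> v; have [] := ih _ (test_mulD v tg).
apply: (@dC_isd _ _ _ _ (fun v x => Im (ift (mulD v g) x))) => //.
  by move=> v x; have [] := is_derive_ift v x tg.
by move=> v; have [] := ih _ (test_mulD v tg).
Qed.

Lemma cpartials_ift g s : test g -> exists2 g' : 'cV[R]_n -> R[i], test g' & cpartials s (ift g) = ift g'.
Proof.
move=> tg; suff [g' tg' [e1 e2]] : exists2 g' : 'cV[R]_n -> R[i], test g' &
    partials s (Re \o ift g) = Re \o ift g' /\ partials s (Im \o ift g) = Im \o ift g'.
  exists g' => //; apply/funext => x; rewrite /cpartials e1 e2 /=.
  exact: ReIm_eq.
elim: s => [|i s [g' tg' [e1 e2]]]; first by exists g.
exists (mulD (delta_mx i 0) g'); first exact: test_mulD.
rewrite /= e1 e2 /partial; split; apply/funext => x.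
  by have [[_ ->]] := is_derive_ift (delta_mx i 0) x tg'.
by have [_ [_ ->]] := is_derive_ift (delta_mx i 0) x tg'.
Qed.

(** Integration by parts: the integral of the derivative of [g * ew x] along the [i]-th axis
    vanishes by [cint_cD], and the derivative of the character contributes the factor 2 pi i x_i. *)
Lemma ift_mul_coord g (i : 'I_n) : test g -> exists2 g' : 'cV[R]_n -> R[i], test g' &
  forall x : 'cV[R]_n, (x i 0)%:C%C * ift g x = ift g' x.
Proof.
move=> tg; pose e : 'cV[R]_n := delta_mx i 0.
have de (x : 'cV[R]_n) : dot x e = x i 0.
  rewrite /dot (bigD1 i) //= big1 ?addr0; first by rewrite mxE !eqxx mulr1.
  by move=> j ji; rewrite mxE (negbTE ji) mulr0.
pose c : R[i] := - ((0 +i* (2 * pi))%C)^-1.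
have c0 : (0 +i* (2 * pi))%C != 0 :> R[i].
  by rewrite eq_complex /= negb_and mulf_neq0 ?orbT // gt_eqF // pi_gt0.
exists (fun xi => c * cD e g xi); first exact/testZ/test_cD.
move=> x; rewrite iftZ; last exact/test_cintegrable/test_cD.
have tge : test (fun xi => g xi * ew x xi) by apply: testMr => //; exact: csmooth_ew.
have := cint_cD e tge.
have -> : cD e (fun xi => g xi * ew x xi) =
   (fun xi => cD e g xi * ew x xi + (0 +i* (2 * pi * x i 0))%C * (g xi * ew x xi)).
  apply/funext => xi; rewrite cD_M; [|by case: tg|exact: csmooth_ew].
  by rewrite cD_ew de mulrCA.
rewrite cintD; last 2 first.
- by apply: cintegrable_ew; exact/test_cintegrable/test_cD.
- by apply: cintegrableZ; exact/test_cintegrable.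
rewrite cintZ; last exact/test_cintegrable.
rewrite -/(ift (cD e g) x) -/(ift g x) => /eqP; rewrite addr_eq0 => /eqP ->.
have -> : (0 +i* (2 * pi * x i 0))%C = (0 +i* (2 * pi))%C * (x i 0)%:C%C.
  by apply: ReIm_eq; rewrite ?cReM ?cImM /=; ring.
by rewrite /c mulrNN -mulrA mulKf.
Qed.

Lemma ift_mul_monom g (a : 'I_n -> nat) : test g -> exists2 g' : 'cV[R]_n -> R[i], test g' &
  forall x : 'cV[R]_n, (\prod_i x i 0 ^+ a i)%:C%C * ift g x = ift g' x.
Proof.
move=> tg; elim: (index_enum _) => [|i r [g' tg' h]].
  by exists g => // x; rewrite big_nil mul1r.
have [k hk e] : exists2 k : 'cV[R]_n -> R[i], test k & forall x : 'cV[R]_n, (x i 0 ^+ a i)%:C%C * ift g' x = ift k x.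
  elim: (a i) => [|m [k hk e]]; first by exists g' => // x; rewrite expr0 mul1r.
  have [k' hk' e'] := ift_mul_coord i hk.
  by exists k' => // x; rewrite exprS rmorphM -mulrA e e'.
by exists k => // x; rewrite big_cons rmorphM -mulrA h e.
Qed.

Lemma schwartz_ift g : test g -> schwartz (ift g).
Proof.
move=> tg; split; first exact/csmooth_smooth/csmooth_ift.
move=> a s; have [g1 tg1 e1] := cpartials_ift s tg.
have [g2 tg2 e2] := ift_mul_monom a tg1.
exists (2 * \int[lam n]_xi normc (g2 xi)) => x.
rewrite e1 -normc_real -Normc.normcM e2; exact/normc_ift/test_cintegrable.
Qed.

Lemma integrable_cauchy : leb.-integrable setT (EFin \o (fun t : R => (1 + t ^+ 2)^-1)).
Proof.
have c : continuous (fun t : R => (1 + t ^+ 2)^-1) := @continuous_oneDsqrV R.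
have p (t : R) : 0 <= (1 + t ^+ 2)^-1 by rewrite invr_ge0 addr_ge0 // sqr_ge0.
apply/integrableP; split.
  by apply/measurable_EFinP; exact: continuous_measurable_fun.
under eq_integral => t _ do rewrite /= ger0_norm //.
rewrite ge0_symfun_integralT //; last by move=> t; rewrite /= sqrrN.
have := integral0y_oneDsqr R; rewrite set_itvE /oneDsqr => ->.
by rewrite -EFinM ltry.
Qed.

Definition cauchyw (x : 'cV[R]_n) : R := \prod_i (1 + x i 0 ^+ 2)^-1.

Lemma integrable_cauchyw : (lam n).-integrable setT (EFin \o cauchyw).
Proof.
apply: (@integrable_prod R n (fun _ t => (1 + t ^+ 2)^-1)) => [i t|i].
  by rewrite invr_ge0 addr_ge0 // sqr_ge0.
exact: integrable_cauchy.
Qed.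

(** The product of the [1 + x_i^2] with [ift g] is again the transform of a test function, hence
    bounded; the reciprocal of that product is an integrable weight. *)
Lemma ift_decay g : test g -> exists2 C : R, 0 <= C & forall x, normc (ift g x) <= C * cauchyw x.
Proof.
move=> tg; have [g' tg' h] : exists2 g' : 'cV[R]_n -> R[i], test g' &
    forall x : 'cV[R]_n, (\prod_i (1 + x i 0 ^+ 2))%:C%C * ift g x = ift g' x.
  elim: (index_enum _) => [|i r [g' tg' h]].
    by exists g => // x; rewrite big_nil mul1r.
  have [k1 tk1 e1] := ift_mul_coord i tg'; have [k2 tk2 e2] := ift_mul_coord i tk1.
  exists (fun xi => g' xi + k2 xi); first exact: testD.
  move=> x; rewrite iftD; try exact: test_cintegrable.
  by rewrite big_cons rmorphM -mulrA h -e2 -e1 rmorphD rmorphXn expr2 /=; ring.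
exists (2 * \int[lam n]_xi normc (g' xi)).
  by rewrite mulr_ge0 // Rintegral_ge0 // => y _; exact: normc_ge0.
move=> x; have := normc_ift x (test_cintegrable tg').
have p0 : 0 < \prod_i (1 + x i 0 ^+ 2) by apply: prodr_gt0 => i _; rewrite ltr_pwDl // sqr_ge0.
rewrite -h Normc.normcM normc_real gtr0_norm // => h'.
by rewrite /cauchyw prodfV ler_pdivlMr // mulrC.
Qed.

Lemma cintegrable_ift g : test g -> cintegrable (lam n) (ift g).
Proof.
move=> tg; have [C C0 hC] := ift_decay tg.
apply: (@cintegrable_le _ _ _ _ _ (fun x => C * cauchyw x)) => //.
  exact/ccontinuous_cmeas/ccontinuous_ift.
by have := integrableZl measurableT C integrable_cauchyw; apply: eq_integrable => // z _ /=; rewrite EFinM.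
Qed.

End fixed_dim.
End fourier_test.

(** * Fourier inversion *)

Section fourier_inversion.
Context (R : realType).
Local Notation Re := (@complex.Re R).
Local Notation Im := (@complex.Im R).
Local Notation normc := (@Normc.normc R).
Local Notation lam n := (@lebesgue_cV R n).
Local Notation leb := (@lebesgue_measure R).

Let expabs (e t : R) : R := expR (- (e * `|t|)).

Let expabs_cont e : continuous (expabs e).
Proof.
move=> t; apply: continuous_comp; last exact: continuous_expR.
apply: cvgN; apply: cvgM; first exact: cvg_cst.
exact: norm_continuous.
Qed.

Let cos_cont (a : R) : continuous (fun t : R => cos (a * t)).
Proof.
move=> t; apply: continuous_comp; last exact: continuous_cos.
by apply: cvgM; [exact: cvg_cst|exact: cvg_id].
Qed.

(** Adding 1 to the cosine makes the integrand non-negative, so that the reduction to the half-line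
    and the fundamental theorem on an unbounded interval apply. *)
Let expabs_int (e a : R) : 0 < e ->
  (\int[leb]_t (expabs e t * (1 + cos (a * t)))%:E = (2 * (e^-1 + e / (e ^+ 2 + a ^+ 2)))%:E)%E.
Proof.
move=> e0; have ea : 0 < e ^+ 2 + a ^+ 2 by rewrite ltr_pwDl ?exprn_gt0 // sqr_ge0.
have f0 (t : R) : 0 <= expabs e t * (1 + cos (a * t)).
  by rewrite mulr_ge0 ?expR_ge0 // -lerBlDl sub0r cos_geN1.
rewrite ge0_symfun_integralT //; last 2 first.
- move=> t; apply: cvgM; first exact: expabs_cont.
  by apply: cvgD; [exact: cvg_cst|exact: cos_cont].
- by move=> t; rewrite /expabs /= normrN mulrN cosN.
rewrite EFinM; congr (_ * _)%E.
pose f (t : R) := expR (- e * t) * (1 + cos (a * t)).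
(* An explicit primitive that tends to 0 at infinity, so the integral is [- F 0]. *)
pose F (t : R) := expR (- e * t) * (- e^-1 + (a * sin (a * t) - e * cos (a * t)) / (e ^+ 2 + a ^+ 2)).
transitivity (\int[leb]_(t in `[0%R, +oo[) (f t)%:E)%E.
  rewrite set_itvE; apply: eq_integral => t; rewrite inE /= => t0.
  by rewrite /expabs /f ger0_norm // mulNr.
have dlin (c t : R) : is_derive t 1 (fun s => c * s) c.
  have := @is_derive_lin R R (fun s => c * s) t 1; rewrite mulr1; apply => h.
  by rewrite -[h *: 1]/(h * 1) mulr1 mulrDr mulrC.
have dF (t : R) : is_derive t 1 F (f t).
  have dE : is_derive t 1 (fun s => expR (- e * s)) (expR (- e * t) * - e).
    exact: is_derive_compR (dlin (- e) t) (is_derive_expR _).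
  have dS : is_derive t 1 (fun s => sin (a * s)) (cos (a * t) * a).
    exact: is_derive_compR (dlin a t) (is_derive_sin _).
  have dC : is_derive t 1 (fun s => cos (a * s)) (- sin (a * t) * a).
    exact: is_derive_compR (dlin a t) (is_derive_cos _).
  have dB : is_derive t 1 (fun s => - e^-1 + (a * sin (a * s) - e * cos (a * s)) / (e ^+ 2 + a ^+ 2))
      ((a * (cos (a * t) * a) - e * (- sin (a * t) * a)) / (e ^+ 2 + a ^+ 2)).
    have h1 := is_deriveB (is_deriveZ a dS) (is_deriveZ e dC).
    have h2 := is_deriveD (is_derive_cst (- e^-1) t 1) (is_deriveZ (e ^+ 2 + a ^+ 2)^-1 h1).
    have E : (fun s : R => - e^-1 + (a * sin (a * s) - e * cos (a * s)) / (e ^+ 2 + a ^+ 2)) =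
      (cst (- e^-1) + (e ^+ 2 + a ^+ 2)^-1 \*: (a \*: (fun s => sin (a * s)) - e \*: (fun s => cos (a * s))))%R.
      by apply/funext => s; rewrite mulrC.
    rewrite E; apply: (is_derive_eq h2).
    by rewrite add0r /GRing.scale /= mulrC.
  have h := is_deriveM dE dB.
  apply: (is_derive_eq h).
  rewrite /GRing.scale /= /f; field; rewrite gt_eqF //=; exact: lt0r_neq0.
rewrite (@ge0_continuous_FTC2y R f F 0 0).
- rewrite sub0e /F mulr0 expR0 mul1r mulr0 sin0 cos0 mulr0 mulr1 sub0r.
  by rewrite -EFinN; congr (_%:E); field; rewrite gt_eqF //=; exact: lt0r_neq0.
- by move=> t t0; rewrite /f mulr_ge0 ?expR_ge0 // -lerBlDl sub0r cos_geN1.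
- apply: continuous_subspaceT => t; apply: cvgM.
    apply: continuous_comp; last exact: continuous_expR.
    by apply: cvgM; [exact: cvg_cst|exact: cvg_id].
  by apply: cvgD; [exact: cvg_cst|exact: cos_cont].
- pose C := e^-1 + (`|a| + e) / (e ^+ 2 + a ^+ 2).
  have C0 : 0 < C by rewrite ltr_pwDl ?invr_gt0 // divr_ge0 ?(ltW ea) // addr_ge0 // ltW.
  have Fle (t : R) : 0 < t -> `|F t| <= C / (e * t).
    move=> t0; have et : 0 < e * t by exact: mulr_gt0.
    rewrite /F normrM ger0_norm ?expR_ge0 // [C / _]mulrC ler_pM ?expR_ge0 //.
      rewrite mulNr expRN lef_pV2 ?posrE ?expR_gt0 //.
      by rewrite (le_trans _ (expR_ge1Dx _)) // lerDr.
    rewrite /C (le_trans (ler_normD _ _)) // normrN ger0_norm ?invr_ge0 ?(ltW e0) //.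
    rewrite lerD2l normrM [X in _ * X]ger0_norm ?invr_ge0 ?(ltW ea) //.
    rewrite ler_wpM2r ?invr_ge0 ?(ltW ea) // (le_trans (ler_normB _ _)) // !normrM.
    rewrite [`|e|]gtr0_norm //; apply: lerD.
      by rewrite ler_piMr // ler_norml sin_geN1 sin_le1.
    by rewrite ler_piMr ?(ltW e0) // ler_norml cos_geN1 cos_le1.
  apply/cvgrPdist_le => d d0; near=> t.
  have t0 : 0 < t by near: t; exact: nbhs_pinfty_gt.
  have tC : (d * e)^-1 * C <= t by near: t; apply: nbhs_pinfty_ge; exact: num_real.
  rewrite sub0r normrN (le_trans (Fle _ t0)) // ler_pdivrMr ?mulr_gt0 //.
  by rewrite mulrA -ler_pdivrMl ?mulr_gt0.
- by move=> t _; have [] := dF t.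
- have cF : continuous F.
    by move=> t; apply/differentiable_continuous/derivable1_diffP; have [] := dF t.
  by apply: cvg_at_right_filter; exact: cF.
- by move=> t _; rewrite derive1E; have [] := dF t.
Unshelve. all: by end_near. Qed.

Let expabs_integrable e : 0 < e -> leb.-integrable setT (EFin \o expabs e).
Proof.
move=> e0.
have p (t : R) : 0 <= expabs e t * (1 + cos (0 * t)).
  by rewrite mul0r cos0 mulr_ge0 ?expR_ge0 // addr_ge0.
have i2 : leb.-integrable setT (EFin \o (fun t => expabs e t * (1 + cos (0 * t)))).
  apply/integrableP; split.
    apply/measurable_EFinP; apply: continuous_measurable_fun => t.
    apply: cvgM; first exact: expabs_cont.
    by apply: cvgD; [exact: cvg_cst|exact: cos_cont].
  under eq_integral => t _ do rewrite /= ger0_norm //.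
  by rewrite expabs_int // ltry.
apply: (le_integrable _ _ _ i2) => //.
  by apply/measurable_EFinP; apply: continuous_measurable_fun; exact: expabs_cont.
move=> t _ /=; rewrite lee_fin (ger0_norm (p t)) ger0_norm ?expR_ge0 //.
by rewrite mul0r cos0 ler_peMr ?expR_ge0 // lerDl.
Qed.

(** The reflection [t -> - t] shows that the value is real. Its real part is the integral with
    weight [1 + cos] minus the integral of the exponential alone, and the latter is half of the
    former at [a = 0]. *)
Lemma cint_expabs (e a : R) : 0 < e ->
  cintegrable leb (fun t => (expR (- (e * `|t|)))%:C%C * expi (a * t)) /\
  cint leb (fun t => (expR (- (e * `|t|)))%:C%C * expi (a * t)) =
    (2 * e / (e ^+ 2 + a ^+ 2))%:C%C.
Proof.
move=> e0; set G := fun t : R => _.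
have ea : 0 < e ^+ 2 + a ^+ 2 by rewrite ltr_pwDl ?exprn_gt0 // sqr_ge0.
have ie := expabs_integrable e0.
have iG : cintegrable leb G.
  apply: (cintegrable_le _ ie).
    apply: cmeasM; first by apply: cmeas_real; apply: continuous_measurable_fun; exact: expabs_cont.
    split; apply: continuous_measurable_fun; first exact: cos_cont.
    move=> t; apply: continuous_comp; last exact: continuous_sin.
    by apply: cvgM; [exact: cvg_cst|exact: cvg_id].
  move=> t; rewrite /G Normc.normcM normc_expi mulr1 normc_real.
  by rewrite ger0_norm // expR_ge0.
split=> //.
have GN : cint leb G = conjc (cint leb G).
  have [_ h] := @cint_change _ _ _ _ R leb leb (fun t => -1 * t + 0) 1 G
    (ltac:(apply: measurable_funD => //; apply: measurable_funM => //)) ltr01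
    (fun g mg g0 => ltac:(by rewrite ge0_integral_affine1 ?oppr_eq0 ?oner_eq0 // normrN1 invr1)) iG.
  rewrite mul1r in h; rewrite -[LHS]h -cint_conj; congr cint; apply/funext => t.
  transitivity (G (- t)); first by rewrite /= addr0 mulN1r.
  by rewrite /G normrN mulrN expiN cjM conjc_real.
have Im0 : Im (cint leb G) = 0.
  by have := congr1 Im GN; rewrite cIm_conj => /eqP; rewrite -subr_eq0 opprK -mulr2n mulrn_eq0 => /eqP.
apply: ReIm_eq => //=.
rewrite (_ : (fun x => Re (G x)) = fun t => expabs e t * cos (a * t)); last first.
  by apply/funext => t; rewrite /G cReM /= mul0r subr0.
have i1 : leb.-integrable setT (EFin \o (fun t => expabs e t * cos (a * t))).
  apply: le_integrable ie => //.
    apply/measurable_EFinP; apply: continuous_measurable_fun => t.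
    by apply: cvgM; [exact: expabs_cont|exact: cos_cont].
  move=> t _ /=; rewrite lee_fin normrM ler_piMr //.
  by rewrite ler_norml cos_geN1 cos_le1.
have h0 : \int[leb]_t (expabs e t * (1 + cos (0 * t))) = 2 * (e^-1 + e^-1).
  by rewrite /Rintegral expabs_int //= expr0n addr0; field; rewrite gt_eqF.
have h1 : \int[leb]_t (expabs e t * (1 + cos (a * t))) = 2 * (e^-1 + e / (e ^+ 2 + a ^+ 2)).
  by rewrite /Rintegral expabs_int.
have h2 : \int[leb]_t (expabs e t * (1 + cos (a * t))) =
   \int[leb]_t expabs e t + \int[leb]_t (expabs e t * cos (a * t)).
  by rewrite -RintegralD //; apply: eq_Rintegral => t _; rewrite mulrDr mulr1.
have h3 : \int[leb]_t (expabs e t * (1 + cos (0 * t))) = 2 * \int[leb]_t expabs e t.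
  by rewrite -RintegralZl //; apply: eq_Rintegral => t _; rewrite mul0r cos0 mulrC.
have h4 : \int[leb]_t expabs e t = 2 * e^-1.
  have two : (2 : R) != 0 by rewrite pnatr_eq0.
  by apply: (mulfI two); rewrite -h3 h0; ring.
rewrite -[LHS](addKr (\int[leb]_t expabs e t)) -h2 h1 h4; field.
by rewrite gt_eqF //= lt0r_neq0.
Qed.

Lemma integral_cauchy : (\int[leb]_t (2 / (1 + (2 * pi * t) ^+ 2))%:E = 1%:E)%E.
Proof.
have c : continuous (fun t : R => (1 + t ^+ 2)^-1) := @continuous_oneDsqrV R.
have p (t : R) : 0 <= (1 + t ^+ 2)^-1 by rewrite invr_ge0 addr_ge0 // sqr_ge0.
have m : measurable_fun setT (EFin \o (fun t : R => (1 + t ^+ 2)^-1)).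
  by apply/measurable_EFinP; exact: continuous_measurable_fun.
have pi0 : 0 < 2 * pi :> R by rewrite mulr_gt0 // pi_gt0.
have i0 : (\int[leb]_t ((1 + t ^+ 2)^-1)%:E = pi%:E :> \bar R)%E.
  rewrite ge0_symfun_integralT //; last by move=> t; rewrite /= sqrrN.
  have := integral0y_oneDsqr R; rewrite set_itvE /oneDsqr => ->.
  by rewrite -EFinM; congr (_%:E); field.
have := @ge0_integral_affine1 R (2 * pi) 0 (fun t => (2 / (1 + t ^+ 2))%:E) (lt0r_neq0 pi0).
under eq_integral do rewrite addr0.
move=> -> //.
- have -> : (\int[leb]_t (2 / (1 + t ^+ 2))%:E = 2%:E * \int[leb]_t ((1 + t ^+ 2)^-1)%:E)%E.
    by rewrite -(ge0_integralZl leb measurableT m) // => t _; rewrite lee_fin.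
  by rewrite i0 -!EFinM gtr0_norm // mulVf // lt0r_neq0.
- apply/measurable_EFinP; apply: continuous_measurable_fun => t.
  by apply: cvgM; [exact: cvg_cst|exact: c].
- by move=> t; rewrite lee_fin mulr_ge0.
Qed.

Lemma normc_lim_unique (u : nat -> R[i]) (a b : R[i]) :
  (fun k => normc (u k - a)) @ \oo --> 0 -> (fun k => normc (u k - b)) @ \oo --> 0 -> a = b.
Proof.
move=> ua ub; apply/eqP; rewrite -subr_eq0; apply/eqP/Normc.eq0_normc/eqP.
rewrite eq_le normc_ge0 andbT; apply/ler_addgt0Pl => e e0; rewrite addr0.
have e2 : 0 < e / 2 by rewrite divr_gt0.
move/cvgrPdist_le : ua => /(_ _ e2) ua; move/cvgrPdist_le : ub => /(_ _ e2) ub.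
near \oo => k.
have h1 : normc (u k - a) <= e / 2.
  by rewrite -[leLHS]ger0_norm ?normc_ge0 // -normrN -sub0r; near: k.
have h2 : normc (u k - b) <= e / 2.
  by rewrite -[leLHS]ger0_norm ?normc_ge0 // -normrN -sub0r; near: k.
rewrite (_ : a - b = - (u k - a) + (u k - b)); last by ring.
by rewrite (le_trans (le_normcD _ _)) // normcN [leRHS]splitr lerD.
Unshelve. all: by end_near. Qed.

Lemma cmeas_ew2 n : cmeas (fun p : 'cV[R]_n * 'cV[R]_n => ew p.1 p.2).
Proof.
have md : measurable_fun setT (fun p : 'cV[R]_n * 'cV[R]_n => 2 * pi * dot p.1 p.2).
  apply: measurable_funM; first exact: measurable_cst.
  apply: measurable_sum => i; apply: measurable_funM.
    exact: (measurableT_comp (measurable_coord i)).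
  exact: (measurableT_comp (measurable_coord i)).
split.
  exact: (measurableT_comp (continuous_measurable_fun (@continuous_cos R)) md).
exact: (measurableT_comp (continuous_measurable_fun (@continuous_sin R)) md).
Qed.

Lemma poisson_scale (e z : R) : e != 0 -> 1 + z ^+ 2 != 0 ->
  2 * e / (e ^+ 2 + (e * z) ^+ 2) = e^-1 * (2 / (1 + z ^+ 2)).
Proof.
move=> e0 z0; have -> : e ^+ 2 + (e * z) ^+ 2 = e * (e * (1 + z ^+ 2)) by ring.
by rewrite !invfM (mulrA (2 * e)) mulfK // mulrCA.
Qed.

Lemma cauchy_bounds (z : R) : 0 <= 2 / (1 + z ^+ 2) <= 2.
Proof.
have z0 : 0 < 1 + z ^+ 2 by rewrite ltr_pwDl // sqr_ge0.
rewrite divr_ge0 ?(ltW z0) //= ler_pdivrMr // ler_peMr //.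
by rewrite lerDl sqr_ge0.
Qed.

Section fixed_dim.
Variable n : nat.
Implicit Types f g : 'cV[R]_n -> R[i].

Lemma cint_scale (e : R) (f : 'cV[R]_n -> R[i]) (eta : 'cV[R]_n) : 0 < e ->
  cintegrable (lam n) f ->
  cintegrable (lam n) (fun y => f (e *: y + eta)) /\
  cint (lam n) (fun y => f (e *: y + eta)) = (e ^- n)%:C%C * cint (lam n) f.
Proof.
move=> e0 fi; have [i1 h1] := cint_addv eta fi.
have uP : e%:M \in @unitmx R n by rewrite unitmxE det_scalar unitfE expf_neq0 // gt_eqF.
have [i2 h2] := cint_mulmx uP i1.
have E : (fun x => f (e%:M *m x + eta)) = (fun y => f (e *: y + eta)).
  by apply/funext => y; rewrite mul_scalar_mx.
rewrite E in i2 h2; split => //; rewrite h2 h1 det_scalar ger0_norm //.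
by rewrite exprn_ge0 // ltW.
Qed.

Let w (e : R) (x : 'cV[R]_n) : R := \prod_i expabs e (x i 0).

Let integrable_w e : 0 < e -> (lam n).-integrable setT (EFin \o w e).
Proof.
move=> e0; apply: (@integrable_prod R n (fun _ => expabs e)) => [i t|i].
  exact: expR_ge0.
exact: expabs_integrable.
Qed.

Let w_ge0 e x : 0 <= w e x.
Proof. by apply: prodr_ge0 => i _; exact: expR_ge0. Qed.

Let w_le1 e x : 0 < e -> w e x <= 1.
Proof.
move=> e0; rewrite /w; apply: prodr_ile1 => i _.
by rewrite expR_ge0 /= expR_le1 oppr_le0 mulr_ge0 // ltW.
Qed.

Let w_fourier (e : R) (z : 'cV[R]_n) : 0 < e ->
  cintegrable (lam n) (fun x => (w e x)%:C%C * ew z x) /\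
  cint (lam n) (fun x => (w e x)%:C%C * ew z x) =
   (\prod_i (2 * e / (e ^+ 2 + (2 * pi * z i 0) ^+ 2)))%:C%C.
Proof.
move=> e0; pose k i (t : R) := (expabs e t)%:C%C * expi (2 * pi * z i 0 * t).
have kE : (fun x => (w e x)%:C%C * ew z x) = fun x => \prod_i k i (x i 0).
  apply/funext => x; rewrite /k big_split /= /w rmorph_prod; congr (_ * _).
  rewrite /ew /dot mulr_sumr.
  by elim/big_rec2: _ => [|i y1 y2 _ h]; rewrite ?expi0 // expiD h mulrA.
have ik i : cintegrable leb (k i) by have [] := cint_expabs (2 * pi * z i 0) e0.
rewrite kE; split; first exact: cintegrable_prod.
rewrite cint_prod // rmorph_prod; apply: eq_bigr => i _.
by have [_] := cint_expabs (2 * pi * z i 0) e0.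
Qed.

Let Q (y : 'cV[R]_n) : R := \prod_i (2 / (1 + (2 * pi * y i 0) ^+ 2)).

Let Q_ge0 y : 0 <= Q y.
Proof. by apply: prodr_ge0 => i _; rewrite divr_ge0 // addr_ge0 // sqr_ge0. Qed.

Let Qm : measurable_fun setT (fun t : R => 2 / (1 + (2 * pi * t) ^+ 2)).
Proof.
apply: continuous_measurable_fun => t; apply: cvgM; first exact: cvg_cst.
apply: (continuous_comp (f := fun t => 2 * pi * t) (g := fun t => (1 + t ^+ 2)^-1)); last exact: (@continuous_oneDsqrV R).
by apply: cvgM; [exact: cvg_cst|exact: cvg_id].
Qed.

Let int_Q : (\int[lam n]_y (Q y)%:E = 1%:E)%E.
Proof.
rewrite (@ge0_integral_prod R n (fun _ t => 2 / (1 + (2 * pi * t) ^+ 2)) (fun _ => 1)).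
- by rewrite big1.
- by move=> _; exact: Qm.
- by move=> _ t; rewrite divr_ge0 // addr_ge0 // sqr_ge0.
- by move=> _; exact: integral_cauchy.
Qed.

Let integrable_Q : (lam n).-integrable setT (EFin \o Q).
Proof.
apply/integrableP; split.
  by apply/measurable_EFinP; apply: (@measurable_prod_coord R n (fun _ t => 2 / (1 + (2 * pi * t) ^+ 2))) => _; exact: Qm.
by under eq_integral => y _ do rewrite /= ger0_norm //; rewrite int_Q ltry.
Qed.

(* Abel summation: the weights exp(-e|x_i|) have Poisson kernels as Fourier
   transforms, and e tends to 0. *)
Lemma fourier_inversion g (C : R) : ccontinuous g -> (forall x, normc (g x) <= C) ->
  cintegrable (lam n) g -> cintegrable (lam n) (ift g) ->
  forall eta, fourier (ift g) eta = g eta.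
Proof.
move=> cg gC ig iig eta; rewrite fourierE.
have [e [e0 ecv]] : exists e : nat -> R, (forall k, 0 < e k) /\ e @ \oo --> 0.
  by exists (@harmonic R); split; [exact: harmonic_gt0|exact: cvg_harmonic].
pose F k (x : 'cV[R]_n) := ift g x * (w (e k) x)%:C%C * ew (- eta) x.
have mg := cintegrable_cmeas ig; have mig := cintegrable_cmeas iig.
have mw k : measurable_fun setT (w (e k)).
  by apply/measurable_EFinP; exact: measurable_int (integrable_w (e0 k)).
have [|||||_ h1] := @cint_dct _ _ _ (lam n) F (fun x => ift g x * ew (- eta) x) (normc \o ift g).
- move=> k; apply: cmeasM; last exact: cmeas_ew.
  by apply: cmeasM => //; exact: cmeas_real.
- by apply: cmeasM => //; exact: cmeas_ew.
- move=> x; have wx : (fun k => w (e k) x) @ \oo --> (1 : R).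
    rewrite (_ : 1 = \prod_(i < n) (1 : R)); last by rewrite big1.
    apply: cvg_big => [|i _]; first exact: mul_continuous.
    rewrite -expR0; apply: continuous_cvg; first exact: continuous_expR.
    rewrite -(oppr0 R) -(mul0r `|x i 0|); apply: cvgN.
    by apply: cvgM; [exact: ecv|exact: cvg_cst].
  apply/cvgrPdist_le => d d0.
  have d' : 0 < d / (normc (ift g x) + 1) by rewrite divr_gt0 // ltr_wpDl ?normc_ge0.
  move/cvgrPdist_le : wx => /(_ _ d'); apply: filterS => k hk.
  rewrite sub0r normrN ger0_norm ?normc_ge0 //.
  rewrite (_ : F k x - _ = ift g x * ew (- eta) x * ((w (e k) x - 1)%:C)%C); last first.
    by rewrite /F rmorphB rmorph1; ring.
  rewrite !Normc.normcM normc_ew mulr1 normc_real distrC.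
  rewrite (le_trans (ler_wpM2l (normc_ge0 _) hk)) // mulrCA ler_piMr ?(ltW d0) //.
  by rewrite ler_pdivrMr ?ltr_wpDl ?normc_ge0 // mul1r lerDl.
- exact: cintegrable_normc.
- move=> k x; rewrite /F !Normc.normcM normc_ew mulr1 normc_real ger0_norm //.
  by rewrite /= ler_piMr ?normc_ge0 ?w_le1.
(* Fubini moves the weight onto [g], where its transform is the Poisson kernel [P] centred at [eta];
   rescaling by [e k] turns [P] into the fixed kernel [Q]. *)
have FE k : cint (lam n) (F k) = cint (lam n) (fun y => g (e k *: y + eta) * (Q y)%:C%C).
  pose f (p : 'cV[R]_n * 'cV[R]_n) := g p.2 * ((w (e k) p.1)%:C%C * ew (p.2 - eta) p.1).
  have mf : cmeas f.
    apply: cmeasM; first exact: cmeas_comp mg measurable_snd.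
    apply: cmeasM.
      by apply: cmeas_real; exact: (measurableT_comp (mw k) measurable_fst).
    rewrite (_ : (fun p => _) = fun p : 'cV[R]_n * 'cV[R]_n => ew p.1 p.2 * ew (- eta) p.1).
      apply: cmeasM; first exact: cmeas_ew2.
      exact: cmeas_comp (cmeas_ew _) measurable_fst.
    by apply/funext => p; rewrite ewDl [ew p.2 _]ewC.
  have fE x xi : f (x, xi) = (w (e k) x)%:C%C * ew (- eta) x * (g xi * ew x xi).
    by rewrite /f /= ewDl [ew xi x]ewC; ring.
  have [|||_ _] := @cint_fubini _ _ _ _ R (lam n) (lam n) f mf.
  - under eq_integral => x _.
      under eq_integral => xi _.
        rewrite /f /= !Normc.normcM normc_ew mulr1 normc_real ger0_norm // mulrC EFinM.
        over.
      rewrite ge0_integralZl //; last 3 first.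
      - by apply/measurable_EFinP; exact: measurable_normc.
      - by move=> y _; rewrite lee_fin normc_ge0.
      - by rewrite lee_fin.
      over.
    rewrite ge0_integralZr //; last 3 first.
    - exact/measurable_EFinP.
    - by move=> y _; rewrite lee_fin.
    - by apply: integral_ge0 => y _; rewrite lee_fin normc_ge0.
    apply: lte_mul_pinfty.
    - by apply: integral_ge0 => y _; rewrite lee_fin.
    - apply: (integrable_fin_num measurableT); exact: integrable_w.
    - exact/(cintegrable_norm_lty (lam n) mg).
  - move=> x; under eq_fun do rewrite fE.
    by apply: cintegrableZ; exact: cintegrable_ew.
  - move=> xi; have [iw _] := w_fourier (xi - eta) (e0 k).
    by rewrite /f /=; exact: cintegrableZ.
  move=> h; transitivity (cint (lam n) (fun x => cint (lam n) (fun y => f (x, y)))).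
    congr cint; apply/funext => x.
    under [in RHS]eq_fun do rewrite fE.
    by rewrite cintZ; [rewrite /F -/(ift g x); ring|exact: cintegrable_ew].
  rewrite h.
  pose P (y : 'cV[R]_n) : R := \prod_i (2 * e k / (e k ^+ 2 + (2 * pi * (y - eta) i 0) ^+ 2)).
  have P0 y : 0 <= P y.
    apply: prodr_ge0 => i _; apply: divr_ge0.
      by apply: mulr_ge0; [exact: ler0n|exact: ltW].
    by apply: addr_ge0; exact: sqr_ge0.
  have -> : (fun y => cint (lam n) (fun x => f (x, y))) = fun y => g y * (P y)%:C%C.
    apply/funext => y; have [iw hw] := w_fourier (y - eta) (e0 k).
    transitivity (g y * cint (lam n) (fun x => (w (e k) x)%:C%C * ew (y - eta) x)).
      by rewrite -(cintZ (g y) iw).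
    by rewrite hw.
  have PQ y : P (e k *: y + eta) = e k ^- n * Q y.
    rewrite /P /Q -[n in e k ^- n]card_ord -prodr_const -prodfV -big_split /=.
    apply: eq_bigr => i _; rewrite addrK mxE.
    have ek0 : e k != 0 by exact: lt0r_neq0.
    have h2 : 1 + (2 * pi * y i 0) ^+ 2 != 0.
      by apply: lt0r_neq0; apply: ltr_pwDl; [exact: ltr01|exact: sqr_ge0].
    by rewrite (mulrCA (2 * pi) (e k)) poisson_scale.
  have mP : measurable_fun setT P.
    have mP : measurable_fun setT (fun y : 'cV[R]_n => \prod_i (2 * e k / (e k ^+ 2 + (2 * pi * (y i 0 - eta i 0)) ^+ 2))).
      apply: (@measurable_prod_coord R n (fun i t => 2 * e k / (e k ^+ 2 + (2 * pi * (t - eta i 0)) ^+ 2))) => i.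
      apply: continuous_measurable_fun => t; apply: cvgM; first exact: cvg_cst.
      apply: cvgV; first by apply: lt0r_neq0; apply: ltr_pwDl; [exact: exprn_gt0|exact: sqr_ge0].
      apply: cvgD; first exact: cvg_cst.
      apply: (continuous_comp (f := fun t : R => 2 * pi * (t - eta i 0)) (g := fun s : R => s ^+ 2)); last exact: exprn_continuous.
      apply: cvgM; first exact: cvg_cst.
      by apply: cvgB; [exact: cvg_id|exact: cvg_cst].
    have PE : P = fun y : 'cV[R]_n => \prod_i (2 * e k / (e k ^+ 2 + (2 * pi * (y i 0 - eta i 0)) ^+ 2)).
      by apply/funext => y; apply: eq_bigr => i _; rewrite !mxE.
    by rewrite PE.
  clearbody P.
  have PQ' y : P y = e k ^- n * Q ((e k)^-1 *: (y - eta)).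
    have := PQ ((e k)^-1 *: (y - eta)); rewrite scalerA divff; last exact: lt0r_neq0.
    by rewrite scale1r subrK.
  have iP : cintegrable (lam n) (fun y => g y * (P y)%:C%C).
    have B y : P y <= e k ^- n * 2 ^+ n.
      rewrite PQ'; apply: ler_wpM2l.
        by rewrite invr_ge0; apply: exprn_ge0; exact: ltW.
      rewrite /Q -[n in 2 ^+ n]card_ord -prodr_const; apply: ler_prod => i _.
      exact: cauchy_bounds.
    apply: (@cintegrable_le _ _ _ _ _ (fun y => e k ^- n * 2 ^+ n * normc (g y))).
    - by apply: cmeasM; [exact: mg|exact: (cmeas_real mP)].
    - have := integrableZl measurableT (e k ^- n * 2 ^+ n) (cintegrable_normc ig).
      by apply: eq_integrable => // y _ /=; rewrite EFinM.
    - move=> y; rewrite Normc.normcM normc_real (ger0_norm (P0 y)) mulrC.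
      by apply: ler_wpM2r; [exact: normc_ge0|exact: B].
  have [iS hS] := cint_scale eta (e0 k) iP.
  have en0 : (e k ^- n)%:C%C != 0 :> R[i].
    rewrite eq_complex negb_and; apply/orP; left; apply: invr_neq0.
    by apply: expf_neq0; exact: lt0r_neq0.
  apply: (mulfI en0); rewrite -hS -cintZ.
    by congr cint; apply/funext => y; rewrite PQ rmorphM mulrCA.
  have := cintegrableZ ((e k ^- n)%:C%C)^-1 iS.
  congr cintegrable; apply/funext => y; rewrite PQ rmorphM mulrCA.
  by rewrite (mulKf en0).
(* Now the kernel no longer depends on [k]: continuity of [g] gives the pointwise limit, its bound
   [C] the majorant [C * Q], and [Q] has integral 1. *)
have [|||||_ h2] := @cint_dct _ _ _ (lam n) (fun k y => g (e k *: y + eta) * (Q y)%:C%C)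
    (fun y => g eta * (Q y)%:C%C) (fun y => C * Q y).
- move=> k; apply: cmeasM; last first.
    by apply: cmeas_real; apply/measurable_EFinP; exact: measurable_int integrable_Q.
  have uP : (e k)%:M \in @unitmx R n by rewrite unitmxE det_scalar unitfE expf_neq0 // gt_eqF.
  have ms : measurable_fun setT (fun y : 'cV[R]_n => e k *: y + eta).
    rewrite (_ : (fun y => _) = (fun y : 'cV[R]_n => (e k)%:M *m y + eta)).
      exact: (measurableT_comp (measurable_addv eta) (measurable_mulmx _)).
    by apply/funext => y; rewrite mul_scalar_mx.
  exact: (cmeas_comp mg ms).
- apply: cmeasM; first exact: cmeas_cst.
  by apply: cmeas_real; apply/measurable_EFinP; exact: measurable_int integrable_Q.
- move=> y; have cy : (fun k => e k *: y + eta) @ \oo --> eta.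
    rewrite -[X in _ --> X]add0r -(scale0r y); apply: cvgD; last exact: cvg_cst.
    by apply: cvgZr_tmp; exact: ecv.
  have [g1 g2] := cg.
  have c1 : (fun k => Re (g (e k *: y + eta))) @ \oo --> Re (g eta).
    exact: (continuous_cvg _ (g1 eta) cy).
  have c2 : (fun k => Im (g (e k *: y + eta))) @ \oo --> Im (g eta).
    exact: (continuous_cvg _ (g2 eta) cy).
  apply/cvgrPdist_le => d d0.
  have d' : 0 < d / 2 / (Q y + 1) by rewrite !divr_gt0 // ltr_wpDl.
  move/cvgrPdist_le : c1 => /(_ _ d') c1; move/cvgrPdist_le : c2 => /(_ _ d') c2.
  near=> k; rewrite sub0r normrN ger0_norm ?normc_ge0 //.
  rewrite -mulrBl Normc.normcM normc_real ger0_norm //.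
  rewrite (@le_trans _ _ (d / (Q y + 1) * (Q y + 1))) //; last by rewrite divfK // gt_eqF // ltr_wpDl.
  apply: ler_pM => //; [exact: normc_ge0| |by rewrite lerDl].
  rewrite normc_distC (le_trans (normc_le _)) // cReD cReN cImD cImN [X in X / _](splitr d) mulrDl.
  by apply: lerD; near: k.
- by have := integrableZl measurableT C integrable_Q; apply: eq_integrable => // y _ /=; rewrite EFinM.
- by move=> k y; rewrite Normc.normcM normc_real ger0_norm // ler_wpM2r.
have QE : cint (lam n) (fun y => g eta * (Q y)%:C%C) = g eta.
  rewrite cintZ; last by split => //=; exact: integrable0.
  by rewrite cint_real /Rintegral int_Q /= mulr1.
rewrite QE in h2.
apply: (normc_lim_unique _ h2); move: h1.
by under eq_fun do rewrite FE.
Unshelve. all: by end_near. Qed.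

End fixed_dim.
End fourier_inversion.

(** * The space L2 *)

Section L2_space.
Context (R : realType) (n : nat).
Local Notation Re := (@complex.Re R).
Local Notation Im := (@complex.Im R).
Local Notation normc := (@Normc.normc R).
Local Notation lam := (@lebesgue_cV R n).
Implicit Types f g h : 'cV[R]_n -> R[i].

(** Squared real-valued norms replace [L2norm] throughout: [L2_closureP] restates closures with
    them, and [nsqD], with its factor 2, stands in for the triangle inequality. *)
Definition nsq f : R := \int[lam]_x normc (f x) ^+ 2.

Lemma measurable_sqnormc f : cmeas f -> measurable_fun setT (fun x => normc (f x) ^+ 2).
Proof. by move=> mf; apply: measurable_funX; exact: measurable_normc. Qed.

Lemma L2norm_sqr f : (L2norm f `^ 2 = \int[lam]_x (normc (f x) ^+ 2)%:E)%E.
Proof.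
rewrite /L2norm poweR_Lnorm ?pnatr_eq0 //; apply: eq_integral => x _ /=.
by rewrite ger0_norm ?normc_ge0 // ?poweR_EFin powR_mulrn ?normc_ge0.
Qed.

Lemma L2norm_ltE f (e : R) : 0 < e ->
  (L2norm f < e%:E)%E = (\int[lam]_x (normc (f x) ^+ 2)%:E < (e ^+ 2)%:E)%E.
Proof.
move=> e0; rewrite -L2norm_sqr.
have := Lnorm_ge0 lam 2%:E (EFin \o (normc \o f)); rewrite -/(L2norm f).
case: (L2norm f) => [r| |] //=.
  by rewrite lee_fin => r0; rewrite ?poweR_EFin !lte_fin powR_mulrn // ltr_pXn2r // nnegrE ltW.
by move=> _; rewrite pnatr_eq0 /= !ltNge !leey.
Qed.

Lemma L2norm_ltyE f : (L2norm f < +oo)%E = (\int[lam]_x (normc (f x) ^+ 2)%:E < +oo)%E.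
Proof.
rewrite -L2norm_sqr.
have := Lnorm_ge0 lam 2%:E (EFin \o (normc \o f)); rewrite -/(L2norm f).
case: (L2norm f) => [r| |] //= r0; first by rewrite ?poweR_EFin !ltry.
by rewrite pnatr_eq0.
Qed.

Lemma L2P f : L2 f <-> cmeas f /\ lam.-integrable setT (EFin \o (fun x => normc (f x) ^+ 2)).
Proof.
split=> [[f1 f2 foo]|[[f1 f2] /integrableP[_ foo]]].
  split=> //; apply/integrableP; split.
    by apply/measurable_EFinP; exact: measurable_sqnormc.
  rewrite L2norm_ltyE in foo; apply: le_lt_trans foo.
  rewrite le_eqVlt; apply/orP; left; apply/eqP; apply: eq_integral => x _ /=.
  by rewrite ger0_norm ?sqr_ge0.
split=> //; rewrite L2norm_ltyE; apply: le_lt_trans foo.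
rewrite le_eqVlt; apply/orP; left; apply/eqP; apply: eq_integral => x _ /=.
by rewrite ger0_norm ?sqr_ge0.
Qed.

Lemma L2_cmeas f : L2 f -> cmeas f.
Proof. by case/L2P. Qed.

Lemma L2_integrable f : L2 f -> lam.-integrable setT (EFin \o (fun x => normc (f x) ^+ 2)).
Proof. by case/L2P. Qed.

Lemma nsq_ge0 f : 0 <= nsq f.
Proof. by apply: Rintegral_ge0 => x _; exact: sqr_ge0. Qed.

Lemma EFin_nsq f : L2 f -> (\int[lam]_x (normc (f x) ^+ 2)%:E = (nsq f)%:E)%E.
Proof.
move=> hf; rewrite /nsq /Rintegral fineK //.
by apply: (integrable_fin_num measurableT); exact: L2_integrable.
Qed.

Lemma L2_le f (u : 'cV[R]_n -> R) : cmeas f -> lam.-integrable setT (EFin \o u) ->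
  (forall x, normc (f x) ^+ 2 <= u x) -> L2 f.
Proof.
move=> mf iu fu; apply/L2P; split => //; apply: (le_integrable _ _ _ iu) => //.
  by apply/measurable_EFinP; exact: measurable_sqnormc.
move=> x _ /=; rewrite lee_fin ger0_norm ?sqr_ge0 //.
exact: le_trans (fu x) (ler_norm _).
Qed.

Lemma L2D f g : L2 f -> L2 g -> L2 (fun x => f x + g x).
Proof.
move=> hf hg; have i1 := integrableZl measurableT 2 (L2_integrable hf).
have i2 := integrableZl measurableT 2 (L2_integrable hg).
apply: (@L2_le _ (fun x => 2 * normc (f x) ^+ 2 + 2 * normc (g x) ^+ 2)).
- by apply: cmeasD; exact: L2_cmeas.
- by have := integrableD measurableT i1 i2; apply: eq_integrable => // x _ /=; rewrite EFinD !EFinM.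
- by move=> x; exact: sqr_normcD.
Qed.

Lemma L2Z (c : R[i]) f : L2 f -> L2 (fun x => c * f x).
Proof.
move=> hf; have i1 := integrableZl measurableT (normc c ^+ 2) (L2_integrable hf).
apply: (@L2_le _ (fun x => normc c ^+ 2 * normc (f x) ^+ 2)).
- by apply: cmeasM; [exact: cmeas_cst|exact: L2_cmeas].
- by apply: eq_integrable i1 => // x _ /=; rewrite EFinM.
- by move=> x; rewrite Normc.normcM exprMn.
Qed.

Lemma L20 : L2 (fun _ : 'cV[R]_n => 0 : R[i]).
Proof.
apply: (@L2_le _ (fun=> 0)); [exact: cmeas_cst|exact: integrable0|].
by move=> x; rewrite Normc.normc0 expr0n.
Qed.

Lemma L2B f g : L2 f -> L2 g -> L2 (fun x => f x - g x).
Proof.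
move=> hf /(L2Z (-1)) hg; have := L2D hf hg.
by congr L2; apply/funext => x; rewrite mulN1r.
Qed.

Lemma L2_sum I (r : seq I) (P : pred I) (F : I -> 'cV[R]_n -> R[i]) :
  (forall i, P i -> L2 (F i)) -> L2 (fun x => \sum_(i <- r | P i) F i x).
Proof.
move=> hF; elim: r => [|i r ih].
  by under eq_fun do rewrite big_nil; exact: L20.
under eq_fun do rewrite big_cons.
by case Pi: (P i) => //; apply: L2D => //; exact: hF.
Qed.

Lemma nsqD f g : L2 f -> L2 g -> nsq (fun x => f x + g x) <= 2 * nsq f + 2 * nsq g.
Proof.
move=> hf hg; have i1 := integrableZl measurableT 2 (L2_integrable hf).
have i2 := integrableZl measurableT 2 (L2_integrable hg).
rewrite /nsq -!RintegralZl //; try exact: L2_integrable.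
rewrite -RintegralD //.
apply: le_Rintegral => //.
- exact: L2_integrable (L2D hf hg).
- by have := integrableD measurableT i1 i2; apply: eq_integrable => // x _ /=; rewrite EFinD !EFinM.
- by move=> x _; exact: sqr_normcD.
Qed.

Lemma nsqZ c f : L2 f -> nsq (fun x => c * f x) = normc c ^+ 2 * nsq f.
Proof.
move=> hf; rewrite /nsq -RintegralZl //; last exact: L2_integrable.
by apply: eq_Rintegral => x _; rewrite Normc.normcM exprMn.
Qed.

Lemma L2_closureP (S : set ('cV[R]_n -> R[i])) f : S `<=` L2 ->
  L2_closure S f <-> L2 f /\ forall e : R, 0 < e -> exists2 g, S g & nsq (fun x => f x - g x) < e.
Proof.
move=> SL; split=> -[hf h]; split=> // e e0.
  have [|g Sg] := h (Num.sqrt e); first by rewrite sqrtr_gt0.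
  rewrite L2norm_ltE ?sqrtr_gt0 // sqr_sqrtr ?(ltW e0) // EFin_nsq ?lte_fin.
    by exists g.
  by apply: L2B => //; exact: SL.
have [|g Sg hg] := h (e ^+ 2); first by rewrite exprn_gt0.
exists g => //; rewrite L2norm_ltE // EFin_nsq ?lte_fin //.
by apply: L2B => //; exact: SL.
Qed.

Lemma sub_L2_closure (S : set ('cV[R]_n -> R[i])) : S `<=` L2 -> S `<=` L2_closure S.
Proof.
move=> SL f Sf; apply/L2_closureP => //; split; first exact: SL.
move=> e e0; exists f => //; rewrite /nsq.
rewrite (_ : (fun x => _) = (fun=> 0)); first by rewrite /Rintegral integral0.
by apply/funext => x; rewrite subrr Normc.normc0 expr0n.
Qed.

Lemma L2_closure_mono (S S' : set ('cV[R]_n -> R[i])) : S `<=` S' ->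
  L2_closure S `<=` L2_closure S'.
Proof. by move=> SS f [hf h]; split => // e /h [g /SS Sg hg]; exists g. Qed.

Lemma L2_closureK (S : set ('cV[R]_n -> R[i])) : S `<=` L2 ->
  L2_closure (L2_closure S) `<=` L2_closure S.
Proof.
move=> SL f; have SL' : L2_closure S `<=` L2 by move=> g [].
move=> /(L2_closureP _ SL')[hf h]; apply/L2_closureP => //; split => // e e0.
have e4 : 0 < e / 4 by rewrite divr_gt0.
have [g Sg fg] := h _ e4; have hg := SL' _ Sg.
have [_ /(_ _ e4)[k Sk gk]] := (L2_closureP g SL).1 Sg.
exists k => //; have hk := SL _ Sk.
rewrite (_ : (fun x => _) = fun x => (f x - g x) + (g x - k x)); last first.
  by apply/funext => x; rewrite addrA subrK.
rewrite (le_lt_trans (nsqD (L2B hf hg) (L2B hg hk))) //; lra.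
Qed.

Lemma cintegrable_inner f g : L2 f -> L2 g -> cintegrable lam (fun x => f x * conjc (g x)).
Proof.
move=> hf hg.
apply: (@cintegrable_le _ _ _ _ _ (fun x => normc (f x) ^+ 2 + normc (g x) ^+ 2)).
- by apply: cmeasM; [exact: L2_cmeas|exact/cmeas_conj/L2_cmeas].
- have := integrableD measurableT (L2_integrable hf) (L2_integrable hg).
  by apply: eq_integrable => // x _ /=; rewrite EFinD.
- move=> x; rewrite Normc.normcM normc_conjc.
  have := sqr_ge0 (normc (f x) - normc (g x)).
  have := mulr_ge0 (normc_ge0 (f x)) (normc_ge0 (g x)); nra.
Qed.

Lemma innerE f g : inner f g = cint lam (fun x => f x * conjc (g x)).
Proof. by []. Qed.

Lemma innerDl f g h : L2 f -> L2 g -> L2 h ->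
  inner (fun x => f x + g x) h = inner f h + inner g h.
Proof.
move=> hf hg hh; rewrite !innerE -cintD; try exact: cintegrable_inner.
by congr cint; apply/funext => x; rewrite mulrDl.
Qed.

Lemma innerZl c f h : L2 f -> L2 h -> inner (fun x => c * f x) h = c * inner f h.
Proof.
move=> hf hh; rewrite !innerE -cintZ; last exact: cintegrable_inner.
by congr cint; apply/funext => x; rewrite mulrA.
Qed.

Lemma innerC f g : inner g f = conjc (inner f g).
Proof.
rewrite !innerE -cint_conj; congr cint; apply/funext => x.
by rewrite cjM conjcK mulrC.
Qed.

Lemma inner0l h : inner (fun=> 0) h = 0.
Proof.
by rewrite innerE (_ : (fun x => _) = fun=> 0) ?cint0 //; apply/funext => x; rewrite mul0r.
Qed.

Lemma innerBl f g h : L2 f -> L2 g -> L2 h ->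
  inner (fun x => f x - g x) h = inner f h - inner g h.
Proof.
move=> hf hg hh; rewrite !innerE -cintB; try exact: cintegrable_inner.
by congr cint; apply/funext => x; rewrite mulrBl.
Qed.

Lemma innerBr f g h : L2 f -> L2 g -> L2 h ->
  inner h (fun x => f x - g x) = inner h f - inner h g.
Proof.
move=> hf hg hh; rewrite innerC innerBl // cjD cjN.
by rewrite -(innerC f h) -(innerC g h).
Qed.

Lemma inner_suml I (r : seq I) (P : pred I) (F : I -> 'cV[R]_n -> R[i]) h :
  (forall i, P i -> L2 (F i)) -> L2 h ->
  inner (fun x => \sum_(i <- r | P i) F i x) h = \sum_(i <- r | P i) inner (F i) h.
Proof.
move=> hF hh; elim: r => [|i r ih].
  by under eq_fun do rewrite big_nil; rewrite inner0l big_nil.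
under eq_fun do rewrite big_cons.
rewrite big_cons; case: ifPn => Pi //; rewrite innerDl ?ih //; first exact: hF.
exact: L2_sum.
Qed.

Lemma inner_self f : inner f f = (nsq f)%:C%C.
Proof.
by rewrite innerE -cint_real; congr cint; apply/funext => x; rewrite mulc_conj.
Qed.

(** A weighted arithmetic-geometric inequality in the role of Cauchy-Schwarz; callers choose the
    weight [t]. The factor 2 of [normc_cint_le] is absorbed by [2 a b <= t a^2 + b^2 / t]. *)
Lemma inner_le f g (t : R) : 0 < t -> L2 f -> L2 g ->
  normc (inner f g) <= t * nsq f + t^-1 * nsq g.
Proof.
move=> t0 hf hg; apply: le_trans (normc_cint_le (cintegrable_inner hf hg)) _.
have i1 := integrableZl measurableT t (L2_integrable hf).
have i2 := integrableZl measurableT t^-1 (L2_integrable hg).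
have i0 := cintegrable_normc (cintegrable_inner hf hg).
rewrite /nsq -!RintegralZl //; try exact: L2_integrable.
rewrite -RintegralD //.
apply: le_Rintegral => //.
- by apply: eq_integrable (integrableZl measurableT 2 i0) => // x _ /=; rewrite EFinM.
- by have := integrableD measurableT i1 i2; apply: eq_integrable => // x _ /=; rewrite EFinD !EFinM.
move=> x _; rewrite Normc.normcM normc_conjc.
set a := normc (f x); set b := normc (g x).
rewrite -subr_ge0 (_ : _ - _ = t^-1 * (t * a - b) ^+ 2); last by field; rewrite gt_eqF.
by rewrite mulr_ge0 ?sqr_ge0 // invr_ge0 ltW.
Qed.

Lemma inner_closure_eq0 (S : set ('cV[R]_n -> R[i])) f h : S `<=` L2 -> L2 h ->
  (forall g, S g -> inner g h = 0) -> L2_closure S f -> inner f h = 0.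
Proof.
move=> SL hh S0 /(L2_closureP _ SL)[hf cf].
apply/Normc.eq0_normc/eqP; rewrite eq_le normc_ge0 andbT.
apply/ler_addgt0Pl => e e0; rewrite addr0.
have h1 : 0 < nsq h + 1 by rewrite ltr_wpDl ?nsq_ge0.
(* With this weight the term in [nsq h] is at most [e / 2]; the approximation [g] is then taken
   close enough for the other half. *)
pose t := 2 * (nsq h + 1) / e.
have t0 : 0 < t by rewrite divr_gt0 // mulr_gt0.
have [|g Sg fg] := cf (e / 2 / t); first by rewrite divr_gt0 // divr_gt0.
have hg := SL _ Sg.
have -> : inner f h = inner (fun x => f x - g x) h by rewrite innerBl // (S0 g Sg) subr0.
apply: le_trans (inner_le t0 (L2B hf hg) hh) _.
rewrite [leRHS]splitr; apply: lerD.
  by rewrite mulrC -ler_pdivlMr // ltW.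
rewrite /t invf_div mulrAC ler_pdivrMr ?mulr_gt0 //.
rewrite [leRHS](_ : _ = e * (nsq h + 1)); last by field.
by rewrite ler_wpM2l ?(ltW e0) // lerDl.
Qed.

Lemma nsq_pythagoras f g : L2 f -> L2 g -> inner f g = 0 ->
  nsq (fun x => f x - g x) = nsq f + nsq g.
Proof.
move=> hf hg fg0; have gf0 : inner g f = 0 by rewrite innerC fg0 conjc0.
apply: complexI; rewrite -inner_self innerBl ?innerBr //; try exact: L2B.
by rewrite fg0 gf0 subr0 sub0r opprK !inner_self rmorphD.
Qed.

Lemma nsq_eq0_ae f : L2 f -> nsq f = 0 -> {ae lam, forall x, f x = 0}.
Proof.
move=> hf f0; have i0 := L2_integrable hf.
have : (\int[lam]_x `|(normc (f x) ^+ 2)%:E| = 0)%E.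
  rewrite -[RHS](_ : (nsq f)%:E = 0%E); last by rewrite f0.
  rewrite -EFin_nsq //; apply: eq_integral => x _.
  by rewrite /= ger0_norm ?sqr_ge0.
move/(ae_eq_integral_abs lam measurableT (measurable_int _ i0)).
apply: filterS => x /= /(_ Logic.I) [] /eqP.
by rewrite sqrf_eq0 => /eqP /Normc.eq0_normc.
Qed.

Section span.
Variables (I : Type) (D : set I) (e : I -> 'cV[R]_n -> R[i]).
Hypothesis eL2 : forall i, D i -> L2 (e i).

Lemma lin_span_L2 : lin_span D e `<=` L2.
Proof.
move=> f [m [i [c [hi ->]]]]; apply: L2_sum => k _; apply: L2Z; exact: eL2.
Qed.

Lemma lin_span0 : lin_span D e (fun=> 0).
Proof.
have [[i Di]|h] := pselect (exists i, D i).
  exists 0%N, (fun _ => i), (fun _ => 0); split=> [[]//|].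
  by apply/funext => x; rewrite big_ord0.
have F (k : 'I_0) : I by case: k.
by exists 0%N, F, (fun _ => 0); split=> [[]//|]; apply/funext => x; rewrite big_ord0.
Qed.

Lemma lin_spanD f g : lin_span D e f -> lin_span D e g ->
  lin_span D e (fun x => f x + g x).
Proof.
move=> [m [i [c [hi ->]]]] [m' [i' [c' [hi' ->]]]].
exists (m + m')%N, (fun k : 'I_(m + m') => match fintype.split k with inl a => i a | inr b => i' b end),
  (fun k : 'I_(m + m') => match fintype.split k with inl a => c a | inr b => c' b end).
split=> [k|]; first by case: (fintype.split k).
apply/funext => x; rewrite big_split_ord /=; congr (_ + _); apply: eq_bigr => k _.
  by rewrite (unsplitK (inl k)).
by rewrite (unsplitK (inr k)).
Qed.

Lemma lin_spanZ a f : lin_span D e f -> lin_span D e (fun x => a * f x).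
Proof.
move=> [m [i [c [hi ->]]]]; exists m, i, (fun k => a * c k); split=> //.
by apply/funext => x; rewrite mulr_sumr; apply: eq_bigr => k _; rewrite mulrA.
Qed.

Lemma lin_span_gen i : D i -> lin_span D e (e i).
Proof.
move=> Di; exists 1%N, (fun=> i), (fun=> 1); split => //.
by apply/funext => x; rewrite big_ord1 mul1r.
Qed.

Lemma lin_span_sum J (r : seq J) (P : pred J) (F : J -> 'cV[R]_n -> R[i]) :
  (forall j, P j -> lin_span D e (F j)) -> lin_span D e (fun x => \sum_(j <- r | P j) F j x).
Proof.
move=> hF; elim: r => [|j r ih].
  by under eq_fun do rewrite big_nil; exact: lin_span0.
under eq_fun do rewrite big_cons.
by case Pj: (P j) => //; apply: lin_spanD => //; exact: hF.
Qed.

Lemma closed_span : closed_subspace (L2_closure (lin_span D e)).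
Proof.
have SL := lin_span_L2; split.
- by move=> f [].
- exact: (sub_L2_closure SL lin_span0).
- move=> a f g /(L2_closureP _ SL)[hf cf] /(L2_closureP _ SL)[hg cg].
  have haf := L2Z a hf; apply/(L2_closureP _ SL); split; first exact: L2D.
  move=> d d0; have N0 : 0 < 4 * (normc a ^+ 2 + 1).
    by rewrite mulr_gt0 // ltr_wpDl // sqr_ge0.
  have [|f' Sf' ff'] := cf (d / (4 * (normc a ^+ 2 + 1))); first by rewrite divr_gt0.
  have [|g' Sg' gg'] := cg (d / 4); first by rewrite divr_gt0.
  exists (fun x => a * f' x + g' x); first by apply: lin_spanD => //; exact: lin_spanZ.
  have hf' := SL _ Sf'; have hg' := SL _ Sg'.
  rewrite (_ : (fun x => _) = fun x => a * (f x - f' x) + (g x - g' x)); last first.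
    by apply/funext => x; ring.
  apply: le_lt_trans (nsqD (L2Z a (L2B hf hf')) (L2B hg hg')) _.
  rewrite nsqZ; last exact: L2B.
  have h1 : normc a ^+ 2 * nsq (fun x => f x - f' x) <= d / 4.
    apply: (@le_trans _ _ ((normc a ^+ 2 + 1) * nsq (fun x => f x - f' x))).
      by rewrite ler_wpM2r ?nsq_ge0 // lerDl.
    rewrite mulrC -ler_pdivlMr ?ltr_wpDl ?sqr_ge0 // (le_trans (ltW ff')) //.
    by rewrite le_eqVlt; apply/orP; left; apply/eqP; rewrite -mulrA -invfM.
  lra.
- exact: L2_closureK.
Qed.

End span.
End L2_space.

(** * Plancherel and density *)

Section plancherel.
Context (R : realType) (n : nat).
Local Notation Re := (@complex.Re R).
Local Notation Im := (@complex.Im R).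
Local Notation normc := (@Normc.normc R).
Local Notation lam := (@lebesgue_cV R n).
Implicit Types f g h : 'cV[R]_n -> R[i].

(** The class is described by the inversion formula and not by smoothness and support, since it must
    also contain Fourier transforms of test functions, which need not have bounded support; see
    [invertible_fourier]. *)
Definition invertible_ft g := [/\ cintegrable lam g, cintegrable lam (ift g) &
  forall eta, fourier (ift g) eta = g eta].

Lemma invertible_test g : test g -> invertible_ft g.
Proof.
move=> tg; split; [exact: test_cintegrable|exact: cintegrable_ift|].
have [C _ hC] := test_bounded tg.
apply: (fourier_inversion _ hC); [|exact: test_cintegrable|exact: cintegrable_ift].
by case: tg => sg _; exact: csmooth_ccontinuous.
Qed.

Lemma L2_bounded_integrable g (C : R) : cintegrable lam g -> (forall x, normc (g x) <= C) -> L2 g.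
Proof.
move=> ig gC; have i1 := integrableZl measurableT C (cintegrable_normc ig).
apply: (L2_le (cintegrable_cmeas ig) i1) => x.
by rewrite expr2 ler_wpM2r ?normc_ge0.
Qed.

Lemma invertible_L2 g : invertible_ft g -> L2 g.
Proof.
move=> [ig iig gE]; apply: (L2_bounded_integrable ig) => x.
by rewrite -gE fourierE; exact: normc_ift.
Qed.

Lemma invertible_ift_L2 g : invertible_ft g -> L2 (ift g).
Proof.
by move=> [ig iig gE]; apply: (L2_bounded_integrable iig) => x; exact: normc_ift.
Qed.

Lemma invertible_B f g : invertible_ft f -> invertible_ft g ->
  invertible_ft (fun x => f x - g x) /\ forall x, ift (fun x => f x - g x) x = ift f x - ift g x.
Proof.
move=> [f1 f2 f3] [g1 g2 g3].
have E x : ift (fun x => f x - g x) x = ift f x - ift g x.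
  rewrite /ift -cintB; try exact: cintegrable_ew.
  by congr cint; apply/funext => xi; rewrite mulrBl.
split=> //; split.
- exact: cintegrableB.
- by rewrite (funext E); exact: cintegrableB.
- move=> eta; rewrite (funext E) -f3 -g3 !fourierE.
  rewrite /ift -cintB; try exact: cintegrable_ew.
  by congr cint; apply/funext => xi; rewrite mulrBl.
Qed.

Lemma cint_opp g : cintegrable lam g ->
  cintegrable lam (fun x => g (- x)) /\ cint lam (fun x => g (- x)) = cint lam g.
Proof.
move=> ig; have uN : (-1)%:M \in @unitmx R n.
  by rewrite unitmxE det_scalar unitfE expf_neq0 // oppr_eq0 oner_eq0.
have [i1 e1] := cint_mulmx uN ig.
have E : (fun x => g ((-1)%:M *m x)) = fun x => g (- x).
  by apply/funext => x; rewrite mul_scalar_mx scaleN1r.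
rewrite E in i1 e1; split=> //; rewrite e1 det_scalar normrX normrN1 expr1n.
by rewrite invr1 mul1r.
Qed.

Lemma invertible_fourier h : test h ->
  invertible_ft (fourier h) /\ forall x, ift (fourier h) x = h x.
Proof.
move=> th; have [ih iih hE] := invertible_test th.
have FE : fourier h = fun xi => ift h (- xi) by apply/funext => xi; rewrite fourierE.
have E x : ift (fourier h) x = h x.
  rewrite -hE fourierE /ift FE.
  have [_ <-] := cint_opp (cintegrable_ew (- x) iih).
  by congr cint; apply/funext => xi; rewrite ewNl ewNr conjcK.
split=> //; split.
- by rewrite FE; have [] := cint_opp iih.
- by rewrite (funext E).
- by move=> eta; rewrite (funext E).
Qed.

(** Fubini for [ift g1 x] times the conjugate of [g2 xi * ew x xi]: integrating in [x] first
    produces the Fourier transform of [ift g1], which is [g1] by inversion. *)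
Lemma plancherel g1 g2 : invertible_ft g1 -> invertible_ft g2 ->
  inner (ift g1) (ift g2) = inner g1 g2.
Proof.
move=> [i1 j1 e1] [i2 j2 e2]; rewrite !innerE.
pose f (p : 'cV[R]_n * 'cV[R]_n) := ift g1 p.1 * conjc (g2 p.2 * ew p.1 p.2).
have m1 := cintegrable_cmeas j1; have m2 := cintegrable_cmeas i2.
have mf : cmeas f.
  apply: cmeasM; first exact: cmeas_comp m1 measurable_fst.
  apply: cmeas_conj; apply: cmeasM; first exact: cmeas_comp m2 measurable_snd.
  exact: cmeas_ew2.
have [|||_ _] := @cint_fubini _ _ _ _ R lam lam f mf.
- under eq_integral => x _.
    under eq_integral => xi _.
      rewrite /f /= Normc.normcM normc_conjc Normc.normcM normc_ew mulr1 EFinM; over.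
    rewrite ge0_integralZl //; last 3 first.
    - by apply/measurable_EFinP; exact: measurable_normc.
    - by move=> y _; rewrite lee_fin normc_ge0.
    - by rewrite lee_fin normc_ge0.
    over.
  rewrite ge0_integralZr //; last 3 first.
  - by apply/measurable_EFinP; exact: measurable_normc.
  - by move=> y _; rewrite lee_fin normc_ge0.
  - by apply: integral_ge0 => y _; rewrite lee_fin normc_ge0.
  apply: lte_mul_pinfty.
  - by apply: integral_ge0 => y _; rewrite lee_fin normc_ge0.
  - apply: (integrable_fin_num measurableT); exact: (cintegrable_normc j1).
  - exact/(cintegrable_norm_lty lam m2).
- move=> x; rewrite /f /=; apply: cintegrableZ; apply: cintegrable_conj; exact: cintegrable_ew.
- move=> xi; have := cintegrableZ (conjc (g2 xi)) (cintegrable_ew (- xi) j1).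
  by congr cintegrable; apply/funext => x; rewrite /f /= cjM ewNl [ew xi x]ewC; ring.
move=> h; transitivity (cint lam (fun x => cint lam (fun y => f (x, y)))).
  congr cint; apply/funext => x; rewrite /f /= cintZ; last first.
    by apply: cintegrable_conj; exact: cintegrable_ew.
  by rewrite cint_conj.
rewrite h; congr cint; apply/funext => xi.
rewrite -[g1 xi]e1 fourierE mulrC -cintZ; last exact: cintegrable_ew.
by congr cint; apply/funext => x; rewrite /f /= cjM ewNl [ew xi x]ewC; ring.
Qed.

Lemma nsq_ift g : invertible_ft g -> nsq (ift g) = nsq g.
Proof. by move=> hg; apply: complexI; rewrite -!inner_self plancherel. Qed.

Lemma nsq_ift_B f g : invertible_ft f -> invertible_ft g ->
  nsq (fun x => ift f x - ift g x) = nsq (fun x => f x - g x).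
Proof.
move=> hf hg; have [hfg e] := invertible_B hf hg.
by rewrite -(nsq_ift hfg); congr nsq; apply/funext => x; rewrite e.
Qed.

Lemma translate_ift (y : 'cV[R]_n) g :
  translate y (ift g) = ift (fun xi => g xi * ew (- y) xi).
Proof.
apply/funext => x; rewrite /translate /ift; congr cint; apply/funext => xi.
by rewrite ewDl; ring.
Qed.

Lemma ift_mulmx (P : 'M[R]_n) g x : P \in unitmx -> cintegrable lam g ->
  ift g (P *m x) = ift (fun xi => (`|\det P|^-1)%:C%C * g ((invmx P)^T *m xi)) x.
Proof.
move=> uP ig; have uPT : (invmx P)^T \in unitmx by rewrite unitmx_tr unitmx_inv.
have [i1 e1] := cint_mulmx uPT (cintegrable_ew (P *m x) ig).
have E xi : ew (P *m x) ((invmx P)^T *m xi) = ew x xi.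
  by rewrite /ew dot_mulmx trmxK mulmxA mulVmx // mul1mx.
have h : cint lam (fun xi => (`|\det P|^-1)%:C%C * (g ((invmx P)^T *m xi) * ew (P *m x) ((invmx P)^T *m xi)))
    = ift g (P *m x).
  rewrite cintZ // e1 det_tr det_inv normfV invrK mulrA -rmorphM mulVf ?mul1r //.
  by rewrite normr_eq0 -unitfE -unitmxE.
by rewrite -h; congr cint; apply/funext => xi; rewrite E mulrA.
Qed.

End plancherel.

(** * Density in L2 of transforms of test functions that vanish near the origin *)

Section density.
Context (R : realType).
Local Notation Re := (@complex.Re R).
Local Notation Im := (@complex.Im R).
Local Notation normc := (@Normc.normc R).
Local Notation lam n := (@lebesgue_cV R n).

(** Pointwise convergence with dominated squares is convergence in L2. Square integrability of the
    limit comes out of the bound [2 u], so that the squared differences are below [4 u + 2 u]. *)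
Lemma L2_closure_dct n (S : set ('cV[R]_n -> R[i])) (F : nat -> 'cV[R]_n -> R[i]) f
    (u : 'cV[R]_n -> R) : S `<=` L2 -> (forall k, L2_closure S (F k)) -> cmeas f ->
  (forall x, (fun k => normc (F k x - f x)) @ \oo --> 0) ->
  (lam n).-integrable setT (EFin \o u) -> (forall k x, normc (F k x) ^+ 2 <= u x) ->
  L2_closure S f.
Proof.
move=> SL SF mf Ff iu Fu.
have mF k : cmeas (F k) by apply: L2_cmeas; case: (SF k).
have fu x : normc (f x) ^+ 2 <= 2 * u x.
  apply/ler_addgt0Pl => e e0.
  have := Ff x; move/cvgrPdist_le => /(_ (Num.sqrt (e / 2))).
  rewrite sqrtr_gt0 divr_gt0 // => /(_ isT) h; near \oo => k.
  have hk : normc (F k x - f x) <= Num.sqrt (e / 2).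
    by rewrite -[leLHS]ger0_norm ?normc_ge0 // -normrN -sub0r; near: k.
  have -> : f x = - (F k x - f x) + F k x by ring.
  rewrite (le_trans (sqr_normcD _ _)) // normcN; apply: lerD; last first.
    by rewrite ler_wpM2l.
  rewrite -ler_pdivlMl // mulrC -[leRHS]sqr_sqrtr ?divr_ge0 ?(ltW e0) //.
  by rewrite lerXn2r ?nnegrE ?normc_ge0 ?sqrtr_ge0.
have L2f : L2 f.
  apply: (L2_le mf (integrableZl measurableT 2 iu)) => x; exact: fu.
apply: L2_closureK => //; apply/L2_closureP; first by move=> g [].
split=> // e e0.
have L2F k : L2 (F k) by case: (SF k).
pose G k x := ((normc (f x - F k x) ^+ 2)%:C)%C.
have [|||||_] := @cint_dct _ _ _ (lam n) G (fun=> 0) (fun x => 8 * u x).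
- by move=> k; apply: cmeas_real; apply: measurable_sqnormc; apply: cmeasB.
- exact: cmeas_cst.
- move=> x; rewrite /G; under eq_fun do rewrite subr0 normc_real ger0_norm ?sqr_ge0 // normc_distC.
  have -> : (0 : R) = 0 ^+ 2 by rewrite expr0n.
  by apply: (@continuous_cvg _ _ _ _ _ _ (fun t : R => t ^+ 2) (0 : R)) (Ff x); exact: exprn_continuous.
- by have := integrableZl measurableT 8 iu; apply: eq_integrable => // y _ /=; rewrite EFinM.
- move=> k x; rewrite normc_real ger0_norm ?sqr_ge0 //.
  rewrite (le_trans (sqr_normcD _ _)) // normcN.
  have := fu x; have := Fu k x; have := sqr_ge0 (normc (F k x)); lra.
rewrite cint0 => /cvgrPdist_lt /(_ _ e0) [k _ /(_ k (leqnn k)) h0].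
exists (F k); first exact: SF.
have E : cint (lam n) (G k) = ((nsq (fun x => f x - F k x))%:C)%C by exact: cint_real.
move: h0; rewrite [cint _ _]E subr0 sub0r normrN !normc_real !ger0_norm ?nsq_ge0.
Unshelve. all: by end_near. Qed.

(* A smooth step from 0 (t <= 0) to 1 (t >= 1). *)
Definition step (t : R) : R := flat 0 t / (flat 0 t + flat 0 (1 - t)).

Lemma flat_gt0 k (t : R) : 0 < t -> 0 < flat k t.
Proof. by move=> t0; rewrite /flat t0 mulr_gt0 ?expR_gt0 // exprn_gt0 // invr_gt0. Qed.

Lemma flat_ge0 k (t : R) : 0 <= flat k t.
Proof. by have /andP[] := flat_le k t. Qed.

Lemma flat_eq0 k (t : R) : t <= 0 -> flat k t = 0.
Proof. by rewrite /flat leNgt => /negbTE ->. Qed.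

Lemma step_den (t : R) : 0 < flat 0 t + flat 0 (1 - t).
Proof.
have [t0|t0] := leP t 0.
  by rewrite ltr_wpDl ?flat_ge0 ?flat_gt0 // subr_gt0 (le_lt_trans t0).
by rewrite ltr_pwDl ?flat_ge0 ?flat_gt0.
Qed.

Lemma step_ge0 t : 0 <= step t.
Proof. by rewrite /step divr_ge0 ?flat_ge0 // ltW ?step_den. Qed.

Lemma step_le1 t : step t <= 1.
Proof. by rewrite /step ler_pdivrMr ?step_den // mul1r lerDl flat_ge0. Qed.

Lemma step_eq0 t : t <= 0 -> step t = 0.
Proof. by move=> t0; rewrite /step flat_eq0 // mul0r. Qed.

Lemma step_eq1 t : 1 <= t -> step t = 1.
Proof.
move=> t1; rewrite /step [flat 0 (1 - t)]flat_eq0 ?subr_le0 // addr0 divff //.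
by rewrite gt_eqF // flat_gt0 // (lt_le_trans ltr01).
Qed.

Lemma stepB t : step (1 - t) = 1 - step t.
Proof.
rewrite /step subKr [flat 0 (1 - t) + _]addrC.
have := step_den t; move: (flat 0 t) (flat 0 (1 - t)) => a b ab.
by field; rewrite gt_eqF.
Qed.

Lemma dsmooth_step (V : normedModType R) (f : V -> R) : dsmooth f ->
  dsmooth (fun x => step (f x)).
Proof.
move=> hf; apply: dsmoothM; first exact: dsmooth_flat.
apply: dsmoothV => [x|]; first by rewrite gt_eqF // step_den.
apply: dsmoothD; first exact: dsmooth_flat.
by apply: dsmooth_flat; apply: dsmoothB => //; exact: dsmooth_cst.
Qed.

(** Doubling fixes the origin but scales integrals by a factor other than 1; the measure of the
    point is finite, hence 0. *)
Lemma lebesgue_cV_set1 n : lebesgue_cV n.+1 [set (0 : 'cV[R]_n.+1)] = 0%E.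
Proof.
have m0 : measurable [set (0 : 'cV[R]_n.+1)].
  rewrite (_ : [set _] = \bigcap_(i in [set: 'I_n.+1]) [set x : 'cV[R]_n.+1 | x i 0 \in `[0, 0]]).
    apply: fin_bigcap_measurable => // i _; rewrite -[X in measurable X]setTI.
    exact: (measurable_coord i measurableT (measurable_itv _)).
  apply/seteqP; split => x /=.
    by move=> -> i _ /=; rewrite mxE in_itv /= lexx.
  move=> h; apply/matrixP => i j; rewrite ord1 mxE.
  by have := h i Logic.I; rewrite /= in_itv /= => /andP[a b]; apply/eqP; rewrite eq_le a b.
pose u (x : 'cV[R]_n.+1) : R := \1_[set 0] x.
have mu : measurable_fun setT (EFin \o u) by exact/measurable_EFinP/measurable_indic.
have iu : (lam n.+1).-integrable setT (EFin \o u).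
  apply: (le_integrable _ _ _ (@integrable_boxfun R n.+1 1)) => // x _ /=.
  rewrite lee_fin /u indicE; have [->|x0] := eqVneq x 0.
    by rewrite mem_set // boxfun1 ?normr0.
  by rewrite memNset ?normr0 // => /eqP; apply/negP.
have uE : (\int[lam n.+1]_x (u x)%:E)%E = lebesgue_cV n.+1 [set 0].
  by rewrite /u integral_indic // setIT.
have two : (2 : R) != 0 by rewrite pnatr_eq0.
have uP : (2%:M : 'M[R]_n.+1) \in unitmx by rewrite unitmxE det_scalar unitfE expf_neq0.
have h := @linear_integral_unit R n.+1 _ uP (EFin \o u) mu (fun x => _).
have /h : forall x, (0 <= (EFin \o u) x)%E by move=> x; rewrite lee_fin /u indicE.
rewrite (_ : (fun x => (EFin \o u) (2%:M *m x)) = EFin \o u); last first.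
  apply/funext => x /=; rewrite /u !indicE mul_scalar_mx; congr ((_ : bool)%:R%:E).
  by apply/idP/idP; rewrite !inE /= => /eqP; rewrite ?scaler_eq0 ?(negbTE two) //= => /eqP ->; rewrite ?scaler0.
have fin := integrable_fin_num measurableT iu.
rewrite -uE; move: fin; rewrite det_scalar.
rewrite [integral _ _ (EFin \o u)](_ : _ = \int[lam n.+1]_x (u x)%:E)%E //.
case: (\int[lam n.+1]_x (u x)%:E)%E => // r _ [] h1; congr (_%:E).
have : r * (1 - `|2 ^+ n.+1|^-1) = 0 by rewrite mulrBr mulr1 [X in _ - X]mulrC -h1 subrr.
move=> /eqP; rewrite mulf_eq0 => /orP[/eqP//|]; rewrite subr_eq0 ger0_norm ?exprn_ge0 // => /eqP.
move/(congr1 (fun t => t^-1)); rewrite invrK invr1 => /eqP.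
by rewrite lt_eqF // exprn_egt1 // ltr1n.
Qed.

End density.

Section density.
Import HBSimple HBNNSimple.
Context (R : realType) (n : nat).
Local Notation Re := (@complex.Re R).
Local Notation Im := (@complex.Im R).
Local Notation normc := (@Normc.normc R).
Local Notation lam := (@lebesgue_cV R n.+1).

(** Vanishing near the origin makes a transform orthogonal to all sufficiently coarse spaces of the
    multiresolution analysis ([Vj_perp]). Density of these functions therefore yields both the
    trivial intersection and the completeness of the wavelets. *)
Definition test_off0 (g : 'cV[R]_n.+1 -> R[i]) :=
  test g /\ exists2 r : R, 0 < r & forall x, `|x| < r -> g x = 0.

Lemma test_off0_lin (a : R[i]) f g : test_off0 f -> test_off0 g -> test_off0 (fun x => a * f x + g x).
Proof.
move=> [tf [r r0 fr]] [tg [s s0 gs]]; split; first by apply: testD => //; exact: testZ.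
exists (Num.min r s); first by rewrite lt_min r0.
by move=> x; rewrite lt_min => /andP[/fr -> /gs ->]; rewrite mulr0 addr0.
Qed.

Lemma test_off0_0 : test_off0 (fun=> 0).
Proof. by split; [exact: test0|exists 1]. Qed.

Lemma lin_span_ift f : lin_span [set g | test_off0 g] (@ift R n.+1) f ->
  exists2 g, test_off0 g & f = ift g.
Proof.
move=> [m [g [c [tg ->]]]]; elim: m g c tg => [|m ih] g c tg.
  exists (fun=> 0); first exact: test_off0_0.
  apply/funext => x; rewrite big_ord0 /ift.
  by rewrite (_ : (fun x => _) = fun=> 0) ?cint0 //; apply/funext => xi; rewrite mul0r.
have [|h th E] := ih (fun k => g (lift ord0 k)) (fun k => c (lift ord0 k)).
  by move=> k; exact: tg.
exists (fun x => c ord0 * g ord0 x + h x); first exact: (test_off0_lin (c ord0) (tg ord0) th).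
have i1 : cintegrable lam (g ord0) by apply: test_cintegrable; case: (tg ord0).
have i2 : cintegrable lam h by apply: test_cintegrable; case: th.
apply/funext => x; rewrite big_ord_recl (congr1 (@^~ x) E).
rewrite iftD ?iftZ //; exact: cintegrableZ.
Qed.

(** A smooth shell: it is 1 where [2/(k+1) <= |xi|^2 <= k+1], and 0 where [|xi|^2 <= 1/(k+1)] or
    [|xi|^2 >= 2(k+1)], the norm being the Euclidean one. *)
Definition cutoff k (xi : 'cV[R]_n.+1) : R :=
  step (k.+1%:R * dot xi xi - 1) * step (2 - dot xi xi / k.+1%:R).

Lemma cutoff_le1 k xi : 0 <= cutoff k xi <= 1.
Proof. by rewrite mulr_ge0 ?step_ge0 //= mulr_ile1 ?step_ge0 ?step_le1. Qed.

Lemma dsmooth_cutoff k : dsmooth (cutoff k).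
Proof.
have hq : dsmooth (fun xi : 'cV[R]_n.+1 => dot xi xi).
  by apply: dsmooth_sum => i; apply: dsmoothM; exact: dsmooth_coord.
apply: dsmoothM; apply: dsmooth_step; apply: dsmoothB; try exact: dsmooth_cst.
  by apply: dsmoothM => //; exact: dsmooth_cst.
by apply: dsmoothM => //; exact: dsmooth_cst.
Qed.

Lemma sqr_norm_le_dot (x : 'cV[R]_n.+1) : `|x| ^+ 2 <= dot x x.
Proof.
have d0 : 0 <= dot x x by rewrite sumr_ge0 // => i _; rewrite -expr2 sqr_ge0.
rewrite -[leRHS]sqr_sqrtr // lerXn2r ?nnegrE ?sqrtr_ge0 //.
apply: norm_cV_le; first exact: sqrtr_ge0.
move=> i; rewrite -sqrtr_sqr ler_wsqrtr // /dot (bigD1 i) //= expr2 lerDl.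
by rewrite sumr_ge0 // => j _; rewrite -expr2 sqr_ge0.
Qed.

Lemma cutoff_eq1 xi : xi != 0 -> \forall k \near \oo, cutoff k xi = 1.
Proof.
move=> x0; have d0 : 0 < dot xi xi.
  by apply: lt_le_trans (sqr_norm_le_dot xi); rewrite exprn_gt0 // normr_gt0.
near=> k; have k1 : 2 / dot xi xi <= k.+1%:R.
  by rewrite (@le_trans _ _ k%:R) // ?ler_nat //; near: k; exact: nbhs_infty_ger.
have k2 : dot xi xi <= k.+1%:R.
  by rewrite (@le_trans _ _ k%:R) // ?ler_nat //; near: k; exact: nbhs_infty_ger.
rewrite /cutoff !step_eq1 ?mulr1 //.
  have : dot xi xi / k.+1%:R <= 1 by rewrite ler_pdivrMr ?ltr0n // mul1r.
  by move: (_ / _) => q; lra.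
by move: k1; rewrite ler_pdivrMr //; lra.
Unshelve. all: by end_near. Qed.

Lemma test_off0_cutoff k (f : 'cV[R]_n.+1 -> R[i]) : csmooth f ->
  test_off0 (fun x => (cutoff k x)%:C%C * f x).
Proof.
move=> sf; have s1 : csmooth (fun x => (cutoff k x)%:C%C) by apply: csmooth_real; exact: dsmooth_cutoff.
have k0 : 0 < k.+1%:R :> R by rewrite ltr0n.
split; [split; first exact: csmoothM|].
  exists (2 * k.+1%:R) => x xk; rewrite /cutoff [step (2 - _)]step_eq0 ?mulr0 ?mul0r //.
  rewrite subr_le0 ler_pdivlMr // (le_trans _ (sqr_norm_le_dot x)) //.
  have k1 : 1 <= k.+1%:R :> R by rewrite ler1n.
  have : 0 <= `|x| - 2 * k.+1%:R by rewrite subr_ge0 ltW.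
  move: xk k1; set a := `|x|; set b := k.+1%:R => xk k1 h; nra.
exists (Num.sqrt ((k.+1 * n.+1)%N%:R^-1)); first by rewrite sqrtr_gt0 invr_gt0 ltr0n.
move=> x xk; rewrite /cutoff [step (_ - 1)]step_eq0 ?mul0r //.
rewrite subr_le0 -ler_pdivlMl // mulr1 (le_trans (ler_norm _)) // (le_trans (dot_le _ _)) //.
rewrite -ler_pdivlMl ?ltr0n // -invfM -natrM mulnC -expr2.
rewrite -[leRHS]sqr_sqrtr ?invr_ge0 ?ler0n // lerXn2r ?nnegrE ?sqrtr_ge0 //.
exact: ltW.
Qed.

Let S := lin_span [set g | test_off0 g] (@ift R n.+1).

Let SL : S `<=` L2.
Proof. by move=> f /lin_span_ift[g [tg _] ->]; exact/invertible_ift_L2/invertible_test. Qed.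

(** By Plancherel it is enough to approximate [fourier h], which is smooth and square integrable, by
    its products with the shells [cutoff k]. *)
Lemma test_dense h : test h -> L2_closure S h.
Proof.
move=> th; have [inv E] := invertible_fourier th.
have sF : csmooth (fourier h).
  have -> : fourier h = fun xi => ift h ((-1)%:M *m xi).
    by apply/funext => xi; rewrite fourierE mul_scalar_mx scaleN1r.
  by apply: csmooth_mulmx; exact: csmooth_ift.
(* All cutoffs vanish at the origin, so the pointwise limit is [fourier h] with its value there
   reset to 0; a single point is negligible. *)
pose f x := if x == 0 then 0 else fourier h x.
have L2F := invertible_L2 inv.
have m0 : measurable [set (0 : 'cV[R]_n.+1)].
  rewrite (_ : [set _] = \bigcap_(i in [set: 'I_n.+1]) [set x : 'cV[R]_n.+1 | x i 0 \in `[0, 0]]).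
    apply: fin_bigcap_measurable => // i _; rewrite -[X in measurable X]setTI.
    exact: (measurable_coord i measurableT (measurable_itv _)).
  apply/seteqP; split => x /=.
    by move=> -> i _ /=; rewrite mxE in_itv /= lexx.
  move=> k; apply/matrixP => i j; rewrite ord1 mxE.
  by have := k i Logic.I; rewrite /= in_itv /= => /andP[a b]; apply/eqP; rewrite eq_le a b.
have mf : cmeas f.
  have -> : f = fun x => (1 - (\1_[set (0 : 'cV[R]_n.+1)] x)%:C%C) * fourier h x.
    apply/funext => x; rewrite /f indicE; case: eqP => [->|x0].
      by rewrite mem_set // subrr mul0r.
    by rewrite memNset // subr0 mul1r.
  apply: cmeasM; last exact: L2_cmeas.
  apply: cmeasB; first exact: cmeas_cst.
  by apply: cmeas_real; exact: measurable_indic.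
have : L2_closure [set g | test_off0 g] f.
  apply: (@L2_closure_dct R n.+1 _ (fun k x => (cutoff k x)%:C%C * fourier h x) f
     (fun x => normc (fourier h x) ^+ 2)) => //.
  - by move=> g [/invertible_test/invertible_L2].
  - by move=> k; apply: sub_L2_closure; [move=> g [/invertible_test/invertible_L2]|exact: test_off0_cutoff].
  - have c0 k : cutoff k 0 = 0.
      rewrite /cutoff (_ : dot 0 0 = 0) ?mulr0 ?sub0r; first by rewrite step_eq0 ?mul0r ?lerN10.
      by rewrite /dot big1 // => i _; rewrite mxE mulr0.
    move=> x; rewrite /f; case: eqP => [->|/eqP x0].
      rewrite (_ : (fun k => _) = fun=> 0); first exact: cvg_cst.
      by apply/funext => k; rewrite c0 mul0r subr0 Normc.normc0.
    apply: cvg_near_cst; near=> k.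
    by rewrite (near (cutoff_eq1 x0) k) // mul1r subrr Normc.normc0.
  - exact: L2_integrable.
  - move=> k x; rewrite Normc.normcM exprMn normc_real -[leRHS]mul1r ler_wpM2r ?sqr_ge0 //.
    by have /andP[a b] := cutoff_le1 k x; rewrite ger0_norm // expr_le1.
have TL : [set g | test_off0 g] `<=` @L2 R n.+1 by move=> g [/invertible_test/invertible_L2].
move=> /(L2_closureP _ TL)[_ cf]; apply/L2_closureP => //; split.
  by rewrite -(funext E); exact: invertible_ift_L2.
move=> e /cf[g tg hg]; exists (ift g); first exact: lin_span_gen.
have -> : h = ift (fourier h) by apply/funext => x; rewrite E.
rewrite nsq_ift_B //; last by case: tg => /invertible_test.
apply: le_lt_trans hg; rewrite le_eqVlt; apply/orP; left; apply/eqP.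
rewrite /nsq /Rintegral; congr fine; apply: ae_eq_integral => //.
- apply/measurable_EFinP; apply: measurable_sqnormc; apply: cmeasB; first exact: L2_cmeas.
  by apply: L2_cmeas; exact: TL.
- apply/measurable_EFinP; apply: measurable_sqnormc; apply: cmeasB => //.
  by apply: L2_cmeas; exact: TL.
exists [set 0]; split=> //; first exact: lebesgue_cV_set1.
by move=> x /= /not_implyP[_]; rewrite /f; case: eqP.
Unshelve. all: by end_near. Qed.

Lemma coord_big (M : R) (x : 'cV[R]_n.+1) : M < `|x| -> exists i, M < `|x i 0|.
Proof.
move=> Mx; apply: contrapT => /forallNP h; move: Mx; rewrite ltNge norm_cV_le //.
  by rewrite (le_trans (normr_ge0 (x ord0 0))) // leNgt; exact/negP/h.
by move=> i; rewrite leNgt; apply/negP/h.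
Qed.

(** Products of smooth steps of growing steepness converge everywhere to the indicator of the open
    box and are supported in its closure. *)
Lemma box_dense (a b : 'I_n.+1 -> R) :
  L2_closure S (fun x => (\prod_i (\1_(`]a i, b i[%classic) (x i 0) : R))%:C%C).
Proof.
pose M := \big[Num.max/0]_i Num.max `|a i| `|b i|.
have aM i : `|a i| <= M by rewrite (le_trans _ (le_bigmax_cond _ (fun i => Num.max `|a i| `|b i|) (j := i) _)) // le_max lexx.
have bM i : `|b i| <= M by rewrite (le_trans _ (le_bigmax_cond _ (fun i => Num.max `|a i| `|b i|) (j := i) _)) // le_max lexx orbT.
pose G k (x : 'cV[R]_n.+1) : R := \prod_i (step (k%:R * (x i 0 - a i)) * step (k%:R * (b i - x i 0))).
have Gs k : csmooth (fun x => (G k x)%:C%C).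
  apply: csmooth_real; apply: dsmooth_prod => i; apply: dsmoothM; apply: dsmooth_step.
    apply: dsmoothM; [exact: dsmooth_cst|apply: dsmoothB; [exact: dsmooth_coord|exact: dsmooth_cst]].
  apply: dsmoothM; [exact: dsmooth_cst|apply: dsmoothB; [exact: dsmooth_cst|exact: dsmooth_coord]].
have G01 k x : 0 <= G k x <= 1.
  rewrite prodr_ge0 ?prodr_ile1 //.
    by move=> i _; rewrite mulr_ge0 ?step_ge0 //= mulr_ile1 ?step_ge0 ?step_le1.
  by move=> i _; rewrite mulr_ge0 ?step_ge0.
have G0 k x : M < `|x| -> G k x = 0.
  move=> /coord_big[i hi].
  rewrite /G (bigD1 i) //=; move: hi; rewrite lter_normr => /orP[] hi.
    rewrite [step (k%:R * (b i - _))]step_eq0 ?mulr0 ?mul0r //.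
    rewrite mulr_ge0_le0 // subr_le0 ltW // (le_lt_trans _ hi) //.
    by rewrite (le_trans (ler_norm _)).
  rewrite [step (k%:R * (_ - a i))]step_eq0 ?mul0r //.
  rewrite mulr_ge0_le0 // subr_le0 -lerN2 ltW // (le_lt_trans _ hi) //.
  by rewrite (le_trans (ler_norm _)) // normrN.
apply: (@L2_closure_dct R n.+1 _ (fun k x => (G k x)%:C%C) _ (@boxfun R n.+1 M)) => //.
- move=> k; apply: test_dense; split=> //.
  by exists M => x /G0 ->.
- apply: cmeas_real; apply: measurable_prod => i _.
  apply: (@measurableT_comp _ _ _ _ _ _ (\1_(`]a i, b i[%classic) : R -> R)); last exact: measurable_coord.
  by apply: measurable_indic; exact: measurable_itv.
- move=> x; have [/forallP h|/forallPn /= [i hi]] := boolP [forall i, a i < x i 0 < b i].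
    apply: cvg_near_cst.
    have h1 i : \forall k \near \oo, step (k%:R * (x i 0 - a i)) * step (k%:R * (b i - x i 0)) = 1.
      have /andP[ha hb] := h i.
      near=> k; rewrite !step_eq1 ?mulr1 //; rewrite -ler_pdivrMr ?subr_gt0 //;
        near: k; exact: nbhs_infty_ger.
    have h2 : \forall k \near \oo, forall i, step (k%:R * (x i 0 - a i)) * step (k%:R * (b i - x i 0)) = 1.
      exact: filter_forall.
    near=> k; rewrite /G !big1 ?subrr ?Normc.normc0 //.
      by move=> i _; have := h i; rewrite indicE => hi; rewrite mem_set //= in_itv.
    by move=> i _; apply: (near h2 k).
  have E2 : \prod_i (\1_(`]a i, b i[%classic) (x i 0) : R) = 0.
    by rewrite (bigD1 i) //= indicE memNset ?mul0r //= in_itv; exact/negP.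
  rewrite E2 (_ : (fun k => _) = fun=> 0); first exact: cvg_cst.
  apply/funext => k; suff -> : G k x = 0 by rewrite subrr; exact: Normc.normc0.
  rewrite /G (bigD1 i) //= [X in X * _](_ : _ = 0) ?mul0r //.
  move: hi; rewrite negb_and -!leNgt => /orP[] hi.
    by rewrite step_eq0 ?mul0r // mulr_ge0_le0 // subr_le0.
  by rewrite [step (_ * (b i - _))]step_eq0 ?mulr0 // mulr_ge0_le0 // subr_le0.
- exact: integrable_boxfun.
- move=> k x; rewrite normc_real; have /andP[g0 g1] := G01 k x.
  rewrite ger0_norm //; have [xM|xM] := leP `|x| M; first by rewrite boxfun1 // expr_le1.
  by rewrite G0 // expr0n /= boxfun_ge0.
Unshelve. all: by end_near. Qed.

Let boxM (M : R) (x : 'cV[R]_n.+1) : R := \prod_i \1_(`]-M, M[%classic) (x i 0).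

Let rays := [set E : set 'cV[R]_n.+1 | exists a : 'I_n.+1 -> R, E = [set x | forall i, a i < x i 0]].

Lemma measurable_rays : @measurable _ 'cV[R]_n.+1 = <<s rays >>.
Proof.
apply/seteqP; split.
  pose T' := g_sigma_algebraType rays.
  have idm : measurable_fun [set: T'] (id : T' -> 'cV[R]_n.+1).
    apply: measurable_fun_cV => i.
    apply: (measurability _ (RGenOInfty.measurableE R)) => _ [_ [c ->] <-]; rewrite setTI.
    change (<<s rays >> [set x : 'cV[R]_n.+1 | x i 0 \in `]c, +oo[ ]).
    rewrite [X in <<s _ >> X](_ : _ = \bigcup_k [set x : 'cV[R]_n.+1 | forall j, (if j == i then c else - k%:R) < x j 0]).
      apply: (@bigcupT_measurable _ T') => k; apply: sub_sigma_algebra.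
      by exists (fun j => if j == i then c else - k%:R).
    apply/seteqP; split => x /=.
      rewrite in_itv /= andbT => cx.
      have [k hk] : exists k : nat, `|x| < k%:R.
        by exists (Num.bound `|x|); rewrite archi_boundP.
      exists k => // j; case: eqP => [->//|_].
      by rewrite ltrNl (le_lt_trans _ hk) // (le_trans (ler_norm _)) // normrN coord_le_norm.
    by move=> [k _ /(_ i)]; rewrite eqxx in_itv /= andbT.
  by move=> E /(idm measurableT); rewrite setTI.
apply: smallest_sub; first exact: sigma_algebra_measurable.
move=> _ [a ->]; rewrite [X in measurable X](_ : _ = \bigcap_(i in [set: 'I_n.+1]) [set x : 'cV[R]_n.+1 | x i 0 \in `]a i, +oo[]).
  apply: fin_bigcap_measurable => // i _; rewrite -[X in measurable X]setTI.
  exact: (measurable_coord i measurableT (measurable_itv _)).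
apply/seteqP; split => x /= h i; last by have := h i Logic.I; rewrite /= ?in_itv /= ?andbT.
by move=> _; rewrite /= ?in_itv /= ?andbT.
Qed.

(** A pi-lambda argument: the open orthants [rays] generate the sigma-algebra and are stable under
    intersection, and the property passes to complements and disjoint unions. The cube [boxM] keeps
    every function square integrable. *)
Lemma indic_dense (E : set 'cV[R]_n.+1) (M : R) : measurable E ->
  L2_closure S (fun x => (\1_E x * boxM M x)%:C%C).
Proof.
have eL2 : forall g : 'cV[R]_n.+1 -> R[i], test_off0 g -> L2 (ift g).
  by move=> g [/invertible_test/invertible_ift_L2].
have [clL cl0 cllin _] := closed_span eL2.
have box1 x : 0 <= boxM M x <= 1.
  apply/andP; split; first by apply: prodr_ge0 => i _; rewrite indicE ler0n.
  by apply: prodr_ile1 => i _; rewrite indicE ler0n lern1 leq_b1.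
have boxE x : M < `|x| -> boxM M x = 0.
  move=> /coord_big[i hi]; rewrite /boxM (bigD1 i) //= indicE memNset ?mul0r //=.
  by rewrite in_itv /= -ltr_norml => /(lt_trans hi); rewrite ltxx.
have indicEE (F : set 'cV[R]_n.+1) x : (\1_F x : R) = 0 \/ (\1_F x : R) = 1.
  by rewrite indicE; case: (_ \in _); [right|left].
rewrite measurable_rays; move: E; apply: dynkin_induction.
- exact: measurable_rays.
- move=> _ _ [a ->] [b ->]; exists (fun i => Num.max (a i) (b i)).
  apply/seteqP; split => x /=; first by move=> [h1 h2] i; rewrite gt_max h1 h2.
  by move=> h; split=> i; have := h i; rewrite gt_max => /andP[].
- have := box_dense (fun=> - M) (fun=> M); congr (L2_closure S _); apply/funext => x.
  by rewrite indicE in_setT mul1r.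
- move=> _ [a ->]; have := box_dense (fun i => Num.max (a i) (- M)) (fun=> M).
  congr (L2_closure S _); apply/funext => x; congr (_%:C%C).
  have [ax|ax] := pselect (forall i, a i < x i 0).
    rewrite indicE mem_set // mul1r; apply: eq_bigr => i _; rewrite !indicE; congr ((nat_of_bool _)%:R).
    by apply/idP/idP => /set_mem h; apply/mem_set; move: h; rewrite /= !in_itv /= gt_max ax.
  rewrite indicE memNset // mul0r; move/existsNP: ax => [i hi]; rewrite (bigD1 i) //= indicE.
  by rewrite memNset ?mul0r //= in_itv /= gt_max => /andP[/andP[/hi]].
- move=> F mF PF; have := cllin (-1) _ _ PF (box_dense (fun=> - M) (fun=> M)).
  congr (L2_closure S _); apply/funext => x; rewrite -/(boxM M x) mulN1r addrC -rmorphB.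
  congr (_%:C%C); rewrite !indicE in_setC; case: (x \in F); first by rewrite mul1r subrr mul0r.
  by rewrite mul0r mul1r subr0.
- move=> F mF tF PF.
  apply: (@L2_closure_dct R n.+1 _ (fun k x => (\1_(\bigcup_(i < k) F i) x * boxM M x)%:C%C) _ (@boxfun R n.+1 M)) => //.
  + elim=> [|k ih].
      move: cl0; congr (L2_closure S _); apply/funext => x.
      by rewrite indicE memNset ?mul0r // => -[].
    have := cllin 1 _ _ ih (PF k); congr (L2_closure S _); apply/funext => x.
    rewrite mul1r -rmorphD -mulrDl; congr (_ * _)%:C%C; rewrite !bigcup_mkord big_ord_recr /= -bigcup_mkord.
    rewrite !indicE in_setU; case: (boolP (x \in F k)) => [xk|_]; last by rewrite orbF addr0.
    rewrite orbT [x \in _](_ : _ = false) ?add0r //; apply/negP => /set_mem[i /= ik xi].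
    move/set_mem: xk => xk; have E := tF i k Logic.I Logic.I (ex_intro _ x (conj xi xk)).
    by rewrite E ltnn in ik.
  + apply: cmeas_real; apply: measurable_funM.
      by apply: measurable_indic; exact: bigcupT_measurable.
    apply: measurable_prod => i _.
    apply: (@measurableT_comp _ _ _ _ _ _ (\1_(`]- M, M[%classic) : R -> R)); last exact: measurable_coord.
    by apply: measurable_indic; exact: measurable_itv.
  + move=> x; have [[i _ xi]|nx] := pselect ((\bigcup_i F i) x).
      apply: cvg_near_cst; near=> k.
      rewrite !indicE !mem_set ?subrr ?Normc.normc0 //; first by exists i.
      by exists i => //=; near: k; exact: nbhs_infty_gt.
    rewrite (_ : (fun k => _) = fun=> 0); first exact: cvg_cst.
    apply/funext => k; rewrite !indicE !memNset ?subrr ?Normc.normc0 //.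
    by move=> [i _ xi]; apply: nx; exists i.
  + exact: integrable_boxfun.
  + move=> k x; have [xM|xM] := leP `|x| M; last by rewrite boxE // mulr0 Normc.normc0 expr0n /= boxfun_ge0.
    rewrite boxfun1 // normc_real; have /andP[b0 b1] := box1 x.
    have [->|->] := indicEE (\bigcup_(i < k) F i) x; first by rewrite mul0r normr0 expr0n ler01.
    by rewrite mul1r ger0_norm // expr_le1.
Unshelve. all: by end_near. Qed.

(** Simple functions increase to [u]; cut off by growing cubes, each one is a finite combination of
    the functions of [indic_dense]. *)
Lemma nonneg_dense (u : 'cV[R]_n.+1 -> R) : L2 (fun x => (u x)%:C%C) -> (forall x, 0 <= u x) ->
  L2_closure S (fun x => (u x)%:C%C).
Proof.
move=> Lu u0; have eL2 : forall g : 'cV[R]_n.+1 -> R[i], test_off0 g -> L2 (ift g).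
  by move=> g [/invertible_test/invertible_ift_L2].
have [clL cl0 cllin _] := closed_span eL2.
have clZ a f : L2_closure S f -> L2_closure S (fun x => a * f x).
  by move=> h; have := cllin a _ _ h cl0; congr (L2_closure S _); apply/funext => x; rewrite addr0.
have clsum m (F : 'I_m -> 'cV[R]_n.+1 -> R[i]) : (forall i, L2_closure S (F i)) ->
    L2_closure S (fun x => \sum_(i < m) F i x).
  elim: m F => [|m ih] F hF; first by under eq_fun do rewrite big_ord0.
  have := cllin 1 _ _ (hF ord0) (ih (fun i => F (lift ord0 i)) (fun i => hF _)).
  by congr (L2_closure S _); apply/funext => x; rewrite big_ord_recl mul1r.
have mu : measurable_fun setT (EFin \o u) by apply/measurable_EFinP; case: (L2_cmeas Lu).
pose g := nnsfun_approx measurableT mu.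
have gu x : (fun k => g k x) @ \oo --> u x.
  have u0' y : setT y -> (0 <= (EFin \o u) y)%E by move=> _; rewrite lee_fin.
  by have /fine_cvgP[] := cvg_nnsfun_approx measurableT mu u0' (Logic.I : setT x).
have gle k x : 0 <= g k x <= u x.
  rewrite fun_ge0 /=; have nd := nd_nnsfun_approx measurableT mu.
  have cg : cvgn (fun k => g k x) by apply/cvg_ex; exists (u x).
  rewrite -(cvg_lim (@Rhausdorff R) (gu x)); apply: nondecreasing_cvgn_le => // i j ij.
  by have /lefP := nd i j ij; apply.
have box1 M x : 0 <= boxM M x <= 1.
  apply/andP; split; first by apply: prodr_ge0 => i _; rewrite indicE ler0n.
  by apply: prodr_ile1 => i _; rewrite indicE ler0n lern1 leq_b1.
apply: (@L2_closure_dct R n.+1 _ (fun k x => (g k x * boxM k%:R x)%:C%C) _ (fun x => normc ((u x)%:C%C) ^+ 2)) => //.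
- move=> k; pose s : seq R := finmap.enum_fset (fset_set (range (g k))).
  have : L2_closure S (fun x => \sum_(i < size s)
      (s`_i)%:C%C * (\1_(g k @^-1` [set s`_i]) x * boxM k%:R x)%:C%C).
    apply: clsum => i.
    have mE : measurable (g k @^-1` [set s`_i]) by exact: measurable_sfunP.
    exact: clZ (indic_dense k%:R mE).
  congr (L2_closure S _); apply/funext => x; rewrite [in RHS]fimfunEord mulr_suml.
  by rewrite rmorph_sum; apply: eq_bigr => i _; rewrite -rmorphM mulrA.
- exact: L2_cmeas.
- move=> x; have [N hN] : exists N : nat, `|x| < N%:R.
    by exists (Num.bound `|x|); rewrite archi_boundP.
  have h1 : \forall k \near \oo, normc ((g k x)%:C%C - (u x)%:C%C) = normc ((g k x * boxM k%:R x)%:C%C - (u x)%:C%C).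
    near=> k; have Nk : (N <= k)%N by near: k; exact: nbhs_infty_ge.
    rewrite /boxM big1 ?mulr1 // => i _; rewrite indicE mem_set //= in_itv /= -ltr_norml.
    by rewrite (le_lt_trans (coord_le_norm _ _)) // (lt_le_trans hN) // ler_nat.
  apply/cvgrPdist_le => e e0; near=> k.
  rewrite sub0r normrN ger0_norm ?normc_ge0 // -(near h1 k) // -rmorphB normc_real distrC.
  by near: k; move/cvgrPdist_le: (gu x); exact.
- exact: L2_integrable.
- move=> k x; rewrite !normc_real lerXn2r ?nnegrE //.
  have /andP[g0 g1] := gle k x; have /andP[b0 b1] := box1 k%:R x.
  by rewrite !ger0_norm ?mulr_ge0 // -[leRHS]mulr1 ler_pM.
Unshelve. all: by end_near. Qed.

Lemma L2_dense : L2_closure S = @L2 R n.+1.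
Proof.
apply/seteqP; split=> [f []//|f Lf].
have eL2 : forall g : 'cV[R]_n.+1 -> R[i], test_off0 g -> L2 (ift g).
  by move=> g [/invertible_test/invertible_ift_L2].
have [clL cl0 cllin _] := closed_span eL2.
have [[m1 m2] i1] := (L2P f).1 Lf.
have part (v : 'cV[R]_n.+1 -> R) : measurable_fun setT v -> (forall x, `|v x| <= normc (f x)) ->
    L2_closure S (fun x => (v x)%:C%C).
  move=> mv vf; have pos (w : 'cV[R]_n.+1 -> R) : measurable_fun setT w ->
      (forall x, 0 <= w x <= `|v x|) -> L2_closure S (fun x => (w x)%:C%C).
    move=> mw h; apply: nonneg_dense; last by move=> x; case/andP: (h x).
    apply: (L2_le _ i1); first exact: cmeas_real.
    move=> x; rewrite normc_real lerXn2r ?nnegrE ?normc_ge0 //.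
    by have /andP[a b] := h x; rewrite ger0_norm // (le_trans b).
  have h1 : L2_closure S (fun x => (Num.max (v x) 0)%:C%C).
    apply: pos; first by apply: measurable_maxr => //; exact: measurable_cst.
    by move=> x; rewrite le_max lexx orbT /= ge_max ler_norm normr_ge0.
  have h2 : L2_closure S (fun x => (Num.max (- v x) 0)%:C%C).
    apply: pos; first by apply: measurable_maxr => //; exact: measurableT_comp.
    by move=> x; rewrite le_max lexx orbT /= ge_max -normrN ler_norm normr_ge0.
  have := cllin (-1) _ _ h2 h1; congr (L2_closure S _); apply/funext => x.
  rewrite mulN1r addrC -rmorphB; congr (_%:C%C).
  have [v0|v0] := leP (v x) 0.
    by rewrite max_l ?oppr_ge0 // sub0r opprK.
  by rewrite max_r ?oppr_le0 ?(ltW v0) // subr0.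
have h1 := part _ m1 (fun x => normc_Re (f x)).
have h2 := part _ m2 (fun x => normc_Im (f x)).
have := cllin 'i%C _ _ h2 h1; congr (L2_closure S _); apply/funext => x.
by rewrite addrC /=; case: (f x) => a b; simpc.
Qed.

End density.

(** * Fejer kernels *)

Section fejer.
Context (R : realType).
Local Notation Re := (@complex.Re R).
Local Notation Im := (@complex.Im R).
Local Notation normc := (@Normc.normc R).

Definition e1 (t : R) : R[i] := expi (2 * pi * t).

Lemma e1D (a b : R) : e1 (a + b) = e1 a * e1 b.
Proof. by rewrite /e1 mulrDr expiD. Qed.

Lemma e1N (a : R) : e1 (- a) = conjc (e1 a).
Proof. by rewrite /e1 mulrN expiN. Qed.

Lemma e1_0 : e1 0 = 1.
Proof. by rewrite /e1 mulr0 expi0. Qed.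

Lemma e1_int (k : int) : e1 k%:~R = 1.
Proof. exact: expi_int. Qed.

Lemma e1_natmul (k : nat) t : e1 (k%:R * t) = e1 t ^+ k.
Proof.
elim: k => [|k ih]; first by rewrite mul0r e1_0 expr0.
by rewrite -natr1 mulrDl mul1r e1D ih exprSr.
Qed.

Lemma sqr_normc_1e1 t : normc (1 - e1 t) ^+ 2 = 2 - 2 * cos (2 * pi * t).
Proof.
rewrite sqr_normcE cReD cImD cReN cImN /=.
have := cos2Dsin2 (2 * pi * t); rewrite /=.
by move: (cos _) (sin _) => c s h; nra.
Qed.

Lemma normc_1e1_le2 t : normc (1 - e1 t) ^+ 2 <= 4.
Proof.
rewrite sqr_normc_1e1; have := cos_geN1 (2 * pi * t).
by move: (cos _) => c h; lra.
Qed.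

(** Take [h = |1 - e1 d|^2]. The cosine decreases on [0, pi], so a point at distance at least [d]
    from the nearest integer has [|1 - e1 t|^2 >= h]. *)
Lemma near_int (d : R) : 0 < d <= 2^-1 -> exists2 h : R, 0 < h &
  forall t, normc (1 - e1 t) ^+ 2 < h -> exists p : int, `|t - p%:~R| < d.
Proof.
move=> /andP[d0 d1]; have pi0 := @pi_gt0 R.
have cd1 : cos (2 * pi * d) < 1.
  rewrite -[ltRHS]cos0 ltr_cos ?in_itv /= ?lexx ?pi_ge0 //; first by do 2 apply: mulr_gt0 => //.
  apply/andP; split; first by apply: mulr_ge0; [apply: mulr_ge0 => //; exact: ltW|exact: ltW].
  rewrite mulrAC -[leRHS]mul1r; apply: ler_wpM2r; [exact: ltW|lra].
exists (2 - 2 * cos (2 * pi * d)); first by move: cd1; move: (cos _) => c; lra.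
move=> t; rewrite sqr_normc_1e1 => h; pose p := Num.floor (t + 2^-1).
exists p; rewrite ltNge; apply/negP => dp.
have /andP[p1 p2] : p%:~R <= t + 2^-1 < (p + 1)%:~R by rewrite floor_le_tmp floorD1_gt.
have e : `|t - p%:~R| <= 2^-1.
  by rewrite ler_norml; move: p2; rewrite intrD; lra.
have E : cos (2 * pi * t) = cos (2 * pi * `|t - p%:~R|).
  have E1 : cos (2 * pi * t) = Re (e1 (t - p%:~R)) by rewrite e1D e1N e1_int conjc1 mulr1.
  rewrite E1 /e1 /=; set dd := t - _.
  have [->|->] : `|dd| = dd \/ `|dd| = - dd.
    by have [?|?] := lerP 0 dd; [left; rewrite ger0_norm|right; rewrite ltr0_norm].
    by [].
  by rewrite mulrN cosN.
move: h; rewrite E ltNge; apply/negP; rewrite negbK.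
have pib (x : R) : 0 <= x <= 2^-1 -> 2 * pi * x \in `[0, pi].
  move=> /andP[x0 x1]; rewrite in_itv /=; apply/andP; split.
    by rewrite mulr_ge0 // mulr_ge0 // pi_ge0.
  have x2 : 2 * x <= 1 by lra.
  by have := ler_wpM2r (ltW pi0) x2; rewrite mul1r mulrAC.
have : cos (2 * pi * `|t - p%:~R|) <= cos (2 * pi * d).
  rewrite leNgt ltr_cos ?pib ?normr_ge0 ?(ltW d0) //.
  by rewrite -leNgt ler_wpM2l // mulr_ge0 // ltW.
by move: (cos _) (cos _) => a b ab; lra.
Qed.

Lemma e1_neq1 t : 0 < `|t| < 1 -> e1 t != 1.
Proof.
move=> /andP[t0 t1]; apply/negP => /eqP E.
pose d := Num.min `|t| (1 - `|t|); have d0 : 0 < d by rewrite lt_min t0 subr_gt0.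
have d1 : d <= 2^-1.
  by rewrite ge_min; have [] := leP `|t| 2^-1; rewrite //=; lra.
have [|h h0 /(_ t)] := @near_int d; first by rewrite d0.
rewrite E subrr Normc.normc0 expr0n => /(_ h0)[p].
rewrite lt_min => /andP[p1 p2].
have [p0|p0] := eqVneq p 0; first by rewrite p0 subr0 ltxx in p1.
have : 1 <= `|p%:~R : R| by rewrite -intr_norm -[1]/(1%:~R) ler_int; lia.
have := lerB_normD; have := ler_normB p%:~R t; rewrite distrC.
have : `|p%:~R : R| <= `|t - p%:~R| + `|t|.
  by rewrite distrC -[X in `|X| <= _](subrK t) ler_normD.
lra.
Qed.

Variable M : nat.
Local Notation M' := M.+1.
Local Notation M'R := (M'%:R : R).

(** The Fejer kernel, normalised so that its values on any translate of the grid of mesh 1/(M+1)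
    over one period sum to 1. Averaging against it is a finite sum over samples. *)
Definition fej (y : R) : R := normc ((M'R^-1)%:C%C * \sum_(l < M') e1 (l%:R * y)) ^+ 2.

Lemma fej_ge0 y : 0 <= fej y.
Proof. exact: sqr_ge0. Qed.

Definition fcoef : R[i] := ((M'R^-1) ^+ 2)%:C%C.

Lemma fejE y : (fej y)%:C%C = \sum_(a : 'I_M' * 'I_M') fcoef * e1 ((a.1%:R - a.2%:R) * y).
Proof.
rewrite -mulc_conj cjM cj_sum conjc_real mulrACA -rmorphM -expr2 -mulr_sumr; congr (_ * _).
rewrite big_distrl /=; under eq_bigr do rewrite big_distrr /=.
rewrite pair_big /=; apply: eq_bigr => a _.
by rewrite mulrBl e1D e1N.
Qed.

Lemma sum_roots (k : int) : (`|k| < M')%N ->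
  \sum_(j < M') e1 (k%:~R * (j%:R / M'R)) = if k == 0 then M'%:R else 0.
Proof.
move=> kM; case: eqP => [->|/eqP k0].
  by under eq_bigr do rewrite mul0r e1_0; rewrite sumr_const card_ord.
have E (j : 'I_M') : e1 (k%:~R * (j%:R / M'R)) = e1 (k%:~R / M'R) ^+ j.
  by rewrite -e1_natmul; congr e1; rewrite mulrCA.
under eq_bigr do rewrite E.
have n1 : 1 - e1 (k%:~R / M'R) != 0.
  rewrite subr_eq0 eq_sym e1_neq1 // normrM normfV [`|M'R|]ger0_norm //.
  rewrite divr_gt0 ?normr_gt0 ?intr_eq0 ?ltr0n //= ltr_pdivrMr ?ltr0n // mul1r.
  by rewrite -intr_norm -[M'R]/((M'%:Z)%:~R) ltr_int; lia.
apply: (mulfI n1); rewrite mulr0 -opprB mulNr -subrX1 -e1_natmul.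
by rewrite mulrCA divff ?pnatr_eq0 // mulr1 e1_int subrr oppr0.
Qed.

Lemma sum_fej y : \sum_(j < M') fej (y - j%:R / M'R) = 1.
Proof.
apply: complexI; rewrite rmorph_sum /=; under eq_bigr do rewrite fejE.
rewrite exchange_big /=.
have E (a : 'I_M' * 'I_M') : \sum_(j < M') fcoef * e1 ((a.1%:R - a.2%:R) * (y - j%:R / M'R)) =
    if a.1 == a.2 then fcoef * M'%:R else 0.
  rewrite -mulr_sumr; under eq_bigr do rewrite mulrBr -mulNr e1D.
  rewrite -mulr_sumr; have h : (- (a.1%:R - a.2%:R) : R) = (a.2%:Z - a.1%:Z)%:~R.
    by rewrite opprB intrB.
  under eq_bigr do rewrite h.
  rewrite sum_roots; last by have := ltn_ord a.1; have := ltn_ord a.2; lia.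
  rewrite subr_eq0 eqz_nat eq_sym -val_eqE; case: eqP => [->|]; last by rewrite !mulr0.
  by rewrite subrr mul0r e1_0 mul1r.
under eq_bigr do rewrite E.
rewrite -(pair_big xpredT xpredT (fun i j : 'I_M' => if i == j then fcoef * M'%:R else 0)) /=.
have E2 (i : 'I_M') : \sum_(j < M') (if i == j then fcoef * M'%:R else 0) = fcoef * M'%:R.
  by rewrite (bigD1 i) //= eqxx big1 ?addr0 // => j; rewrite eq_sym => /negbTE ->.
under eq_bigr do rewrite E2.
rewrite sumr_const card_ord -[LHS]mulr_natr /fcoef -mulrA -natrM -(rmorph_nat (real_complex R)) -rmorphM.
by rewrite expr2 natrM mulrACA mulVf ?mulr1 ?pnatr_eq0.
Qed.

(** Multiplying the geometric sum by [1 - e1 y] telescopes it to [1 - e1 ((M+1) y)], of modulus at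
    most 2. *)
Lemma fej_tail y : normc (1 - e1 y) ^+ 2 * fej y <= 4 / M'R ^+ 2.
Proof.
rewrite /fej -exprMn -Normc.normcM mulrCA.
under eq_bigr do rewrite e1_natmul.
rewrite -opprB mulNr -subrX1 -e1_natmul opprB Normc.normcM exprMn normc_real.
rewrite ger0_norm ?invr_ge0 ?ler0n // mulrC exprVn ler_wpM2r ?invr_ge0 ?sqr_ge0 //.
exact: normc_1e1_le2.
Qed.

Lemma sum_fej_tail y :
  \sum_(j < M') normc (1 - e1 (y - j%:R / M'R)) ^+ 2 * fej (y - j%:R / M'R) <= 4 / M'R.
Proof.
apply: le_trans (ler_sum _ (fun j _ => fej_tail _)) _.
rewrite sumr_const card_ord -[X in X <= _]mulr_natr.
have : M'R != 0 by rewrite pnatr_eq0.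
by move: M'R => m m0; rewrite (_ : 4 / m ^+ 2 * m = 4 / m) //; field.
Qed.

Variable n : nat.
Implicit Types (s : 'cV[R]_n -> R[i]).

Definition grid (j : {ffun 'I_n -> 'I_M'}) : 'cV[R]_n := \col_i ((j i)%:R / M'R).

Definition fejk (xi : 'cV[R]_n) (j : {ffun 'I_n -> 'I_M'}) : R :=
  \prod_i fej (xi i 0 - (j i)%:R / M'R).

(** A discrete Fejer mean: the weights are non-negative with sum 1, so this is a weighted average of
    samples of [s], centred at [xi]. *)
Definition fejer s (xi : 'cV[R]_n) : R[i] := \sum_j s (grid j) * (fejk xi j)%:C%C.

Lemma fejk_ge0 xi j : 0 <= fejk xi j.
Proof. by apply: prodr_ge0 => i _; exact: fej_ge0. Qed.

Lemma sum_fejk xi : \sum_j fejk xi j = 1.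
Proof.
rewrite /fejk -(bigA_distr_bigA (fun i (j : 'I_M') => fej (xi i 0 - j%:R / M'R))).
by rewrite big1 // => i _; rewrite sum_fej.
Qed.

Lemma sum_fejk_tail (xi : 'cV[R]_n) i :
  \sum_(j : {ffun 'I_n -> 'I_M'}) normc (1 - e1 (xi i 0 - (j i)%:R / M'R)) ^+ 2 * fejk xi j <= 4 / M'R.
Proof.
pose F i' (a : 'I_M') := (if i' == i then normc (1 - e1 (xi i' 0 - a%:R / M'R)) ^+ 2 else 1) *
  fej (xi i' 0 - a%:R / M'R).
rewrite (_ : \sum_j _ = \sum_(j : {ffun 'I_n -> 'I_M'}) \prod_i' F i' (j i')).
  rewrite -(bigA_distr_bigA F) (bigD1 i) //= [X in _ * X]big1 ?mulr1; last first.
    move=> i' /negbTE i'i; rewrite -[RHS](sum_fej (xi i' 0)).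
    by apply: eq_bigr => a _; rewrite /F i'i mul1r.
  have E a : F i a = normc (1 - e1 (xi i 0 - a%:R / M'R)) ^+ 2 * fej (xi i 0 - a%:R / M'R).
    by rewrite /F eqxx.
  rewrite (eq_bigr _ (fun a _ => E a)).
  exact: sum_fej_tail.
apply: eq_bigr => j _; rewrite /F big_split /=; congr (_ * _).
by rewrite (bigD1 i) //= eqxx big1 ?mulr1 // => i' /negbTE ->.
Qed.

(** The error is an average of [s (grid j) - s xi]. The hypothesis bounds each difference by [e]
    plus [K] times tail factors, and the average of each tail factor is at most 4/(M+1) by
    [sum_fejk_tail]. *)
Lemma fejer_error s xi (e K : R) : 0 <= K ->
  (forall y, normc (s y - s xi) <= e + K * \sum_i normc (1 - e1 (xi i 0 - y i 0)) ^+ 2) ->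
  normc (fejer s xi - s xi) <= e + K * (n%:R * (4 / M'R)).
Proof.
move=> K0 h; have -> : fejer s xi - s xi = \sum_j (s (grid j) - s xi) * (fejk xi j)%:C%C.
  under [RHS]eq_bigr do rewrite mulrBl.
  by rewrite sumrB -mulr_sumr -rmorph_sum sum_fejk mulr1.
apply: le_trans (normc_sum _ _ _) _.
have E j : normc ((s (grid j) - s xi) * (fejk xi j)%:C%C) <=
   e * fejk xi j + K * \sum_i normc (1 - e1 (xi i 0 - (j i)%:R / M'R)) ^+ 2 * fejk xi j.
  rewrite Normc.normcM normc_real ger0_norm ?fejk_ge0 // -mulr_suml mulrA -mulrDl.
  apply: ler_wpM2r; first exact: fejk_ge0.
  apply: le_trans (h (grid j)) _; rewrite le_eqVlt; apply/orP; left; apply/eqP.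
  by congr (_ + _ * _); apply: eq_bigr => i _; rewrite mxE.
apply: le_trans (ler_sum _ (fun j _ => E j)) _.
rewrite big_split /= -mulr_sumr sum_fejk mulr1 lerD2l -mulr_sumr ler_wpM2l //.
rewrite exchange_big /=; apply: le_trans (ler_sum _ (fun i _ => sum_fejk_tail xi i)) _.
by rewrite sumr_const card_ord [X in _ <= X]mulr_natl.
Qed.

Lemma fejer_le s xi (C : R) : (forall y, normc (s y) <= C) -> normc (fejer s xi) <= C.
Proof.
move=> h; apply: le_trans (normc_sum _ _ _) _.
rewrite -[leRHS]mulr1 -(sum_fejk xi) mulr_sumr; apply: ler_sum => j _.
by rewrite Normc.normcM normc_real ger0_norm ?fejk_ge0 // ler_wpM2r ?fejk_ge0.
Qed.

(** By [fejE] each factor of the kernel is a sum of characters with integer frequencies; the grid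
    points only contribute constant phases. *)
Lemma fejer_trig s : lin_span int_lattice (@ew R n) (fejer s).
Proof.
apply: lin_span_sum => j _; apply: lin_spanZ.
rewrite (_ : (fun x => _) = fun xi : 'cV[R]_n => \sum_(a : {ffun 'I_n -> 'I_M' * 'I_M'})
    \prod_i (fcoef * e1 (((a i).1%:R - (a i).2%:R) * (xi i 0 - (j i)%:R / M'R)))); last first.
  apply/funext => xi; rewrite -(bigA_distr_bigA (fun (i : 'I_n) (a : 'I_M' * 'I_M') => fcoef * e1 ((a.1%:R - a.2%:R) * (xi i 0 - (j i)%:R / M'R)))).
  by rewrite rmorph_prod; apply: eq_bigr => i _; exact: fejE.
apply: lin_span_sum => a _.
pose k : 'cV[int]_n := \col_i ((a i).1%:Z - (a i).2%:Z).
rewrite (_ : (fun x => _) = fun xi : 'cV[R]_n => (\prod_i (fcoef * e1 (- (((a i).1%:R - (a i).2%:R) * ((j i)%:R / M'R)))))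
   * ew (map_mx intr k) xi).
  by apply/lin_spanZ/lin_span_gen; exists k.
apply/funext => xi; rewrite /ew /dot.
have -> : expi (2 * pi * \sum_i (map_mx intr k : 'cV[R]_n) i 0 * xi i 0) =
    \prod_i e1 (((a i).1%:R - (a i).2%:R) * xi i 0).
  rewrite mulr_sumr; elim/big_rec2 : _ => [|i y x _ ih]; first by rewrite expi0.
  by rewrite expiD ih; congr (_ * _); rewrite /e1 !mxE intrB.
rewrite -big_split /=; apply: eq_bigr => i _.
by rewrite mulrBr e1D; ring.
Qed.

End fejer.

(** * Convergence of Fejer means; multiplication by periodic functions *)

Section fejer_limit.
Context (R : realType) (n : nat).
Local Notation normc := (@Normc.normc R).
Implicit Types (s u : 'cV[R]_n -> R[i]).

Definition periodic1 s := forall (k : 'cV[int]_n) x, s (x + map_mx intr k) = s x.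

Lemma periodic1_bounded s : periodic1 s -> ccontinuous s ->
  exists2 C : R, 0 < C & forall x, normc (s x) <= C.
Proof.
move=> ps [c1 c2].
have [C1 C10 h1] := continuous_bounded_ball 1 c1.
have [C2 C20 h2] := continuous_bounded_ball 1 c2.
exists (C1 + C2); first exact: addr_gt0.
move=> x; pose k : 'cV[int]_n := \col_i - Num.floor (x i 0).
rewrite -(ps k); apply: le_trans (normc_le _) _; apply: lerD; [apply: h1|apply: h2];
  apply: norm_cV_le => // i; rewrite !mxE mulrNz.
  have := floor_le_tmp (x i 0); have := floorD1_gt (x i 0).
  by rewrite ler_norml intrD; lra.
have := floor_le_tmp (x i 0); have := floorD1_gt (x i 0).
by rewrite ler_norml intrD; lra.
Qed.

Lemma coord_ge (d : R) (x : 'cV[R]_n) : 0 < d -> d <= `|x| -> exists i, d <= `|x i 0|.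
Proof.
move=> d0 dx; apply: contrapT => /forallNP h.
have [i0|n0] := pselect (exists i : 'I_n, True).
  pose m := \big[Num.max/0]_i `|x i 0|.
  have md : m < d.
    by rewrite /m; elim/big_rec : _ => // i y _ yd; rewrite gt_max yd andbT ltNge; exact/negP/h.
  have : `|x| <= m.
    apply: norm_cV_le => [|i]; last exact: (le_bigmax_cond _ (fun i => `|x i 0|) (j := i)).
    by rewrite /m; elim/big_rec : _ => // i y _ yd; rewrite le_max yd orbT.
  by rewrite leNgt => /negP; apply; exact: lt_le_trans dx.
have : `|x| <= 0 by apply: norm_cV_le => // i; case: n0; exists i.
by rewrite leNgt => /negP; apply; exact: lt_le_trans dx.
Qed.

Lemma fejer_cvg s : periodic1 s -> ccontinuous s -> forall xi,
  (fun M => normc (fejer M s xi - s xi)) @ \oo --> 0.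
Proof.
move=> ps cs xi; have [C C0 hC] := periodic1_bounded ps cs.
apply/cvgrPdist_le => e e0.
have e4 : 0 < e / 4 by rewrite divr_gt0.
case: cs => /(_ xi)/normed_cvgP /(_ _ e4)[d1 d10 h1] /(_ xi)/normed_cvgP /(_ _ e4)[d2 d20 h2].
pose d := Num.min 2^-1 (Num.min d1 d2).
have [|h h0 hh] := @near_int R d.
  by rewrite /d !lt_min d10 d20 invr_gt0 ltr0n /= ge_min lexx.
(* If [y] is not close to [xi] modulo integers, some summand is at least [h], and [K * h = 2 * C]
   bounds the difference of values trivially. *)
pose K := 2 * C / h; have K0 : 0 < K by rewrite divr_gt0 ?mulr_gt0.
have main y : normc (s y - s xi) <= e / 2 + K * \sum_i normc (1 - e1 (xi i 0 - y i 0)) ^+ 2.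
  have S0 : 0 <= K * \sum_i normc (1 - e1 (xi i 0 - y i 0)) ^+ 2.
    by rewrite mulr_ge0 ?(ltW K0) // sumr_ge0 // => i _; rewrite sqr_ge0.
  have [/forallP near|/forallPn[i /=]] := boolP [forall i, normc (1 - e1 (xi i 0 - y i 0)) ^+ 2 < h].
    have /choice[p hp] i : exists p : int, `|xi i 0 - y i 0 - p%:~R| < d by exact: hh.
    pose k : 'cV[int]_n := \col_i p i; rewrite -(ps k y).
    have xy : `|xi - (y + map_mx intr k)| < d.
      rewrite ltNge; apply/negP => dxy.
      have dd0 : 0 < d by rewrite /d !lt_min d10 d20 invr_gt0 ltr0n.
      have [j] := coord_ge dd0 dxy.
      by rewrite !mxE opprD addrA leNgt hp.
    apply: le_trans (normc_le _) _; rewrite -[leLHS]addr0; apply: lerD => //.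
    have /andP[xy1 xy2] : (`|xi - (y + map_mx intr k)| < d1) && (`|xi - (y + map_mx intr k)| < d2).
      by move: xy; rewrite /d !lt_min => /andP[_].
    have := h1 _ xy1; have := h2 _ xy2; rewrite /= !cReD !cImD !cReN !cImN.
    rewrite [X in X <= _ -> _]distrC [X in _ -> X <= _ -> _]distrC; lra.
  rewrite -leNgt => hi; apply: (@le_trans _ _ (2 * C)).
    apply: le_trans (le_normcD _ _) _; rewrite normcN.
    by have := hC y; have := hC xi; lra.
  apply: (@le_trans _ _ (K * \sum_i normc (1 - e1 (xi i 0 - y i 0)) ^+ 2)); last first.
    by rewrite lerDr divr_ge0 // ltW.
  rewrite {1}(_ : 2 * C = K * h); last by rewrite /K divfK // gt_eqF.
  apply: ler_wpM2l; first exact: ltW.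
  apply: le_trans hi _; rewrite (bigD1 i) //= lerDl sumr_ge0 // => j _; exact: sqr_ge0.
near=> M.
rewrite sub0r normrN ger0_norm ?normc_ge0 //.
apply: le_trans (fejer_error M (ltW K0) main) _.
have : K * (n%:R * (4 / M.+1%:R)) <= e / 2.
  rewrite !mulrA ler_pdivrMr ?ltr0n // -ler_pdivrMl ?divr_gt0 //.
  by rewrite (@le_trans _ _ M%:R) ?ler_nat //; near: M; exact: nbhs_infty_ger.
move: (K * _) => z; lra.
Unshelve. all: by end_near. Qed.

(** Fejer means converge to [s] pointwise and stay below its supremum bound [C]; the majorant
    [C^2 |u|^2] owes its integrability to [u]. *)
Lemma periodic_mul_closure s u : periodic1 s -> ccontinuous s -> L2 u ->
  L2_closure (lin_span int_lattice (fun k xi => ew k xi * u xi)) (fun xi => s xi * u xi).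
Proof.
move=> ps cs Lu; have [C C0 hC] := periodic1_bounded ps cs.
have eL2 : forall k, int_lattice k -> L2 (fun xi : 'cV[R]_n => ew k xi * u xi).
  move=> k _; apply: (L2_le _ (L2_integrable Lu)).
    by apply: cmeasM; [exact: cmeas_ew|exact: L2_cmeas].
  by move=> x; rewrite Normc.normcM normc_ew mul1r.
apply: (@L2_closure_dct R n _ (fun M xi => fejer M s xi * u xi) _ (fun x => C ^+ 2 * normc (u x) ^+ 2)).
- exact: lin_span_L2.
- move=> M; apply: sub_L2_closure; first exact: lin_span_L2.
  have [m [k [c [hk E]]]] := fejer_trig M s; exists m, k, c; split=> //.
  apply/funext => xi; rewrite (congr1 (@^~ xi) E) mulr_suml.
  by apply: eq_bigr => i _; rewrite mulrA.
- by apply: cmeasM; [exact: ccontinuous_cmeas|exact: L2_cmeas].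
- move=> x; rewrite (_ : (fun M => _) = fun M => normc (fejer M s x - s x) * normc (u x)); last first.
    by apply/funext => M; rewrite -mulrBl Normc.normcM.
  have h := cvgM (fejer_cvg ps cs x) (@cvg_cst _ (normc (u x)) _ \oo _).
  by rewrite mul0r in h; exact: h.
- have := integrableZl measurableT (C ^+ 2) (L2_integrable Lu).
  by apply: eq_integrable => // x _ /=; rewrite EFinM.
- move=> M x; rewrite Normc.normcM exprMn ler_wpM2r ?sqr_ge0 //.
  by rewrite lerXn2r ?nnegrE ?normc_ge0 ?(ltW C0) // fejer_le.
Qed.

End fejer_limit.

(** * Periodization *)

Section periodization.
Context (R : realType) (n : nat).
Local Notation Re := (@complex.Re R).
Local Notation Im := (@complex.Im R).
Local Notation normc := (@Normc.normc R).
Local Notation lam := (@lebesgue_cV R n).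
Implicit Types (h s : 'cV[R]_n -> R[i]) (P : 'M[R]_n).

Definition latpt P (k : 'cV[int]_n) : 'cV[R]_n := P *m map_mx intr k.

Lemma latptD P k l : latpt P (k + l) = latpt P k + latpt P l.
Proof. by rewrite /latpt map_mxD mulmxDr. Qed.

Lemma latptN P k : latpt P (- k) = - latpt P k.
Proof. by rewrite /latpt map_mxN mulmxN. Qed.

Definition per P h x : R[i] := \sum_(k \in [set: 'cV[int]_n]) h (x + latpt P k).

(** Enumerates the integer points with all coordinates in [-K, K] by a finite type. *)
Definition cbox K (f : {ffun 'I_n -> 'I_(K.*2.+1)}) : 'cV[int]_n := \col_i ((f i)%:Z - K%:Z).

Lemma cbox_inj K : injective (@cbox K).
Proof.
move=> f g /matrixP fg; apply/ffunP => i; apply/val_inj/eqP; have := fg i 0.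
by rewrite !mxE => /addIr/eqP.
Qed.

Lemma cbox_surj K (k : 'cV[int]_n) : (forall i, `|k i 0| <= K%:Z) -> exists f : {ffun 'I_n -> 'I_(K.*2.+1)}, k = @cbox K f.
Proof.
move=> kK; exists [ffun i => inord (absz (k i 0 + K%:Z))].
apply/matrixP => i j; rewrite ord1 !mxE ffunE; have := kK i => h.
rewrite inordK; lia.
Qed.

Lemma fsbig_cbox (F : 'cV[int]_n -> R[i]) K :
  (forall k, F k != 0 -> forall i, `|k i 0| <= K%:Z) ->
  \sum_(k \in [set: 'cV[int]_n]) F k = \sum_(f : {ffun 'I_n -> 'I_(K.*2.+1)}) F (@cbox K f).
Proof.
move=> FK; rewrite -(fsbig_widen [set` [seq @cbox K f | f <- enum {ffun 'I_n -> 'I_(K.*2.+1)}]]) //.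
  by rewrite -fsbig_seq ?big_map ?big_enum // map_inj_uniq ?enum_uniq //; exact: cbox_inj.
move=> k [_ /= hk]; apply/eqP; apply: contraT => /FK /cbox_surj[f kE]; case: hk.
by rewrite kE map_f // mem_enum.
Qed.

Lemma lat_bound P (M N : R) : P \in unitmx -> exists K0 : nat, forall x k,
  `|x| <= N -> `|x + latpt P k| <= M -> forall i, `|k i 0| <= K0%:Z.
Proof.
move=> uP; have [C C0 hC] := norm_mulmx_le (invmx P).
pose B := C * (Num.max 0 (M + N)); exists (Num.bound B) => x k xN xM i.
have B0 : 0 <= B by rewrite mulr_ge0 ?(ltW C0) // le_max lexx.
have h : `|(k i 0)%:~R : R| <= B.
  have -> : (k i 0)%:~R = (invmx P *m latpt P k) i 0 by rewrite mulKmx // mxE.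
  apply: le_trans (coord_le_norm _ _) _; apply: le_trans (hC _) _.
  apply: ler_wpM2l; first exact: ltW.
  rewrite le_max; apply/orP; right; rewrite -[latpt P k](addrK x).
  by apply: le_trans (ler_normB _ _) _; apply: lerD => //; rewrite addrC.
have : `|(k i 0)%:~R : R| < (Num.bound B)%:R by apply: le_lt_trans h _; exact: archi_boundP.
by rewrite -intr_norm -[X in _ < X]/((Num.bound B)%:Z%:~R) ltr_int => /ltW.
Qed.

Lemma per_box P h (N : R) : P \in unitmx -> bsupp h -> exists K0 : nat,
  forall K x, (K0 <= K)%N -> `|x| <= N -> per P h x = \sum_(f : {ffun 'I_n -> 'I_(K.*2.+1)}) h (x + latpt P (@cbox K f)).
Proof.
move=> uP [M hM]; have [K0 hK] := lat_bound M N uP; exists K0 => K x K0K xN.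
apply: fsbig_cbox => k h0 i; apply: (@le_trans _ _ K0%:Z); last by rewrite lez_nat.
apply: (hK x) => //; rewrite leNgt; apply/negP => /hM /eqP; exact/negP.
Qed.

Definition periodic P s := forall k x, s (x + latpt P k) = s x.

Lemma per_periodic P h : periodic P (per P h).
Proof.
move=> l x; rewrite /per (reindex_fsbigT (fun k => k - l)).
  apply: eq_fsbigr => k _; rewrite latptD latptN; congr h.
  by rewrite -addrA [latpt P l + _]addrC subrK.
by exists (fun k => k + l) => k; rewrite ?subrK ?addrK.
Qed.

Lemma csmooth_per P h : P \in unitmx -> test h -> csmooth (per P h).
Proof.
move=> uP [sh bh]; apply: csmooth_local => x.
have [K hK] := per_box (`|x| + 1) uP bh.
exists (fun y => \sum_(f : {ffun 'I_n -> 'I_(K.*2.+1)}) h (y + latpt P (@cbox K f))).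
  by apply: csmooth_sum => f; exact: csmooth_addv.
apply/nbhs_normP; exists 1 => //= y; rewrite /ball_ /= => xy; apply: hK => //.
rewrite -[y](subrK x) addrC; apply: le_trans (ler_normD _ _) _.
by rewrite lerD2l distrC ltW.
Qed.

Lemma per_mull P s h x : P \in unitmx -> periodic P s -> bsupp h ->
  per P (fun y => s y * h y) x = s x * per P h x.
Proof.
move=> uP ps bh; have [K hK] := per_box `|x| uP bh.
have [K' hK'] := per_box `|x| uP (bsuppMr s bh).
rewrite (hK (maxn K K')) ?leq_maxl // (hK' (maxn K K')) ?leq_maxr // mulr_sumr.
by apply: eq_bigr => f _; rewrite ps.
Qed.

Lemma perZ P (c : R[i]) h x : P \in unitmx -> bsupp h ->
  per P (fun y => c * h y) x = c * per P h x.
Proof. by move=> uP bh; apply: (@per_mull P (fun=> c)). Qed.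

Lemma perD P (f g : 'cV[R]_n -> R[i]) x : P \in unitmx -> bsupp f -> bsupp g ->
  per P (fun y => f y + g y) x = per P f x + per P g x.
Proof.
move=> uP bf bg; have [K1 h1] := per_box `|x| uP bf; have [K2 h2] := per_box `|x| uP bg.
have [K3 h3] := per_box `|x| uP (bsuppD bf bg).
pose K := maxn K1 (maxn K2 K3).
rewrite (h1 K) ?(h2 K) ?(h3 K) ?leq_max ?leqnn ?orbT // -big_split.
by [].
Qed.

Lemma per0 P x : P \in unitmx -> per P (fun=> 0) x = 0.
Proof. by move=> uP; rewrite /per fsbig1. Qed.

Lemma per_sum P I (r : seq I) (F : I -> 'cV[R]_n -> R[i]) x : P \in unitmx ->
  (forall i, bsupp (F i)) -> per P (fun y => \sum_(i <- r) F i y) x = \sum_(i <- r) per P (F i) x.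
Proof.
move=> uP bF; elim: r => [|i r ih].
  by under eq_fun do rewrite big_nil; rewrite big_nil per0.
under eq_fun do rewrite big_cons; rewrite big_cons -ih perD //; exact: bsupp_sum.
Qed.

Lemma bsupp_conj h : bsupp h -> bsupp (fun x => conjc (h x)).
Proof. by move=> [M hM]; exists M => x /hM ->; rewrite conjc0. Qed.

Lemma per_conj P h x : P \in unitmx -> bsupp h ->
  per P (fun y => conjc (h y)) x = conjc (per P h x).
Proof.
move=> uP bh; have [K1 h1] := per_box `|x| uP bh; have [K2 h2] := per_box `|x| uP (bsupp_conj bh).
by rewrite (h1 (maxn K1 K2)) ?(h2 (maxn K1 K2)) ?leq_maxl ?leq_maxr // cj_sum.
Qed.

(** Translation invariance moves each lattice shift from [g] to [f], and [k] is replaced by [- k].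
    As both supports are bounded, one finite cube of indices serves for all points. *)
Lemma cint_unfold P (f g : 'cV[R]_n -> R[i]) : P \in unitmx -> ccontinuous f -> bsupp f -> ccontinuous g -> bsupp g ->
  cint lam (fun x => f x * per P g x) = cint lam (fun x => per P f x * g x).
Proof.
move=> uP cf [M fM] cg bg; have [K hK] := per_box M uP bg; case: (bg) => N gN.
have [K' hK'] := lat_bound N M uP.
pose L := maxn K K'.
have [C1 C10 hC1] := ccontinuous_bounded cf (ex_intro _ M fM).
have [C2 C20 hC2] := ccontinuous_bounded cg (ex_intro _ N gN).
have ia a : cintegrable lam (fun x => f x * g (x + a)).
  apply: (@cintegrable_bounded _ _ _ (C1 * C2) M).
  - apply: cmeasM; first exact: ccontinuous_cmeas.
    by apply: cmeas_comp (ccontinuous_cmeas cg) _; exact: measurable_addv.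
  - by move=> x; rewrite Normc.normcM ler_pM ?normc_ge0.
  - by move=> x /fM ->; rewrite mul0r.
transitivity (\sum_(k : {ffun 'I_n -> 'I_(L.*2.+1)}) cint lam (fun x => f x * g (x + latpt P (@cbox L k)))).
  rewrite -cint_sum //; congr cint; apply/funext => x.
  have [xM|/fM ->] := leP `|x| M; last by rewrite mul0r big1 // => k _; rewrite mul0r.
  by rewrite (hK L) ?leq_maxl // mulr_sumr.
transitivity (\sum_(k : {ffun 'I_n -> 'I_(L.*2.+1)}) cint lam (fun x => f (x - latpt P (@cbox L k)) * g x)).
  apply: eq_bigr => k _; have [_ <-] := cint_addv (- latpt P (cbox k)) (ia (latpt P (cbox k))).
  by congr cint; apply/funext => x; rewrite subrK.
have ib a : cintegrable lam (fun x => f (x - a) * g x).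
  have [i1 _] := cint_addv (- a) (ia a); move: i1; congr cintegrable.
  by apply/funext => x; rewrite subrK.
rewrite -cint_sum //; congr cint; apply/funext => x.
rewrite -(@fsbig_cbox (fun k => f (x - latpt P k) * g x)).
  rewrite /per (reindex_fsbigT (fun k => - k)); last by exists (fun k => - k) => k; rewrite opprK.
  by rewrite mulr_fsuml; apply: eq_fsbigr => k _; rewrite latptN opprK.
move=> k; rewrite mulf_eq0 negb_or => /andP[f0 g0] i.
apply: (@le_trans _ _ K'%:Z); last by rewrite lez_nat leq_maxr.
apply: (hK' (x - latpt P k)).
  by rewrite leNgt; apply/negP => /fM /eqP; exact/negP.
by rewrite subrK leNgt; apply/negP => /gN /eqP; exact/negP.
Qed.

Lemma test_conjM h f : test h -> test f -> test (fun x => h x * conjc (f x)).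
Proof. by move=> th [sf _]; apply: testMr => //; exact: csmooth_conj. Qed.

(** A positive value at [x] persists at half its size on a cube around [x], and the cube has measure
    [(2 d)^n > 0]. *)
Lemma continuous_int0 (v : 'cV[R]_n -> R) : continuous v -> (forall x, 0 <= v x) ->
  lam.-integrable setT (EFin \o v) -> \int[lam]_x v x = 0 -> forall x, v x = 0.
Proof.
move=> cv v0 iv I0 x; apply/eqP; rewrite eq_le v0 andbT leNgt; apply/negP => vx.
have v2 : 0 < v x / 2 by rewrite divr_gt0.
have [d d0 hd] := (normed_cvgP v x).1 (cv x) _ v2.
pose k i t : R := \1_(`]x i 0 - d, x i 0 + d[) t.
have mk i : measurable_fun setT (k i) by apply: measurable_indic; exact: measurable_itv.
have k0 i t : 0 <= k i t by rewrite /k indicE ler0n.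
have kE i : (\int[@lebesgue_measure R]_t (k i t)%:E = (2 * d)%:E)%E.
  rewrite /k integral_indic // setIT.
  rewrite [LHS](lebesgue_measure_itv `]x i 0 - d, x i 0 + d[) /= lte_fin ifT; last by lra.
  by rewrite -EFinB; congr (_%:E); ring.
have E := ge0_integral_prod mk k0 kE.
have : ((v x / 2)%:E * (\int[lam]_y (\prod_i k i (y i 0%R))%:E) <= 0%:E)%E.
  rewrite -I0 /Rintegral fineK; last exact: (integrable_fin_num measurableT iv).
  rewrite -ge0_integralZl //; last 3 first.
  - apply/measurable_EFinP; apply: measurable_prod => i _.
    exact: measurableT_comp (mk i) (measurable_coord i).
  - by move=> y _; rewrite lee_fin prodr_ge0.
  - by rewrite lee_fin ltW.
  apply: ge0_le_integral => //.
  - by move=> y _; rewrite -EFinM lee_fin mulr_ge0 ?prodr_ge0 // ltW.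
  - apply/measurable_EFinP; apply: measurable_funM; first exact: measurable_cst.
    apply: measurable_prod => i _; exact: measurableT_comp (mk i) (measurable_coord i).
  - exact: measurable_int iv.
  move=> y _; rewrite -EFinM lee_fin.
  have [xy|/forallPn/=[i hi]] := boolP [forall i, `|x i 0 - y i 0| < d]; last first.
    rewrite (bigD1 i) //= {1}/k indicE memNset ?mul0r ?mulr0 //= in_itv /=.
    by move: hi; rewrite ltr_norml => /negP h /andP[h1 h2]; apply: h; lra.
  rewrite big1 ?mulr1; last first.
    move=> i _; rewrite /k indicE mem_set //= in_itv /=.
    by have := forallP xy i; rewrite ltr_norml => /andP[h1 h2]; apply/andP; split; lra.
  have /hd : `|x - y| < d.
    rewrite ltNge; apply/negP => /(coord_ge d0)[j]; rewrite !mxE leNgt.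
    by rewrite (forallP xy).
  rewrite ler_norml; lra.
rewrite E -EFinM lee_fin leNgt mulr_gt0 // prodr_gt0 // => i _; exact: mulr_gt0.
Qed.

Lemma test_nsq0 h : test h -> nsq h = 0 -> forall x, h x = 0.
Proof.
move=> th h0 x; have Lh : L2 h by exact/invertible_L2/invertible_test.
apply: Normc.eq0_normc; apply/eqP; rewrite -sqrf_eq0; apply/eqP.
apply: (@continuous_int0 (fun x => normc (h x) ^+ 2)) => //.
- have [c1 c2] : ccontinuous (fun x => h x * conjc (h x)).
    by apply: csmooth_ccontinuous; have [] := test_conjM th th.
  move=> y; have := c1 y; rewrite (_ : _ \o _ = fun x => normc (h x) ^+ 2) //.
  by apply/funext => z /=; rewrite mulc_conj.
- by move=> y; exact: sqr_ge0.
- exact: L2_integrable.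
Qed.

(** * Integration over a torus by means of a smooth partition of unity *)

Section partition_of_unity.
Variable chi : 'cV[R]_n -> R[i].
Hypotheses (chi_test : test chi) (per_chi : forall x, per 1%:M chi x = 1)
  (chi_ge0 : forall x, exists2 t : R, 0 <= t & chi x = t%:C%C) (chi_int : cint lam chi = 1).

Let u1 : (1%:M : 'M[R]_n) \in unitmx := unitmx1 R n.

Lemma latpt1 k : latpt 1%:M k = map_mx intr k.
Proof. by rewrite /latpt mul1mx. Qed.

Lemma ew_int (l k : 'cV[int]_n) : ew (map_mx intr l : 'cV[R]_n) (map_mx intr k) = 1.
Proof.
rewrite /ew /dot.
have -> : \sum_i (map_mx intr l : 'cV[R]_n) i 0 * (map_mx intr k : 'cV[R]_n) i 0 =
    (\sum_i l i 0 * k i 0)%:~R.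
  by rewrite rmorph_sum; apply: eq_bigr => i _; rewrite !mxE rmorphM.
exact: expi_int.
Qed.

(** Points of the lattice P^-T Z^n dual to P Z^n: their characters are P Z^n-periodic. *)
Definition dual P (l : 'cV[int]_n) : 'cV[R]_n := latpt (invmx P)^T l.

Lemma periodic_ew P l : P \in unitmx -> periodic P (ew (dual P l)).
Proof.
move=> uP k x; rewrite ewDr -[RHS]mulr1; congr (_ * _).
rewrite -(ew_int l k) /ew; congr expi; congr (_ * _).
by rewrite /dual /latpt dot_mulmx mulmxA -trmx_mul mulVmx // trmx1 mul1mx.
Qed.

Lemma periodic_conj P s : periodic P s -> periodic P (fun x => conjc (s x)).
Proof. by move=> ps k x; rewrite ps. Qed.

(* Integration of a periodic function against [chi] is integration over a fundamental domain. *)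
Lemma cint_per1 h s : test h -> periodic 1%:M s -> csmooth s ->
  cint lam (fun x => h x * s x) = cint lam (fun x => per 1%:M h x * s x * chi x).
Proof.
move=> th ps ss; have tf : test (fun x => s x * h x) by exact: testMl.
have := cint_unfold u1 (csmooth_ccontinuous tf.1) tf.2 (csmooth_ccontinuous chi_test.1) chi_test.2.
rewrite (_ : (fun x => _ * per _ chi x) = fun x => h x * s x); last first.
  by apply/funext => x; rewrite per_chi mulr1 mulrC.
move=> ->; congr cint; apply/funext => x; rewrite per_mull //; last by case: th.
by rewrite [s x * _]mulrC.
Qed.

(** Orthogonality of characters on the torus: for [l != 0] a shift of the variable changes the sign
    of the character but not the integral over a period. *)
Lemma cint_ew_chi (l : 'cV[int]_n) :
  cint lam (fun x => ew (map_mx intr l) x * chi x) = (l == 0)%:R.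
Proof.
have pe : periodic 1%:M (ew (map_mx intr l : 'cV[R]_n)).
  by move=> k x; rewrite latpt1 ewDr ew_int mulr1.
case: eqP => [->|/eqP l0].
  rewrite -chi_int; congr cint; apply/funext => x.
  by rewrite (_ : map_mx _ _ = 0) ?ew0 ?mul1r //; apply/matrixP => i j; rewrite !mxE.
have [j lj] : exists j, l j 0 != 0.
  apply: contrapT => /forallNP h; case/eqP: l0; apply/matrixP => i k; rewrite ord1 mxE.
  by apply/eqP; apply: contraPT (h i) => ?; exact.
have ljR : (l j 0)%:~R != 0 :> R by rewrite intr_eq0.
(* Half a wavelength along an axis on which [l] does not vanish, so the character takes the value -1
   at [v]. *)
pose v : 'cV[R]_n := \col_i (if i == j then (2 * (l j 0)%:~R)^-1 else 0).
have ev : ew (map_mx intr l) v = -1 :> R[i].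
  rewrite /ew (_ : dot _ _ = 2^-1); last first.
    rewrite /dot (bigD1 j) //= !mxE eqxx big1 ?addr0.
      by rewrite invfM mulrCA divff ?mulr1.
    by move=> i /negbTE ij; rewrite !mxE ij mulr0.
  rewrite [2 * pi * _]mulrAC divff ?pnatr_eq0 // mul1r /expi cospi sinpi.
  by apply: ReIm_eq; rewrite /= ?oppr0.
pose I := cint lam (fun x => ew (map_mx intr l) x * chi x).
have ie : cintegrable lam (fun x => ew (map_mx intr l) x * chi x).
  by apply: test_cintegrable; apply: testMl => //; exact: csmooth_ew.
have tv : test (fun x => chi (x + v)) by exact: test_addv.
have pv x : per 1%:M (fun x => chi (x + v)) x = 1.
  rewrite -(per_chi (x + v)) /per; apply: eq_fsbigr => k _; congr chi.
  by rewrite -!addrA [v + _]addrC.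
have I1 : I = - I.
  rewrite {1}/I; have [_ <-] := cint_addv v ie.
  transitivity (- cint lam (fun x => chi (x + v) * ew (map_mx intr l) x)).
    transitivity (cint lam (fun x => - (chi (x + v) * ew (map_mx intr l) x))); last first.
      by rewrite cintN //; apply: test_cintegrable; apply: testMr tv (csmooth_ew _).
    congr cint; apply/funext => x.
    by rewrite ewDr ev mulrN1 mulNr mulrC.
  rewrite cint_per1 //; last exact: csmooth_ew.
  by congr (- cint lam _); apply/funext => x; rewrite pv mul1r.
have : I *+ 2 = 0 by rewrite mulr2n {1}I1 addNr.
by move/eqP; rewrite mulrn_eq0 /= => /eqP.
Qed.

Definition chiP P x := chi (invmx P *m x).

Lemma chiP_test P : P \in unitmx -> test (chiP P).
Proof. by move=> uP; apply: test_mulmx => //; rewrite unitmx_inv. Qed.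

Lemma per_chiP P x : P \in unitmx -> per P (chiP P) x = 1.
Proof.
move=> uP; rewrite -(per_chi (invmx P *m x)) /per; apply: eq_fsbigr => k _.
by rewrite /chiP mulmxDr /latpt mulKmx // mul1mx.
Qed.

Lemma cint_per P h s : P \in unitmx -> test h -> periodic P s -> csmooth s ->
  cint lam (fun x => h x * s x) = cint lam (fun x => per P h x * s x * chiP P x).
Proof.
move=> uP th ps ss; have tf : test (fun x => s x * h x) by exact: testMl.
have tc := chiP_test uP.
have := cint_unfold uP (csmooth_ccontinuous tf.1) tf.2 (csmooth_ccontinuous tc.1) tc.2.
rewrite (_ : (fun x => _ * per _ _ x) = fun x => h x * s x); last first.
  by apply/funext => x; rewrite per_chiP // mulr1 mulrC.
move=> ->; congr cint; apply/funext => x; rewrite per_mull //; last by case: th.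
by rewrite [s x * _]mulrC.
Qed.

Lemma cint_per_cst P h (c : R[i]) l : P \in unitmx -> test h -> (forall x, per P h x = c) ->
  cint lam (fun x => h x * ew (dual P l) x) = (`|\det P|)%:C%C * c * (l == 0)%:R.
Proof.
move=> uP th hc; rewrite (cint_per uP th (periodic_ew l uP) (csmooth_ew _)).
have E : (fun x => per P h x * ew (dual P l) x * chiP P x) =
    fun x => c * ((fun y => ew (map_mx intr l) y * chi y) (invmx P *m x)).
  apply/funext => x; rewrite hc mulrA /chiP; congr (_ * _ * _).
  by rewrite /ew /dual /latpt dot_mulmx.
have ui : invmx P \in unitmx by rewrite unitmx_inv.
have ie : cintegrable lam (fun x => ew (map_mx intr l) x * chi x).
  by apply: test_cintegrable; apply: testMl => //; exact: csmooth_ew.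
have [i1 e1] := cint_mulmx ui ie.
rewrite E cintZ // e1 cint_ew_chi det_inv normfV invrK.
by rewrite mulrCA mulrA.
Qed.

Definition ONsys (I : eqType) P (u : I -> 'cV[R]_n -> R[i]) := forall i j x,
  per P (fun y => u i y * conjc (u j y)) x = ((`|\det P|^-1)%:C%C *+ (i == j)).

Lemma ONsys_inner (I : eqType) P (u : I -> 'cV[R]_n -> R[i]) : P \in unitmx ->
  (forall i, test (u i)) -> ONsys P u -> forall i j k l,
  inner (fun x => ew (dual P k) x * u i x) (fun x => ew (dual P l) x * u j x) =
  ((i == j) && (k == l))%:R.
Proof.
move=> uP tu ou i j k l; rewrite innerE.
have E : (fun x => ew (dual P k) x * u i x * conjc (ew (dual P l) x * u j x)) =
    fun x => (u i x * conjc (u j x)) * ew (dual P (k - l)) x.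
  apply/funext => x; rewrite /dual latptD latptN ewDl ewNl cjM; ring.
rewrite E (cint_per_cst _ uP _ (ou i j)); last exact: test_conjM.
rewrite subr_eq0; case: (i == j); last by rewrite mulr0n mulr0 mul0r.
rewrite mulr1n -rmorphM divff ?mul1r //.
by rewrite normr_eq0 -unitfE -unitmxE.
Qed.

(** Fejer means put [per h], cut off by a cube, into the closed span of cut-off characters, all
    orthogonal to [h]. The inner product of [per h] with [h] unfolds to the integral of [|per h|^2]
    over the torus, which is therefore 0. *)
Lemma per_eq0 h : test h -> (forall l : 'cV[int]_n, cint lam (fun x => h x * conjc (ew (map_mx intr l) x)) = 0) ->
  forall x, per 1%:M h x = 0.
Proof.
move=> th h0; have sp := csmooth_per u1 th; have pp := @per_periodic 1%:M h.
case: (th) => sh [M hM].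
have ccnj : csmooth (fun x => conjc (per 1%:M h x)) by exact: csmooth_conj.
have Lh : L2 h by exact/invertible_L2/invertible_test.
(* Characters are not square integrable; the cube is 1 on the support of [h], so multiplying by it
   leaves inner products with [h] unchanged. *)
pose b (x : 'cV[R]_n) := ((boxfun M x)%:C)%C.
have Lb : L2 b.
  apply: (L2_le _ (@integrable_boxfun R n M)).
    by apply: cmeas_real; have /measurable_int/measurable_EFinP := @integrable_boxfun R n M.
  move=> x; rewrite normc_real ger0_norm ?boxfun_ge0 //.
  have [xM|xM] := leP `|x| M; first by rewrite boxfun1 // expr1n.
  have [M0|M0] := leP 0 M; first by rewrite boxfun0 // expr0n.
  rewrite expr2 ler_piMr ?boxfun_ge0 //; apply: prodr_ile1 => i _; rewrite indicE ler0n.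
  by rewrite lern1 leq_b1.
have p1 : periodic1 (per 1%:M h) by move=> k x; rewrite -latpt1 pp.
have cl := periodic_mul_closure p1 (csmooth_ccontinuous sp) Lb.
have eL2 : forall k, int_lattice k -> L2 (fun xi : 'cV[R]_n => ew k xi * b xi).
  move=> k _; apply: (L2_le _ (L2_integrable Lb)).
    by apply: cmeasM; [exact: cmeas_ew|exact: L2_cmeas].
  by move=> x; rewrite Normc.normcM normc_ew mul1r.
have hb x : b x * conjc (h x) = conjc (h x).
  have [xM|/hM ->] := leP `|x| M; last by rewrite conjc0 mulr0.
  by rewrite /b boxfun1 // mul1r.
have I0 : inner (fun x => per 1%:M h x * b x) h = 0.
  apply: (inner_closure_eq0 (lin_span_L2 eL2) Lh _ cl) => _ [m [k [c [hk ->]]]].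
  rewrite inner_suml //; last by move=> i _; apply/L2Z/eL2.
  rewrite big1 // => i _; rewrite innerZl //; last exact: eL2.
  have [l _ <-] := hk i; have := h0 l => /(congr1 conjc); rewrite -cint_conj conjc0.
  rewrite innerE => E; rewrite (_ : cint lam _ = 0) ?mulr0 // -[RHS]E.
  by congr cint; apply/funext => x; rewrite cjM conjcK -mulrA hb mulrC.
have : cint lam (fun x => (((normc (per 1%:M h x)) ^+ 2)%:C%C * chi x)) = 0.
  rewrite -[RHS]conjc0 -[in RHS]I0 innerE -cint_conj.
  transitivity (cint lam (fun x => h x * conjc (per 1%:M h x))).
    rewrite cint_per1 //; last exact: periodic_conj.
    by congr cint; apply/funext => x; rewrite mulc_conj.
  by congr cint; apply/funext => x; rewrite -mulrA hb cjM conjcK mulrC.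
have /choice[t ht] : forall x, exists t : R, 0 <= t /\ chi x = t%:C%C.
  by move=> x; have [t ? ?] := chi_ge0 x; exists t.
have E : (fun x => ((normc (per 1%:M h x)) ^+ 2)%:C%C * chi x) =
    (fun x => (normc (per 1%:M h x) ^+ 2 * t x)%:C%C).
  by apply/funext => x; rewrite (ht x).2 -rmorphM.
have tt : test (fun x => ((normc (per 1%:M h x)) ^+ 2)%:C%C * chi x).
  apply: testMl => //; have := csmoothM sp ccnj; congr csmooth.
  by apply/funext => x; rewrite mulc_conj.
rewrite E in tt *; rewrite cint_real => /complexI V0.
have V x : normc (per 1%:M h x) ^+ 2 * t x = 0.
  apply: (@continuous_int0 (fun x => normc (per 1%:M h x) ^+ 2 * t x)) => //.
  - by have [] := csmooth_ccontinuous tt.1.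
  - by move=> y; rewrite mulr_ge0 ?sqr_ge0 // (ht y).1.
  - by have [] := test_cintegrable tt.
move=> x; apply: Normc.eq0_normc; apply/eqP; rewrite -sqrf_eq0.
rewrite -(inj_eq (@complexI R)) -[X in X == _]mulr1 -(per_chi x).
(* Since the translates of [chi] sum to 1, [|per h|^2] is the periodization of [|per h|^2 * chi],
   which has just been shown to vanish. *)
have ps : periodic 1%:M (fun y => ((normc (per 1%:M h y)) ^+ 2)%:C%C) by move=> k y; rewrite pp.
have := per_mull x u1 ps chi_test.2; move=> /= <-.
rewrite rmorph0; apply/eqP; rewrite -[RHS](per0 x u1); congr per.
by apply/funext => y; rewrite (ht y).2 -rmorphM V.
Qed.

Lemma cint_per0 h (l : 'cV[int]_n) : test h -> (forall x, per 1%:M h x = 0) ->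
  cint lam (fun x => h x * conjc (ew (map_mx intr l) x)) = 0.
Proof.
move=> th h0; rewrite cint_per1 //.
- by rewrite (_ : (fun x => _) = fun=> 0) ?cint0 //; apply/funext => x; rewrite h0 !mul0r.
- apply: periodic_conj => k x; rewrite latpt1 ewDr ew_int mulr1 //.
- by apply: csmooth_conj; exact: csmooth_ew.
Qed.

End partition_of_unity.
End periodization.

(** * Tensor products, and a concrete smooth partition of unity *)

Section tensor.
Context (R : realType) (n : nat).
Local Notation normc := (@Normc.normc R).
Local Notation lam := (@lebesgue_cV R n.+1).
Local Notation leb := (@lebesgue_measure R).

Definition tens (h : 'I_n.+1 -> R -> R) (x : 'cV[R]_n.+1) : R[i] := (\prod_i h i (x i 0))%:C%C.

Lemma dsmooth_id : dsmooth (fun t : R => t).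
Proof.
case=> [|k]; first by split => //; move=> t; exact: cvg_id.
split=> [t|v]; first exact: cvg_id.
split=> [x|]; first exact: derivable_id.
rewrite (_ : (fun x => _) = fun=> v); first exact: dC_cst.
by apply/funext => x; rewrite derive_id.
Qed.

Lemma dsmooth_line (h : R -> R) (i : 'I_n.+1) : dsmooth h -> dsmooth (fun x : 'cV[R]_n.+1 => h (x i 0)).
Proof.
apply: (@dsmooth_affine _ _ _ (fun x : 'cV[R]_n.+1 => x i 0) (fun x : 'cV[R]_n.+1 => x i 0)).
  exact: coord_continuous.
by move=> x v t; rewrite !mxE.
Qed.

Lemma test_tens h (M : R) : (forall i, dsmooth (h i)) -> (forall i t, M < `|t| -> h i t = 0) ->
  test (tens h).
Proof.
move=> sh hM; split.
  by apply: csmooth_real; apply: dsmooth_prod => i; exact: dsmooth_line.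
exists M => x /coord_big[j hj]; rewrite /tens (bigD1 j) //= (hM j) ?mul0r //.
Qed.

Lemma per_tens h (M : R) x : (forall i t, M < `|t| -> h i t = 0) -> exists K0 : nat, forall K, (K0 <= K)%N ->
  per 1%:M (tens h) x = (\prod_i \sum_(a < K.*2.+1) h i (x i 0 + (a%:R - K%:R)))%:C%C.
Proof.
move=> hM; have bh : bsupp (tens h).
  by exists M => y /coord_big[j hj]; rewrite /tens (bigD1 j) //= (hM j) ?mul0r.
have [K0 hK] := per_box `|x| (@unitmx1 R n.+1) bh; exists K0 => K K0K.
rewrite (hK K x K0K (lexx _)) bigA_distr_bigA rmorph_sum; apply: eq_bigr => f _.
congr (_%:C%C); apply: eq_bigr => i _; congr (h i _).
by rewrite latpt1 !mxE intrB.
Qed.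

(** A difference of consecutive smooth steps, so that the integer translates telescope to 1. *)
Definition bump (t : R) : R := step (t + 1) - step t.

Lemma bump_ge0 t : 0 <= bump t.
Proof.
rewrite /bump subr_ge0; have [t0|t0] := leP t 0; first by rewrite [leLHS]step_eq0 // step_ge0.
by rewrite [leRHS]step_eq1 ?step_le1 // lerDr ltW.
Qed.

Lemma bump_eq0 t : 1 < `|t| -> bump t = 0.
Proof.
rewrite /bump lter_normr => /orP[] h.
  by rewrite !step_eq1 ?subrr //; lra.
by rewrite !step_eq0 ?subrr //; lra.
Qed.

Lemma dsmooth_bump : dsmooth bump.
Proof.
apply: dsmoothB; apply: dsmooth_step.
  by apply: dsmoothD; [exact: dsmooth_id|exact: dsmooth_cst].
exact: dsmooth_id.
Qed.

Lemma sum_bump t K : `|t| <= K%:R -> \sum_(a < K.*2.+1) bump (t + (a%:R - K%:R)) = 1.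
Proof.
move=> tK; pose F (a : nat) := step (t + (a%:R - K%:R)).
transitivity (\sum_(0 <= a < K.*2.+1) (F a.+1 - F a)).
  rewrite big_mkord; apply: eq_bigr => a _; rewrite /F /bump; congr (step _ - _).
  by rewrite -natr1; ring.
rewrite telescope_sumr // /F step_eq1 ?step_eq0 ?subr0 //.
  by move: tK; rewrite ler_norml; lra.
by move: tK; rewrite ler_norml -natr1 -addnn natrD; lra.
Qed.

(** With [g] the step restricted to [0, 1[, one has [bump t + g t = I1 t + g (t + 1)] pointwise; the
    finite integral of [g] cancels and that of [I1] is 1. *)
Lemma integral_bump : (\int[leb]_t (bump t)%:E = 1)%E.
Proof.
pose I1 (t : R) : R := \1_(`[0, 1[) t; pose g (t : R) := step t * I1 t.
have mI : measurable_fun setT I1 by apply: measurable_indic; exact: measurable_itv.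
have dcm (f : R -> R) : dsmooth f -> measurable_fun setT f.
  by move=> /dsmooth_continuous; exact: continuous_measurable_fun.
have mb := dcm _ dsmooth_bump.
have ms : measurable_fun setT (@step R) by apply: dcm; apply: dsmooth_step; exact: dsmooth_id.
have mg : measurable_fun setT g by exact: measurable_funM.
have I0 t : 0 <= I1 t by rewrite /I1 indicE ler0n.
have g0 t : 0 <= g t by rewrite mulr_ge0 ?step_ge0.
have II : (\int[leb]_t (I1 t)%:E = 1)%E.
  rewrite /I1 integral_indic // setIT.
  by rewrite [LHS](lebesgue_measure_itv `[0, 1[) /= lte_fin ltr01 oppr0 adde0.
have gI t : g t <= I1 t by rewrite /g -[leRHS]mul1r ler_wpM2r ?step_le1.
have ig : (\int[leb]_t (g t)%:E \is a fin_num)%E.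
  rewrite ge0_fin_numE; last by apply: integral_ge0 => t _; rewrite lee_fin.
  apply: (@le_lt_trans _ _ 1%E); last exact: ltry.
  rewrite -II; apply: ge0_le_integral => //.
  - by move=> t _; rewrite lee_fin.
  - exact/measurable_EFinP.
  - exact/measurable_EFinP.
  - by move=> t _; rewrite lee_fin.
have E t : bump t + g t = I1 t + g (1 * t + 1).
  rewrite mul1r /g /I1 /bump !indicE.
  have [t1|t1] := ltP t (-1).
    rewrite !memNset ?step_eq0 /= ?in_itv /=; try lra.
  have [t0|t0] := ltP t 0.
    rewrite [t \in _]memNset ?[t + 1 \in _]mem_set ?[step t]step_eq0 /= ?in_itv /=; try lra.
  have [t2|t2] := ltP t 1.
    rewrite [t \in _]mem_set ?[t + 1 \in _]memNset ?[step (t + 1)]step_eq1 /= ?in_itv /=; try lra.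
  rewrite !memNset ?step_eq1 /= ?in_itv /=; try lra.
have : (\int[leb]_t (bump t)%:E + \int[leb]_t (g t)%:E = 1 + \int[leb]_t (g t)%:E)%E.
  rewrite -ge0_integralD //; last 4 first.
  - by move=> t _; rewrite lee_fin bump_ge0.
  - exact/measurable_EFinP.
  - by move=> t _; rewrite lee_fin.
  - exact/measurable_EFinP.
  under eq_integral do rewrite -EFinD E EFinD.
  rewrite ge0_integralD //; last 4 first.
  - by move=> t _; rewrite lee_fin.
  - exact/measurable_EFinP.
  - by move=> t _; rewrite lee_fin.
  - apply/measurable_EFinP; apply: (@measurableT_comp _ _ _ _ _ _ g) => //.
    by apply: measurable_funD => //; exact: measurable_funM.
  rewrite II (@ge0_integral_affine1 R 1 1 (EFin \o g)) ?oner_eq0 //.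
  - by rewrite normr1 invr1 mul1e.
  - exact/measurable_EFinP.
move/(congr1 (fun z => z - \int[leb]_t (g t)%:E))%E.
by rewrite !addeK.
Qed.

Definition chi0 : 'cV[R]_n.+1 -> R[i] := tens (fun _ => bump).

Lemma chi0_test : test chi0.
Proof. apply: (@test_tens _ 1) => i; [exact: dsmooth_bump|exact: bump_eq0]. Qed.

Lemma per_chi0 x : per 1%:M chi0 x = 1.
Proof.
have [K0 hK] := per_tens x (fun _ : 'I_n.+1 => bump_eq0).
have [N hN] : exists N : nat, `|x| < N%:R by exists (Num.bound `|x|); rewrite archi_boundP.
rewrite (hK (maxn K0 N)) ?leq_maxl // big1 // => i _; apply: sum_bump.
rewrite (le_trans (coord_le_norm _ _)) // (le_trans (ltW hN)) // ler_nat; exact: leq_maxr.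
Qed.

Lemma chi0_ge0 x : exists2 t : R, 0 <= t & chi0 x = t%:C%C.
Proof. by exists (\prod_i bump (x i 0)) => //; rewrite prodr_ge0 // => i _; exact: bump_ge0. Qed.

Lemma chi0_int : cint lam chi0 = 1.
Proof.
have ib : cintegrable leb (fun t => (bump t)%:C%C).
  split; last by apply: (eq_integrable measurableT (cst 0%E)) => //; exact: integrable0.
  apply/integrableP; split.
    apply/measurable_EFinP; apply: continuous_measurable_fun.
    exact: (dsmooth_continuous dsmooth_bump).
  under eq_integral do rewrite /= ger0_norm ?bump_ge0 //.
  by rewrite integral_bump ltry.
have := cint_prod (fun _ : 'I_n.+1 => ib).
rewrite cint_real /Rintegral integral_bump /= big1 // => <-.
by congr cint; apply/funext => x; rewrite /chi0 /tens rmorph_prod.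
Qed.

End tensor.

(** * Wilson bases *)

Section wilson1.
Context (R : realType).

(** Meyer's angle: 0 for [t <= -1/4], pi/2 for [t >= 1/4], with [wang t + wang (- t) = pi/2]. Its
    sine [ws] and cosine [wc] are the rising and the falling edge of the windows. *)
Definition wang (t : R) : R := pi / 2 * step (2 * t + 2^-1).
Definition ws (t : R) : R := sin (wang t).
Definition wc (t : R) : R := cos (wang t).

Lemma wc2_ws2 t : wc t ^+ 2 + ws t ^+ 2 = 1.
Proof. exact: cos2Dsin2. Qed.

Lemma wangN t : wang (- t) = pi / 2 - wang t.
Proof.
rewrite /wang (_ : 2 * - t + 2^-1 = 1 - (2 * t + 2^-1)); last by lra.
by rewrite stepB mulrBr mulr1.
Qed.

Lemma wsN t : ws (- t) = wc t.
Proof. by rewrite /ws /wc wangN sinB sin_pihalf cos_pihalf mul1r mul0r subr0. Qed.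

Lemma wcN t : wc (- t) = ws t.
Proof. by rewrite -wsN opprK. Qed.

Lemma ws0 t : t <= - 4^-1 -> ws t = 0.
Proof. by move=> h; rewrite /ws /wang step_eq0 ?mulr0 ?sin0 //; lra. Qed.

Lemma ws1 t : 4^-1 <= t -> ws t = 1.
Proof. by move=> h; rewrite /ws /wang step_eq1 ?mulr1 ?sin_pihalf //; lra. Qed.

Lemma wc0 t : 4^-1 <= t -> wc t = 0.
Proof. by move=> h; rewrite -wsN ws0 //; lra. Qed.

Lemma wc1 t : t <= - 4^-1 -> wc t = 1.
Proof. by move=> h; rewrite -wsN ws1 //; lra. Qed.

Definition wb (m : nat) (t : R) : R := ws (t - m%:R / 2) * wc (t - m.+1%:R / 2).

(** Window 0 covers [-1/2, 1/2]; window [m > 0] covers [m/2, (m+1)/2] and its mirror image, so each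
    has total width 1, as orthonormality of integer modulates demands. The sign [(-1)^m] makes the
    overlaps of consecutive windows at the two mirror edges cancel after periodization. *)
Definition wu (m : nat) (t : R) : R :=
  if m is 0 then ws (t + 2^-1) * wc (t - 2^-1) else wb m t + (-1) ^+ m * wb m (- t).

Lemma dsmooth_wsc (a b : R) : dsmooth (fun t : R => ws (a * t + b)) /\ dsmooth (fun t : R => wc (a * t + b)).
Proof.
have h : dsmooth (fun t : R => wang (a * t + b)).
  apply: dsmoothM; first exact: dsmooth_cst.
  apply: dsmooth_step; apply: dsmoothD; last exact: dsmooth_cst.
  apply: dsmoothM; first exact: dsmooth_cst.
  apply: dsmoothD; last exact: dsmooth_cst.
  by apply: dsmoothM; [exact: dsmooth_cst|exact: dsmooth_id].
by split; [exact: dsmooth_sin|exact: dsmooth_cos].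
Qed.

Lemma dsmooth_wu m : dsmooth (wu m).
Proof.
have E (a b : R) (f : R -> R) : (fun t => f (a * t + b)) = (fun t => f (a * t + b)) by [].
have s1 b : dsmooth (fun t : R => ws (t + b)).
  by have [h _] := dsmooth_wsc 1 b; move: h; congr dsmooth; apply/funext => t; rewrite mul1r.
have c1 b : dsmooth (fun t : R => wc (t + b)).
  by have [_ h] := dsmooth_wsc 1 b; move: h; congr dsmooth; apply/funext => t; rewrite mul1r.
have s2 b : dsmooth (fun t : R => ws (- t + b)).
  by have [h _] := dsmooth_wsc (-1) b; move: h; congr dsmooth; apply/funext => t; rewrite mulN1r.
have c2 b : dsmooth (fun t : R => wc (- t + b)).
  by have [_ h] := dsmooth_wsc (-1) b; move: h; congr dsmooth; apply/funext => t; rewrite mulN1r.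
case: m => [|m]; first exact: dsmoothM.
apply: dsmoothD; first exact: dsmoothM.
by apply: dsmoothM; [exact: dsmooth_cst|exact: dsmoothM].
Qed.

(* Value of [wu m] at [p / 2 + d] with [`|d| <= 1/4], where [s = ws d] and [c = wc d]. *)
Definition wW (s c : R) (m : nat) (p : int) : R :=
  if m is 0 then (p == -1)%:R * s + (p == 0)%:R + (p == 1)%:R * c else
  (p == m%:Z)%:R * s + (p == m%:Z + 1)%:R * c +
  (-1) ^+ m * ((p == - m%:Z)%:R * c + (p == - m%:Z - 1)%:R * s).

Lemma wwE (q : int) (d : R) : `|d| <= 4^-1 ->
  ws (q%:~R / 2 + d) = (if q < 0 then 0 else if q == 0 then ws d else 1) /\
  wc (q%:~R / 2 + d) = (if q < 0 then 1 else if q == 0 then wc d else 0).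
Proof.
rewrite ler_norml => /andP[d1 d2].
have [q0|q0|->] := ltgtP q 0; last by rewrite mul0r add0r.
  have h : q%:~R <= -1 :> R by rewrite -[-1]/((-1)%:~R) ler_int; lia.
  by rewrite ws0 ?wc1 //; lra.
have h : 1 <= q%:~R :> R by rewrite -[1]/(1%:~R) ler_int; lia.
by rewrite ws1 ?wc0 //; lra.
Qed.

Lemma wbE m (p : int) (d : R) : `|d| <= 4^-1 ->
  wb m (p%:~R / 2 + d) = (p == m%:Z)%:R * ws d + (p == m%:Z + 1)%:R * wc d.
Proof.
move=> hd; rewrite /wb.
rewrite (_ : p%:~R / 2 + d - m%:R / 2 = (p - m%:Z)%:~R / 2 + d); last by rewrite intrB; ring.
rewrite (_ : p%:~R / 2 + d - m.+1%:R / 2 = (p - m%:Z - 1)%:~R / 2 + d); last by rewrite !intrB -natr1; ring.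
have [-> _] := wwE (p - m%:Z) hd; have [_ ->] := wwE (p - m%:Z - 1) hd.
have [h|h|h] := ltgtP p m%:Z.
- have e1 : p - m%:Z < 0 by lia.
  have e2 : (p == m%:Z + 1) = false by lia.
  by rewrite e1 e2 !mul0r addr0.
- have e1 : (p - m%:Z < 0) = false by lia.
  have e3 : (p - m%:Z == 0) = false by lia.
  rewrite e1 e3 !mul0r mul1r add0r.
  have [h2|h2] := eqVneq p (m%:Z + 1).
    have e4 : (p - m%:Z - 1 < 0) = false by lia.
    have e5 : (p - m%:Z - 1 == 0) by lia.
    by rewrite e4 e5 mul1r.
  have e4 : (p - m%:Z - 1 < 0) = false by lia.
  have e5 : (p - m%:Z - 1 == 0) = false by lia.
  by rewrite e4 e5 mul0r.
- have e1 : (p - m%:Z < 0) = false by lia.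
  have e3 : (p - m%:Z == 0) by lia.
  have e4 : (p - m%:Z - 1 < 0) by lia.
  have e5 : (m%:Z == m%:Z + 1) = false by lia.
  by rewrite e1 e3 e4 h e5 mulr1 mul1r mul0r addr0.
Qed.

Lemma wuE m (p : int) (d : R) : `|d| <= 4^-1 -> wu m (p%:~R / 2 + d) = wW (ws d) (wc d) m p.
Proof.
move=> hd; case: m => [|m]; last first.
  rewrite /wu /wW wbE //; congr (_ + _ * _).
  rewrite (_ : - (p%:~R / 2 + d) = (- p)%:~R / 2 + - d); last by rewrite mulrNz; ring.
  have e1 : (- p == m.+1%:Z) = (p == - m.+1%:Z) by lia.
  have e2 : (- p == m.+1%:Z + 1) = (p == - m.+1%:Z - 1) by lia.
  by rewrite wbE ?normrN // wsN wcN e1 e2.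
rewrite /wu /wW.
rewrite (_ : p%:~R / 2 + d + 2^-1 = (p + 1)%:~R / 2 + d); last by rewrite intrD; ring.
rewrite (_ : p%:~R / 2 + d - 2^-1 = (p - 1)%:~R / 2 + d); last by rewrite intrB; ring.
have [-> _] := wwE (p + 1) hd; have [_ ->] := wwE (p - 1) hd.
have [->|p1] := eqVneq p (-1); first by rewrite /= mul1r mul0r addr0 mulr1 addr0.
have [->|p2] := eqVneq p 1; first by rewrite /= ?mul1r ?mul0r ?mul1r ?add0r ?mul1r.
have [->|p3] := eqVneq p 0; first by rewrite /= !mul0r mulr1 add0r addr0.
rewrite !mul0r !addr0; have [h|h] := leP p 0.
  have e1 : p + 1 < 0 by lia.
  by rewrite e1 mul0r.
have e1 : (p - 1 < 0) = false by lia.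
have e2 : (p - 1 == 0) = false by lia.
by rewrite e1 e2 mulr0.
Qed.

Lemma half_decomp (t : R) : exists p : int, exists2 d : R, `|d| <= 4^-1 & t = p%:~R / 2 + d.
Proof.
pose p := Num.floor (2 * t + 2^-1); exists p, (t - p%:~R / 2); last by ring.
have := floor_le_tmp (2 * t + 2^-1); have := floorD1_gt (2 * t + 2^-1); rewrite -/p intrD => h1 h2.
by rewrite ler_norml; lra.
Qed.

Lemma sum_pick (G : int -> R) (p r : int) K : `|p| + `|r| <= K%:Z ->
  \sum_(a < K.*2.+1) ((p + 2 * (a%:Z - K%:Z) == r)%:R * G (p + 2 * (a%:Z - K%:Z))) =
  (2 %| r - p)%Z%:R * G r.
Proof.
move=> h; have [/dvdzP[b hb]|nd] := boolP (2 %| r - p)%Z.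
  have bK : (absz (b + K%:Z)%R < K.*2.+1)%N by lia.
  rewrite (bigD1 (Ordinal bK)) //= big1 ?addr0.
    have E : p + 2 * ((absz (b + K%:Z)%R)%:Z - K%:Z) = r by lia.
    by rewrite E eqxx.
  move=> a /eqP ab; rewrite (_ : _ == _ = false) ?mul0r //; apply/negP => /eqP E.
  by apply: ab; apply/val_inj => /=; lia.
rewrite mul0r big1 // => a _; rewrite (_ : _ == _ = false) ?mul0r //; apply/negP => /eqP E.
by move/negP: nd; apply; apply/dvdzP; exists (a%:Z - K%:Z); lia.
Qed.

Let natb : (false%:R = 0 :> R) * (true%:R = 1 :> R).
Proof. by []. Qed.

Lemma wW0 s c p : wW s c 0 p = (p == -1)%:R * s + (p == 0)%:R + (p == 1)%:R * c.
Proof. by []. Qed.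

Lemma wWS s c m p : wW s c m.+1 p = (p == m.+1%:Z)%:R * s + (p == m.+1%:Z + 1)%:R * c +
  (-1) ^+ m.+1 * ((p == - m.+1%:Z)%:R * c + (p == - m.+1%:Z - 1)%:R * s).
Proof. by []. Qed.

(** Integer shifts change [p] by even numbers, so of the edges [m], [m + 1], [- m], [- m - 1] only
    those of one parity are met. For [m' = m] they contribute [s^2 + c^2], or the single value 1 at
    [p = 0]; for neighbouring indices they contribute [c s] with opposite signs. *)
Lemma wW_sum_shift s c m m' p K : s ^+ 2 + c ^+ 2 = 1 -> (`|p| + m%:Z + 1 <= K%:Z) ->
  \sum_(a < K.*2.+1) wW s c m (p + 2 * (a%:Z - K%:Z)) * wW s c m' (p + 2 * (a%:Z - K%:Z)) = (m == m')%:R.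
Proof.
move=> sc hK; pose G := wW s c m'.
have pick r : `|p| + `|r| <= K%:Z -> \sum_(a < K.*2.+1)
    ((p + 2 * (a%:Z - K%:Z) == r)%:R * wW s c m' (p + 2 * (a%:Z - K%:Z))) = (2 %| r - p)%Z%:R * wW s c m' r.
  exact: sum_pick.
case: m hK pick => [|m] hK pick.
  under eq_bigr do rewrite wW0 2!mulrDl [_ * s * _]mulrAC [_ * c * _]mulrAC.
  rewrite !big_split /= -!mulr_suml !pick; [|lia|lia|lia].
  have [h|h] := boolP (2 %| 0 - p)%Z.
    have e1 : (2 %| -1 - p)%Z = false by lia.
    have e2 : (2 %| 1 - p)%Z = false by lia.
    rewrite e1 e2 !mul0r add0r addr0 mul1r; case: m' {G pick} => [|m'].
      by rewrite wW0 /= mul0r add0r mul0r addr0.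
    rewrite wWS.
    have -> : (0 == m'.+1%:Z) = false by lia.
    have -> : (0 == m'.+1%:Z + 1) = false by lia.
    have -> : (0 == - m'.+1%:Z) = false by lia.
    have -> : (0 == - m'.+1%:Z - 1) = false by lia.
    by rewrite /=; rewrite ?natb; ring.
  have e1 : (2 %| -1 - p)%Z by lia.
  have e2 : (2 %| 1 - p)%Z by lia.
  rewrite e1 e2 mul0r addr0 !mul1r; case: m' {G pick} => [|m'].
    by rewrite !wW0 /= !mul1r !mul0r !addr0 !add0r -!expr2.
  rewrite !wWS.
  have -> : (-1 == m'.+1%:Z) = false by lia.
  have -> : (-1 == m'.+1%:Z + 1) = false by lia.
  have -> : (-1 == - m'.+1%:Z) = (m' == 0%N) by lia.
  have -> : (-1 == - m'.+1%:Z - 1) = false by lia.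
  have -> : (1 == m'.+1%:Z) = (m' == 0%N) by lia.
  have -> : (1 == m'.+1%:Z + 1) = false by lia.
  have -> : (1 == - m'.+1%:Z) = false by lia.
  have -> : (1 == - m'.+1%:Z - 1) = false by lia.
  by case: m' => [|m'] /=; rewrite ?expr1; rewrite ?natb; ring.
pose e : R := (-1) ^+ m.+1.
have E q : wW s c m.+1 q * wW s c m' q = s * ((q == m.+1%:Z)%:R * wW s c m' q) +
    c * ((q == m.+1%:Z + 1)%:R * wW s c m' q) + e * (c * ((q == - m.+1%:Z)%:R * wW s c m' q) +
    s * ((q == - m.+1%:Z - 1)%:R * wW s c m' q)).
  by rewrite wWS -/e; move: (wW _ _ _ _) => w; rewrite ?natb; ring.
under eq_bigr do rewrite E.
rewrite !big_split /= -!mulr_sumr big_split /= -!mulr_sumr !pick; [|lia|lia|lia|lia].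
have [h|h] := boolP (2 %| m.+1%:Z - p)%Z.
  have e1 : (2 %| m.+1%:Z + 1 - p)%Z = false by lia.
  have e2 : (2 %| - m.+1%:Z - p)%Z by lia.
  have e3 : (2 %| - m.+1%:Z - 1 - p)%Z = false by lia.
  rewrite e1 e2 e3 !mul0r !mulr0 !addr0 !mul1r; case: m' {G pick E} => [|m'].
    rewrite !wW0.
    have -> : (m.+1%:Z == -1) = false by lia.
    have -> : (m.+1%:Z == 0) = false by lia.
    have -> : (m.+1%:Z == 1) = (m == 0%N) by lia.
    have -> : (- m.+1%:Z == -1) = (m == 0%N) by lia.
    have -> : (- m.+1%:Z == 0) = false by lia.
    have -> : (- m.+1%:Z == 1) = false by lia.
    by rewrite /e; case: m {hK h e1 e2 e3 e} => [|m] /=; rewrite ?expr1; rewrite ?natb; ring.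
  rewrite !wWS.
  have -> : (m.+1%:Z == m'.+1%:Z) = (m == m') by lia.
  have -> : (m.+1%:Z == m'.+1%:Z + 1) = (m == m'.+1) by lia.
  have -> : (m.+1%:Z == - m'.+1%:Z) = false by lia.
  have -> : (m.+1%:Z == - m'.+1%:Z - 1) = false by lia.
  have -> : (- m.+1%:Z == m'.+1%:Z) = false by lia.
  have -> : (- m.+1%:Z == m'.+1%:Z + 1) = false by lia.
  have -> : (- m.+1%:Z == - m'.+1%:Z) = (m == m') by lia.
  have -> : (- m.+1%:Z == - m'.+1%:Z - 1) = (m == m'.+1) by lia.
  rewrite eqSS; have [E|E] := eqVneq m m'.
    have -> : (m == m'.+1) = false by lia.
    rewrite /e -E; have := sqrr_sign R m.+1; move: ((-1) ^+ m.+1) => x; rewrite expr2 => hx.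
    transitivity (s ^+ 2 + x * x * c ^+ 2); first by rewrite !natb; ring.
    by rewrite hx mul1r.
  have [E2|E2] := eqVneq m m'.+1; last by rewrite ?natb; ring.
  rewrite /e E2 [(-1) ^+ m'.+2]exprS; have := sqrr_sign R m'.+1; move: ((-1) ^+ m'.+1) => x; rewrite expr2 => hx.
  transitivity (c * s * (1 - x * x)); first by rewrite ?natb; ring.
  by rewrite hx subrr mulr0.
have e1 : (2 %| m.+1%:Z + 1 - p)%Z by lia.
have e2 : (2 %| - m.+1%:Z - p)%Z = false by lia.
have e3 : (2 %| - m.+1%:Z - 1 - p)%Z by lia.
rewrite e1 e2 e3 !mul0r !mulr0 !add0r !mul1r; case: m' {G pick E} => [|m'].
  rewrite !wW0.
  have -> : (m.+1%:Z + 1 == -1) = false by lia.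
  have -> : (m.+1%:Z + 1 == 0) = false by lia.
  have -> : (m.+1%:Z + 1 == 1) = false by lia.
  have -> : (- m.+1%:Z - 1 == -1) = false by lia.
  have -> : (- m.+1%:Z - 1 == 0) = false by lia.
  have -> : (- m.+1%:Z - 1 == 1) = false by lia.
  by rewrite ?natb; ring.
rewrite !wWS.
have -> : (m.+1%:Z + 1 == m'.+1%:Z) = (m' == m.+1) by lia.
have -> : (m.+1%:Z + 1 == m'.+1%:Z + 1) = (m == m') by lia.
have -> : (m.+1%:Z + 1 == - m'.+1%:Z) = false by lia.
have -> : (m.+1%:Z + 1 == - m'.+1%:Z - 1) = false by lia.
have -> : (- m.+1%:Z - 1 == m'.+1%:Z) = false by lia.
have -> : (- m.+1%:Z - 1 == m'.+1%:Z + 1) = false by lia.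
have -> : (- m.+1%:Z - 1 == - m'.+1%:Z) = (m' == m.+1) by lia.
have -> : (- m.+1%:Z - 1 == - m'.+1%:Z - 1) = (m == m') by lia.
rewrite eqSS; have [E|E] := eqVneq m m'.
  have -> : (m' == m.+1) = false by lia.
  rewrite /e -E; have := sqrr_sign R m.+1; move: ((-1) ^+ m.+1) => x; rewrite expr2 => hx.
  transitivity (c ^+ 2 + x * x * s ^+ 2); first by rewrite ?natb; ring.
  by rewrite hx mul1r addrC.
have [E2|E2] := eqVneq m' m.+1; last by rewrite ?natb; ring.
rewrite /e E2 [(-1) ^+ m.+2]exprS; have := sqrr_sign R m.+1; move: ((-1) ^+ m.+1) => x; rewrite expr2 => hx.
transitivity (c * s * (1 - x * x)); first by rewrite ?natb; ring.
by rewrite hx subrr mulr0.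
Qed.

Lemma sum_picknat (G : nat -> R) (p : int) M : p < M%:Z ->
  \sum_(m < M) (p == m%:Z)%:R * G m = if 0 <= p then G `|p|%N else 0.
Proof.
move=> pM; case: ifP => p0.
  have pl : (`|p| < M)%N by lia.
  rewrite (bigD1 (Ordinal pl)) //= big1 ?addr0.
    have E : (p == (absz p)%:Z) by lia.
    by rewrite /= E mul1r.
  move=> m /eqP mp; rewrite (_ : p == _ = false) ?mul0r //; apply/negP => /eqP E; apply: mp.
  by apply/val_inj => /=; lia.
by rewrite big1 // => m _; rewrite (_ : p == _ = false) ?mul0r //; lia.
Qed.

(** The companion of [wW_sum_shift]: summation over windows instead of shifts. The last summand
    corrects the value at [q = 0], where window 0 is 1 whatever [s] and [c] are. *)
Lemma wW_sum_m s c (q q' : int) M : `|q| < M%:Z -> (2 %| q - q')%Z ->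
  \sum_(m < M) wW s c m q * wW s c m q' = (q == q')%:R * (s ^+ 2 + c ^+ 2 + (q == 0)%:R * (1 - s ^+ 2 - c ^+ 2)).
Proof.
move=> qM qq.
have E (m : nat) : wW s c m q * wW s c m q' =
    if q == 0 then (0 == m%:Z)%:R * wW s c 0 q' else
    if 0 < q then s * ((q == m%:Z)%:R * wW s c m q') + c * ((q - 1 == m%:Z)%:R * wW s c m q')
    else s * ((- q - 1 == m%:Z)%:R * ((-1) ^+ m * wW s c m q')) + c * ((- q == m%:Z)%:R * ((-1) ^+ m * wW s c m q')).
  have [->|q0] := eqVneq q 0.
    case: m => [|m]; first by rewrite wW0 /= mul0r add0r mul0r addr0.
    rewrite wWS.
    have -> : (0 == m.+1%:Z) = false by lia.
    have -> : (0 == m.+1%:Z + 1) = false by lia.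
    have -> : (0 == - m.+1%:Z) = false by lia.
    have -> : (0 == - m.+1%:Z - 1) = false by lia.
    by rewrite !natb; ring.
  case: ifP => q1.
    case: m => [|m].
      rewrite wW0 (negbTE q0).
      have -> : (q == -1) = false by lia.
      have -> : (q - 1 == 0%:Z) = (q == 1) by lia.
      by rewrite !mul0r add0r mulr0 !add0r mulrA [c * _]mulrC.
    rewrite wWS.
    have -> : (q == - m.+1%:Z) = false by lia.
    have -> : (q == - m.+1%:Z - 1) = false by lia.
    have -> : (q - 1 == m.+1%:Z) = (q == m.+1%:Z + 1) by lia.
    by rewrite !natb; ring.
  case: m => [|m].
    rewrite wW0 (negbTE q0).
    have -> : (q == 1) = false by lia.
    have -> : (- q - 1 == 0%:Z) = (q == -1) by lia.
    have -> : (- q == 0%:Z) = false by lia.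
    by rewrite expr0; rewrite ?natb; ring.
  rewrite wWS.
  have -> : (q == m.+1%:Z) = false by lia.
  have -> : (q == m.+1%:Z + 1) = false by lia.
  have -> : (- q - 1 == m.+1%:Z) = (q == - m.+1%:Z - 1) by lia.
  have -> : (- q == m.+1%:Z) = (q == - m.+1%:Z) by lia.
  by move: (wW _ _ _ _) => w; rewrite ?natb; ring.
under eq_bigr do rewrite E.
have [h|h|h] := ltgtP q 0; last first.
- rewrite (@sum_picknat (fun=> wW s c 0 q')) /=; last by lia.
  rewrite h /= in qq *.
  rewrite ?wW0 [0 == q']eq_sym; case: (eqVneq q' 0) => [->|q0] /=; first by rewrite /=; rewrite ?natb; ring.
  have -> : (q' == 1) = false by lia.
  have -> : (q' == -1) = false by lia.
  by rewrite ?natb; ring.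
- rewrite big_split /= -!mulr_sumr.
  rewrite (@sum_picknat (fun m => wW s c m q')); last by lia.
  rewrite (@sum_picknat (fun m => wW s c m q')); last by lia.
  rewrite !ifT; [|lia|lia].
  case: q qM qq E h => [[|r]|r] // qM qq _ _.
  have -> : `|Posz r.+1|%N = r.+1 by [].
  have -> : `|Posz r.+1 - 1|%N = r by lia.
  rewrite mul0r addr0 wWS; case: r qM qq => [|r] qM qq; rewrite ?wW0 ?wWS.
    have -> : (q' == 1%:Z + 1) = false by lia.
    have -> : (q' == 0) = false by lia.
    have -> : (q' == - 1%:Z - 1) = false by lia.
    have -> : (1%:Z == q') = (q' == 1) by rewrite eq_sym.
    by rewrite expr1; rewrite ?natb; ring.
  have -> : (q' == r.+2%:Z + 1) = false by lia.
  have -> : (q' == - r.+2%:Z - 1) = false by lia.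
  have -> : (q' == r.+1%:Z) = false by lia.
  have -> : (q' == - r.+1%:Z) = false by lia.
  have -> : (q' == r.+1%:Z + 1) = (q' == r.+2%:Z) by lia.
  have -> : (q' == - r.+1%:Z - 1) = (q' == - r.+2%:Z) by lia.
  have -> : (r.+2%:Z == q') = (q' == r.+2%:Z) by rewrite eq_sym.
  rewrite [(-1) ^+ r.+2]exprS; move: ((-1) ^+ r.+1) => x; rewrite ?natb; ring.
rewrite big_split /= -!mulr_sumr.
rewrite (@sum_picknat (fun m => (-1) ^+ m * wW s c m q')); last by lia.
rewrite (@sum_picknat (fun m => (-1) ^+ m * wW s c m q')); last by lia.
rewrite !ifT; [|lia|lia].
case: q qM qq E h => [r|r] // qM qq _ _.
have -> : `|- Negz r|%N = r.+1 by [].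
have -> : `|- Negz r - 1|%N = r by lia.
rewrite mul0r addr0 wWS NegzE.
rewrite NegzE in qq.
case: r qM qq => [|r] qM qq; rewrite ?wW0 ?wWS.
  have -> : (q' == 1%:Z + 1) = false by lia.
  have -> : (q' == 0) = false by lia.
  have -> : (q' == - 1%:Z - 1) = false by lia.
  have -> : (- 1%:Z == q') = (q' == -1) by rewrite eq_sym.
  by rewrite expr1 expr0; rewrite ?natb; ring.
have -> : (q' == r.+2%:Z + 1) = false by lia.
have -> : (q' == - r.+2%:Z - 1) = false by lia.
have -> : (q' == r.+1%:Z) = false by lia.
have -> : (q' == - r.+1%:Z) = false by lia.
have -> : (q' == r.+1%:Z + 1) = (q' == r.+2%:Z) by lia.
have -> : (q' == - r.+1%:Z - 1) = (q' == - r.+2%:Z) by lia.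
have -> : (- r.+2%:Z == q') = (q' == - r.+2%:Z) by rewrite eq_sym.
have := sqrr_sign R r.+1; rewrite [(-1) ^+ r.+2]exprS; move: ((-1) ^+ r.+1) => x; rewrite expr2 => hx.
transitivity ((q' == - r.+2%:Z)%:R * (x * x) * (s ^+ 2 + c ^+ 2)); first by rewrite ?natb; ring.
by rewrite hx mulr1.
Qed.

Lemma wu_sum_shift m m' (t : R) : exists K0 : nat, forall K, (K0 <= K)%N ->
  \sum_(a < K.*2.+1) wu m (t + (a%:R - K%:R)) * wu m' (t + (a%:R - K%:R)) = (m == m')%:R.
Proof.
have [p [d hd ->]] := half_decomp t.
exists (absz p + m + 1)%N => K hK.
rewrite -(@wW_sum_shift (ws d) (wc d) m m' p K); last by lia.
  apply: eq_bigr => a _; rewrite (_ : p%:~R / 2 + d + _ = (p + 2 * (a%:Z - K%:Z))%:~R / 2 + d).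
    by rewrite !wuE.
  by rewrite intrD intrM intrB; field.
by rewrite addrC wc2_ws2.
Qed.

Lemma wu_sum_m (t : R) (k : int) M : 2 * `|t| + 1 < M%:R ->
  \sum_(m < M) wu m t * wu m (t + k%:~R) = (k == 0)%:R.
Proof.
have [p [d hd ->]] := half_decomp t => hM.
rewrite (_ : p%:~R / 2 + d + k%:~R = (p + 2 * k)%:~R / 2 + d); last by rewrite intrD intrM; field.
under eq_bigr do rewrite !wuE //.
rewrite wW_sum_m; last by lia.
  have -> : ws d ^+ 2 = 1 - wc d ^+ 2 by rewrite -(wc2_ws2 d) addrAC subrr add0r.
  rewrite (_ : _ - _ + _ + _ = 1) ?mulr1; last by ring.
  by congr (_%:R); congr nat_of_bool; lia.
rewrite -(ltr_int R) intr_norm; apply: le_lt_trans hM; clear -hd.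
have E : p%:~R = 2 * (p%:~R / 2 + d) - 2 * d by field.
rewrite {1}E.
apply: le_trans (ler_normB _ _) _; rewrite !normrM (ger0_norm (_ : 0 <= 2)) //.
have h2 : 2 * `|d| <= 1 by lra.
exact: lerD.
Qed.

(** Only [|p| = m] or [m + 1] give non-zero values, and [t] is within 1/4 of [p / 2]. *)
Lemma wu_supp m (t : R) : wu m t != 0 -> `| `|t| - m%:R / 2 | <= 1.
Proof.
have [p [d hd ->]] := half_decomp t; rewrite wuE // => h.
have hp : (`|p| = m%:Z) \/ (`|p| = m%:Z + 1).
  apply: contrapT => hn; move/negP: h; apply; apply/eqP.
  case: m hn => [|m] hn.
    rewrite wW0; have -> : (p == -1) = false by lia.
    have -> : (p == 0) = false by lia.
    have -> : (p == 1) = false by lia.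
    by rewrite !mul0r !addr0.
  rewrite wWS.
  have -> : (p == m.+1%:Z) = false by lia.
  have -> : (p == m.+1%:Z + 1) = false by lia.
  have -> : (p == - m.+1%:Z) = false by lia.
  have -> : (p == - m.+1%:Z - 1) = false by lia.
  by rewrite !natb; ring.
have hp' : `|p%:~R / 2 : R| = m%:R / 2 \/ `|p%:~R / 2 : R| = m%:R / 2 + 2^-1.
  rewrite normrM (ger0_norm (_ : 0 <= 2^-1)) // -intr_norm.
  by case: hp => ->; [left|right; rewrite intrD; ring].
have := ler_normD (p%:~R / 2) d; have := ler_normB (p%:~R / 2 + d) d; rewrite addrK => h1 h2.
by rewrite ler_norml; case: hp' => h3; rewrite h3 in h1 h2; lra.
Qed.

End wilson1.

(** * Wilson systems in several variables *)

Section wilson.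
Context (R : realType) (n : nat).
Local Notation normc := (@Normc.normc R).
Local Notation lam := (@lebesgue_cV R n.+1).

Definition ww (m : 'I_n.+1 -> nat) : 'cV[R]_n.+1 -> R[i] := tens (fun i => wu (m i)).

Lemma wu_far m (t : R) : m%:R / 2 + 1 < `|t| -> wu m t = 0.
Proof.
move=> h; apply/eqP; apply: contraT => /wu_supp; rewrite ler_norml => /andP[_ h2].
by move: h h2; lra.
Qed.

Lemma wu_far_seq (m : 'I_n.+1 -> nat) : exists M : R, forall i t, M < `|t| -> wu (m i) t = 0.
Proof.
exists (\sum_i ((m i)%:R / 2 + 1)) => i t h; apply: wu_far; apply: le_lt_trans h.
rewrite (bigD1 i) //= lerDl sumr_ge0 // => j _; rewrite addr_ge0 // divr_ge0 //.
Qed.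

Lemma ww_test m : test (ww m).
Proof. by have [M hM] := wu_far_seq m; apply: (test_tens _ hM) => i; exact: dsmooth_wu. Qed.

Lemma ww_real m x : conjc (ww m x) = ww m x.
Proof. by rewrite /ww /tens conjc_real. Qed.

Lemma ww_supp m x i : ww m x != 0 -> `| `|x i 0| - (m i)%:R / 2 | <= 1.
Proof.
move=> h; apply: wu_supp; apply: contra h => /eqP h.
by rewrite /ww /tens (bigD1 i) //= h mul0r.
Qed.

Lemma per_ww m m' x : per 1%:M (fun y => ww m y * conjc (ww m' y)) x =
  (\prod_i ((m i == m' i)%:R : R))%:C%C.
Proof.
have [M hM] := wu_far_seq m.
rewrite (_ : (fun y => _) = tens (fun i t => wu (m i) t * wu (m' i) t)); last first.
  by apply/funext => y; rewrite ww_real /ww /tens -rmorphM big_split.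
have h0 i t : M < `|t| -> wu (m i) t * wu (m' i) t = 0 by move=> h; rewrite hM // mul0r.
have [K0 hK] := per_tens x h0.
have /choice[K1 hK1] := fun i => @wu_sum_shift R (m i) (m' i) (x i 0).
pose K := (K0 + \sum_i K1 i)%N.
rewrite (hK K) ?leq_addr //; congr (_%:C%C); apply: eq_bigr => i _; rewrite hK1 //.
by rewrite /K (bigD1 i) //= addnCA leq_addr.
Qed.

Variable M : nat.
Local Notation T := {ffun 'I_n.+1 -> 'I_M}.

(* Doubling coordinate [0] makes the parity of the Wilson index explicit. *)
Definition mi (p : T * bool) (i : 'I_n.+1) : nat :=
  if i == ord0 then ((p.1 i).*2 + p.2)%N else p.1 i.

Lemma mi_inj p q : mi p =1 mi q -> p = q.
Proof.
case: p q => [f b] [g c] h; have h0 := h ord0; rewrite /mi eqxx /= in h0.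
have bc : b = c by case: b c h0 {h} => [] [] //=; lia.
rewrite -{c}bc in h0 h *; congr (_, _); apply/ffunP => i; apply/val_inj => /=.
have := h i; rewrite /mi; case: eqP => [->|] //=; lia.
Qed.

Lemma sum_double (G : nat -> R) K : \sum_(m < K.*2) G m = \sum_(m < K) \sum_(b : bool) G (m.*2 + b)%N.
Proof.
elim: K => [|K ih]; first by rewrite !big_ord0.
rewrite doubleS !big_ord_recr /= ih -addrA; congr (_ + _).
by rewrite big_bool /= addn0 addn1 addrC.
Qed.

Lemma sum_mi (G : 'I_n.+1 -> nat -> R) : \sum_(p : T * bool) \prod_i G i (mi p i) =
  \prod_i \sum_(m < if i == ord0 then M.*2 else M) G i m.
Proof.
pose G' (i : 'I_n.+1) (a : 'I_M) := if i == ord0 then \sum_(b : bool) G i (a.*2 + b)%N else G i a.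
transitivity (\prod_i \sum_(a < M) G' i a); last first.
  by apply: eq_bigr => i _; rewrite /G'; case: eqP => // ->; rewrite sum_double.
rewrite bigA_distr_bigA -(pair_big xpredT xpredT (fun (f : T) (b : bool) => \prod_i G i (mi (f, b) i))) /=.
apply: eq_bigr => f _; rewrite [RHS](bigD1 ord0) //= {1}/G' eqxx mulr_suml.
apply: eq_bigr => b _; rewrite (bigD1 ord0) //= /mi eqxx; congr (_ * _).
by apply: eq_bigr => i i0; rewrite /G' (negbTE i0).
Qed.

(** The resolution of the identity: [k = 0] gives the partition of unity by squares, and [k != 0]
    says that aliasing cancels. The bound on [x] ensures that all windows meeting [x] have an index
    in range. *)
Lemma sum_ww (x : 'cV[R]_n.+1) (k : 'cV[int]_n.+1) : 2 * `|x| + 1 < M%:R ->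
  \sum_(p : T * bool) ww (mi p) x * ww (mi p) (x + map_mx intr k) = (k == 0)%:R.
Proof.
move=> hx.
transitivity ((\sum_(p : T * bool) \prod_i (wu (mi p i) (x i 0) * wu (mi p i) (x i 0 + (k i 0)%:~R)))%:C%C).
  rewrite rmorph_sum; apply: eq_bigr => p _; rewrite /ww /tens -rmorphM -big_split.
  by congr (_%:C%C); apply: eq_bigr => i _; rewrite !mxE.
rewrite (@sum_mi (fun i m => wu m (x i 0) * wu m (x i 0 + (k i 0)%:~R))).
have E i : \sum_(m < if i == ord0 then M.*2 else M) wu m (x i 0) * wu m (x i 0 + (k i 0)%:~R) = (k i 0 == 0)%:R.
  apply: wu_sum_m; have := coord_le_norm x i => h.
  apply: (@le_lt_trans _ _ (2 * `|x| + 1)); first lra.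
  apply: lt_le_trans hx _; rewrite ler_nat; case: eqP => // _; lia.
under eq_bigr do rewrite E.
have [->|k0] := eqVneq k 0; first by rewrite big1 // => i _; rewrite mxE eqxx.
have [j hj] : exists j, k j 0 != 0.
  apply: contrapT => /forallNP h; case/eqP: k0; apply/matrixP => i l; rewrite ord1 mxE.
  by apply/eqP; apply: contraPT (h i) => ?; exact.
by rewrite (bigD1 j) //= (negbTE hj) mul0r.
Qed.

Variable (P : 'M[R]_n.+1).
Hypothesis uP : P \in unitmx.

Definition uw (m : 'I_n.+1 -> nat) x : R[i] := ((Num.sqrt `|\det P|)^-1)%:C%C * ww m (invmx P *m x).

Let det0 : 0 < `|\det P|.
Proof. by rewrite normr_gt0 -unitfE -unitmxE. Qed.

Lemma uw_test m : test (uw m).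
Proof.
by apply: testZ; apply: (test_mulmx _ (ww_test m)); rewrite unitmx_inv.
Qed.

Lemma uw_real m x : conjc (uw m x) = uw m x.
Proof. by rewrite /uw cjM conjc_real ww_real. Qed.

Lemma per_comp (h : 'cV[R]_n.+1 -> R[i]) x : per P h x = per 1%:M (fun y => h (P *m y)) (invmx P *m x).
Proof.
apply: eq_fsbigr => k _; congr h.
by rewrite mulmxDr mulKVmx // /latpt mul1mx.
Qed.

Lemma ONsys_uw : ONsys P (fun p => uw (mi p)).
Proof.
move=> p q x.
rewrite per_comp.
rewrite (_ : (fun y => _) = fun y => (`|\det P|^-1)%:C%C * (ww (mi p) y * conjc (ww (mi q) y))); last first.
  apply/funext => y; rewrite /uw mulKmx // cjM conjc_real mulrACA -rmorphM; congr (_%:C%C * _).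
  by rewrite -invfM -expr2 sqr_sqrtr // ltW.
have tw := test_conjM (ww_test (mi p)) (ww_test (mi q)).
rewrite perZ ?unitmx1 //; last by case: tw.
rewrite per_ww; have [->|pq] := eqVneq p q.
  by rewrite big1 ?mulr1 // => i _; rewrite eqxx.
have [i hi] : exists i, mi p i != mi q i.
  apply: contrapT => /forallNP h; case/eqP: pq; apply: mi_inj => i.
  by apply/eqP; apply: contraPT (h i) => ?; exact.
by rewrite (bigD1 i) //= (negbTE hi) mul0r mulr0.
Qed.

(** Exchanging the sum over windows with the periodization, [sum_ww] kills every lattice shift
    except 0, which reproduces [g x]. The predicate [F] may discard windows that do not meet the
    support of [g]. *)
Lemma uw_resolution (F : pred (T * bool)) g x : test g ->
  (forall y, g y != 0 -> 2 * `|invmx P *m y| + 1 < M%:R) ->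
  (forall y p, g y != 0 -> uw (mi p) y != 0 -> F p) ->
  g x = `|\det P|%:C%C * \sum_(p | F p) per P (fun y => g y * conjc (uw (mi p) y)) x * uw (mi p) x.
Proof.
move=> tg gM gF.
have E p : per P (fun y => g y * conjc (uw (mi p) y)) x * uw (mi p) x =
    per P (fun y => uw (mi p) x * (g y * uw (mi p) y)) x.
  have tp := testMr tg (uw_test (mi p)).1.
  by rewrite perZ //; [rewrite mulrC; congr (_ * per P _ _); apply/funext => y; rewrite uw_real|case: tp].
under eq_bigr do rewrite E.
rewrite big_mkcond /= (eq_bigr (fun p => per P (fun y => if F p then uw (mi p) x * (g y * uw (mi p) y) else 0) x)); last first.
  by move=> p _; case: (F p) => //; rewrite per0.
rewrite -per_sum //; last first.
  move=> p; case: (F p); last by exists 0.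
  by have [_ b] := testZ (uw (mi p) x) (testMr tg (uw_test (mi p)).1).
rewrite -perZ //; last first.
  apply: bsupp_sum => p; case: (F p); last by exists 0.
  by have [_ b] := testZ (uw (mi p) x) (testMr tg (uw_test (mi p)).1).
rewrite /per -(fsbig_widen [set (0 : 'cV[int]_n.+1)]) //.
  rewrite fsbig_set1 (_ : x + _ = x); last first.
    by rewrite /latpt (_ : map_mx _ _ = 0) ?mulmx0 ?addr0 //; apply/matrixP => i j; rewrite !mxE.
  have [g0|g0] := eqVneq (g x) 0.
    by rewrite g0 big1 ?mulr0 // => p _; case: (F p); rewrite ?mul0r ?mulr0.
  have S1 := sum_ww 0 (gM x g0).
  rewrite eqxx (_ : map_mx _ _ = 0) ?addr0 in S1; last by apply/matrixP => i j; rewrite !mxE.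
  rewrite (eq_bigr (fun p => g x * (`|\det P|^-1)%:C%C * (ww (mi p) (invmx P *m x) * ww (mi p) (invmx P *m x)))).
    rewrite -mulr_sumr; have -> : \sum_(p : T * bool) ww (mi p) (invmx P *m x) * ww (mi p) (invmx P *m x) = 1.
      by rewrite -[RHS]S1.
    by rewrite mulr1 mulrCA -rmorphM divff ?mulr1 // gt_eqF.
  move=> p _; case Fp: (F p).
    rewrite /uw; set a := _%:C%C; set c := ww _ _.
    have -> : (`|\det P|^-1)%:C%C = a * a by rewrite /a -rmorphM -invfM -expr2 sqr_sqrtr ?ltW.
    by ring.
  have [->|h] := eqVneq (ww (mi p) (invmx P *m x)) 0; first by rewrite mulr0 mulr0.
  have : F p; last by rewrite Fp.
  apply: (gF x) => //; rewrite /uw mulf_neq0 //.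
  by rewrite fmorph_eq0 invr_eq0 gt_eqF // sqrtr_gt0.
move=> k [_ /= /eqP k0].
have [g0|g0] := eqVneq (g (x + latpt P k)) 0.
  by rewrite g0 big1 ?mulr0 // => p _; case: (F p); rewrite ?mul0r ?mulr0.
have S1 := sum_ww (- k) (gM _ g0).
rewrite oppr_eq0 (negbTE k0) in S1.
rewrite (eq_bigr (fun p => g (x + latpt P k) * (`|\det P|^-1)%:C%C * (ww (mi p) (invmx P *m (x + latpt P k)) * ww (mi p) (invmx P *m x)))).
  rewrite -mulr_sumr; have -> : \sum_(p : T * bool) ww (mi p) (invmx P *m (x + latpt P k)) * ww (mi p) (invmx P *m x) = 0.
    rewrite -[RHS]S1; apply: eq_bigr => p _; congr (_ * ww _ _).
    by rewrite mulmxDr /latpt mulKmx // map_mxN addrK.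
  by rewrite !mulr0.
move=> p _; case Fp: (F p).
  rewrite /uw; set a := _%:C%C; set c := ww _ _; set d := ww _ _.
  have -> : (`|\det P|^-1)%:C%C = a * a by rewrite /a -rmorphM -invfM -expr2 sqr_sqrtr ?ltW.
  by ring.
have [->|h] := eqVneq (ww (mi p) (invmx P *m (x + latpt P k))) 0; first by rewrite mul0r mulr0.
have : F p; last by rewrite Fp.
apply: (gF (x + latpt P k)) => //; rewrite /uw mulf_neq0 //.
by rewrite fmorph_eq0 invr_eq0 gt_eqF // sqrtr_gt0.
Qed.

End wilson.

(** * Translation-invariant spaces *)

Section frames.
Context (R : realType) (n : nat).
Local Notation normc := (@Normc.normc R).
Local Notation lam := (@lebesgue_cV R n.+1).
Local Notation fn := ('cV[R]_n.+1 -> R[i]).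

Lemma test_L2 (g : fn) : test g -> L2 g.
Proof. by move=> /invertible_test/invertible_L2. Qed.

Lemma test_ift_L2 (g : fn) : test g -> L2 (ift g).
Proof. by move=> /invertible_test/invertible_ift_L2. Qed.

Lemma closed_subspace_sum (V : set fn) I (r : seq I) (F : I -> fn) : closed_subspace V ->
  (forall i, V (F i)) -> V (fun x => \sum_(i <- r) F i x).
Proof.
move=> [_ V0 Vlin _] VF; elim: r => [|i r ih]; first by under eq_fun do rewrite big_nil.
by have := Vlin 1 _ _ (VF i) ih; congr V; apply/funext => x; rewrite big_cons mul1r.
Qed.

Lemma closed_subspaceZ (V : set fn) a f : closed_subspace V -> V f -> V (fun x => a * f x).
Proof.
move=> [_ V0 Vlin _] Vf; have := Vlin a _ _ Vf V0.
by congr V; apply/funext => x; rewrite addr0.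
Qed.

Lemma span_closure_sub I (D : set I) (e : I -> fn) (V : set fn) : closed_subspace V ->
  (forall i, D i -> V (e i)) -> L2_closure (lin_span D e) `<=` V.
Proof.
move=> cV eV; have [VL _ _ VK] := cV.
have sV : lin_span D e `<=` V.
  by move=> _ [m [i [c [hi ->]]]]; apply: closed_subspace_sum => // k; apply: closed_subspaceZ => //; exact: eV.
by move=> f /(L2_closure_mono sV); exact: VK.
Qed.

(** Spans on the frequency side, by modulates. [TS] is the span of the corresponding translates;
    [ift] carries one to the other with [y] replaced by [- y]. *)
Definition FS (G : set 'cV[R]_n.+1) (J : Type) (u : J -> fn) :=
  lin_span [set p : 'cV[R]_n.+1 * J | G p.1] (fun p xi => ew p.1 xi * u p.2 xi).

Definition TS (G : set 'cV[R]_n.+1) (J : Type) (u : J -> fn) :=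
  lin_span [set p : 'cV[R]_n.+1 * J | G p.1] (fun p => translate p.1 (ift (u p.2))).

Definition duals (P : 'M[R]_n.+1) : set 'cV[R]_n.+1 := [set dual P k | k in setT].

Lemma test_ewM y (g : fn) : test g -> test (fun xi => ew y xi * g xi).
Proof. by move=> tg; apply: testMl => //; exact: csmooth_ew. Qed.

Lemma FS_test G J (u : J -> fn) f : (forall j, test (u j)) -> FS G u f -> test f.
Proof.
move=> tu [m [i [c [hi ->]]]]; apply: test_sum => k; apply: testZ; exact: test_ewM.
Qed.

Lemma translateE y (g : fn) : translate y (ift g) = ift (fun xi => ew (- y) xi * g xi).
Proof. by rewrite translate_ift; congr ift; apply/funext => xi; rewrite mulrC. Qed.

Lemma translate_L2 y (g : fn) : test g -> L2 (translate y (ift g)).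
Proof. by move=> tg; rewrite translateE; apply: test_ift_L2; exact: test_ewM. Qed.

Lemma TS_L2 G J (u : J -> fn) : (forall j, test (u j)) -> TS G u `<=` L2.
Proof. by move=> tu; apply: lin_span_L2 => -[y j] _; exact: translate_L2. Qed.

Lemma TS_closed G J (u : J -> fn) : (forall j, test (u j)) -> closed_subspace (L2_closure (TS G u)).
Proof. by move=> tu; apply: closed_span => -[y j] _; exact: translate_L2. Qed.

Lemma FS_L2 G J (u : J -> fn) : (forall j, test (u j)) -> FS G u `<=` L2.
Proof. by move=> tu f /(FS_test tu) /test_L2. Qed.

Lemma FS_closed G J (u : J -> fn) : (forall j, test (u j)) -> closed_subspace (L2_closure (FS G u)).
Proof. by move=> tu; apply: closed_span => -[y j] _; apply: test_L2; exact: test_ewM. Qed.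

Lemma ift_sum I (r : seq I) (F : I -> fn) x : (forall i, test (F i)) ->
  ift (fun xi => \sum_(i <- r) F i xi) x = \sum_(i <- r) ift (F i) x.
Proof.
move=> tF; elim: r => [|i r ih].
  rewrite big_nil /ift (_ : (fun xi => _) = fun=> 0) ?cint0 //.
  by apply/funext => xi; rewrite big_nil mul0r.
rewrite big_cons -ih -iftD; [|exact: test_cintegrable|by apply: test_cintegrable; exact: test_sum].
by congr (ift _ x); apply/funext => xi; rewrite big_cons.
Qed.

Lemma closure_ift (G : set 'cV[R]_n.+1) J (u : J -> fn) g : (forall y, G y -> G (- y)) ->
  (forall j, test (u j)) -> test g -> L2_closure (FS G u) g -> L2_closure (TS G u) (ift g).
Proof.
move=> GN tu tg /(L2_closureP _ (@FS_L2 G J u tu))[_ cg].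
apply/(L2_closureP _ (@TS_L2 G J u tu)); split; first exact: test_ift_L2.
move=> e /cg[h Sh gh]; have th := FS_test tu Sh; exists (ift h).
  case: Sh => m [i [c [hi hE]]]; exists m, (fun k => (- (i k).1, (i k).2)), c; split.
    by move=> k; apply: GN; exact: hi.
  apply/funext => x; rewrite hE ift_sum.
    apply: eq_bigr => k _; rewrite translateE opprK iftZ //.
    by apply: test_cintegrable; exact: test_ewM.
  by move=> k; apply: testZ; exact: test_ewM.
by rewrite nsq_ift_B //; exact: invertible_test.
Qed.

Lemma nsq_mulmx (P : 'M[R]_n.+1) (f : fn) : P \in unitmx -> L2 f ->
  L2 (fun x => f (P *m x)) /\ nsq (fun x => f (P *m x)) = `|\det P|^-1 * nsq f.
Proof.
move=> uP Lf; have i1 : cintegrable lam (fun x => (normc (f x) ^+ 2)%:C%C).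
  have := cintegrable_inner Lf Lf; congr cintegrable; apply/funext => x.
  by rewrite mulc_conj.
have [i2 e2] := cint_mulmx uP i1; split.
  apply/L2P; split; last by have [] := i2.
  by apply: cmeas_comp (L2_cmeas Lf) _; exact: measurable_mulmx.
by apply: complexI; rewrite rmorphM -[X in _ * X]cint_real -e2 -[LHS]cint_real.
Qed.

(** The substitution [P *m x] turns a P Z^n-periodic factor into a Z^n-periodic one and the dual
    lattice into Z^n, where [periodic_mul_closure] applies. *)
Lemma per_mul_closure (P : 'M[R]_n.+1) (s u : fn) : P \in unitmx -> periodic P s ->
  csmooth s -> test u ->
  L2_closure (lin_span (duals P) (fun y xi => ew y xi * u xi)) (fun xi => s xi * u xi).
Proof.
move=> uP ps ss tu; have uPi : invmx P \in unitmx by rewrite unitmx_inv.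
have tu' := test_mulmx uP tu.
have ps' : periodic1 (fun x => s (P *m x)) by move=> k x; rewrite mulmxDr -[P *m map_mx _ _]/(latpt P k) ps.
have ss' := csmooth_ccontinuous (csmooth_mulmx P ss).
have eL : forall k, int_lattice k -> L2 (fun xi : 'cV[R]_n.+1 => ew k xi * u (P *m xi)).
  by move=> k _; apply: test_L2; exact: test_ewM.
have eL2 : forall k, duals P k -> L2 (fun xi => ew k xi * u xi).
  by move=> k _; apply: test_L2; exact: test_ewM.
have /(L2_closureP _ (lin_span_L2 eL))[_ cl] := periodic_mul_closure ps' ss' (test_L2 tu').
apply/(L2_closureP _ (lin_span_L2 eL2)); split.
  by apply: test_L2; exact: testMl.
have det0 : 0 < `|\det P| by rewrite normr_gt0 -unitfE -unitmxE.
move=> e e0; have [|h [m [k [c [hk hE]]]] hd] := cl (e / `|\det P|); first exact: divr_gt0.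
have /choice[l hl] : forall i, exists l : 'cV[int]_n.+1, map_mx intr l = k i.
  by move=> i; have [l _ <-] := hk i; exists l.
pose h' xi := \sum_i c i * (ew (dual P (l i)) xi * u xi).
have hP x : h' (P *m x) = h x.
  rewrite hE; apply: eq_bigr => i _; congr (_ * (_ * _)).
  by rewrite -hl /ew /dual /latpt dot_mulmx mulmxA -trmx_mul mulVmx // trmx1 mul1mx.
have Sh' : lin_span (duals P) (fun y xi => ew y xi * u xi) h'.
  by exists m, (fun i => dual P (l i)), c; split => // i; exists (l i).
exists h' => //; move: hd.
rewrite (_ : (fun x => _ - h x) = fun x => (fun y => s y * u y - h' y) (P *m x)); last first.
  by apply/funext => x; rewrite hP.
have L' : L2 (fun y => s y * u y - h' y).
  by apply: L2B; [apply: test_L2; exact: testMl|exact: (lin_span_L2 eL2 Sh')].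
have [_ ->] := nsq_mulmx uP L'.
by rewrite mulrC ltr_pM2r // invr_gt0.
Qed.

Lemma frame_closure (P : 'M[R]_n.+1) (J : finType) (s u : J -> fn) : P \in unitmx ->
  (forall j, periodic P (s j)) -> (forall j, csmooth (s j)) -> (forall j, test (u j)) ->
  L2_closure (FS (duals P) u) (fun xi => \sum_j s j xi * u j xi).
Proof.
move=> uP ps ss tu; apply: (closed_subspace_sum _ (FS_closed (duals P) tu)) => j.
have := per_mul_closure uP (ps j) (ss j) (tu j); apply: L2_closure_mono.
by move=> _ [m [k [c [hk ->]]]]; exists m, (fun i => (k i, j)), c.
Qed.

Lemma dual1 (k : 'cV[int]_n.+1) : dual 1%:M k = map_mx intr k :> 'cV[R]_n.+1.
Proof. by rewrite /dual /latpt invmx1 trmx1 mul1mx. Qed.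

Lemma duals1 : duals 1%:M = int_lattice.
Proof.
by apply/seteqP; split => x [k _ <-]; exists k => //; rewrite dual1.
Qed.

Let u1 : (1%:M : 'M[R]_n.+1) \in unitmx := unitmx1 R n.+1.

(** The difference of the two sides lies in the closed span, by [frame_closure], and has zero
    brackets with all generators, so it is orthogonal to itself. Being a test function it vanishes
    everywhere, not only almost everywhere. *)
Lemma frame_resolution (J : finType) (chi : J -> fn) g : (forall j, test (chi j)) ->
  ONsys 1%:M chi -> test g -> L2_closure (FS int_lattice chi) g ->
  forall x, g x = \sum_j per 1%:M (fun y => g y * conjc (chi j y)) x * chi j x.
Proof.
move=> tc oc tg cg; pose s j := per 1%:M (fun y => g y * conjc (chi j y)).
have tgc j : test (fun y => g y * conjc (chi j y)) by exact: test_conjM.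
have ss j : csmooth (s j) by exact: csmooth_per.
have ps j : periodic 1%:M (s j) by exact: per_periodic.
pose g' x := \sum_j s j x * chi j x.
have tg' : test g' by apply: test_sum => j; exact: testMl.
have cg' : L2_closure (FS int_lattice chi) g' by rewrite -duals1; exact: frame_closure.
have tD : test (fun x => g x - g' x) by exact: testB.
have cD : L2_closure (FS int_lattice chi) (fun x => g x - g' x).
  have [_ _ lin _] := FS_closed int_lattice tc; have := lin (-1) _ _ cg' cg.
  by congr (L2_closure _ _); apply/funext => x; rewrite mulN1r addrC.
have D0 j x : per 1%:M (fun y => (g y - g' y) * conjc (chi j y)) x = 0.
  have tg'c : test (fun y => g' y * conjc (chi j y)) by exact: test_conjM.
  rewrite (_ : (fun y => _) = fun y => g y * conjc (chi j y) + (-1) * (g' y * conjc (chi j y))); last first.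
    by apply/funext => y; ring.
  have [_ b1] := tgc j; have [_ b2] := tg'c.
  rewrite perD //; last by have [] := testZ (-1) tg'c.
  rewrite perZ // mulN1r.
  rewrite [X in _ - X](_ : _ = s j x); first by rewrite subrr.
  rewrite (_ : (fun y => g' y * _) = fun y => \sum_i s i y * (chi i y * conjc (chi j y))); last first.
    by apply/funext => y; rewrite mulr_suml; apply: eq_bigr => i _; rewrite mulrA.
  have bij i : bsupp (fun y => chi i y * conjc (chi j y)) by have [] := test_conjM (tc i) (tc j).
  rewrite per_sum //; last by move=> i; exact: bsuppMr.
  rewrite (bigD1 j) //= per_mull // oc eqxx det1 normr1 invr1 mulr1 big1 ?addr0 // => i ij.
  by rewrite per_mull // oc (negbTE ij) mulr0.
have : inner (fun x => g x - g' x) (fun x => g x - g' x) = 0.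
  apply: (inner_closure_eq0 (@FS_L2 _ _ _ tc) (test_L2 tD) _ cD) => _ [m [i [c [hi ->]]]].
  have Le k : L2 (fun xi => ew (i k).1 xi * chi (i k).2 xi) by apply: test_L2; exact: test_ewM.
  rewrite inner_suml ?big1 //; try exact: test_L2.
    move=> k _; rewrite innerZl //; last exact: test_L2.
    rewrite innerC innerE; have [l _ <-] := hi k.
    rewrite (_ : cint _ _ = 0) ?conjc0 ?mulr0 //.
    rewrite -[RHS](@cint_per0 R n.+1 _ (chi0_test R n) (@per_chi0 R n) _ l (test_conjM tD (tc (i k).2)) (D0 _)).
    by congr cint; apply/funext => x; rewrite cjM; ring.
  by move=> k _; exact: L2Z.
rewrite inner_self => /complexI /(test_nsq0 tD) h x.
by apply/eqP; rewrite -subr_eq0; apply/eqP; exact: h.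
Qed.

End frames.

(** * Linear algebra and lattices *)

Section diagonalization.
Variable F : realFieldType.

Definition qform m (S : 'M[F]_m) (x : 'cV[F]_m) : F := (x^T *m S *m x) 0 0.

(** Completing the square and passing to the Schur complement. No square root is extracted, so over
    the rationals the change of basis stays rational. *)
Lemma posdef_diag m (S : 'M[F]_m) : S^T = S -> (forall x, x != 0 -> 0 < qform S x) ->
  exists2 T : 'M[F]_m, T \in unitmx & exists2 d : 'rV[F]_m, T^T *m S *m T = diag_mx d &
    forall i, 0 < d 0 i.
Proof.
elim: m S => [|m ih] S sS pS.
  exists 1%:M; first exact: unitmx1.
  by exists 0; [apply/matrixP => -[]|case].
change 'M[F]_(1 + m) in S.
pose a := S 0 0; pose b := dlsubmx S; pose D := drsubmx S.
have a0 : 0 < a.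
  have := pS (delta_mx 0 0); rewrite /qform trmx_delta -rowE -colE !mxE; apply.
  apply/negP => /eqP /matrixP /(_ 0 0); rewrite !mxE !eqxx => /eqP; rewrite oner_eq0 //.
have SE : S = block_mx a%:M b^T b D.
  rewrite -[LHS](@submxK _ 1 m 1 m); congr block_mx.
    apply/matrixP => i j; rewrite !ord1 !mxE eqxx mulr1n /a; congr (S _ _); exact: ord_inj.
  by rewrite /b trmx_dlsub sS.
pose T1 : 'M[F]_(1 + m) := block_mx 1%:M (- (a^-1 *: b^T)) 0 1%:M.
pose S' := D - a^-1 *: (b *m b^T).
have DT : D^T = D by rewrite /D trmx_drsub sS.
have T1T : T1^T = block_mx 1%:M 0 (- (a^-1 *: b)) 1%:M.
  rewrite /T1 tr_block_mx !trmx1 trmx0; congr block_mx.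
  by apply/matrixP => i j; rewrite !mxE.
have T1E : T1^T *m S *m T1 = block_mx a%:M 0 0 S'.
  rewrite T1T SE /T1 !mulmx_block.
  rewrite !mul1mx !mulmx1 !mul0mx !mulmx0 !addr0.
  rewrite !mulNmx !mulmxN -!scalemxAl -!scalemxAr !mul_scalar_mx !mul_mx_scalar.
  rewrite !scalerA !mulVf ?gt_eqF // !scale1r !addNr mul0mx.
  by rewrite scaler0 oppr0 add0r /S' addrC.
have uT1 : T1 \in unitmx.
  by rewrite unitmxE det_ublock !det1 mulr1 unitr1.
have S'S : S'^T = S' by rewrite /S' linearB /= linearZ /= trmx_mul trmxK DT.
have pS' x : x != 0 -> 0 < qform S' x.
  move=> x0; pose y : 'cV[F]_(1 + m) := T1 *m col_mx 0 x.
  have y0 : y != 0.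
    apply: contra x0 => /eqP /(congr1 (mulmx (invmx T1))).
    rewrite mulmx0 /y mulKmx // -(@col_mx0 _ 1 m 1) => /eq_col_mx[_ ->] //.
  have := pS y y0; rewrite /qform /y trmx_mul mulmxA -[_ *m T1^T *m S *m T1]mulmxA.
  rewrite -!mulmxA [T1^T *m (S *m _)]mulmxA [_ *m (T1 *m _)]mulmxA T1E.
  by rewrite mul_block_col !mul0mx !mulmx0 !add0r tr_col_mx mul_row_col trmx0 mul0mx add0r mulmxA.
have [T' uT' [d dE dp]] := ih S' S'S pS'.
exists (T1 *m block_mx 1%:M 0 0 T').
  by rewrite unitmx_mul uT1 /= unitmxE (@det_ublock _ 1 m) det1 mul1r -unitmxE.
exists (row_mx a%:M d).
  rewrite trmx_mul -!mulmxA [S *m (_ *m _)]mulmxA [T1^T *m (_ *m _)]mulmxA [T1^T *m (S *m _)]mulmxA T1E.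
  rewrite (@tr_block_mx _ 1 m 1 m) !trmx1 !trmx0 !(@mulmx_block _ 1 m 1 m 1 m) !mul1mx !mulmx1 !mul0mx !mulmx0 !addr0 !add0r.
  rewrite mulmxA dE; transitivity (diag_mx (row_mx a%:M d : 'rV_(1 + m))); last by [].
  have E : a%:M = diag_mx (a%:M : 'rV[F]_1).
    by apply/matrixP => i j; rewrite !ord1 !mxE eqxx.
  by rewrite diag_mx_row mulmx0 -E.
move=> i; case: (split_ordP (i : 'I_(1 + m))) => j ->.
  by rewrite (@row_mxEl _ 1 1 m) !ord1 mxE eqxx.
by rewrite (@row_mxEr _ 1 1 m).
Qed.

End diagonalization.

Lemma common_denominator (I : finType) (f : I -> rat) : exists2 N : int, N != 0 &
  forall i, exists z : int, N%:~R * f i = z%:~R.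
Proof.
exists (\prod_i denq (f i)); first by apply/prodf_neq0 => i _; exact: denq_neq0.
move=> i; exists (numq (f i) * \prod_(j | j != i) denq (f j)).
rewrite (bigD1 i) //= !intrM mulrAC; congr (_ * _).
by rewrite -{2}(divq_num_den (f i)) mulrC divfK // intr_eq0 denq_neq0.
Qed.

(** * Powers of the inverse of an expansive matrix, and a contracted rational form *)

Section contraction.
Context (R : realType).
Local Notation normc := (@Normc.normc R).

Lemma cvg_affine_rec (x b : nat -> R) (r : R) : 0 <= r < 1 -> (forall k, 0 <= x k) ->
  (forall k, x k.+1 <= r * x k + b k) -> b @ \oo --> 0 -> x @ \oo --> 0.
Proof.
move=> /andP[r0 r1] x0 hx /cvgrPdist_le hb; apply/cvgrPdist_le => e e0.
have r1' : 0 < 1 - r by rewrite subr_gt0.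
have [N _ hN] := hb (e / 2 * (1 - r)) (mulr_gt0 (divr_gt0 e0 (ltr0n _ 2)) r1').
have h j : x (N + j)%N <= e / 2 + r ^+ j * x N.
  elim: j => [|j ih]; first by rewrite addn0 expr0 mul1r lerDr divr_ge0 // ltW.
  rewrite addnS; apply: le_trans (hx _) _; have := hN (N + j)%N (leq_addr _ _).
  rewrite /= sub0r normrN => /(le_trans (ler_norm _)) h1.
  have := ler_wpM2l r0 ih; rewrite exprS mulrDr mulrA => h2.
  apply: le_trans (lerD h2 h1) _; rewrite le_eqVlt; apply/orP; left; apply/eqP; ring.
have hr : (fun j => r ^+ j * x N) @ \oo --> 0.
  have hc : (fun j => r ^+ j) @ \oo --> 0 by apply: cvg_expr; rewrite ger0_norm.
  by have hM := cvgM hc (@cvg_cst _ (x N) _ \oo _); rewrite mul0r in hM; exact: hM.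
have [J _ hJ] := (cvgrPdist_le _ _).1 hr (e / 2) (divr_gt0 e0 (ltr0n _ 2)).
exists (N + J)%N => //= k hk; rewrite sub0r normrN ger0_norm //.
have -> : k = (N + (k - N))%N by rewrite subnKC // (leq_trans _ hk) // leq_addr.
apply: le_trans (h _) _.
have hk' : (J <= k - N)%N by rewrite leq_subRL // (leq_trans _ hk) // leq_addr.
have := hJ _ hk'; rewrite /= sub0r normrN => /(le_trans (ler_norm _)) h1.
by apply: le_trans (lerD (lexx _) h1) _; rewrite -splitr.
Qed.

(** Induction on the roots: removing the root [l] gives [x_(k+1) = l x_k + y_k], where [y_k] tends
    to 0 by induction. This replaces the Jordan normal form. *)
Lemma horner_decay n (C : 'M[R[i]]_n.+1) (s : seq R[i]) (Y : 'M[R[i]]_n.+1) :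
  (forall l, l \in s -> normc l < 1) ->
  horner_mx C (\prod_(l <- s) ('X - l%:P)) *m Y = 0 ->
  forall i j, (fun k => normc ((C ^+ k *m Y) i j)) @ \oo --> 0.
Proof.
elim: s Y => [|l s ih] Y hs.
  rewrite big_nil rmorph1 mul1mx => -> i j.
  rewrite (_ : (fun k => _) = fun=> 0); first exact: cvg_cst.
  by apply/funext => k; rewrite mulmx0 mxE Normc.normc0.
rewrite big_cons mulrC rmorphM /= -mulmxE -mulmxA => h i j.
have hl : normc l < 1 by apply: hs; rewrite inE eqxx.
have ih' : forall i j, (fun k => normc ((C ^+ k *m (horner_mx C ('X - l%:P) *m Y)) i j)) @ \oo --> 0.
  by apply: ih => // l' hl'; apply: hs; rewrite inE hl' orbT.
apply: (@cvg_affine_rec _ (fun k => normc ((C ^+ k *m (horner_mx C ('X - l%:P) *m Y)) i j)) (normc l)).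
- by rewrite normc_ge0.
- by move=> k; exact: normc_ge0.
- move=> k; rewrite -Normc.normcM; apply: le_trans (le_normcD _ _).
  rewrite le_eqVlt; apply/orP; left; apply/eqP; congr (normc _).
  have -> : C ^+ k.+1 *m Y = l *: (C ^+ k *m Y) + C ^+ k *m (horner_mx C ('X - l%:P) *m Y).
    rewrite rmorphB /= horner_mx_X horner_mx_C mulmxBl mulmxBr mul_scalar_mx -scalemxAr.
    by rewrite !mulmxE mulrA -exprSr addrC subrK.
  by rewrite mxE [X in X + _]mxE.
- exact: ih'.
Qed.

(** The eigenvalues of the complexified inverse are inverses of those of [A], hence of modulus below
    1; Cayley-Hamilton supplies the polynomial relation that [horner_decay] takes. *)
Lemma expansive_decay n (A : 'M[R]_n.+1) : expansive A ->
  A \in unitmx /\ forall i j, (fun k => `|(invmx A ^+ k) i j|) @ \oo --> 0.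
Proof.
move=> eA; pose Ac := map_mx (fun a : R => a%:C%C) A.
have uAc : Ac \in unitmx.
  rewrite unitmxE unitfE; apply/negP => /det0P[v v0 vA].
  have : eigenvalue Ac 0 by apply/eigenvalueP; exists v => //; rewrite scale0r.
  by move=> /eA; rewrite normr0 ltr10.
have uA : A \in unitmx by move: uAc; rewrite map_unitmx.
split=> // i j; pose C := invmx Ac.
have [s sE] := closed_field_poly_normal (char_poly C).
have mon : lead_coef (char_poly C) = 1 by apply/monicP; exact: char_poly_monic.
rewrite mon scale1r in sE.
have hs l : l \in s -> normc l < 1.
  move=> ls; have : root (char_poly C) l by rewrite sE root_prod_XsubC.
  rewrite -eigenvalue_root_char => /eigenvalueP[v vC v0].
  have vE : v = l *: (v *m Ac) by rewrite scalemxAl -vC mulmxKV.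
  have l0 : l != 0 by apply: contra v0 => /eqP l0; rewrite vE l0 scale0r.
  have : eigenvalue Ac l^-1.
    by apply/eigenvalueP; exists v => //; rewrite {2}vE scalerA mulVf // scale1r.
  move/eA; rewrite normfV invf_gt1 ?normr_gt0 // normc_normr.
  by rewrite -[1]/(1%:C%C) ltcR.
have CH : horner_mx C (\prod_(l <- s) ('X - l%:P)) *m 1%:M = 0.
  by rewrite -sE Cayley_Hamilton mul0mx.
rewrite (_ : (fun k => _) = fun k => normc ((C ^+ k *m 1%:M) i j)); first exact: (horner_decay hs CH).
apply/funext => k; rewrite mulmx1 /C /Ac -map_invmx -rmorphXn mxE normc_real //.
Qed.

Lemma mx_entries_cvg m (X : nat -> 'M[R]_m) : (forall i j, (fun k => `|X k i j|) @ \oo --> 0) ->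
  forall e : R, 0 < e -> exists N, forall k, (N <= k)%N -> forall i j, `|X k i j| <= e.
Proof.
move=> h e e0.
have hk : \forall k \near \oo, forall i, forall j, `|X k i j| <= e.
  apply: filter_forall => i; apply: filter_forall => j.
  have /cvgrPdist_le /(_ _ e0) := h i j; apply: filterS => k.
  by rewrite sub0r normrN normr_id.
by have [N _ hN] := hk; exists N => k Nk; exact: hN.
Qed.

Lemma dot_mulmx_small m (X : 'M[R]_m.+1) : (forall i j, `|X i j| <= (2 * (m.+1%:R ^+ 2))^-1) ->
  forall x, dot (X *m x) (X *m x) <= dot x x / 2.
Proof.
move=> hX x; set e := (2 * _)^-1 in hX; have e0 : 0 <= e by rewrite invr_ge0 mulr_ge0 ?exprn_ge0 ?ler0n.
have d0 : 0 <= dot x x by rewrite sumr_ge0 // => i _; rewrite -expr2 sqr_ge0.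
have hx j : `|x j 0| <= Num.sqrt (dot x x).
  rewrite -sqrtr_sqr ler_wsqrtr // /dot (bigD1 j) //= expr2 lerDl sumr_ge0 // => k _.
  by rewrite -expr2 sqr_ge0.
have hy i : `|(X *m x) i 0| <= m.+1%:R * e * Num.sqrt (dot x x).
  rewrite mxE (le_trans (ler_norm_sum _ _ _)) // -mulrA mulr_natl -[X in _ *+ X]card_ord -sumr_const.
  by apply: ler_sum => j _; rewrite normrM ler_pM.
have : dot (X *m x) (X *m x) <= \sum_(i < m.+1) (m.+1%:R * e) ^+ 2 * dot x x.
  apply: ler_sum => i _; rewrite -expr2 -real_normK ?num_real // -[X in _ <= _ * X]sqr_sqrtr // -exprMn.
  by rewrite lerXn2r ?nnegrE ?mulr_ge0 ?sqrtr_ge0 ?ler0n.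
move/le_trans; apply; rewrite sumr_const card_ord -mulrnAl mulrC ler_wpM2l //.
rewrite -mulr_natr /e; have : 1 <= m.+1%:R :> R by rewrite ler1n.
move: (m.+1%:R) => t t1; have t0 : 0 < t by apply: lt_le_trans t1.
have -> : (t * (2 * t ^+ 2)^-1) ^+ 2 * t = (4 * t)^-1 by field; rewrite gt_eqF.
rewrite lef_pV2 ?posrE ?mulr_gt0 //; lra.
Qed.

(* The form is [sum_(k < K) |A^(-T k) x|^2]: rational, hence diagonal in a rational basis. *)
Lemma contractive_lattice n (A : 'M[R]_n.+1) : expansive A ->
  (forall i j, exists q : rat, A i j = ratr q) ->
  exists (P : 'M[R]_n.+1) (Pz PBz : 'M[int]_n.+1) (d : 'I_n.+1 -> R) (rho : R),
  [/\ A \in unitmx, P \in unitmx, P = map_mx intr Pz, A^T *m P = map_mx intr PBz &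
     (forall i, 0 < d i) /\ 0 < rho < 1 /\
     forall z : 'cV[R]_n.+1, \sum_i d i * ((invmx P *m (invmx A^T *m (P *m z))) i 0) ^+ 2 <=
       rho * \sum_i d i * (z i 0) ^+ 2].
Proof.
move=> eA Arat; have [uA dec] := expansive_decay eA.
have /choice[a0 ha0] : forall ij : 'I_n.+1 * 'I_n.+1, exists q : rat, A ij.1 ij.2 = ratr q.
  by move=> ij; exact: Arat.
pose A0 : 'M[rat]_n.+1 := \matrix_(i, j) a0 (i, j).
have AE : A = map_mx ratr A0 by apply/matrixP => i j; rewrite !mxE -(ha0 (i, j)).
have uA0 : A0 \in unitmx by move: uA; rewrite AE map_unitmx.
pose C0 := invmx A0^T; pose C := invmx A^T.
have CE : C = map_mx ratr C0 by rewrite /C /C0 map_invmx AE; congr invmx; apply/matrixP => i j; rewrite !mxE.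
have e0 : 0 < (2 * (n.+1%:R ^+ 2))^-1 :> R by rewrite invr_gt0 mulr_gt0 ?exprn_gt0 ?ltr0n.
have [N hN] := mx_entries_cvg dec e0.
pose K := N.+1.
have CK i j : `|(C ^+ K) i j| <= (2 * (n.+1%:R ^+ 2))^-1.
  have trX k : C ^+ k = (invmx A ^+ k)^T.
    elim: k => [|k ih]; first by rewrite !expr0 trmx1.
    by rewrite exprS exprSr -!mulmxE trmx_mul ih trmx_inv.
  rewrite trX mxE; exact: hN.
pose S0 : 'M[rat]_n.+1 := \sum_(k < K) (C0 ^+ k)^T *m C0 ^+ k.
pose Q (x : 'cV[R]_n.+1) := \sum_(k < K) dot (C ^+ k *m x) (C ^+ k *m x).
have dd0 (x : 'cV[R]_n.+1) : 0 <= dot x x by rewrite sumr_ge0 // => i _; rewrite -expr2 sqr_ge0.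
(* The sum telescopes: [Q (C x) = Q x - |x|^2 + |C^K x|^2], and [K] was chosen so that the last term
   is at most half of [|x|^2]. *)
have QC x : Q (C *m x) <= Q x - dot x x / 2.
  have E : Q (C *m x) + dot x x = Q x + dot (C ^+ K *m x) (C ^+ K *m x).
    rewrite /Q big_ord_recr [in RHS]big_ord_recl /= expr0 mul1mx.
    have h k : C ^+ k *m (C *m x) = C ^+ k.+1 *m x by rewrite mulmxA mulmxE -exprSr.
    rewrite h addrAC [X in X + _ = _]addrC; congr (_ + _ + _).
    by apply: eq_bigr => k _; rewrite h.
  have := dot_mulmx_small CK x; move: E; lra.
have qS0 y : qform S0 y = \sum_(k < K) \sum_i ((C0 ^+ k *m y) i 0) ^+ 2.
  rewrite /qform /S0 mulmx_sumr mulmx_suml summxE; apply: eq_bigr => k _.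
  rewrite mulmxA -trmx_mul -mulmxA mxE; apply: eq_bigr => i _.
  by rewrite mxE expr2.
have S0T : S0^T = S0.
  by rewrite /S0 linear_sum; apply: eq_bigr => k _; rewrite /= trmx_mul trmxK.
have pS0 y : y != 0 -> 0 < qform S0 y.
  move=> y0; rewrite qS0 big_ord_recl /= expr0 mul1mx ltr_pwDl //; last first.
    by apply: sumr_ge0 => k _; apply: sumr_ge0 => i _; exact: sqr_ge0.
  rewrite lt_neqAle eq_sym sumr_ge0 ?andbT; last by move=> i _; exact: sqr_ge0.
  apply: contra y0 => /eqP /psumr_eq0P h; apply/eqP/matrixP => i j; rewrite ord1 mxE.
  by apply/eqP; rewrite -sqrf_eq0; apply/eqP; apply: h => // k _; exact: sqr_ge0.
have [T uT [d0 dE dp]] := posdef_diag S0T pS0.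
(* One denominator for the entries of [T] and of [A0^T T], so that multiplying [T] by it makes both
   [P] and [A^T P] integral. *)
have [N1 N10 hN1] := common_denominator (fun p : bool * ('I_n.+1 * 'I_n.+1) =>
  if p.1 then T p.2.1 p.2.2 else (A0^T *m T) p.2.1 p.2.2).
have /choice[z1 hz1] : forall p : 'I_n.+1 * 'I_n.+1, exists z : int, N1%:~R * T p.1 p.2 = z%:~R.
  by move=> p; exact: (hN1 (true, p)).
have /choice[z2 hz2] : forall p : 'I_n.+1 * 'I_n.+1, exists z : int, N1%:~R * (A0^T *m T) p.1 p.2 = z%:~R.
  by move=> p; exact: (hN1 (false, p)).
have N1R : (N1%:~R : rat) != 0 by rewrite intr_eq0.
pose P0 := (N1%:~R : rat) *: T.
have uP0 : P0 \in unitmx by rewrite unitmxZ // unitfE.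
pose P : 'M[R]_n.+1 := map_mx ratr P0.
have uP : P \in unitmx by rewrite map_unitmx.
pose d i : R := ratr (N1%:~R ^+ 2 * d0 0 i).
have QP z : Q (P *m z) = \sum_i d i * (z i 0) ^+ 2.
  have E (y : 'cV[R]_n.+1) : Q y = (y^T *m map_mx ratr S0 *m y) 0 0.
    rewrite /S0 map_mx_sum mulmx_sumr mulmx_suml summxE; apply: eq_bigr => k _.
    rewrite map_mxM -map_trmx rmorphXn /= -CE mulmxA -trmx_mul -mulmxA.
    by rewrite dotE.
  rewrite E trmx_mul -!mulmxA [map_mx _ S0 *m _]mulmxA [P^T *m _]mulmxA mulmxA.
  have -> : P^T *m (map_mx ratr S0 *m P) = diag_mx (\row_i d i).
    rewrite /P map_trmx -!map_mxM /P0 linearZ /= -!scalemxAr -scalemxAl mulmxA dE scalerA.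
    by apply/matrixP => i j; rewrite !mxE mulrnAr rmorphMn /= -expr2.
  rewrite mxE; apply: eq_bigr => i _; rewrite mul_mx_diag !mxE expr2; ring.
exists P, (\matrix_(i, j) z1 (i, j)), (\matrix_(i, j) z2 (i, j)), d.
(* The loss [|x|^2 / 2] in [QC] is at least [Q x / (2 c)], whence [rho = 1 - 1/(2c)]; taking
   [c >= 1] keeps it positive. *)
have Qc : exists2 c : R, 1 <= c & forall x, Q x <= c * dot x x.
  have /choice[c hc] : forall k : 'I_K, exists c : R, 0 <= c /\ forall x, dot (C ^+ k *m x) (C ^+ k *m x) <= c * dot x x.
    move=> k; have [c c0 hc] := norm_mulmx_le (C ^+ k); exists (n.+1%:R * c ^+ 2); split.
      by rewrite mulr_ge0 ?sqr_ge0.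
    move=> x; rewrite (le_trans (ler_norm _)) // (le_trans (dot_le _ _)) // -mulrA ler_wpM2l //.
    rewrite -expr2 (@le_trans _ _ ((c * `|x|) ^+ 2)) //.
      by rewrite lerXn2r ?nnegrE ?mulr_ge0 // ltW.
    by rewrite exprMn ler_wpM2l ?sqr_ge0 // sqr_norm_le_dot.
  exists (1 + \sum_k c k); first by rewrite lerDl sumr_ge0 // => k _; case: (hc k).
  move=> x; apply: (@le_trans _ _ ((\sum_k c k) * dot x x)).
    by rewrite mulr_suml; apply: ler_sum => k _; case: (hc k).
  by rewrite ler_wpM2r // lerDr.
have [c c1 hc] := Qc; have c0 : 0 < c by apply: lt_le_trans c1.
exists (1 - (2 * c)^-1); split=> //.
- by apply/matrixP => i j; rewrite !mxE (hz1 (i, j)) ratr_int.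
- rewrite AE map_trmx /P -map_mxM; apply/matrixP => i j.
  rewrite [LHS]mxE [RHS]mxE (_ : (\matrix_(i, j) z2 (i, j)) i j = z2 (i, j)); last by rewrite mxE.
  rewrite -(ratr_int R) -(hz2 (i, j)) /=.
  by rewrite /P0 -scalemxAr; congr ratr; rewrite [LHS]mxE.
split; [|split].
- by move=> i; rewrite /d ltr0q mulr_gt0 // exprn_even_gt0.
- have h : 0 < (2 * c)^-1 <= 2^-1.
    by rewrite invr_gt0 mulr_gt0 //= lef_pV2 ?posrE ?mulr_gt0 //; lra.
  by case/andP: h => h1 h2; apply/andP; split; lra.
move=> z; rewrite -!QP mulKVmx //; apply: le_trans (QC _) _.
have := hc (P *m z); move: (Q _) (dot _ _) => q t qt.
rewrite mulrBl mul1r lerD2l lerN2 mulrC ler_pdivrMr ?mulr_gt0 //.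
by rewrite (_ : t / 2 * (2 * c) = c * t) //; field.
Qed.

End contraction.

(** * Subgroups, coset representatives and lattices of full rank *)

Section lattices.
Context (R : realType) (n : nat).
Local Notation V := 'cV[R]_n.+1.

Definition subgroup (G : set V) := G 0 /\ forall x y, G x -> G y -> G (x - y).

Lemma int_lattice_subgroup : subgroup int_lattice.
Proof.
split; first by exists 0 => //; apply/matrixP => i j; rewrite !mxE.
by move=> _ _ [k _ <-] [l _ <-]; exists (k - l) => //; rewrite map_mxB.
Qed.

Lemma subgroupN (G : set V) x : subgroup G -> G x -> G (- x).
Proof. by move=> [G0 GB] Gx; rewrite -sub0r; exact: GB. Qed.

Lemma subgroupD (G : set V) x y : subgroup G -> G x -> G y -> G (x + y).
Proof. by move=> sG Gx Gy; rewrite -[y]opprK; apply: sG.2 => //; exact: subgroupN. Qed.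

(* [rep] enumerates the cosets of [H] in [G]. *)
Definition coset_reps (H G : set V) (q : nat) (rep : 'I_q -> V) :=
  [/\ forall r, G (rep r), forall r r', H (rep r - rep r') -> r = r' &
      forall x, G x -> exists r, H (x - rep r)].

Lemma coset_reps_exist (H G : set V) (T : finType) (c : V -> T) : subgroup H -> subgroup G ->
  (forall x y, G x -> G y -> c x = c y -> H (x - y)) ->
  (forall x y, G x -> G y -> H (x - y) -> c x = c y) ->
  exists q (rep : 'I_q -> V), coset_reps H G rep.
Proof.
move=> sH sG c1 c2.
pose D := [set t : T | `[< exists x, G x /\ c x = t >]]%SET.
have /choice[f hf] : forall t : T, exists x, t \in D -> G x /\ c x = t.
  move=> t; have [|nt] := boolP (t \in D); last by exists 0.
  by rewrite inE => /asboolP[x hx]; exists x.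
exists #|D|, (fun r => f (enum_val r)); split.
- by move=> r; have [] := hf _ (enum_valP r).
- move=> r r' h; have [g1 e1] := hf _ (enum_valP r); have [g2 e2] := hf _ (enum_valP r').
  by apply: enum_val_inj; rewrite -e1 -e2; exact: c2.
move=> x Gx; have cD : c x \in D by rewrite inE; apply/asboolP; exists x.
exists (enum_rank_in cD (c x)); rewrite enum_rankK_in //.
by have [g1 e1] := hf _ cD; exact: c1.
Qed.

(** The class of [x] modulo Z^n is read off from the integer vector [d x], reduced modulo [d]. *)
Lemma residue (d : nat) (G : set V) : (0 < d)%N -> (forall x, G x -> int_lattice (d%:R *: x)) ->
  exists (T : finType) (c : V -> T), (forall x y, G x -> G y -> c x = c y -> int_lattice (x - y)) /\
    (forall x y, G x -> G y -> int_lattice (x - y) -> c x = c y).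
Proof.
move=> d0 Gd; have dR : d%:R != 0 :> R by rewrite pnatr_eq0 -lt0n.
have /choice[z hz] : forall x, exists z : 'cV[int]_n.+1, G x -> map_mx intr z = d%:R *: x.
  move=> x; have [/Gd[z _ hz]|] := pselect (G x); first by exists z.
  by exists 0.
case: d d0 Gd dR z hz => // d _ Gd dR z hz.
exists {ffun 'I_n.+1 -> 'I_d.+1}, (fun x => [ffun i => inord (absz (modz (z x i 0) d.+1%:Z))]); split=> x y Gx Gy.
  move=> /ffunP h; have hi i : modz (z x i 0) d.+1%:Z = modz (z y i 0) d.+1%:Z.
    have := h i; rewrite !ffunE => /(congr1 val); rewrite /= !inordK; first by lia.
      by lia.
    by lia.
  have /choice[w hw] : forall i, exists w, z x i 0 - z y i 0 = w * d.+1%:Z.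
    move=> i; apply/dvdzP; rewrite -eqz_mod_dvd; exact/eqP.
  exists (\col_i w i) => //; apply/matrixP => i j; rewrite ord1 !mxE.
  have h1 := congr1 (fun v : 'cV[R]_n.+1 => v i 0) (hz x Gx).
  have h2 := congr1 (fun v : 'cV[R]_n.+1 => v i 0) (hz y Gy).
  rewrite !mxE in h1 h2; apply: (mulfI dR); rewrite mulrBr -h1 -h2 -intrB hw intrM mulrC.
  by congr (_ * _).
move=> [w _ hw]; apply/ffunP => i; rewrite !ffunE; congr inord; congr absz.
apply/eqP; rewrite eqz_mod_dvd; apply/dvdzP; exists (w i 0).
have h1 := congr1 (fun v : 'cV[R]_n.+1 => v i 0) (hz x Gx).
have h2 := congr1 (fun v : 'cV[R]_n.+1 => v i 0) (hz y Gy).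
have h3 := congr1 (fun v : 'cV[R]_n.+1 => v i 0) hw.
rewrite !mxE in h1 h2 h3; apply: (@intr_inj R); rewrite intrB h1 h2 -mulrBr -h3 intrM mulrC.
by congr (_ * _).
Qed.

(* Cosets of a group containing the integer lattice are told apart by the set of
   integer-lattice classes they meet. *)
Lemma coset_reps_lattice (d : nat) (H G : set V) : (0 < d)%N -> subgroup H -> subgroup G ->
  int_lattice `<=` H -> H `<=` G -> (forall x, G x -> int_lattice (d%:R *: x)) ->
  exists q (rep : 'I_q -> V), coset_reps H G rep.
Proof.
move=> d0 sH sG ZH HG Gd; have [T [c [c1 c2]]] := residue d0 Gd.
apply: (@coset_reps_exist H G {set T}
  (fun x => [set t | `[< exists y, [/\ G y, H (y - x) & c y = t] >]]%SET)) => // x y Gx Gy.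
  move=> /setP /(_ (c x)); rewrite !inE.
  have -> : `[< exists y, [/\ G y, H (y - x) & c y = c x] >].
    by apply/asboolP; exists x; split=> //; rewrite subrr; case: sH.
  move=> /esym /asboolP[z [Gz Hzy czx]].
  have /ZH Hzx := c1 _ _ Gz Gx czx.
  by have := sH.2 _ _ Hzy Hzx; rewrite opprB addrC addrA subrK.
move=> Hxy; apply/setP => t; rewrite !inE; apply/asboolP/asboolP => -[z [Gz Hz ct]]; exists z; split => //.
  by have := subgroupD sH Hz Hxy; rewrite addrA subrK.
by have := sH.2 _ _ Hz Hxy; rewrite opprB addrA subrK.
Qed.

Lemma dilation_lattice_subgroup (A : 'M[R]_n.+1) : subgroup (dilation_lattice A).
Proof.
have sZ := int_lattice_subgroup; split.
  exists 0; [by case: sZ|exists 0; [by case: sZ|by rewrite mulmx0 addr0]].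
move=> _ _ [k hk [l hl <-]] [k' hk' [l' hl' <-]].
exists (k - k'); first exact: sZ.2.
exists (l - l'); first exact: sZ.2.
by rewrite mulmxBr opprD addrACA.
Qed.

(** Up to a factor 1/D the lattice is the image of the integer matrix with blocks [D A] and [D]; the
    Smith normal form exhibits the same image with a square matrix. *)
Lemma dilation_lattice_full (A : 'M[R]_n.+1) :
  (forall i j, exists q : rat, A i j = ratr q) -> full_rank_lattice (dilation_lattice A).
Proof.
move=> Arat.
have /choice[a0 ha0] : forall ij : 'I_n.+1 * 'I_n.+1, exists q : rat, A ij.1 ij.2 = ratr q.
  by move=> ij; exact: Arat.
have [D D0 hD] := common_denominator a0.
have DR : (D%:~R : R) != 0 by rewrite intr_eq0.
have /choice[z hz] : forall ij, exists z : int, D%:~R * A ij.1 ij.2 = z%:~R :> R.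
  move=> ij; have [z hz] := hD ij; exists z; rewrite ha0 -(ratr_int R z) -hz rmorphM /=.
  by rewrite ratr_int.
pose Az : 'M[int]_n.+1 := \matrix_(i, j) z (i, j).
have AzE : map_mx intr Az = D%:~R *: A by apply/matrixP => i j; rewrite !mxE -hz.
pose M : 'M[int]_(n.+1, n.+1 + n.+1) := row_mx Az D%:M.
have [L uL [Q uQ [d _ ME]]] := int_Smith_normal_form M.
pose E : 'M[int]_n.+1 := \matrix_(i, j) (d`_i *+ (i == j)).
have SE : (\matrix_(i, j) (d`_i *+ (i == j :> nat)) : 'M[int]_(n.+1, n.+1 + n.+1)) = row_mx E 0.
  apply/matrixP => i j; rewrite !mxE; case: splitP => k jk; rewrite !mxE jk //.
  by rewrite (_ : (i == _ :> nat) = false) //; apply/negP => /eqP; have := ltn_ord i; lia.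
pose P : 'M[R]_n.+1 := D%:~R^-1 *: (map_mx intr L *m map_mx intr E).
have PE (w : 'cV[int]_(n.+1 + n.+1)) : map_mx intr (M *m w) =
    D%:~R *: (P *m map_mx intr (usubmx (Q *m w))) :> 'cV[R]_n.+1.
  rewrite ME SE -!mulmxA -{1}[Q *m w]vsubmxK mul_row_col mul0mx addr0.
  by rewrite /P -scalemxAl scalerA divff // scale1r -!map_mxM mulmxA.
have MQ (v : 'cV[int]_n.+1) : exists w, usubmx (Q *m w) = v.
  by exists (invmx Q *m col_mx v 0); rewrite mulKVmx // col_mxKu.
have Mw (k l : 'cV[int]_n.+1) : map_mx intr (M *m col_mx k l) =
    D%:~R *: (A *m map_mx intr k + map_mx intr l) :> 'cV[R]_n.+1.
  rewrite /M mul_row_col map_mxD !map_mxM AzE scalerDr -scalemxAl; congr (_ + _).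
  by rewrite map_scalar_mx /= mul_scalar_mx.
have PG : dilation_lattice A = [set P *m k | k in int_lattice].
  apply/seteqP; split => x.
    move=> [_ [k _ <-] [_ [l _ <-] <-]]; exists (map_mx intr (usubmx (Q *m col_mx k l))).
      by exists (usubmx (Q *m col_mx k l)).
    by apply: (scalerI DR); rewrite -PE Mw.
  move=> [_ [v _ <-] <-]; have [w wv] := MQ v.
  exists (map_mx intr (usubmx w)); first by exists (usubmx w).
  exists (map_mx intr (dsubmx w)); first by exists (dsubmx w).
  by apply: (scalerI DR); rewrite -Mw vsubmxK PE wv.
exists P => //.
(* The lattice contains the standard basis; preimages of the basis vectors under [P] form a right
   inverse. *)
rewrite -row_full_unit; apply/row_fullP.
have col_in (j : 'I_n.+1) : exists v : 'cV[int]_n.+1, P *m map_mx intr v = delta_mx j 0.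
  have : dilation_lattice A (delta_mx j 0).
    exists 0; first by exists 0 => //; apply/matrixP => i k; rewrite !mxE.
    exists (delta_mx j 0); last by rewrite mulmx0 add0r.
    by exists (delta_mx j 0) => //; apply/matrixP => i k; rewrite !mxE rmorph_nat.
  by rewrite PG => -[_ [v _ <-] hv]; exists v.
have /choice[v hv] := col_in.
have PV : P *m \matrix_(i, j) ((v j i 0)%:~R) = 1%:M.
  apply/matrixP => i j; have := congr1 (fun w : 'cV[R]_n.+1 => w i 0) (hv j).
  rewrite !mxE eqxx andbT => <-; apply: eq_bigr => k _; by rewrite !mxE.
by exists (\matrix_(i, j) ((v j i 0)%:~R)); exact: mulmx1C.
Qed.

End lattices.

(** * Completion of matrices with orthonormal rows *)

Section hermitian.
Context (R : realType).
Local Notation C := R[i].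
Local Notation normc := (@Normc.normc R).

Definition ctr m q (X : 'M[C]_(m, q)) : 'M[C]_(q, m) := (map_mx (@conjc R) X)^T.

Lemma ctrK m q (X : 'M[C]_(m, q)) : ctr (ctr X) = X.
Proof. by apply/matrixP => i j; rewrite !mxE conjcK. Qed.

Lemma ctrM m q r (X : 'M[C]_(m, q)) (Y : 'M[C]_(q, r)) : ctr (X *m Y) = ctr Y *m ctr X.
Proof.
apply/matrixP => i j; rewrite !mxE cj_sum; apply: eq_bigr => k _.
by rewrite !mxE cjM mulrC.
Qed.

Lemma ctr1 m : ctr (1%:M : 'M[C]_m) = 1%:M.
Proof. by apply/matrixP => i j; rewrite !mxE [j == i]eq_sym; case: eqP; rewrite ?conjc1 ?conjc0. Qed.

Lemma ctr_col m q r (X : 'M[C]_(m, r)) (Y : 'M[C]_(q, r)) : ctr (col_mx X Y) = row_mx (ctr X) (ctr Y).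
Proof. by rewrite /ctr map_col_mx tr_col_mx. Qed.

(** A complex reflection. The factor is [c^-1] and not [2 / |v|^2], which lets [H] send [p] exactly
    to [s] even if their inner product is not real; unitarity follows from [|v|^2 = c + conjc c]. *)
Lemma householder q (p s : 'rV[C]_q) : p *m ctr p = 1%:M -> s *m ctr s = 1%:M ->
  let c := 1 - (p *m ctr s) 0 0 in let H := 1%:M - c^-1 *: (ctr (s - p) *m (s - p)) in
  c != 0 -> H *m ctr H = 1%:M /\ p *m H = s.
Proof.
move=> pp ss c H c0; set v := s - p in H *.
have cv : ctr v = ctr s - ctr p by apply/matrixP => i j; rewrite !mxE rmorphB.
have E1 : p *m ctr s = (1 - c)%:M.
  by rewrite [LHS]mx11_scalar /c opprB addrCA subrr addr0.
have E2 : s *m ctr p = (1 - conjc c)%:M.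
  rewrite -[s]ctrK -ctrM E1; apply/matrixP => i j; rewrite !ord1 !mxE eqxx !mulr1n.
  by rewrite rmorphB rmorph1.
have pv : p *m ctr v = (- c)%:M.
  by rewrite cv mulmxBr E1 pp -raddfB /= addrAC subrr add0r.
have vv : v *m ctr v = (c + conjc c)%:M.
  rewrite cv mulmxBr !mulmxBl ss E1 pp E2 -!raddfB /=; congr (_%:M).
  by rewrite !opprB; ring.
split; last first.
  rewrite /H mulmxBr mulmx1 -scalemxAr mulmxA pv mul_scalar_mx scalerA.
  by rewrite mulrN mulVf // scaleN1r opprK /v addrC subrK.
have HT : ctr H = 1%:M - (conjc c)^-1 *: (ctr v *m v).
  apply/matrixP => i j; rewrite !mxE rmorphB /= rmorphM fmorphV /=.
  rewrite [j == i]eq_sym; congr (_ - _ * _); first by case: eqP; rewrite ?rmorph1 ?rmorph0.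
  by rewrite cj_sum; apply: eq_bigr => k _; rewrite !mxE cjM conjcK mulrC.
have cc0 : conjc c != 0 by rewrite fmorph_eq0.
rewrite HT /H mulmxBr mulmx1 mulmxBl mul1mx -scalemxAr -scalemxAl.
rewrite -mulmxA [v *m (ctr v *m v)]mulmxA vv mul_scalar_mx -scalemxAr !scalerA.
rewrite -addrA -opprD; apply/eqP; rewrite subr_eq addrC -subr_eq subrr eq_sym; apply/eqP.
rewrite -scalerBl -scalerDl -[RHS](scale0r (ctr v *m v)); congr (_ *: _).
by field; rewrite c0 cc0.
Qed.

End hermitian.

(** * Smooth completion of orthonormal rows over the torus *)

Section completion.
Context (R : realType) (n : nat).
Local Notation C := R[i].
Local Notation normc := (@Normc.normc R).
Local Notation V := 'cV[R]_n.+1.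

Definition good (f : V -> C) := csmooth f /\ periodic1 f.
Definition goodm m q (X : V -> 'M[C]_(m, q)) := forall i j, good (fun x => X x i j).

Lemma good_cst c : good (fun=> c).
Proof. by split; [exact: csmooth_cst|]. Qed.

Lemma goodD f g : good f -> good g -> good (fun x => f x + g x).
Proof. by move=> [f1 f2] [g1 g2]; split; [exact: csmoothD|move=> k x; rewrite f2 g2]. Qed.

Lemma goodM f g : good f -> good g -> good (fun x => f x * g x).
Proof. by move=> [f1 f2] [g1 g2]; split; [exact: csmoothM|move=> k x; rewrite f2 g2]. Qed.

Lemma good_conj f : good f -> good (fun x => conjc (f x)).
Proof. by move=> [f1 f2]; split; [exact: csmooth_conj|move=> k x; rewrite f2]. Qed.

Lemma goodV f : (forall x, f x != 0) -> good f -> good (fun x => (f x)^-1).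
Proof. by move=> f0 [f1 f2]; split; [exact: csmoothV|move=> k x; rewrite f2]. Qed.

Lemma good_sum I (r : seq I) (F : I -> V -> C) : (forall i, good (F i)) ->
  good (fun x => \sum_(i <- r) F i x).
Proof.
move=> hF; split; first by apply: csmooth_sum => i; case: (hF i).
by move=> k x; apply: eq_bigr => i _; case: (hF i) => _ ->.
Qed.

Lemma good_eq (f g : V -> C) : f =1 g -> good f -> good g.
Proof. by move=> /funext ->. Qed.

Lemma goodm_cst m q (X : 'M[C]_(m, q)) : goodm (fun=> X).
Proof. by move=> i j; exact: good_cst. Qed.

Lemma goodm_mul m q r (X : V -> 'M[C]_(m, q)) (Y : V -> 'M[C]_(q, r)) :
  goodm X -> goodm Y -> goodm (fun x => X x *m Y x).
Proof.
move=> gX gY i j; apply: (@good_eq (fun x => \sum_k X x i k * Y x k j)).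
  by move=> x; rewrite mxE.
by apply: good_sum => k; exact: goodM.
Qed.

Lemma goodm_ctr m q (X : V -> 'M[C]_(m, q)) : goodm X -> goodm (fun x => ctr (X x)).
Proof.
move=> gX i j; apply: (@good_eq (fun x => conjc (X x j i))); first by move=> x; rewrite !mxE.
exact: good_conj.
Qed.

Lemma goodmD m q (X Y : V -> 'M[C]_(m, q)) : goodm X -> goodm Y -> goodm (fun x => X x + Y x).
Proof.
move=> gX gY i j; apply: (@good_eq (fun x => X x i j + Y x i j)); first by move=> x; rewrite !mxE.
exact: goodD.
Qed.

Lemma goodmZ m q (c : V -> C) (X : V -> 'M[C]_(m, q)) : good c -> goodm X -> goodm (fun x => c x *: X x).
Proof.
move=> gc gX i j; apply: (@good_eq (fun x => c x * X x i j)); first by move=> x; rewrite !mxE.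
exact: goodM.
Qed.

Lemma goodmN m q (X : V -> 'M[C]_(m, q)) : goodm X -> goodm (fun x => - X x).
Proof.
move=> /(goodmZ (good_cst (-1))) h i j; apply: good_eq (h i j) => x.
by rewrite scaleN1r.
Qed.

(** Periodicity bounds each partial derivative on the whole space; the two points are joined by
    changing one coordinate at a time. *)
Lemma good_lipschitz (f : V -> C) : good f -> exists2 K : R, 0 < K &
  forall x y, `|complex.Re (f x) - complex.Re (f y)| <= K * `|x - y|.
Proof.
move=> [[f1 f2] pf]; pose g := @complex.Re R \o f.
have pD (i : 'I_n.+1) : exists2 K : R, 0 < K & forall x, `|'D_(delta_mx i 0 : V) g x| <= K.
  have [||K K0 hK] := @periodic1_bounded R n.+1 (fun x => ('D_(delta_mx i 0 : V) g x)%:C%C).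
  - move=> k x; congr (_%:C%C); rewrite /derive.
    rewrite (_ : (fun h : R => h^-1 *: ((g \o shift (x + map_mx intr k)) (h *: (delta_mx i 0 : V)) - g (x + map_mx intr k))) =
      (fun h : R => h^-1 *: ((g \o shift x) (h *: (delta_mx i 0 : V)) - g x))) //.
    by apply/funext => h; rewrite /= addrA /g /= !pf.
  - by apply: csmooth_ccontinuous; apply: csmooth_real; exact: dsmooth_derive.
  by exists K => // x; have := hK x; rewrite normc_real.
have /choice[K hK] : forall i : 'I_n.+1, exists K : R, 0 < K /\ forall x, `|'D_(delta_mx i 0 : V) g x| <= K.
  by move=> i; have [K K0 hK] := pD i; exists K.
exists (\sum_i K i).
  by rewrite (bigD1 ord0) //= ltr_pwDl ?(hK _).1 // sumr_ge0 // => i _; rewrite ltW // (hK i).1.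
move=> x y; pose z (k : nat) : V := \col_i (if (i < k)%N then x i 0 else y i 0).
have step1 (i : 'I_n.+1) : `|g (z i.+1) - g (z i)| <= K i * `|x - y|.
  have zE : z i.+1 = (x i 0 - y i 0) *: (delta_mx i 0 : V) + z i.
    apply/matrixP => j l; rewrite ord1 !mxE eqxx andbT; have [->|ji] := eqVneq j i.
      by rewrite ltnSn ltnn mulr1 subrK.
    by rewrite mulr0 add0r ltnS leq_eqVlt val_eqE (negbTE ji).
  have := @mvt_le R (fun t => g (t *: (delta_mx i 0 : V) + z i)) _ (x i 0 - y i 0) (K i)
    (derivable_line (z i) (delta_mx i 0) f1) (fun t _ => (hK i).2 _).
  rewrite -zE scale0r add0r => /le_trans; apply; apply: ler_wpM2l; first by rewrite ltW // (hK i).1.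
  by have := coord_le_norm (x - y) i; rewrite !mxE.
have -> : complex.Re (f x) - complex.Re (f y) = \sum_(i < n.+1) (g (z i.+1) - g (z i)).
  rewrite -(big_mkord xpredT (fun i => g (z i.+1) - g (z i))) telescope_sumr //; congr (g _ - g _).
    by apply/matrixP => i j; rewrite ord1 mxE ltn_ord.
  by apply/matrixP => i j; rewrite ord1 mxE ltn0.
rewrite mulr_suml; apply: le_trans (ler_norm_sum _ _ _) _.
by apply: ler_sum => i _; exact: step1.
Qed.

(** Suppose every one of a fine grid of target vectors were attained. There are more targets than
    small cubes in the torus, so two targets would be attained in the same cube; they differ by more
    than the Lipschitz bound allows. All targets have entries at most 1/t, hence squared length at
    most 1. *)
Lemma good_miss t (f : 'I_t -> V -> C) : (n.+1 < t)%N -> (forall i, good (f i)) ->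
  exists a : 'I_t -> R, (forall i, 0 <= a i) /\ (forall i, a i < 1) /\ \sum_i a i ^+ 2 <= 1 /\
    forall x, exists i, complex.Re (f i x) != a i.
Proof.
move=> nt gf; have t0 : (0 < t)%N by apply: leq_trans nt.
have /choice[K hK] : forall i, exists K : R, 0 < K /\
    forall x y, `|complex.Re (f i x) - complex.Re (f i y)| <= K * `|x - y|.
  by move=> i; have [K K0 hK] := good_lipschitz (gf i); exists K.
pose KK := \sum_i K i.
have KKi i : K i <= KK.
  by rewrite /KK (bigD1 i) //= lerDl sumr_ge0 // => j _; rewrite ltW // (hK j).1.
have KK0 : 0 <= KK by rewrite sumr_ge0 // => j _; rewrite ltW // (hK j).1.
pose C1 := (Num.bound (KK * t%:R)).+1.
have C1P : KK * t%:R < C1%:R.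
  by apply: lt_le_trans (archi_boundP _) _; rewrite ?mulr_ge0 // ler_nat.
(* There are [N^t >= N^(n+2)] targets and [M^(n+1) = C1^(n+1) N^(n+1)] cubes, fewer because
   [N > C1^(n+1)]. Cubes have side [1/M] with [M = C1 N] and [C1 > KK t], so that functions vary by
   less than the spacing [1/(N t)] of the targets. *)
pose N := (C1 ^ n.+1).+1; pose M := (C1 * N)%N.
have M0 : (0 < M)%N by rewrite muln_gt0.
have NtR : 0 < (N * t)%:R :> R by rewrite ltr0n muln_gt0.
pose a (u : {ffun 'I_t -> 'I_N}) i : R := (u i)%:R / (N * t)%:R.
have a0 u i : 0 <= a u i by rewrite divr_ge0.
have at1 u i : a u i <= t%:R^-1.
  rewrite /a natrM invfM mulrA ler_pdivrMr ?ltr0n // mulVf ?pnatr_eq0 -?lt0n //.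
  by rewrite ler_pdivrMr ?ltr0n // mul1r ler_nat ltnW.
apply: contrapT => hn.
have /choice[xi hxi] : forall u, exists x : V, forall i, complex.Re (f i x) = a u i.
  move=> u; apply: contrapT => hu; apply: hn; exists (a u); split; [exact: a0|split; [|split]].
  - move=> i; rewrite /a ltr_pdivrMr // mul1r ltr_nat (leq_trans (ltn_ord _)) //.
    by rewrite leq_pmulr.
  - apply: (@le_trans _ _ (\sum_(i < t) (t%:R^-1 : R))).
      apply: ler_sum => i _; rewrite expr2 -[leRHS]mulr1 ler_pM //.
      by rewrite (le_trans (at1 _ _)) // invf_le1 ?ltr0n // ler1n.
    by rewrite sumr_const card_ord -[X in X <= _]mulr_natr mulVf // pnatr_eq0 -lt0n.
  move=> x; apply: contrapT => /forallNP h; apply: hu; exists x => i.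
  by apply/eqP; apply: contraPT (h i) => ?; exact.
pose fr u i : R := xi u i 0 - (Num.floor (xi u i 0))%:~R.
have fr01 u i : 0 <= fr u i < 1.
  have := floor_le_tmp (xi u i 0); have := floorD1_gt (xi u i 0).
  by rewrite intrD /fr; lra.
have tr u i : (Num.truncn (M%:R * fr u i))%:R <= M%:R * fr u i < (Num.truncn (M%:R * fr u i)).+1%:R.
  by apply: truncn_itv; rewrite mulr_ge0 //; case/andP: (fr01 u i).
have cM u i : (Num.truncn (M%:R * fr u i) < M)%N.
  rewrite -(ltr_nat R); have /andP[h _] := tr u i; apply: le_lt_trans h _.
  by rewrite -[ltRHS]mulr1 ltr_pM2l ?ltr0n //; case/andP: (fr01 u i).
pose cell (u : {ffun 'I_t -> 'I_N}) : {ffun 'I_n.+1 -> 'I_M} := [ffun i => Ordinal (cM u i)].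
have [u [v uv cuv]] : exists u, exists2 v, u != v & cell u = cell v.
  apply/injectivePn; apply/negP => /injectiveP /leq_card; rewrite !card_ffun !card_ord leqNgt.
  move=> /negP; apply; apply: (@leq_trans (N ^ n.+2)); last by apply: leq_pexp2l.
  by rewrite /M expnMn [X in (_ < X)%N]expnS ltn_pmul2r ?expn_gt0.
have [j uvj] : exists j, u j != v j.
  apply: contrapT => /forallNP h; case/eqP: uv; apply/ffunP => j.
  by apply/eqP; apply: contraPT (h j) => ?; exact.
pose x : V := \col_i fr u i; pose y : V := \col_i fr v i.
have fx w : complex.Re (f j (\col_i fr w i)) = a w j.
  rewrite -hxi; congr (complex.Re _); have [_ pf] := gf j.
  rewrite -[RHS](pf (\col_i - Num.floor (xi w i 0))); congr (f j _).
  by apply/matrixP => i l; rewrite ord1 !mxE mulrNz.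
have xy : `|x - y| <= M%:R^-1.
  apply: norm_cV_le => [|i]; first by rewrite invr_ge0.
  have := tr u i; have := tr v i; have /ffunP/(_ i) := cuv; rewrite !ffunE => /(congr1 val) /= ->.
  rewrite !mxE; move: (Num.truncn _) => q; rewrite -natr1 => /andP[h1 h2] /andP[h3 h4].
  rewrite -[leRHS]mulr1 ler_pdivlMl ?ltr0n // -{1}[M%:R]ger0_norm // -normrM mulrBr ler_norml.
  by lra.
have := (hK j).2 x y; rewrite !fx; apply/negP; rewrite -ltNge.
apply: (@lt_le_trans _ _ (N * t)%:R^-1); last first.
  rewrite /a -mulrBl normrM normfV [`|(N * t)%:R|]ger0_norm // -[leLHS]mul1r ler_pM2r ?invr_gt0 //.
  have : (u j)%:R - (v j)%:R = ((u j)%:Z - (v j)%:Z)%:~R :> R by rewrite intrB.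
  move=> ->; rewrite -intr_norm -[1]/(1%:~R) ler_int.
  move/eqP: uvj => uvj; have : (u j : nat) != v j by apply/eqP => e; apply: uvj; exact: val_inj.
  by lia.
apply: (@le_lt_trans _ _ (KK * M%:R^-1)).
  by apply: ler_pM => //; rewrite ltW // (hK j).1.
rewrite /M !natrM invfM mulrA -[ltRHS]mul1r invfM [N%:R^-1 * _]mulrC mulrA ltr_pM2r ?invr_gt0 ?ltr0n //.
by rewrite mul1r ltr_pdivrMr ?ltr0n // ltr_pdivlMl ?ltr0n // mulrC.
Qed.

(** A constant unit row [p] is found that [s] never equals. The reflection [H x] taking [p] to [s x]
    then depends smoothly on [x]; after a constant reflection [W] its first row is [s x], and the
    other rows are the completion. *)
Lemma step_completion t (s : V -> 'rV[C]_(1 + t)) : (n.+1 < t)%N -> goodm s ->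
  (forall x, s x *m ctr (s x) = 1%:M) ->
  exists2 U : V -> 'M[C]_(t, 1 + t), goodm U &
    forall x, col_mx (s x) (U x) *m ctr (col_mx (s x) (U x)) = 1%:M.
Proof.
move=> nt gs ss; have t0 : (0 < t)%N by apply: leq_trans nt.
have [a [a0 [a1 [a2 ha]]]] := good_miss nt (fun i => gs 0 (widen_ord (leq_addl 1 t) i)).
pose b := Num.sqrt (1 - \sum_i a i ^+ 2).
(* The missed vector [a] followed by the entry [b] that makes the length 1: [insub] succeeds exactly
   on the first [t] indices. *)
pose p : 'rV[C]_(1 + t) := \row_j (if insub (j : nat) is Some i then (a i)%:C%C else b%:C%C).
have pw i : p 0 (widen_ord (leq_addl 1 t) i) = (a i)%:C%C.
  by rewrite mxE insubT //= => h; congr ((a _)%:C%C); apply: val_inj.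
have pp : p *m ctr p = 1%:M.
  apply/matrixP => i j; rewrite !ord1 !mxE eqxx.
  transitivity (\sum_(k < t.+1) p 0 k * conjc (p 0 k)).
    by apply: eq_bigr => k _; rewrite !mxE.
  rewrite big_ord_recr /=.
  have -> : p 0 ord_max = b%:C%C by rewrite mxE insubF //= ltnn.
  rewrite (eq_bigr (fun i : 'I_t => (a i ^+ 2)%:C%C)); last first.
    move=> k _; rewrite (_ : widen_ord _ k = widen_ord (leq_addl 1 t) k) ?pw; last exact: val_inj.
    by rewrite conjc_real -rmorphM expr2.
  rewrite conjc_real -rmorphM -expr2 -rmorph_sum -rmorphD sqr_sqrtr ?subr_ge0 //.
  by rewrite addrC subrK.
(* Unit rows with inner product 1 are equal, whereas the real part of some entry of [s x] differs
   from that of [p]. *)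
have sp x : 1 - (p *m ctr (s x)) 0 0 != 0.
  rewrite subr_eq0; apply/negP => /eqP h.
  have v0 : (s x - p) *m ctr (s x - p) = 0.
    have cv : ctr (s x - p) = ctr (s x) - ctr p by apply/matrixP => i j; rewrite !mxE rmorphB.
    have E1 : p *m ctr (s x) = 1%:M by rewrite [LHS]mx11_scalar -h.
    have E2 : s x *m ctr p = 1%:M by rewrite -[s x]ctrK -ctrM E1 ctr1.
    by rewrite cv mulmxBr !mulmxBl ss E1 E2 pp !subrr.
  have [j] := ha x; apply/negP; rewrite negbK; apply/eqP.
  pose v := s x - p.
  have : \sum_k (normc (v 0 k)) ^+ 2 = 0.
    apply: complexI; rewrite rmorph_sum rmorph0.
    have E : (v *m ctr v) 0 0 = 0 by rewrite /v v0 mxE.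
    rewrite mxE in E; rewrite -[RHS]E; apply: eq_bigr => k _.
    by rewrite /ctr [X in _ = _ * X]mxE [X in _ = _ * X]mxE mulc_conj.
  move=> /psumr_eq0P /(_ (widen_ord (leq_addl 1 t) j)) h1.
  have : normc (v 0 (widen_ord (leq_addl 1 t) j)) ^+ 2 = 0 by apply: h1 => // k _; exact: sqr_ge0.
  move=> /eqP; rewrite sqrf_eq0 => /eqP /Normc.eq0_normc /eqP.
  by rewrite /v mxE [X in _ + X]mxE pw subr_eq0 => /eqP ->.
(* Reflecting the first basis row directly to [s x] could break down where their inner product is 1;
   going through [p] is safe, since the first entry of [p] is below 1. *)
pose e0 : 'rV[C]_(1 + t) := delta_mx 0 0.
have ee : e0 *m ctr e0 = 1%:M.
  rewrite /e0 -rowE; apply/matrixP => i j; rewrite !ord1 !mxE !eqxx.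
  by rewrite conjc1.
have ep : 1 - (e0 *m ctr p) 0 0 != 0.
  have p00 : p 0 0 = (a (Ordinal t0))%:C%C by rewrite -pw; congr (p 0 _); exact: val_inj.
  rewrite /e0 -rowE; do 3 rewrite [X in _ - X]mxE.
  by rewrite p00 conjc_real subr_eq0 -[1]/(1%:C%C) (inj_eq (@complexI R)) eq_sym lt_eqF.
have [WW eW] := householder ee pp ep.
set W := 1%:M - _ in WW eW.
pose H x := 1%:M - (1 - (p *m ctr (s x)) 0 0)^-1 *: (ctr (s x - p) *m (s x - p)).
have HH x : H x *m ctr (H x) = 1%:M by have [h _] := householder pp (ss x) (sp x); exact: h.
have pH x : p *m H x = s x by have [_ h] := householder pp (ss x) (sp x); exact: h.
have gH : goodm H.
  apply: goodmD; first exact: goodm_cst.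
  have gv : goodm (fun x => s x - p).
    by apply: goodmD => //; apply: goodmN; exact: goodm_cst.
  apply: goodmN; apply: goodmZ.
    apply: goodV => //; apply: goodD; first exact: good_cst.
    have := goodmN (goodm_mul (goodm_cst p) (goodm_ctr gs)) => /(_ 0 0).
    by apply: good_eq => x; rewrite mxE.
  by apply: goodm_mul => //; exact: goodm_ctr.
clearbody W H.
pose U x := W *m H x.
have UU x : U x *m ctr (U x) = 1%:M by rewrite /U ctrM -mulmxA [H x *m _]mulmxA HH mul1mx.
have eU x : e0 *m U x = s x by rewrite /U mulmxA eW.
have gU : goodm U by apply: goodm_mul => //; exact: goodm_cst.
clearbody U.
exists (fun x => dsubmx (U x)).
  by move=> i j; apply: good_eq (gU (rshift 1 i) j) => x; rewrite [RHS]mxE.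
move=> x; have -> : s x = usubmx (U x).
  rewrite -eU /e0 -rowE; apply/matrixP => i j; rewrite !mxE !ord1.
  by congr (U x _ j); exact: val_inj.
by rewrite vsubmxK.
Qed.

(** Induction on the rows. The first row is completed by [step_completion]; the remaining rows,
    written in the orthonormal frame [U] of its complement, form a matrix with one row and one
    column fewer. The number [r] of missing rows never changes. *)
Lemma completion m r (S : V -> 'M[C]_(m, m + r)) : (n.+1 < r)%N -> goodm S ->
  (forall x, S x *m ctr (S x) = 1%:M) ->
  exists2 S' : V -> 'M[C]_(r, m + r), goodm S' & forall x,
    [/\ S' x *m ctr (S' x) = 1%:M, S x *m ctr (S' x) = 0 &
        ctr (S x) *m S x + ctr (S' x) *m S' x = 1%:M].
Proof.
elim: m S => [|m ih] S nr gS SS.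
  exists (fun=> 1%:M); first exact: goodm_cst.
  move=> x; rewrite ctr1 mul1mx; split=> //; first by apply/matrixP => -[].
  by rewrite (_ : ctr (S x) *m S x = 0) ?add0r //; apply/matrixP => i j; rewrite !mxE big_ord0.
change (V -> 'M[C]_(1 + m, 1 + (m + r))) in S.
pose s x := usubmx (S x); pose S1 x := dsubmx (S x).
have SS' : forall x, S x *m ctr (S x) = 1%:M :> 'M[C]_(1 + m) := SS.
have SE x : S x = col_mx (s x) (S1 x) by rewrite vsubmxK.
have gs : goodm s by move=> i j; apply: good_eq (gS (lshift m i) j) => x; rewrite mxE.
have gS1 : goodm S1 by move=> i j; apply: good_eq (gS (rshift 1 i) j) => x; rewrite mxE.
have Sx x : [/\ s x *m ctr (s x) = 1%:M, S1 x *m ctr (s x) = 0 & S1 x *m ctr (S1 x) = 1%:M].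
  have := SS' x; rewrite SE ctr_col mul_col_row [RHS](@scalar_mx_block _ 1 m) => /eq_block_mx[-> _ -> ->] //.
have nmr : (n.+1 < m + r)%N by rewrite (leq_trans nr) // leq_addl.
have [|U gU UU] := step_completion nmr gs; first by move=> x; case: (Sx x).
have Ux x : [/\ s x *m ctr (U x) = 0, U x *m ctr (s x) = 0 & U x *m ctr (U x) = 1%:M].
  have := UU x; rewrite ctr_col mul_col_row [RHS](@scalar_mx_block _ 1 (m + r)) => /eq_block_mx[_ -> -> ->] //.
have Uc x : ctr (U x) *m U x = 1%:M - ctr (s x) *m s x.
  have := mulmx1C (UU x); rewrite ctr_col mul_row_col => <-.
  by rewrite addrC addKr.
(* The other rows are orthogonal to [s x], hence combinations of the rows of [U x]; these are their
   coordinates. *)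
pose S2 x := S1 x *m ctr (U x).
have gS2 : goodm S2 by apply: goodm_mul => //; exact: goodm_ctr.
have S1U x : S1 x *m (ctr (U x) *m U x) = S1 x.
  by have [_ h _] := Sx x; rewrite Uc mulmxBr mulmx1 mulmxA h mul0mx subr0.
have SS2 x : S2 x *m ctr (S2 x) = 1%:M.
  by have [_ _ h] := Sx x; rewrite /S2 ctrM ctrK mulmxA -[S1 x *m _ *m _]mulmxA S1U.
have [S2' gS2' hS2'] := ih S2 nr gS2 SS2.
exists (fun x => S2' x *m U x); first exact: goodm_mul.
move=> x; have [h1 h2 h3] := hS2' x; have [u1 u2 u3] := Ux x; have [s1 s2 s3] := Sx x.
rewrite ctrM; split.
- by rewrite mulmxA -[S2' x *m U x *m _]mulmxA u3 mulmx1.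
- rewrite SE (@mul_col_mx C 1 m (1 + (m + r)) r) !mulmxA u1 mul0mx.
  transitivity (col_mx 0 0 : 'M[C]_(1 + m, r)); last exact: (@col_mx0 C 1 m r).
  by rewrite -[S1 x *m ctr (U x)]/(S2 x) h2.
have -> : ctr (S x) *m S x = ctr (s x) *m s x + ctr (S1 x) *m S1 x.
  by rewrite SE (@ctr_col R 1 m) (@mul_row_col C _ 1 m).
rewrite -addrA.
have -> : ctr (U x) *m ctr (S2' x) *m (S2' x *m U x) = ctr (U x) *m U x - ctr (S1 x) *m S1 x.
  rewrite mulmxA -[_ *m _ *m S2' x]mulmxA (_ : ctr (S2' x) *m S2' x = 1%:M - ctr (S2 x) *m S2 x); last first.
    by rewrite -h3 addrC addKr.
  rewrite mulmxBr mulmx1 mulmxBl; congr (_ - _).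
  rewrite /S2 ctrM ctrK !mulmxA -[_ *m _ *m ctr (U x) *m U x]mulmxA -[_ *m S1 x *m _]mulmxA S1U.
  by rewrite -[ctr (U x) *m U x *m _]mulmxA; congr (_ *m S1 x); rewrite -{2}[S1 x]S1U -[in RHS](ctrK (U x)) !ctrM !ctrK -mulmxA.
by rewrite Uc [X in _ + X]addrC subrK addrC subrK.
Qed.

End completion.

(** * Complementary generators from matrix completion *)

Section frame_completion.
Context (R : realType) (n : nat).
Local Notation normc := (@Normc.normc R).
Local Notation lam := (@lebesgue_cV R n.+1).
Local Notation fn := ('cV[R]_n.+1 -> R[i]).

Let u1 : (1%:M : 'M[R]_n.+1) \in unitmx := unitmx1 R n.+1.

Lemma ONsysE1 (I : eqType) (u : I -> fn) : ONsys 1%:M u -> forall i j x,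
  per 1%:M (fun y => u i y * conjc (u j y)) x = (i == j)%:R.
Proof. by move=> h i j x; rewrite h det1 normr1 invr1. Qed.

Lemma good_per h : test h -> good (per (1%:M : 'M[R]_n.+1) h).
Proof.
move=> th; split; first exact: csmooth_per.
by move=> k x; rewrite -latpt1 per_periodic.
Qed.

Lemma good_periodic (f : fn) : good f -> periodic 1%:M f /\ csmooth f.
Proof. by move=> [sf pf]; split=> // k x; rewrite latpt1 pf. Qed.

Lemma per_comb (J : finType) (s : J -> fn) (u : J -> fn) (v : fn) x :
  (forall j, good (s j)) -> (forall j, test (u j)) -> test v ->
  per 1%:M (fun y => (\sum_j s j y * u j y) * conjc (v y)) x =
  \sum_j s j x * per 1%:M (fun y => u j y * conjc (v y)) x.
Proof.
move=> gs tu tv.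
rewrite (_ : (fun y => _) = fun y => \sum_j s j y * (u j y * conjc (v y))); last first.
  by apply/funext => y; rewrite mulr_suml; apply: eq_bigr => j _; rewrite mulrA.
have tuv j := test_conjM (tu j) tv.
rewrite per_sum //; last by move=> j; apply: bsuppMr; case: (tuv j).
apply: eq_bigr => j _; rewrite per_mull //; last by case: (tuv j).
by case: (good_periodic (gs j)).
Qed.

Lemma per_swap (u v : fn) x : test u -> test v ->
  per 1%:M (fun y => v y * conjc (u y)) x = conjc (per 1%:M (fun y => u y * conjc (v y)) x).
Proof.
move=> tu tv; rewrite -per_conj //; last by case: (test_conjM tu tv).
by congr per; apply/funext => y; rewrite cjM conjcK mulrC.
Qed.

(** The brackets of [phi] against [chi] form a smooth periodic matrix [S] with orthonormal rows and
    [phi = S chi]; the completing rows applied to [chi] give [psi]. The adjoint of the completed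
    matrix expresses each [chi j] back through [phi] and [psi], which is the last conclusion. *)
Lemma frame_completion (m q N0 : nat) (phi : 'I_m -> fn) (chi : 'I_q -> fn) :
  (forall i, test (phi i)) -> (forall j, test (chi j)) ->
  ONsys 1%:M phi -> ONsys 1%:M chi ->
  (forall i, L2_closure (FS int_lattice chi) (phi i)) ->
  (exists x0, (forall i, phi i x0 = 0) /\ exists j, chi j x0 != 0) ->
  (n.+1 < N0)%N -> (N0 %| m)%N -> (N0 %| q)%N ->
  exists r (psi : 'I_r -> fn),
    [/\ forall l, test (psi l), ONsys 1%:M psi,
        forall l i x, per 1%:M (fun y => psi l y * conjc (phi i y)) x = 0,
        forall l, L2_closure (FS int_lattice chi) (psi l) &
        forall j, exists s t, [/\ forall i, good (s i), forall l, good (t l) &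
          forall x, chi j x = \sum_(i < m) s i x * phi i x + \sum_(l < r) t l x * psi l x]].
Proof.
move=> tp tc op oc cl [x0 [phi0 [j0 chi0]]] nN Nm Nq.
pose S x : 'M[R[i]]_(m, q) := \matrix_(i, j) per 1%:M (fun y => phi i y * conjc (chi j y)) x.
have gS : goodm S.
  by move=> i j; apply: good_eq (good_per (test_conjM (tp i) (tc j))) => x; rewrite mxE.
have phiE i x : phi i x = \sum_j S x i j * chi j x.
  rewrite (frame_resolution tc oc (tp i) (cl i)); apply: eq_bigr => j _.
  by rewrite mxE.
have SS x : S x *m ctr (S x) = 1%:M.
  apply/matrixP => i i'; rewrite mxE [RHS]mxE -(ONsysE1 op i i' x).
  have -> : (fun y => phi i y * conjc (phi i' y)) = (fun y => (\sum_j S y i j * chi j y) * conjc (phi i' y)).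
    by apply/funext => y; rewrite -phiE.
  rewrite (per_comb (s := fun j x => S x i j)) //; try by move=> j; exact: gS.
  apply: eq_bigr => j _; congr (_ * _).
  by rewrite /ctr !mxE (per_swap _ (tp i') (tc j)).
(* Rank gives [m <= q]. If equality held, [S x0] would be unitary and [chi] at [x0] would be
   recovered from the values of [phi], which are all 0 there. *)
have mq : (m < q)%N.
  rewrite ltnNge; apply/negP => qm.
  have := congr1 mxrank (SS x0); rewrite mxrank1 => rk.
  have mq : (m <= q)%N by rewrite -rk (leq_trans (mxrankM_maxl _ _)) // rank_leq_col.
  have eqm : q = m by apply/eqP; rewrite eqn_leq qm mq.
  move: (chi) (S) j0 chi0 phiE SS {gS oc tc cl Nq}; rewrite eqm => chi' S' j0 chi0 phiE SS.
  have := mulmx1C (SS x0) => /matrixP h.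
  case/eqP: chi0; transitivity (\sum_i ctr (S' x0) j0 i * phi i x0); last first.
    by rewrite big1 // => i _; rewrite phi0 mulr0.
  under eq_bigr do rewrite phiE mulr_sumr.
  rewrite exchange_big /= (bigD1 j0) //= [X in _ = _ + X]big1 ?addr0.
    under eq_bigr do rewrite mulrA.
    by rewrite -mulr_suml; have := h j0 j0; rewrite mxE [RHS]mxE eqxx => ->; rewrite mul1r.
  move=> j jj0; under eq_bigr do rewrite mulrA.
  by rewrite -mulr_suml; have := h j0 j; rewrite mxE [RHS]mxE eq_sym (negbTE jj0) => ->; rewrite mul0r.
(* A positive multiple of [N0], hence more than [n.+1]. *)
pose r := (q - m)%N; have qE : q = (m + r)%N by rewrite subnKC // ltnW.
have nr : (n.+1 < r)%N.
  apply: leq_trans nN _; apply: dvdn_leq; first by rewrite subn_gt0.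
  exact: dvdn_sub.
clear chi0 j0.
move: (chi) (S) tc oc cl gS phiE SS; rewrite qE => {}chi {}S tc oc cl gS phiE SS.
have [S' gS' hS'] := completion nr gS SS.
pose psi l x := \sum_j S' x l j * chi j x.
have gp (f : fn) : good f -> csmooth f by case.
have tpsi l : test (psi l).
  by apply: test_sum => j; apply: testMl => //; apply: gp; exact: gS'.
have perc l (v : fn) x : test v -> per 1%:M (fun y => psi l y * conjc (v y)) x =
    \sum_j S' x l j * per 1%:M (fun y => chi j y * conjc (v y)) x.
  by move=> tv; rewrite (per_comb (s := fun j x => S' x l j)) //; try by move=> j; exact: gS'.
have perchi l j x : per 1%:M (fun y => psi l y * conjc (chi j y)) x = S' x l j.
  rewrite perc // (bigD1 j) //= (ONsysE1 oc) eqxx mulr1 big1 ?addr0 // => k kj.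
  by rewrite (ONsysE1 oc) (negbTE kj) mulr0.
have perphi i j x : per 1%:M (fun y => chi j y * conjc (phi i y)) x = conjc (S x i j).
  rewrite (per_swap _ (tp i) (tc j)); congr conjc.
  rewrite (_ : (fun y => _) = (fun y => (\sum_j S y i j * chi j y) * conjc (chi j y))); last first.
    by apply/funext => y; rewrite -phiE.
  rewrite (per_comb (s := fun j x => S x i j)) //; try by move=> k; exact: gS.
  rewrite (bigD1 j) //= (ONsysE1 oc) eqxx mulr1 big1 ?addr0 // => k kj.
  by rewrite (ONsysE1 oc) (negbTE kj) mulr0.
exists r, psi; split => //.
- move=> l l' x; rewrite det1 normr1 invr1 perc //.
  have [h _ _] := hS' x; have := congr1 (fun X : 'M[R[i]]_r => X l l') h; rewrite mxE [RHS]mxE => <-.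
  by apply: eq_bigr => j _; rewrite (per_swap _ (tpsi l') (tc j)) perchi /ctr !mxE.
- move=> l i x; rewrite perc //.
  have [_ h _] := hS' x; have := congr1 (fun X => ctr X l i) h.
  rewrite ctrM ctrK mxE => E; rewrite -[RHS]conjc0; transitivity (ctr (0 : 'M[R[i]]_(m, r)) l i); last by rewrite !mxE.
  by rewrite -E; apply: eq_bigr => j _; rewrite perphi /ctr !mxE.
- move=> l; rewrite -duals1; apply: frame_closure => // j; first by case: (good_periodic (gS' l j)).
  by apply: gp; exact: gS'.
move=> j; exists (fun i x => conjc (S x i j)), (fun l x => conjc (S' x l j)); split.
- by move=> i; apply: good_conj; exact: gS.
- by move=> l; apply: good_conj; exact: gS'.
move=> x; have [_ _ h] := hS' x.
transitivity (\sum_k (ctr (S x) *m S x + ctr (S' x) *m S' x) j k * chi k x).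
  rewrite h (bigD1 j) //= mxE eqxx mul1r big1 ?addr0 // => k kj.
  by rewrite mxE eq_sym (negbTE kj) mul0r.
under eq_bigr do rewrite mxE mulrDl.
rewrite big_split /=; congr (_ + _).
  under [RHS]eq_bigr do rewrite phiE mulr_sumr.
  rewrite exchange_big /=; apply: eq_bigr => k _; rewrite mxE mulr_suml.
  by apply: eq_bigr => i _; rewrite /ctr !mxE mulrA.
under [RHS]eq_bigr do rewrite mulr_sumr.
rewrite exchange_big /=; apply: eq_bigr => k _; rewrite mxE mulr_suml.
by apply: eq_bigr => i _; rewrite /ctr !mxE mulrA.
Qed.

Lemma ONsys_of_inner (I : eqType) (u : I -> fn) : (forall i, test (u i)) ->
  (forall i j (l : 'cV[int]_n.+1),
    inner (u i) (fun x => ew (map_mx intr l) x * u j x) = ((i == j) && (l == 0))%:R) ->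
  ONsys 1%:M u.
Proof.
move=> tu ou i j x; rewrite det1 normr1 invr1.
have tuv := test_conjM (tu i) (tu j).
pose h y := u i y * conjc (u j y) - (i == j)%:R * chi0 y.
have tz := testZ (i == j)%:R (@chi0_test R n).
have th : test h by exact: testB.
have h0 l : cint lam (fun y => h y * conjc (ew (map_mx intr l) y)) = 0.
  have cw : csmooth (fun y : 'cV[R]_n.+1 => conjc (ew (map_mx intr l) y)) by apply: csmooth_conj; exact: csmooth_ew.
  rewrite (_ : (fun y => _) = fun y => u i y * conjc (ew (map_mx intr l) y * u j y) -
     (i == j)%:R * (ew (map_mx intr (- l)) y * chi0 y)); last first.
    by apply/funext => y; rewrite /h cjM map_mxN ewNl; ring.
  have t1 : test (fun y => u i y * conjc (ew (map_mx intr l) y * u j y)).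
    by apply: test_conjM => //; exact: test_ewM.
  have t2 : test (fun y => ew (map_mx intr (- l)) y * chi0 y : R[i]).
    exact: test_ewM (@chi0_test R n).
  rewrite cintB; [|exact: test_cintegrable|by apply: test_cintegrable; exact: testZ].
  rewrite cintZ; last exact: test_cintegrable.
  rewrite -innerE ou (cint_ew_chi (@chi0_test R n) (@per_chi0 R n) (@chi0_int R n)) oppr_eq0.
  by case: (i == j); rewrite /= ?mul1r ?mul0r subrr.
have := per_eq0 (@chi0_test R n) (@per_chi0 R n) (@chi0_ge0 R n) th h0 x.
rewrite /h (_ : (fun y => _) = fun y => u i y * conjc (u j y) + (- (i == j)%:R) * chi0 y); last first.
  by apply/funext => y; rewrite mulNr.
have [_ bc] := @chi0_test R n.
rewrite perD //; [|by case: tuv|by exact: bsuppMr].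
by rewrite perZ // per_chi0 mulr1 => /eqP; rewrite addr_eq0 opprK => /eqP.
Qed.

End frame_completion.

(** * The multiresolution analysis *)

Section ellipsoids.
Context (R : realType) (n : nat).
Variable d : 'I_n.+1 -> R.
Hypothesis d0 : forall i, 0 < d i.
Variable rho : R.
Hypotheses (rho0 : 0 < rho) (rho1 : rho < 1).

Definition Qd (z : 'cV[R]_n.+1) : R := \sum_i d i * z i 0 ^+ 2.

(** In coordinate 0 the window index is [2 f + b], at position near [f]; elsewhere it is [f], at
    position [f / 2]. The centre ignores [b], so the two windows of a pair are kept or dropped
    together. *)
Definition centre M (f : {ffun 'I_n.+1 -> 'I_M}) : 'cV[R]_n.+1 :=
  \col_i (if i == ord0 then (f i)%:R else (f i)%:R / 2).

(* [(a + b)^2 <= (1 + e) a^2 + (1 + 1/e) b^2], coordinatewise. *)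
Lemma Qd_near (e : R) (x y : 'cV[R]_n.+1) : 0 < e ->
  (forall i, `| `|x i 0| - `|y i 0| | <= 3 / 2) ->
  Qd x <= (1 + e) * Qd y + (1 + e^-1) * (9 / 4 * \sum_i d i).
Proof.
move=> e0 h; rewrite /Qd !mulr_sumr -big_split /=; apply: ler_sum => i _.
rewrite -[x i 0 ^+ 2]real_normK ?num_real // -[y i 0 ^+ 2]real_normK ?num_real //.
have -> : (1 + e) * (d i * `|y i 0| ^+ 2) + (1 + e^-1) * (9 / 4 * d i) =
    d i * ((1 + e) * `|y i 0| ^+ 2 + (1 + e^-1) * (9 / 4)) by ring.
apply: ler_wpM2l; first exact: ltW.
have := h i; move: (`|x i 0|) (`|y i 0|) => a b hab.
have key : 0 <= (1 + e) * b ^+ 2 + (1 + e^-1) * (a - b) ^+ 2 - a ^+ 2.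
  rewrite (_ : _ - _ = e * (b - e^-1 * (a - b)) ^+ 2); last by field; rewrite gt_eqF.
  by rewrite mulr_ge0 ?sqr_ge0 // ltW.
have : (a - b) ^+ 2 <= 9 / 4.
  rewrite -real_normK ?num_real //; have := normr_ge0 (a - b); move: (`|a - b|) hab => t; nra.
have e1 : 0 < 1 + e^-1 by rewrite ltr_wpDl // invr_gt0.
by move=> /(ler_wpM2l (ltW e1)); move: key; lra.
Qed.

(** The passage from [r_in] to [Rr] to [r_out] costs two factors [1 + e] and two bounded additive
    terms. The factors are harmless once [rho (1 + e)^2 < 1], and the additive terms are dominated
    by taking [Rr] large. *)
Lemma radii (T0 : R) : exists Rr r_in r_out e : R, [/\ 0 < e, T0 <= Rr, 0 < r_in, rho * r_out < r_in &
  (1 + e) * r_in + (1 + e^-1) * (9 / 4 * \sum_i d i) <= Rr /\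
  (1 + e) * Rr + (1 + e^-1) * (9 / 4 * \sum_i d i) <= r_out].
Proof.
(* Small enough that [rho (1 + e)^2 < 1], which is [h1]. *)
pose e := (1 - rho) / 4; have e0 : 0 < e by rewrite divr_gt0 // subr_gt0.
pose C := (1 + e^-1) * (9 / 4 * \sum_i d i).
have C0 : 0 <= C.
  by rewrite mulr_ge0 ?addr_ge0 ?invr_ge0 ?(ltW e0) // mulr_ge0 // sumr_ge0 // => i _; rewrite ltW.
have h1 : 0 < 1 - rho * (1 + e) ^+ 2 by rewrite /e; move: rho0 rho1 => a b; nra.
pose Rr := Num.max T0 (C + 1 + C * (1 + rho * (1 + e)) / (1 - rho * (1 + e) ^+ 2)).
exists Rr, ((Rr - C) / (1 + e)), ((1 + e) * Rr + C), e.
have e1 : 0 < 1 + e by rewrite addr_gt0.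
have Rb : C + 1 + C * (1 + rho * (1 + e)) / (1 - rho * (1 + e) ^+ 2) <= Rr by rewrite le_max lexx orbT.
have P0 : 0 <= C * (1 + rho * (1 + e)) / (1 - rho * (1 + e) ^+ 2).
  by rewrite mulr_ge0 ?invr_ge0 ?(ltW h1) // mulr_ge0 // addr_ge0 // mulr_ge0 // ltW.
have RC : 0 < Rr - C by lra.
split=> //; [by rewrite le_max lexx|by rewrite divr_gt0| |split].
- rewrite ltr_pdivlMr //.
  have : C * (1 + rho * (1 + e)) < Rr * (1 - rho * (1 + e) ^+ 2).
    by rewrite -ltr_pdivrMr //; lra.
  move=> h; rewrite (_ : rho * ((1 + e) * Rr + C) * (1 + e) = rho * (1 + e) ^+ 2 * Rr + rho * (1 + e) * C); last by ring.
  have : rho * (1 + e) * C + C < Rr - rho * (1 + e) ^+ 2 * Rr by move: h; lra.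
  lra.
- by rewrite -/C mulrC divfK ?gt_eqF // subrK.
- by rewrite -/C.
Qed.

(** The distance 1 of [ww_supp], plus 1/2 for the offset [b / 2] in coordinate 0. *)
Lemma centre_near M (f : {ffun 'I_n.+1 -> 'I_M}) b z i : ww (mi (f, b)) z != 0 ->
  `| `|z i 0| - `|centre f i 0| | <= 3 / 2.
Proof.
move=> /(@ww_supp R n _ _ i); rewrite /mi /centre mxE /=; case: eqP => [_|_].
  rewrite natrD -muln2 natrM [`|(f i)%:R|]ger0_norm // !ler_norml.
  have : (b : nat)%:R <= 1 :> R by rewrite lern1 leq_b1.
  have : 0 <= (b : nat)%:R :> R by [].
  by lra.
by rewrite [`|(f i)%:R / 2|]ger0_norm ?divr_ge0 // !ler_norml; lra.
Qed.

Lemma Qd_bound (z : 'cV[R]_n.+1) (r : R) : Qd z <= r -> `|z| <= \sum_i Num.sqrt (r / d i).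
Proof.
move=> zr; have s0 i : 0 <= Num.sqrt (r / d i) by exact: sqrtr_ge0.
apply: norm_cV_le => [|i]; first exact: sumr_ge0.
apply: (@le_trans _ _ (Num.sqrt (r / d i))); last by rewrite (bigD1 i) //= lerDl sumr_ge0.
rewrite -sqrtr_sqr ler_wsqrtr // ler_pdivlMr // mulrC; apply: le_trans zr.
rewrite /Qd (bigD1 i) //= lerDl sumr_ge0 // => j _; rewrite mulr_ge0 ?sqr_ge0 // ltW //.
Qed.

Lemma Qd_scale (a : R) z : Qd (a *: z) = a ^+ 2 * Qd z.
Proof. by rewrite /Qd mulr_sumr; apply: eq_bigr => i _; rewrite !mxE; ring. Qed.

Lemma Qd_le_norm : exists2 c : R, 0 < c & forall z, Qd z <= c * `|z| ^+ 2.
Proof.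
exists (\sum_i d i); first by rewrite (bigD1 ord0) //= ltr_pwDl // sumr_ge0 // => i _; rewrite ltW.
move=> z; rewrite /Qd mulr_suml; apply: ler_sum => i _; apply: ler_wpM2l; first exact: ltW.
by rewrite -[leLHS]real_normK ?num_real // lerXn2r ?nnegrE // coord_le_norm.
Qed.

End ellipsoids.

Lemma inner_mulmx (R : realType) n (Q : 'M[R]_n) (f g : 'cV[R]_n -> R[i]) : Q \in unitmx -> L2 f -> L2 g ->
  inner (fun x => f (Q *m x)) (fun x => g (Q *m x)) = (`|\det Q|^-1)%:C%C * inner f g.
Proof. by move=> uQ Lf Lg; have [_ e] := cint_mulmx uQ (cintegrable_inner Lf Lg); exact: e. Qed.

Lemma innerZr (R : realType) n (c : R[i]) (f h : 'cV[R]_n -> R[i]) : L2 f -> L2 h ->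
  inner h (fun x => c * f x) = conjc c * inner h f.
Proof. by move=> Lf Lh; rewrite innerC innerZl // [inner f h]innerC cjM conjcK. Qed.

(** * Dilates of closed subspaces *)

Section scalings.
Context (R : realType) (n : nat).
Local Notation fn := ('cV[R]_n.+1 -> R[i]).
Variable A : 'M[R]_n.+1.
Hypothesis uA : A \in unitmx.

Lemma closed_subspace_dil (V : set fn) Q : Q \in unitmx -> closed_subspace V ->
  closed_subspace [set f : fn | V (fun x => f (Q *m x))].
Proof.
move=> uQ [VL V0' Vlin VK]; have uQi : invmx Q \in unitmx by rewrite unitmx_inv.
have back (f : fn) : L2 (fun x => f (Q *m x)) -> L2 f.
  move=> /(nsq_mulmx uQi)[h _]; move: h; congr L2; apply/funext => x.
  by rewrite mulKVmx.
have VLQ : [set f : fn | V (fun x => f (Q *m x))] `<=` L2 by move=> f /VL/back.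
split => //; first by move=> a f g; exact: Vlin.
move=> f /(L2_closureP _ VLQ)[Lf cf]; apply: VK; apply/(L2_closureP _ VL).
have [LQ _] := nsq_mulmx uQ Lf; split=> // eps eps0.
have det0 : 0 < `|\det Q| by rewrite normr_gt0 -unitfE -unitmxE.
have [|g Vg fg] := cf (eps * `|\det Q|); first exact: mulr_gt0.
exists (fun x => g (Q *m x)) => //.
have [_ ->] := nsq_mulmx uQ (L2B Lf (VLQ _ Vg)).
by rewrite mulrC ltr_pdivrMr.
Qed.

Lemma uAj j : A ^ j \in unitmx.
Proof. by have : A \is a GRing.unit by []; move=> /(unitrXz j). Qed.

Lemma powA a b (x : 'cV[R]_n.+1) : A ^ a *m (A ^ b *m x) = A ^ (a + b) *m x.
Proof. by rewrite mulmxA mulmxE -exprzDr. Qed.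

(** No determinant factor appears, in agreement with [mra_dilation]; subspaces are insensitive to
    non-zero scalars. *)
Definition scaled V (j : int) : set fn := [set f | V (fun x => f (A ^ (- j) *m x))].

Lemma scaled_closed V j : closed_subspace V -> closed_subspace (scaled V j).
Proof. by move=> cV; apply: closed_subspace_dil => //; exact: uAj. Qed.

Lemma scaled0 V : scaled V 0 = V.
Proof.
by apply/funext => f; rewrite /scaled /= oppr0 expr0z; congr V; apply/funext => x; rewrite mul1mx.
Qed.

Lemma scaledD V i j f : scaled V (i + j) f <-> scaled V i (fun x => f (A ^ (- j) *m x)).
Proof.
rewrite /scaled /= (_ : (fun x => f (A ^ (- j) *m _)) = fun x => f (A ^ (- (i + j)) *m x)) //.
by apply/funext => x; rewrite powA // -opprD addrC.
Qed.

Lemma scaled_pow V j f : scaled V j (fun x => f (A ^ j *m x)) <-> V f.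
Proof.
rewrite /scaled /= (_ : (fun x => f _) = f) //.
by apply/funext => x; rewrite powA // addrN expr0z mul1mx.
Qed.

End scalings.

Section multiresolution.
Context (R : realType) (n : nat).
Local Notation normc := (@Normc.normc R).
Local Notation lam := (@lebesgue_cV R n.+1).
Local Notation fn := ('cV[R]_n.+1 -> R[i]).
Variables (A P : 'M[R]_n.+1) (d : 'I_n.+1 -> R) (rho : R).
Hypotheses (uA : A \in unitmx) (uP : P \in unitmx) (d0 : forall i, 0 < d i) (rho0 : 0 < rho) (rho1 : rho < 1).
Hypothesis contr : forall z, Qd d (invmx P *m (invmx A^T *m (P *m z))) <= rho * Qd d z.
Variables (M : nat) (Rr r_in r_out e : R).
Hypotheses (e0 : 0 < e) (r_in0 : 0 < r_in) (r_io : rho * r_out < r_in)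
  (in_le : (1 + e) * r_in + (1 + e^-1) * (9 / 4 * \sum_i d i) <= Rr)
  (out_le : (1 + e) * Rr + (1 + e^-1) * (9 / 4 * \sum_i d i) <= r_out)
  (M_big : 2 * (\sum_i Num.sqrt (r_in / d i)) + 1 < M%:R).

Let B := A^T.
Let uB : B \in unitmx. Proof. by rewrite unitmx_tr. Qed.

Definition Qf (x : 'cV[R]_n.+1) : R := Qd d (invmx P *m x).

Lemma Qf_contr x : Qf (invmx B *m x) <= rho * Qf x.
Proof. by have := contr (invmx P *m x); rewrite mulKVmx. Qed.

Definition J0 := {f : {ffun 'I_n.+1 -> 'I_M} | Qd d (centre R f) <= Rr}.
Local Notation J := (J0 * bool)%type.

Definition uj (Q : 'M[R]_n.+1) (j : J) : fn := uw Q (mi (val j.1, j.2)).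

Lemma uj_test Q j : Q \in unitmx -> test (uj Q j).
Proof. by move=> uQ; exact: uw_test. Qed.

Lemma ONsys_uj Q : Q \in unitmx -> ONsys Q (uj Q).
Proof.
move=> uQ [f b] [g c] x; rewrite (ONsys_uw uQ) -!pair_eqE /=.
by rewrite (inj_eq val_inj).
Qed.

Lemma uj_out j x : uj P j x != 0 -> Qf x <= r_out.
Proof.
case: j => -[f hf] b /=; rewrite /uj /uw mulf_eq0 negb_or => /andP[_ h].
rewrite /Qf; apply: le_trans (Qd_near d0 e0 (fun i => centre_near i h)) _.
by apply: le_trans out_le; rewrite lerD2r ler_wpM2l // addr_ge0 // ltW.
Qed.

(** A window meeting the ellipsoid of radius [r_in] has its centre in the one of radius [Rr], by
    [in_le], so the full resolution reduces to the selected windows. [M_big] guarantees that the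
    index range omits none of the windows needed. *)
Lemma resol_P g : test g -> (forall x, g x != 0 -> Qf x <= r_in) -> forall x,
  g x = \sum_(j : J) (`|\det P|%:C%C * per P (fun y => g y * conjc (uj P j y)) x) * uj P j x.
Proof.
move=> tg gin x.
rewrite (@uw_resolution R n M P uP (fun p => Qd d (centre R p.1) <= Rr) g x tg); last first.
- move=> y [f b] /gin hy; rewrite /uw mulf_eq0 negb_or => /andP[_ h] /=.
  have hs i : `| `|centre R f i 0| - `|(invmx P *m y) i 0| | <= 3 / 2.
    by rewrite distrC; exact: centre_near i h.
  apply: le_trans (Qd_near d0 e0 hs) _; apply: le_trans in_le.
  by rewrite lerD2r ler_wpM2l // addr_ge0 // ltW.
- move=> y /gin hy; apply: le_lt_trans M_big; rewrite lerD2r ler_wpM2l //.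
  exact: Qd_bound.
rewrite mulr_sumr (reindex_omap (fun j : J => (val j.1, j.2)) (fun p => omap (fun f => (f, p.2)) (insub p.1))) /=; last first.
  by case=> f b /= Ff; rewrite insubT.
rewrite (eq_bigl xpredT); last by case=> f b /=; rewrite (valP f) valK eqxx.
by apply: eq_bigr => j _; rewrite mulrA.
Qed.

Definition V0 : set fn := L2_closure (TS (duals P) (uj P)).

Lemma V0_closed : closed_subspace V0.
Proof. by apply: TS_closed => j; exact: uj_test. Qed.

Lemma duals_subgroup Q : subgroup (@duals R n Q).
Proof.
split; first by exists 0 => //; rewrite /dual /latpt (_ : map_mx _ _ = 0) ?mulmx0 //; apply/matrixP => i j; rewrite !mxE.
by move=> _ _ [k _ <-] [l _ <-]; exists (k - l) => //; rewrite /dual latptD latptN.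
Qed.

Lemma V0_in g : test g -> (forall x, g x != 0 -> Qf x <= r_in) -> V0 (ift g).
Proof.
move=> tg gin; apply: closure_ift => //.
- by move=> y; exact: subgroupN (duals_subgroup P).
- by move=> j; exact: uj_test.
pose s (j : J) x := `|\det P|%:C%C * per P (fun y => g y * conjc (uj P j y)) x.
have -> : g = fun x => \sum_j s j x * uj P j x by apply/funext => x; exact: resol_P.
apply: (@frame_closure R n P J s (uj P) uP).
- by move=> j x k; rewrite /s per_periodic.
- move=> j; apply: csmoothM; first exact: csmooth_cst.
  by apply: csmooth_per => //; apply: test_conjM => //; exact: uj_test.
- by move=> j; exact: uj_test.
Qed.

Lemma V0_perp h f : test h -> (forall x, Qf x <= r_out -> h x = 0) -> V0 f -> inner f (ift h) = 0.
Proof.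
move=> th h0; apply: inner_closure_eq0; [by apply: TS_L2 => j; exact: uj_test|exact: test_ift_L2|].
move=> _ [m [k [c [hk ->]]]]; have tu j : test (uj P j) by exact: uj_test.
rewrite inner_suml ?big1 //; [|by move=> i _; apply: L2Z; exact: translate_L2|exact: test_ift_L2].
move=> i _; rewrite innerZl; [|exact: translate_L2|exact: test_ift_L2].
rewrite translateE plancherel; [|by apply: invertible_test; exact: test_ewM|exact: invertible_test].
rewrite innerE (_ : (fun x => _) = fun=> 0) ?cint0 ?mulr0 //; apply/funext => x.
have [->|/uj_out/h0 ->] := eqVneq (uj P (k i).2 x) 0; first by rewrite mulr0 mul0r.
by rewrite conjc0 mulr0.
Qed.

Lemma ift_dil Q (g : fn) : Q \in unitmx -> test g ->
  (fun x => ift g (Q *m x)) = fun x => (`|\det Q|^-1)%:C%C * ift (fun xi => g ((invmx Q)^T *m xi)) x.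
Proof.
move=> uQ tg; apply/funext => x; rewrite ift_mulmx //; last exact: test_cintegrable.
rewrite iftZ //; apply: test_cintegrable; apply: test_mulmx => //.
by rewrite unitmx_tr unitmx_inv.
Qed.

Local Notation Vj := (scaled A V0).

Lemma Vj_in j g : test g -> (forall x, g x != 0 -> Qf ((A ^ (- j))^T *m x) <= r_in) -> Vj j (ift g).
Proof.
move=> tg gin; rewrite /scaled /= ift_dil //; last exact: (uAj uA).
apply: (closed_subspaceZ _ V0_closed); apply: V0_in.
  by apply: test_mulmx => //; rewrite unitmx_tr unitmx_inv (uAj uA).
move=> x /gin; rewrite mulmxA -trmx_mul mulVmx ?(uAj uA) // trmx1 mul1mx //.
Qed.

Lemma Vj_nested j : Vj j `<=` Vj (j + 1).
Proof.
move=> f; rewrite addrC; have -> : f = (fun x => f x) by [].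
move=> Vf; apply/(scaledD uA V0 1 j).
have cV := closed_subspace_dil (uAj uA (- 1)) V0_closed.
apply: (span_closure_sub cV _ Vf) => -[y k] _; rewrite /= translateE.
rewrite ift_dil; [|exact: (uAj uA)|by apply: test_ewM; exact: uj_test].
apply: (closed_subspaceZ _ V0_closed); apply: V0_in.
  have uQ : (invmx (A ^ (- 1)))^T \in unitmx by rewrite unitmx_tr unitmx_inv (uAj uA).
  exact: (test_mulmx uQ (test_ewM (- y) (uj_test k uP))).
move=> x; rewrite mulf_eq0 negb_or => /andP[_ /uj_out h].
have := Qf_contr ((invmx (A ^ -1))^T *m x); rewrite mulmxA.
rewrite (_ : invmx B *m _ = 1%:M) ?mul1mx; last first.
  by rewrite exprN1 -[A^-1]/(invmx A) invmxK mulVmx.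
move/le_trans; apply; apply: (@le_trans _ _ (rho * r_out)); last exact: ltW.
by apply: ler_wpM2l => //; exact: ltW.
Qed.

Lemma Qf_decay (j : nat) x : Qf ((A ^ (- j%:Z))^T *m x) <= rho ^+ j * Qf x.
Proof.
elim: j => [|j ih]; first by rewrite oppr0 expr0z trmx1 mul1mx expr0 mul1r.
have -> : (A ^ (- j.+1%:Z))^T *m x = invmx B *m ((A ^ (- j%:Z))^T *m x).
  have -> : - j.+1%:Z = - j%:Z + -1 by rewrite -addn1 PoszD opprD.
  rewrite exprzDr // exprN1 -mulmxE trmx_mul mulmxA.
  by rewrite -[A^-1]/(invmx A) trmx_inv.
apply: le_trans (Qf_contr _) _; rewrite exprS -mulrA.
by apply: ler_wpM2l => //; exact: ltW.
Qed.

(** The spectrum of [g] is bounded, so [Qf <= q] on it; once [rho^j q <= r_in], the criterion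
    [Vj_in] applies. *)
Lemma Vj_union (g : fn) : test g -> exists j, Vj j (ift g).
Proof.
move=> tg; have [_ [N gN]] := tg; have [c c0 hc] := Qd_le_norm d0.
have [C C0 hC] := norm_mulmx_le (invmx P).
pose q := c * (C * `|N|) ^+ 2 + 1.
have q0 : 0 < q by rewrite ltr_wpDl // mulr_ge0 ?sqr_ge0 // ltW.
have gq x : g x != 0 -> Qf x <= q.
  move=> gx; have xN : `|x| <= `|N|.
    apply: le_trans (ler_norm N); rewrite leNgt; apply/negP => /gN /eqP; exact/negP.
  apply: le_trans (hc _) _; apply: (@le_trans _ _ (c * (C * `|N|) ^+ 2)); last by rewrite lerDl.
  apply: ler_wpM2l; first exact: ltW.
  rewrite lerXn2r ?nnegrE ?mulr_ge0 ?(ltW C0) //; apply: le_trans (hC _) _.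
  by apply: ler_wpM2l => //; exact: ltW.
have hr : (fun j => rho ^+ j) @ \oo --> 0 by apply: cvg_expr; rewrite ger0_norm // ltW.
have [j _ hj] := (cvgrPdist_le _ _).1 hr (r_in / q) (divr_gt0 r_in0 q0).
exists j%:Z; apply: Vj_in => // x /gq xq; apply: le_trans (Qf_decay j x) _.
have := hj j (leqnn j); rewrite /= sub0r normrN => /(le_trans (ler_norm _)).
rewrite ler_pdivlMr //; apply: le_trans; apply: ler_wpM2l => //.
by rewrite exprn_ge0 // ltW.
Qed.

(** The spectra of the space of index [- j] lie where [Qf <= rho^j r_out], a neighbourhood of the
    origin that shrinks with [j] until [g] vanishes on it. *)
Lemma Vj_perp (g : fn) : test_off0 g -> exists j : nat, forall f, Vj (- j%:Z) f -> inner f (ift g) = 0.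
Proof.
move=> [tg [s s0 gs]].
have [C C0 hC] := norm_mulmx_le P.
pose K := 1 + \sum_i Num.sqrt (1 / d i).
have K0 : 0 < K by rewrite ltr_pwDl // sumr_ge0 // => i _; rewrite sqrtr_ge0.
(* If [Qf x <= t] then [invmx P *m x] has norm at most [(K - 1) sqrt t], so
   [|x| <= C (K - 1) sqrt t < s]. *)
pose t := (s / (2 * C * K)) ^+ 2; have t0 : 0 < t by rewrite exprn_gt0 // divr_gt0 // !mulr_gt0.
have small x : Qf x <= t -> `|x| < s.
  move=> xt; have sq0 : 0 < Num.sqrt t by rewrite sqrtr_gt0.
  have : Qd d ((Num.sqrt t)^-1 *: (invmx P *m x)) <= 1.
    by rewrite Qd_scale exprVn (sqr_sqrtr (ltW t0)) ler_pdivrMl // mulr1.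
  move=> /(Qd_bound d0); rewrite normrZ gtr0_norm ?invr_gt0 // ler_pdivrMl // => h.
  rewrite -[x](mulKVmx uP); apply: le_lt_trans (hC _) _.
  apply: (@le_lt_trans _ _ (C * (Num.sqrt t * \sum_i Num.sqrt (1 / d i)))).
    by apply: ler_wpM2l h; exact: ltW.
  have sK : Num.sqrt t = s / (2 * C * K).
    by rewrite sqrtr_sqr ger0_norm // divr_ge0 ?ltW // !mulr_gt0.
  have -> : C * (Num.sqrt t * \sum_i Num.sqrt (1 / d i)) = s * ((K - 1) / (2 * K)).
    have -> : \sum_i Num.sqrt (1 / d i) = K - 1 by rewrite /K [RHS]addrC addKr.
    have fE (a k y : R) : a != 0 -> k != 0 -> a * (y / (2 * a * k) * (k - 1)) = y * ((k - 1) / (2 * k)).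
      by move=> h1 h2; field; rewrite h2 h1.
    by rewrite sK; apply: fE; exact: lt0r_neq0.
  by rewrite gtr_pMr // ltr_pdivrMr ?mulr_gt0 //; move: K0; lra.
have ro : 0 < `|r_out| + 1 by rewrite ltr_wpDl.
have hr : (fun j => rho ^+ j) @ \oo --> 0 by apply: cvg_expr; rewrite ger0_norm // ltW.
have [j _ hj] := (cvgrPdist_le _ _).1 hr (t / (`|r_out| + 1)) (divr_gt0 t0 ro).
exists j => f Vf; have [VL _ _ _] := scaled_closed uA (- j%:Z) V0_closed.
have uj' := uAj uA j%:Z; have Lf := VL _ Vf.
have tg' : test (fun xi => g ((invmx (A ^ j%:Z))^T *m xi)).
  by apply: test_mulmx => //; rewrite unitmx_tr unitmx_inv.
have := inner_mulmx uj' Lf (test_ift_L2 tg).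
have L1 : L2 (fun x => f (A ^ j%:Z *m x)) by have [] := nsq_mulmx uj' Lf.
rewrite (ift_dil uj' tg) (innerZr _ (test_ift_L2 tg') L1).
rewrite V0_perp ?mulr0 //; last first.
- by move: Vf; rewrite /scaled /= opprK.
- move=> x xr; apply: gs; apply: small.
  have -> : invmx (A ^ j%:Z) = A ^ (- j%:Z) by rewrite -invr_expz.
  apply: le_trans (Qf_decay j x) _.
  have := hj j (leqnn j); rewrite /= sub0r normrN => /(le_trans (ler_norm _)).
  rewrite ler_pdivlMr //; apply: le_trans; apply: ler_wpM2l; first by rewrite exprn_ge0 // ltW.
  by apply: le_trans xr _; apply: (le_trans (ler_norm _)); rewrite lerDl.
move/esym/eqP; rewrite mulf_eq0 => /orP[|/eqP->] //.
rewrite (_ : _ == 0 = (`|\det (A ^ j%:Z)|^-1 == 0)); last by rewrite -[0 in LHS]/(0%:C)%C (inj_eq (@complexI R)).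
by rewrite invr_eq0 normr_eq0 => /eqP dj; move: uj'; rewrite unitmxE dj unitr0.
Qed.

End multiresolution.

(** * Joins of closed subspaces and orthogonal splitting *)

Section orthogonal_sums.
Context (R : realType) (n : nat).
Local Notation normc := (@Normc.normc R).
Local Notation fn := ('cV[R]_n.+1 -> R[i]).
Implicit Types (f g v w : fn) (V W : set fn).

Lemma nsq0 : nsq ((fun=> 0) : fn) = 0.
Proof. by apply: complexI; rewrite -inner_self inner0l. Qed.

Lemma nsq_ae0 f : L2 f -> {ae lebesgue_cV n.+1, forall x, f x = 0} -> nsq f = 0.
Proof.
move=> Lf f0; have mi := measurable_int _ (L2_integrable Lf).
apply: EFin_inj; rewrite -EFin_nsq //.
transitivity (\int[lebesgue_cV n.+1]_x `|(normc (f x) ^+ 2)%:E|)%E.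
  by apply: eq_integral => x _; rewrite /= ger0_norm ?sqr_ge0.
apply/(ae_eq_integral_abs (lebesgue_cV n.+1) measurableT mi); apply: filterS f0 => x /= -> _.
by rewrite -[0]/(0%:C)%C normc_real normr0 expr0n.
Qed.

Lemma L2_closure_incl V : V `<=` L2 -> V `<=` L2_closure V.
Proof.
move=> VL v Vv; apply/(L2_closureP _ VL); split; first exact: VL.
move=> e e0; exists v => //; rewrite (_ : (fun x => _) = fun=> 0) ?nsq0 //.
by apply/funext => x; rewrite subrr.
Qed.

Lemma closure_gen I (D : set I) (e : I -> fn) i : (forall i, D i -> L2 (e i)) -> D i ->
  L2_closure (lin_span D e) (e i).
Proof. by move=> eL Di; apply: L2_closure_incl; [exact: lin_span_L2|exact: lin_span_gen]. Qed.

Lemma closed_join V W : closed_subspace V -> closed_subspace W ->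
  closed_subspace (L2_closure (lin_span (V `|` W) id)).
Proof. by move=> [VL _ _ _] [WL _ _ _]; apply: closed_span => f [/VL|/WL]. Qed.

Lemma join_subl V W : closed_subspace V -> closed_subspace W -> V `<=` L2_closure (lin_span (V `|` W) id).
Proof.
move=> [VL _ _ _] [WL _ _ _] v Vv; apply: (@closure_gen _ _ id) => [f [/VL|/WL]//|].
by left.
Qed.

Lemma join_subr V W : closed_subspace V -> closed_subspace W -> W `<=` L2_closure (lin_span (V `|` W) id).
Proof. by move=> cV cW; rewrite setUC; exact: join_subl. Qed.

Lemma join_sub V W X : closed_subspace X -> V `<=` X -> W `<=` X ->
  L2_closure (lin_span (V `|` W) id) `<=` X.
Proof. by move=> cX VX WX; apply: span_closure_sub => // f [/VX|/WX]. Qed.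

(* If [f] is close to [a + b] with [a] in [V], [b] in [W] then [f - b] is orthogonal to [a], so [b] alone is at least as close. *)
Lemma closure_split V W f : closed_subspace V -> closed_subspace W ->
  (forall w v, W w -> V v -> inner w v = 0) ->
  L2_closure (lin_span (V `|` W) id) f -> (forall v, V v -> inner f v = 0) -> W f.
Proof.
move=> cV cW WV; have [VL V0 Vlin _] := cV; have [WL W0 Wlin WK] := cW.
have SL : lin_span (V `|` W) id `<=` L2 by apply: lin_span_L2 => h [/VL|/WL].
move=> /(L2_closureP _ SL)[Lf cf] fV; apply: WK; apply/(L2_closureP _ WL); split=> // e /cf[_ [m [h [c [hh ->]]]]].
pose a x := \sum_k (if `[< V (h k) >] then c k else 0) * h k x.
pose b x := \sum_k (if `[< V (h k) >] then 0 else c k) * h k x.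
have Va : V a.
  apply: closed_subspace_sum => // k; case: asboolP => hk; first exact: closed_subspaceZ.
  by under eq_fun do rewrite mul0r.
have Wb : W b.
  apply: closed_subspace_sum => // k; case: asboolP => hk; first by under eq_fun do rewrite mul0r.
  by apply: closed_subspaceZ => //; case: (hh k).
rewrite (_ : (fun x => f x - _) = fun x => (f x - b x) - a x); last first.
  apply/funext => x; rewrite -addrA -opprD -big_split /=; congr (_ - _); apply: eq_bigr => k _.
  by rewrite -mulrDl; case: asboolP => _; rewrite ?add0r ?addr0.
have La := VL _ Va; have Lb := WL _ Wb.
rewrite nsq_pythagoras //; [|exact: L2B|by rewrite innerBl // fV // WV // subrr].
by move=> h'; exists b => //; apply: le_lt_trans h'; rewrite lerDl nsq_ge0.
Qed.

End orthogonal_sums.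

(** * Wavelets *)

Section wavelets_of_multiresolution.
Context (R : realType) (n : nat).
Local Notation normc := (@Normc.normc R).
Local Notation fn := ('cV[R]_n.+1 -> R[i]).
Implicit Types (f g v w : fn) (V W : set fn).
Variable A : 'M[R]_n.+1.
Hypothesis uA : A \in unitmx.

Local Notation scaled := (scaled A).

Lemma scaled_join V W j : closed_subspace V -> closed_subspace W ->
  scaled (L2_closure (lin_span (V `|` W) id)) j `<=`
  L2_closure (lin_span (scaled V j `|` scaled W j) id).
Proof.
move=> cV cW f hf.
have cVj := scaled_closed uA j cV; have cWj := scaled_closed uA j cW.
have cX := scaled_closed uA (- j) (closed_join cVj cWj).
suff : scaled (L2_closure (lin_span (scaled V j `|` scaled W j) id)) (- j) (fun x => f (A ^ (- j) *m x)).
  by rewrite -(scaledD uA) addNr scaled0.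
apply: (join_sub cX _ _ hf) => h hh.
- by rewrite /scaled /= opprK; apply: join_subl => //; exact/(scaled_pow uA V j h).
- by rewrite /scaled /= opprK; apply: join_subr => //; exact/(scaled_pow uA W j h).
Qed.

Variables (V0 : set fn) (L : nat) (psi : 'I_L -> fn).
Let W0 := L2_closure (TS int_lattice psi).
Hypotheses (cV0 : closed_subspace V0) (nested : V0 `<=` scaled V0 1) (tpsi : forall l, test (psi l))
  (W0_sub : W0 `<=` scaled V0 1) (W0_perp : forall w v, W0 w -> V0 v -> inner w v = 0)
  (V1_sub : scaled V0 1 `<=` L2_closure (lin_span (V0 `|` W0) id))
  (psi_inner : forall y z i j, int_lattice y -> int_lattice z ->
    inner (translate y (ift (psi i))) (translate z (ift (psi j))) = ((i == j) && (y == z))%:R)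
  (V_union : forall g, test g -> exists j, scaled V0 j (ift g))
  (V_perp : forall g, test_off0 g -> exists j : nat, forall f, scaled V0 (- j%:Z) f -> inner f (ift g) = 0).

Let cW0 : closed_subspace W0. Proof. exact: TS_closed. Qed.

Let psiW y l : int_lattice y -> W0 (translate y (ift (psi l))).
Proof.
move=> hy; apply: (@closure_gen _ _ _ _ (fun p => translate p.1 (ift (psi p.2))) (y, l)) => //.
by move=> i _; exact: translate_L2.
Qed.

Lemma associated_psi : associated (fun l => ift (psi l)) (scaled V0).
Proof.
split.
- move=> [y l] /= hy; split; first by apply: W0_sub; exact: psiW.
  by move=> g; rewrite scaled0 => Vg; apply: W0_perp => //; exact: psiW.
- by move=> [y l] /= hy; rewrite psi_inner // !eqxx.
- move=> [y l] [z k] /= hy hz yz; rewrite psi_inner //; case: (eqVneq l k) => [lk|//].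
  by case: eqP => // yz'; case: yz; rewrite lk yz'.
- move=> f [V1f fV]; apply: (closure_split cV0 cW0 W0_perp); first exact: V1_sub.
  by move=> v Vv; apply: fV; rewrite scaled0.
Qed.

Lemma scaled_nested j : scaled V0 j `<=` scaled V0 (j + 1).
Proof. by move=> f; rewrite addrC => Vf; apply/(scaledD uA); exact: nested. Qed.

Lemma scaled_le i j : i <= j -> scaled V0 i `<=` scaled V0 j.
Proof.
rewrite -subr_ge0 => ij; rewrite -[j](subrK i) addrC; move: (j - i) ij => k; case: k => [k _|//].
elim: k => [|k ih] f Vf; first by rewrite addr0.
rewrite (_ : i + k.+1%:Z = i + k%:Z + 1); last by rewrite -addrA -PoszD addn1.
by apply: scaled_nested; exact: ih.
Qed.

Lemma scaled_W_sub j : scaled W0 j `<=` scaled V0 (j + 1).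
Proof. by move=> f Wf; rewrite addrC; apply/(scaledD uA); exact: W0_sub. Qed.

Lemma scaled_inner j f g : L2 f -> L2 g ->
  inner f g = `|\det (A ^ j)|%:C%C * inner (fun x => f (A ^ j *m x)) (fun x => g (A ^ j *m x)).
Proof.
move=> Lf Lg; have uj := uAj uA j; rewrite inner_mulmx // mulrA -rmorphM /= mulfV ?mul1r //.
by rewrite normr_eq0 -unitfE -unitmxE.
Qed.

Lemma scaled_perp j w v : scaled W0 j w -> scaled V0 j v -> inner w v = 0.
Proof.
move=> Ww Vv; have [VL _ _ _] := scaled_closed uA j cV0; have [WL _ _ _] := scaled_closed uA j cW0.
by rewrite (@scaled_inner (- j)) ?W0_perp ?mulr0 //; [exact: WL|exact: VL].
Qed.

Let e (p : int * 'cV[R]_n.+1 * 'I_L) := dilate (A ^ p.1.1) (translate p.1.2 (ift (psi p.2))).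

Let c j : R := Num.sqrt `|\det (A ^ j)|.

Let c0 j : 0 < c j.
Proof. by rewrite sqrtr_gt0 normr_gt0 -unitfE -unitmxE uAj. Qed.

Let eW j y l : int_lattice y -> scaled W0 j (e (j, y, l)).
Proof.
move=> hy; rewrite /e /dilate /=.
apply: (closed_subspaceZ _ (scaled_closed uA j cW0)); apply/(scaled_pow uA); exact: psiW.
Qed.

Let eL2 p : int_lattice p.1.2 -> L2 (e p).
Proof. by case: p => -[j y] l /= hy; have [WL _ _ _] := scaled_closed uA j cW0; apply: WL; exact: eW. Qed.

(* The wavelets of scale at least [m]. *)
Let X m := L2_closure (lin_span [set p | int_lattice p.1.2 /\ m <= p.1.1] e).

Let cX m : closed_subspace (X m).
Proof. by apply: closed_span => p [hp _]; exact: eL2. Qed.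

Let WX m j : m <= j -> scaled W0 j `<=` X m.
Proof.
move=> mj f Wf.
suff : scaled (X m) (- j) (fun x => f (A ^ (- j) *m x)) by rewrite -(scaledD uA) addNr scaled0.
apply: (span_closure_sub (scaled_closed uA (- j) (cX m)) _ Wf) => -[y l] /= hy.
rewrite /scaled /= opprK.
have := @closure_gen R n _ [set p | int_lattice p.1.2 /\ m <= p.1.1] e (j, y, l) (fun p hp => eL2 hp.1) (conj hy mj).
move=> /(closed_subspaceZ ((c j)^-1)%:C%C (cX m)); congr (X m).
by apply/funext => x; rewrite /e /dilate /= mulrA -rmorphM /= mulVf ?mul1r // gt_eqF.
Qed.

Let XV m v f : X m f -> scaled V0 m v -> inner f v = 0.
Proof.
move=> Xf Vv; have [VL _ _ _] := scaled_closed uA m cV0.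
apply: (inner_closure_eq0 _ _ _ Xf); [by apply: lin_span_L2 => p [hp _]; exact: eL2|exact: VL|].
move=> _ [k [i [a [hi ->]]]].
rewrite inner_suml ?big1 //; [|by move=> j _; apply: L2Z; apply: eL2; have [] := hi j|exact: VL].
move=> j _; have [hj mj] := hi j; rewrite innerZl; [|exact: eL2|exact: VL].
rewrite (@scaled_perp (i j).1.1) ?mulr0 //; last exact: (scaled_le mj).
by case: (i j) hj => -[? ?] ?; exact: eW.
Qed.

(** Induction on [k]: each finer space is contained in the join of the previous one with the
    wavelets of scale [m + k], which belong to [X m]. *)
Let VX m k : scaled V0 (m + k%:Z) `<=` L2_closure (lin_span (scaled V0 m `|` X m) id).
Proof.
have cVm := scaled_closed uA m cV0; have cVX := closed_join cVm (cX m).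
elim: k => [|k ih]; first by rewrite addr0; exact: join_subl.
rewrite (_ : m + k.+1%:Z = 1 + (m + k%:Z)); last by rewrite addrCA -PoszD.
move=> f /(scaledD uA)/V1_sub/(@scaled_join V0 W0 (m + k%:Z) cV0 cW0).
apply: join_sub => // g Wg; apply: join_subr => //; apply: WX Wg.
by rewrite lerDl.
Qed.

Lemma wavelet_inner_lt p q : int_lattice p.1.2 -> int_lattice q.1.2 -> p.1.1 < q.1.1 -> inner (e q) (e p) = 0.
Proof.
move: p q => [[j y] l] [[k z] i] /= hy hz jk.
apply: (@scaled_perp k); first exact: eW.
apply: (@scaled_le (j + 1)); first by rewrite lezD1.
by apply: scaled_W_sub; exact: eW.
Qed.

(** For completeness, the transform of a test function vanishing near the origin lies in some space
    [V_J] and is orthogonal to some [V_(-J')]. As [V_J] is contained in the join of [V_(-J')] and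
    [X (-J')], [closure_split] puts it into [X (-J')]; such transforms are dense. *)
Lemma wavelet_psi : orthonormal_wavelet A (fun l => ift (psi l)).
Proof.
have same j y z l k : int_lattice y -> int_lattice z ->
    inner (e (j, y, l)) (e (j, z, k)) = ((l == k) && (y == z))%:R.
  move=> hy hz; rewrite /e /dilate /= -/(c j).
  have Ly : L2 (translate y (ift (psi l))) by exact: translate_L2.
  have Lz : L2 (translate z (ift (psi k))) by exact: translate_L2.
  have [Ly' _] := nsq_mulmx (uAj uA j) Ly; have [Lz' _] := nsq_mulmx (uAj uA j) Lz.
  rewrite (innerZl _ Ly') ?(innerZr _ Lz' Ly'); last exact: L2Z.
  rewrite -psi_inner // (@scaled_inner j _ _ Ly Lz) mulrA; congr (_ * _).
  by rewrite conjc_real -rmorphM /= -expr2 sqr_sqrtr.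
split.
- by move=> p /= hp; exact: eL2.
- by move=> [[j y] l] /= hy; rewrite -/(e (j, y, l)) same // !eqxx.
- move=> [[j y] l] [[k z] i] /= hy hz jk; rewrite -/(e (j, y, l)) -/(e (k, z, i)).
  have [jk'|kj|jk'] := ltgtP j k.
  + by rewrite innerC wavelet_inner_lt // conjc0.
  + by rewrite wavelet_inner_lt.
  + rewrite -jk' same //; case: (eqVneq l i) => [li|//].
    by case: eqP => // yz; case: jk; rewrite jk' li yz.
- have cY : closed_subspace (L2_closure (lin_span [set p | int_lattice p.1.2] e)).
    by apply: closed_span => p hp; exact: eL2.
  have [_ _ _ YK] := cY.
  rewrite -(L2_dense R n) => f; move=> hf; apply: YK; move: hf.
  apply: L2_closure_mono => _ /lin_span_ift[g [tg g0] ->].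
  have [J VJ] := V_union tg; have [J' VJ'] := V_perp (conj tg g0).
  have [k Jk] : exists k : nat, J <= - J'%:Z + k%:Z.
    exists (`|J| + J')%N; rewrite PoszD addrC addrK; exact: lez_abs.
  have : X (- J'%:Z) (ift g).
    apply: (closure_split (scaled_closed uA _ cV0) (cX _) (fun w v => @XV _ v w)).
      by apply: (@VX _ k); exact: (scaled_le Jk).
    by move=> v Vv; rewrite innerC VJ' // conjc0.
  apply: L2_closure_mono => _ [m [i [a [hi ->]]]]; exists m, i, a; split=> // j.
  by have [] := hi j.
Qed.

Lemma scaled_dense : L2_closure (\bigcup_j scaled V0 j) = L2.
Proof.
apply/seteqP; split=> [f []//|]; rewrite -(L2_dense R n).
apply: L2_closure_mono => _ /lin_span_ift[g [tg _] ->].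
by have [j Vj] := V_union tg; exists j.
Qed.

(** An element of all the spaces is orthogonal to a dense set by [V_perp], so its norm is 0.
    Conversely a null function is at distance 0 from the zero function, and the spaces are
    closed. *)
Lemma scaled_cap : \bigcap_j scaled V0 j =
  [set f : fn | L2 f /\ {ae lebesgue_cV n.+1, forall x, f x = 0}].
Proof.
apply/seteqP; split=> f.
- move=> Vf; have Lf : L2 f by have [VL _ _ _] := cV0; apply: VL; rewrite -(scaled0 A V0); exact: Vf.
  split=> //; apply: nsq_eq0_ae => //; apply: complexI; rewrite -inner_self.
  have : L2_closure (lin_span [set g | test_off0 g] (@ift R n.+1)) f by rewrite L2_dense.
  apply: inner_closure_eq0 => //; first by apply: lin_span_L2 => g [tg _]; exact: test_ift_L2.
  move=> _ /lin_span_ift[g tg ->]; have [j hj] := V_perp tg.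
  by rewrite innerC hj ?conjc0 //; exact: Vf.
- move=> [Lf f0] j _; have [VL V0' _ VK] := scaled_closed uA j cV0; apply: VK.
  apply/(L2_closureP _ VL); split=> // eps eps0; exists (fun=> 0) => //.
  by under eq_fun do rewrite subr0; rewrite nsq_ae0.
Qed.

End wavelets_of_multiresolution.

(** * Real frames and sublattices *)

Section frames.
Context (R : realType) (n : nat).
Local Notation fn := ('cV[R]_n.+1 -> R[i]).
Local Notation set_V := (set 'cV[R]_n.+1).

Lemma inner_translate y z (f g : fn) : test f -> test g ->
  inner (translate y (ift f)) (translate z (ift g)) =
  inner (fun x => ew (- y) x * f x) (fun x => ew (- z) x * g x).
Proof.
by move=> tf tg; rewrite !translateE plancherel //; apply: invertible_test; exact: test_ewM.
Qed.

Lemma TS_closure_sub (G H : set_V) I J (u : I -> fn) (v : J -> fn) : subgroup G -> subgroup H ->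
  (forall i, test (u i)) -> (forall j, test (v j)) ->
  (forall y i, G y -> FS H v (fun xi => ew y xi * u i xi)) ->
  L2_closure (TS G u) `<=` L2_closure (TS H v).
Proof.
move=> sG sH tu tv h; apply: span_closure_sub; first exact: TS_closed.
move=> [y i] /= Gy; rewrite translateE; apply: closure_ift => //.
- by move=> z; exact: subgroupN.
- exact: test_ewM.
- by apply: L2_closure_incl; [exact: FS_L2|apply: h; exact: subgroupN].
Qed.

(** The converse of [closure_ift], by the same isometry. *)
Lemma FS_closure (G : set_V) I (u : I -> fn) g : subgroup G -> (forall i, test (u i)) -> test g ->
  L2_closure (TS G u) (ift g) -> L2_closure (FS G u) g.
Proof.
move=> sG tu tg /(L2_closureP _ (@TS_L2 R n G I u tu))[_ cg].
apply/(L2_closureP _ (@FS_L2 R n G I u tu)); split; first exact: test_L2.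
move=> e /cg[_ [m [k [c [hk ->]]]] ge].
have [h [Fh hE]] : exists h, FS G u h /\ ift h = fun x => \sum_i c i * translate (k i).1 (ift (u (k i).2)) x.
  exists (fun xi => \sum_i c i * (ew (- (k i).1) xi * u (k i).2 xi)); split.
    exists m, (fun i => (- (k i).1, (k i).2)), c; split=> // i; exact: (subgroupN sG (hk i)).
  apply/funext => x; rewrite ift_sum; last by move=> i; apply: testZ; exact: test_ewM.
  apply: eq_bigr => i _; rewrite iftZ ?translateE //.
  by apply: test_cintegrable; exact: test_ewM.
exists h => //; rewrite -nsq_ift_B; [by rewrite hE|exact: invertible_test|].
by apply: invertible_test; exact: FS_test Fh.
Qed.

Lemma FS_gen (G : set_V) I (u : I -> fn) y i : G y -> FS G u (fun xi => ew y xi * u i xi).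
Proof.
move=> Gy.
exact: (@lin_span_gen R n.+1 _ [set p : 'cV[R]_n.+1 * I | G p.1] (fun p xi => ew p.1 xi * u p.2 xi) (y, i)).
Qed.

Section lattice_system.
Variables (P : 'M[R]_n.+1) (J : finType) (u : J -> fn).
Hypotheses (uP : P \in unitmx) (tu : forall j, test (u j)) (ou : ONsys P u).

Lemma dual_inj : injective (dual P).
Proof.
move=> k l; rewrite /dual /latpt => /(congr1 (mulmx P^T)).
rewrite !mulmxA -trmx_mul mulVmx // trmx1 !mul1mx => /matrixP h.
by apply/matrixP => i j; apply: (@intr_inj R); have := h i j; rewrite !mxE.
Qed.

Lemma ONsys_duals y z i j : duals P y -> duals P z ->
  inner (fun x => ew y x * u i x) (fun x => ew z x * u j x) = ((i == j) && (y == z))%:R.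
Proof.
move=> [k _ <-] [l _ <-]; rewrite (inj_eq dual_inj).
exact: (ONsys_inner (@chi0_test R n) (@per_chi0 R n) (@chi0_int R n) uP tu ou i j k l).
Qed.

Lemma ONsys_translates y z i j : duals P y -> duals P z ->
  inner (translate y (ift (u i))) (translate z (ift (u j))) = ((i == j) && (y == z))%:R.
Proof.
move=> hy hz; have sP := duals_subgroup P; rewrite inner_translate //.
by rewrite ONsys_duals ?eqr_opp //; exact: subgroupN.
Qed.

Section sublattice.
Variables (H : set_V) (q : nat) (rep : 'I_q -> 'cV[R]_n.+1).
Hypotheses (sH : subgroup H) (HG : H `<=` duals P) (repP : coset_reps H (duals P) rep).

(** Passing from the dual lattice to a subgroup [H] of finite index multiplies the generators by the
    characters of the coset representatives; [enum_val] makes the index set an ordinal. *)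
Definition sub_frame (p : 'I_#|{: J * 'I_q}|) : fn :=
  fun x => ew (rep (enum_val p).2) x * u (enum_val p).1 x.

Lemma sub_frame_test p : test (sub_frame p).
Proof. exact: test_ewM. Qed.

Lemma sub_frame_closure : L2_closure (TS H sub_frame) = L2_closure (TS (duals P) u).
Proof.
have sP := duals_subgroup P; have [rG _ rS] := repP.
apply/seteqP; split; apply: TS_closure_sub => //; try exact: sub_frame_test.
- move=> y p Hy.
  rewrite (_ : (fun xi => _) = fun xi => ew (y + rep (enum_val p).2) xi * u (enum_val p).1 xi).
    by apply: FS_gen; apply: subgroupD => //; exact: HG.
  by apply/funext => x; rewrite ewDl /sub_frame mulrA.
- move=> y j /rS[r hr].
  rewrite (_ : (fun xi => _) = fun xi => ew (y - rep r) xi * sub_frame (enum_rank (j, r)) xi).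
    exact: FS_gen.
  by apply/funext => x; rewrite /sub_frame enum_rankK /= mulrA -ewDl subrK.
Qed.

Lemma sub_frame_ON : H = int_lattice -> ONsys 1%:M sub_frame.
Proof.
move=> HE; have sP := duals_subgroup P; have [rG rI _] := repP.
apply: ONsys_of_inner => [|p p' l]; first exact: sub_frame_test.
have Hl : H (map_mx intr l) by rewrite HE; exists l.
rewrite (_ : (fun x => _) = fun x => ew (map_mx intr l + rep (enum_val p').2) x * u (enum_val p').1 x); last first.
  by apply/funext => x; rewrite ewDl /sub_frame mulrA.
rewrite ONsys_duals //; last by apply: subgroupD => //; exact: HG.
rewrite -(inj_eq enum_val_inj) -pair_eqE /= -andbA; congr (((_ && _) : bool)%:R).
apply/eqP/andP => [h|[/eqP-> /eqP->]]; last first.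
  by rewrite (_ : map_mx _ _ = 0) ?add0r //; apply/matrixP => i j; rewrite !mxE.
have h' : (enum_val p).2 = (enum_val p').2 by apply: rI; rewrite h addrK.
split; first exact/eqP.
move: h; rewrite h' -[LHS]add0r => /addIr/matrixP h.
by apply/eqP/matrixP => i j; apply: (@intr_inj R); have := h i j; rewrite !mxE.
Qed.

End sublattice.
End lattice_system.

(** * Real-valued generators over a sublattice *)

Section real_frames.
Variables (P : 'M[R]_n.+1) (I : finType) (u : I * bool -> fn).
Hypotheses (uP : P \in unitmx) (tu : forall j, test (u j)) (ou : ONsys P u)
  (ru : forall j x, conjc (u j x) = u j x).
Variables (H : set_V) (q : nat) (rep : 'I_q -> 'cV[R]_n.+1).
Hypotheses (sH : subgroup H) (HG : H `<=` duals P) (repP : coset_reps H (duals P) rep).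

(* With [ew k = C + i S], the pair [(u0, u1)] is rotated to the real pair [(C u0 - S u1, S u0 + C u1)];
   [rot b (s, c)] is the coefficient of [ew (+-k) u_c] in the component [b]. *)
Definition rot (b : bool) (p : bool * bool) : R[i] :=
  2^-1 * (if b == p.2 then 1 else if b == p.1 then - 'i%C else 'i%C).

Definition sgv (s : bool) (k : 'cV[R]_n.+1) := if s then k else - k.

Definition rframe (i : I) (k : 'cV[R]_n.+1) (b : bool) : fn :=
  fun x => \sum_p rot b p * (ew (sgv p.1 k) x * u (i, p.2) x).

Let big_bool2 (F : bool * bool -> R[i]) :
  \sum_p F p = F (true, true) + F (true, false) + F (false, true) + F (false, false).
Proof.
transitivity (\sum_p F (p.1, p.2)); first by apply: eq_bigr => -[].
by rewrite -(pair_bigA _ (fun a b => F (a, b))) /= !big_bool /= addrA.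
Qed.

Let ii : 'i%C * 'i%C = -1 :> R[i].
Proof. by rewrite -expr2 sqr_i. Qed.

Let rotE (b : bool) (a : bool * bool -> R[i]) : \sum_p rot b p * a p =
  2^-1 * (if b then a (true, true) + a (false, true) - 'i%C * (a (true, false) - a (false, false))
  else a (true, false) + a (false, false) + 'i%C * (a (true, true) - a (false, true))).
Proof. by rewrite big_bool2 /rot; case: b => /=; ring. Qed.

Let conj2 : conjc (2^-1 : R[i]) = 2^-1.
Proof. by rewrite (_ : 2^-1 = (2^-1 : R)%:C%C) ?conjc_real // fmorphV rmorph_nat. Qed.

Let conji : conjc 'i%C = - 'i%C :> R[i].
Proof. by apply/eqP; rewrite eq_complex /= oppr0 !eqxx. Qed.

Let rotC b p : conjc (rot b p) = 2^-1 * (if b == p.2 then 1 else if b == p.1 then 'i%C else - 'i%C).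
Proof.
by rewrite /rot cjM conj2; case: ifP => _; [rewrite rmorph1|case: ifP => _; rewrite ?cjN conji ?opprK].
Qed.

Lemma rframe_test i k b : test (rframe i k b).
Proof. by apply: test_sum => p; apply: testZ; exact: test_ewM. Qed.

Lemma rframe_real i k b x : conjc (rframe i k b x) = rframe i k b x.
Proof.
rewrite /rframe !rotE /= !ewNl.
by case: b; rewrite !(cjM, cjD, cjN, conjcK, ru, conj2, conji); ring.
Qed.

Lemma rframe_ew i k b y x :
  ew y x * rframe i k b x = \sum_p rot b p * (ew (y + sgv p.1 k) x * u (i, p.2) x).
Proof.
by rewrite /rframe mulr_sumr; apply: eq_bigr => p _; rewrite ewDl; ring.
Qed.

(** The terms that pair opposite signs of [k] and [k'] cancel by the choice of the coefficients in
    [rot], whether or not the points involved coincide. The hypothesis [hE] equates the two terms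
    with equal signs, which then add up for [b = b'] and cancel otherwise. *)
Lemma rframe_inner i k b y i' k' b' y' : (y + k == y' + k') = (y - k == y' - k') -> duals P k -> duals P y -> duals P k' -> duals P y' ->
  inner (fun x => ew y x * rframe i k b x) (fun x => ew y' x * rframe i' k' b' x) =
  (i == i')%:R * (b == b')%:R * (y + k == y' + k')%:R.
Proof.
move=> hE hk hy hk' hy'; have sP := duals_subgroup P.
have hs s z l : duals P z -> duals P l -> duals P (z + sgv s l).
  by move=> hz hl; apply: subgroupD => //; case: s => //; exact: subgroupN.
rewrite (funext (rframe_ew i k b y)) (funext (rframe_ew i' k' b' y')).
have L a p z l j : L2 (fun x => rot a p * (ew (z + sgv p.1 l) x * u (j, p.2) x)).
  by apply: L2Z; apply: test_L2; exact: test_ewM.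
pose E s s' : R[i] := (y + sgv s k == y' + sgv s' k')%:R.
transitivity (\sum_p rot b p * \sum_p' conjc (rot b' p') * ((i == i')%:R * (p.2 == p'.2)%:R * E p.1 p'.1)).
  rewrite inner_suml => [|p _|]; [|exact: L| by apply: test_L2; apply: test_sum => p; apply: testZ; exact: test_ewM].
  apply: eq_bigr => p _; rewrite innerZl; last first.
  - by apply: test_L2; apply: test_sum => p'; apply: testZ; exact: test_ewM.
  - by apply: test_L2; exact: test_ewM.
  congr (_ * _); rewrite innerC inner_suml => [|p' _|]; [|exact: L|by apply: test_L2; exact: test_ewM].
  rewrite rmorph_sum; apply: eq_bigr => p' _.
  have Lp : L2 (fun x => ew (y + sgv p.1 k) x * u (i, p.2) x) by apply: test_L2; exact: test_ewM.
  have Lp' : L2 (fun x => ew (y' + sgv p'.1 k') x * u (i', p'.2) x) by apply: test_L2; exact: test_ewM.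
  have := innerZl (rot b' p') Lp' Lp; cbv beta => ->.
  rewrite [LHS]rmorphM; congr (_ * _).
  transitivity (inner (fun x => ew (y + sgv p.1 k) x * u (i, p.2) x) (fun x => ew (y' + sgv p'.1 k') x * u (i', p'.2) x)).
    exact: esym (innerC _ _).
  rewrite (ONsys_duals uP tu ou); try exact: hs.
  by rewrite -pair_eqE /= /E; case: (i == i'); case: (p.2 == p'.2) => //=; rewrite ?mul1r ?mul0r.
have Eff : E false false = E true true by rewrite /E /= hE.
rewrite -/(E true true); clearbody E; move: ((i == i')%:R : R[i]) => t.
rewrite !big_bool2 !rotC /rot; move: ('i%C : R[i]) ii => im im2.
by rewrite Eff; case: b; case: b' => /=; rewrite ?mulr0n ?mulr1n; field: im2.
Qed.

Definition real_frame (p : 'I_#|{: I * 'I_q * bool}|) : fn :=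
  rframe (enum_val p).1.1 (rep (enum_val p).1.2) (enum_val p).2.

Lemma real_frame_test p : test (real_frame p).
Proof. exact: rframe_test. Qed.

Let sP := duals_subgroup P.

Lemma real_frame_translates y z p p' : H y -> H z ->
  inner (translate y (ift (real_frame p))) (translate z (ift (real_frame p'))) = ((p == p') && (y == z))%:R.
Proof.
move=> Hy Hz; have [rG rI _] := repP.
have Hy' := subgroupN sH Hy; have Hz' := subgroupN sH Hz.
rewrite inner_translate; try exact: real_frame_test.
rewrite -(inj_eq enum_val_inj) /real_frame.
move: (enum_val p) (enum_val p') => [[i r] b] [[i' r'] b'] /=.
have rr s : (- y + sgv s (rep r) == - z + sgv s (rep r')) = (r == r') && (y == z).
  apply/eqP/andP => [h|[/eqP-> /eqP->] //].
  have hr : sgv s (rep r) - sgv s (rep r') = y - z.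
    by apply: (addrI (- y)); rewrite addrA h addKr -addrA subrr addr0.
  have e : r = r'.
    have Hyz : H (y - z) by exact: sH.2.
    apply: rI; case: s hr {h} => /= hr; first by rewrite hr.
    have -> : rep r - rep r' = - (y - z) by rewrite -hr opprK opprD opprK.
    exact: subgroupN.
  by move: h; rewrite e => /addIr/oppr_inj ->.
rewrite rframe_inner; [|by rewrite (rr true) (rr false)|exact: rG|exact: HG|exact: rG|exact: HG].
rewrite (rr true) !xpair_eqE -!natrM !mulnb; congr ((_ : bool)%:R).
by case: (i == i'); case: (b == b'); case: (r == r'); case: (y == z).
Qed.

(** Complex combinations diagonalise the rotation, with eigenvalues [ew k] and [ew (- k)]; this and
    [rframe_neg] recover the original modulates from the real pair. *)
Lemma rframe_pos i k x : rframe i k false x + 'i%C * rframe i k true x =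
  ew k x * (u (i, false) x + 'i%C * u (i, true) x).
Proof. by rewrite /rframe !rotE /=; move: ('i%C : R[i]) ii => im im2; field: im2. Qed.

Lemma rframe_neg i k x : rframe i k false x - 'i%C * rframe i k true x =
  ew (- k) x * (u (i, false) x - 'i%C * u (i, true) x).
Proof. by rewrite /rframe !rotE /=; move: ('i%C : R[i]) ii => im im2; field: im2. Qed.

Lemma real_frame_closure : L2_closure (TS H real_frame) = L2_closure (TS (duals P) u).
Proof.
have [rG rI rS] := repP.
apply/seteqP; split; apply: TS_closure_sub => //; try exact: real_frame_test.
- move=> y p Hy; rewrite (funext (rframe_ew _ _ _ _)); apply: lin_span_sum => c _.
  apply: lin_spanZ; apply: FS_gen; apply: subgroupD => //; first exact: HG.
  by case: c.1; [exact: rG|apply: subgroupN => //; exact: rG].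
- move=> y [i b] Gy.
  (* The modulate [ew y u] is split into its two eigencomponents. One carries [+ k], the other
     [- k], so the first takes a representative of [y] and the second one of [- y]. *)
  have [r hr] := rS _ Gy; have [r' hr'] := rS _ (subgroupN sP Gy).
  pose h (s : bool) := if s then y - rep r else y + rep r'.
  pose k (s : bool) := if s then rep r else rep r'.
  have Hh s : H (h s).
    by case: s => //=; rewrite -[_ + _]opprK opprD; exact: subgroupN.
  have yE s : y = h s + sgv s (k s) by case: s; rewrite /= ?subrK ?addrK.
  rewrite (_ : (fun x => _) = fun x => \sum_c rot b c * (ew (h c.1) x * real_frame (enum_rank (i, if c.1 then r else r', c.2)) x)).
    apply: lin_span_sum => c _; apply: lin_spanZ; exact: FS_gen.
  apply/funext => x.
  rewrite rotE /= /real_frame !enum_rankK /=.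
  have e1 := rframe_pos i (rep r) x; have e2 := rframe_neg i (rep r') x.
  move: (yE true) (yE false) => /= y1 y2.
  have f1 : ew y x * (u (i, false) x + 'i%C * u (i, true) x) =
      ew (y - rep r) x * (rframe i (rep r) false x + 'i%C * rframe i (rep r) true x).
    by rewrite e1 mulrA -ewDl -y1.
  have f2 : ew y x * (u (i, false) x - 'i%C * u (i, true) x) =
      ew (y + rep r') x * (rframe i (rep r') false x - 'i%C * rframe i (rep r') true x).
    by rewrite e2 mulrA -ewDl -y2.
  move: f1 f2; move: ('i%C : R[i]) ii => im im2.
  case: (b); move=> f1 f2.
  - rewrite (_ : ew y x * u (i, true) x = 2^-1 * (- im * (ew y x * (u (i, false) x + im * u (i, true) x))
      + im * (ew y x * (u (i, false) x - im * u (i, true) x)))); last by field: im2.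
    by rewrite f1 f2; field: im2.
  - rewrite (_ : ew y x * u (i, false) x = 2^-1 * (ew y x * (u (i, false) x + im * u (i, true) x)
      + ew y x * (u (i, false) x - im * u (i, true) x))); last by field.
    by rewrite f1 f2; field.
Qed.

End real_frames.

(** * The dilated system *)

Section dilated_frame.
Variables (A : 'M[R]_n.+1) (J : finType) (m : J -> 'I_n.+1 -> nat).
Hypothesis uA : A \in unitmx.
Local Notation uf P := (fun j => @uw R n P (m j)).

Lemma uw_mulmx (Q P : 'M[R]_n.+1) k : Q \in unitmx -> P \in unitmx -> exists c : R[i],
  (fun x => @uw R n P k ((invmx Q)^T *m x)) = fun x => c * @uw R n (Q^T *m P) k x.
Proof.
move=> uQ uP; have uQP : Q^T *m P \in unitmx by rewrite unitmx_mul unitmx_tr uQ.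
have IE : invmx (Q^T *m P) = invmx P *m (invmx Q)^T.
  by rewrite trmx_inv; apply: (can_inj (mulKmx uQP)); rewrite mulmxV // mulmxA mulmxK // mulmxV ?unitmx_tr.
exists (((Num.sqrt `|\det P|)^-1)%:C%C * ((Num.sqrt `|\det (Q^T *m P)|))%:C%C).
apply/funext => x; rewrite /uw IE -mulmxA -mulrA; congr (_ * _).
rewrite mulrA -rmorphM /= mulfV ?mul1r // gt_eqF // sqrtr_gt0 normr_gt0.
by rewrite -unitfE -unitmxE.
Qed.

Lemma translate_mulmx Q P y j : Q \in unitmx -> P \in unitmx -> exists c : R[i],
  (fun x => translate y (ift (uf P j)) (Q *m x)) =
  fun x => c * translate (invmx Q *m y) (ift (uf (Q^T *m P) j)) x.
Proof.
move=> uQ uP; have [c hc] := uw_mulmx (m j) uQ uP.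
have uQP : Q^T *m P \in unitmx by rewrite unitmx_mul unitmx_tr uQ.
exists ((`|\det Q|^-1)%:C%C * c); apply/funext => x; rewrite /translate.
rewrite -{1}[y](mulKVmx uQ) -mulmxBr.
have := congr1 (fun f => f (x - invmx Q *m y)) (ift_dil uQ (uw_test uP (m j))) => /= ->.
by rewrite hc iftZ ?mulrA //; apply: test_cintegrable; exact: uw_test.
Qed.

Lemma dual_mulmx P k : P \in unitmx -> A *m dual (A^T *m P) k = dual P k.
Proof.
move=> uP; have uAP : A^T *m P \in unitmx by rewrite unitmx_mul unitmx_tr uA.
rewrite /dual /latpt mulmxA; congr (_ *m _); apply: trmx_inj.
rewrite trmx_mul !trmxK; apply: (can_inj (mulmxK uP)).
by rewrite mulVmx // -mulmxA mulVmx.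
Qed.

(** Dilation by [A] amounts to replacing [P] by [A^T P], up to scalars in the generators, so the
    next finer space is produced by the same construction with another matrix. *)
Lemma scaled_frame P : P \in unitmx ->
  scaled A (L2_closure (TS (duals P) (uf P))) 1 =
  L2_closure (TS (duals (A^T *m P)) (uf (A^T *m P))).
Proof.
move=> uP; have uAP : A^T *m P \in unitmx by rewrite unitmx_mul unitmx_tr uA.
have uAi : invmx A \in unitmx by rewrite unitmx_inv.
have t0 j : test (uf P j) by exact: uw_test.
have t1 j : test (uf (A^T *m P) j) by exact: uw_test.
have c0 := TS_closed (duals P) t0; have c1 := TS_closed (duals (A^T *m P)) t1.
have EA (f : fn) : (fun x => f (A ^ (- 1) *m x)) = fun x => f (invmx A *m x) by rewrite exprN1.
apply/seteqP; split => f.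
- rewrite /scaled /= EA => hf.
  suff : [set h : fn | L2_closure (TS (duals (A^T *m P)) (uf (A^T *m P))) (fun x => h (A *m x))] (fun x => f (invmx A *m x)).
    by rewrite /= (_ : (fun x => f _) = f) //; apply/funext => x; rewrite mulKmx.
  apply: (span_closure_sub (closed_subspace_dil uA c1) _ hf) => -[y j] /= [k _ <-].
  have [c ->] := translate_mulmx (dual P k) j uA uP; apply: closed_subspaceZ => //.
  rewrite -(dual_mulmx k uP) mulKmx //.
  apply: (closure_gen (i := (dual (A^T *m P) k, j))) => [p _|]; first exact: translate_L2.
  by exists k.
- move=> hf; rewrite /scaled /= EA.
  apply: (span_closure_sub (closed_subspace_dil uAi c0) _ hf) => -[y j] /= [k _ <-].
  have [c ->] := translate_mulmx (dual (A^T *m P) k) j uAi uAP; apply: closed_subspaceZ => //.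
  rewrite invmxK dual_mulmx // mulmxA -trmx_mul mulmxV // trmx1 mul1mx.
  apply: (closure_gen (i := (dual P k, j))) => [p _|]; first exact: translate_L2.
  by exists k.
Qed.

End dilated_frame.

Lemma int_lattice_duals (P : 'M[R]_n.+1) (Pz : 'M[int]_n.+1) : P \in unitmx -> P = map_mx intr Pz ->
  int_lattice `<=` duals P.
Proof.
move=> uP PE _ [k _ <-]; exists (Pz^T *m k) => //.
rewrite /dual /latpt map_mxM -map_trmx -PE mulmxA -trmx_mul mulmxV //.
by rewrite trmx1 mul1mx.
Qed.

(** The adjugate clears denominators: P^-T times [|det P|] is, up to sign, the transposed adjugate
    of an integer matrix. *)
Lemma duals_int_lattice (P : 'M[R]_n.+1) (Pz : 'M[int]_n.+1) : P \in unitmx -> P = map_mx intr Pz ->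
  exists2 d : nat, (0 < d)%N & forall x, duals P x -> int_lattice (d%:R *: x).
Proof.
move=> uP PE; have dE : \det P = (\det Pz)%:~R by rewrite PE det_map_mx.
have dP : \det P != 0 by rewrite -unitfE -unitmxE.
have dz : \det Pz != 0 by apply: contra dP => /eqP h; rewrite dE h.
exists `|\det Pz|%N; first by rewrite absz_gt0.
move=> _ [k _ <-]; exists (sgz (\det Pz) *: ((\adj Pz)^T *m k)) => //.
rewrite /dual /latpt /invmx uP map_mxZ map_mxM -map_trmx map_mx_adj -PE.
rewrite linearZ /= -scalemxAl scalerA; congr (_ *: _).
rewrite dE -[(`|\det Pz|%N)%:R]/((`|\det Pz|%N : int)%:~R) abszE normrEsg intrM mulfK //.
by rewrite -dE.
Qed.

Lemma dilation_lattice_duals (A P : 'M[R]_n.+1) (Pz PBz : 'M[int]_n.+1) : P \in unitmx ->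
  P = map_mx intr Pz -> A^T *m P = map_mx intr PBz -> dilation_lattice A `<=` duals P.
Proof.
move=> uP PE PBE _ [k [k' _ <-] [l hl <-]]; apply: subgroupD; first exact: duals_subgroup.
  exists (PBz^T *m k') => //; rewrite /dual /latpt map_mxM -map_trmx -PBE trmx_mul trmxK.
  by rewrite !mulmxA -trmx_mul mulmxV // trmx1 mul1mx.
exact: (int_lattice_duals uP PE).
Qed.

Lemma int_lattice_dilation (A : 'M[R]_n.+1) : int_lattice `<=` dilation_lattice A.
Proof.
move=> l hl; have [Z0 _] := @int_lattice_subgroup R n; exists 0 => //.
by exists l => //; rewrite mulmx0 add0r.
Qed.

Lemma FS_modulate I (u : I -> fn) (G : set_V) y g : subgroup G -> (forall i, test (u i)) -> G y ->
  test g -> L2_closure (FS G u) g -> L2_closure (FS G u) (fun x => ew y x * g x).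
Proof.
move=> sG tu Gy tg /(L2_closureP _ (@FS_L2 R n G I u tu))[_ cg].
apply/(L2_closureP _ (@FS_L2 R n G I u tu)); split; first by apply: test_L2; exact: test_ewM.
move=> e /cg[_ [m [k [c [hk ->]]]] ge].
exists (fun x => \sum_i c i * (ew (y + (k i).1) x * u (k i).2 x)).
  exists m, (fun i => (y + (k i).1, (k i).2)), c; split=> // i.
  by apply: subgroupD => //; exact: hk.
rewrite (_ : nsq _ = nsq (fun x => g x - \sum_i c i * (ew (k i).1 x * u (k i).2 x))) //.
congr Rintegral; apply/funext => x.
have -> : ew y x * g x - \sum_i c i * (ew (y + (k i).1) x * u (k i).2 x) =
    ew y x * (g x - \sum_i c i * (ew (k i).1 x * u (k i).2 x)).
  by rewrite mulrBr mulr_sumr; congr (_ - _); apply: eq_bigr => i _; rewrite ewDl; ring.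
by rewrite Normc.normcM normc_expi mul1r.
Qed.

End frames.

(** * Construction *)

Section wavelet_frames.
Context (R : realType) (n : nat).
Local Notation fn := ('cV[R]_n.+1 -> R[i]).
Variables (A P : 'M[R]_n.+1) (Pz PBz : 'M[int]_n.+1) (d : 'I_n.+1 -> R) (rho : R).
Hypotheses (uA : A \in unitmx) (uP : P \in unitmx) (PE : P = map_mx intr Pz)
  (PBE : A^T *m P = map_mx intr PBz) (d0 : forall i, 0 < d i) (rho0 : 0 < rho) (rho1 : rho < 1).
Hypothesis contr : forall z, Qd d (invmx P *m (invmx A^T *m (P *m z))) <= rho * Qd d z.
Variables (M : nat) (Rr r_in r_out e : R).
Hypotheses (e0 : 0 < e) (r_in0 : 0 < r_in) (r_io : rho * r_out < r_in)
  (in_le : (1 + e) * r_in + (1 + e^-1) * (9 / 4 * \sum_i d i) <= Rr)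
  (out_le : (1 + e) * Rr + (1 + e^-1) * (9 / 4 * \sum_i d i) <= r_out)
  (M_big : 2 * (\sum_i Num.sqrt (r_in / d i)) + 1 < M%:R).
Hypothesis M_n : (n.+1 < M)%N.
Hypothesis Rr_n : n.+2%:R ^+ 2 * d ord0 <= Rr.

Local Notation J := (J0 d M Rr * bool)%type.
Local Notation P1 := (A^T *m P).
Local Notation u0 := (@uj R n d M Rr P).
Local Notation u1 := (@uj R n d M Rr P1).
Local Notation V := (V0 P d M Rr).

Let uP1 : P1 \in unitmx.
Proof. by rewrite unitmx_mul unitmx_tr uA. Qed.

Let t0 j : test (u0 j). Proof. exact: uj_test. Qed.
Let t1 j : test (u1 j). Proof. exact: uj_test. Qed.

(** The points [k] on axis 0 with [k < n.+2] are centres with [Qd <= (n.+2)^2 d_0 <= Rr], so at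
    least [n.+2] pairs of windows are selected. *)
Let card_J : (n.+1 < #|{: J}|)%N.
Proof.
have h0 (k : 'I_n.+2) : (k < M)%N by apply: leq_trans M_n; rewrite ltnS -ltnS.
have z0 : (0 < M)%N by apply: leq_trans M_n.
pose f (k : 'I_n.+2) : {ffun 'I_n.+1 -> 'I_M} := [ffun i => if i == ord0 then Ordinal (h0 k) else Ordinal z0].
have hf k : Qd d (centre R (f k)) <= Rr.
  apply: le_trans Rr_n; rewrite /Qd (bigD1 ord0) //= big1 ?addr0.
    rewrite mxE eqxx ffunE eqxx /= mulrC; apply: ler_wpM2r; first exact: ltW.
    by rewrite lerXn2r ?nnegrE // ler_nat ltnW.
  by move=> i i0; rewrite mxE ffunE (negPf i0) /= mul0r expr0n mulr0.
pose F (k : 'I_n.+2) : J := (exist _ (f k) (hf k), true).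
have := @leq_card _ _ F; rewrite card_ord; apply => k l [] /ffunP/(_ ord0).
by rewrite !ffunE eqxx => -[kl]; apply: val_inj.
Qed.

(** With [Qd z = r_in], the contraction read backwards gives [Qf >= r_in / rho > r_out] at
    [P1 *m z], beyond the reach of every [u0 j]. The squares of the windows sum to 1 at [z], so one
    of them is non-zero there, and it is among the selected ones by [in_le]. *)
Let far_point : exists2 x0, (forall j, u0 j x0 = 0) & exists j, u1 j x0 != 0.
Proof.
pose z : 'cV[R]_n.+1 := Num.sqrt (r_in / d ord0) *: delta_mx ord0 0.
have Qz : Qd d z = r_in.
  rewrite Qd_scale sqr_sqrtr ?divr_ge0 ?(ltW r_in0) ?(ltW (d0 _)) //.
  rewrite /Qd (bigD1 ord0) //= big1 ?addr0 => [|i i0]; rewrite mxE ?eqxx ?(negPf i0) /=.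
    by rewrite expr1n mulr1 divfK // gt_eqF.
  by rewrite expr0n mulr0.
have PzE : invmx P *m (invmx A^T *m (P1 *m z)) = z by rewrite -[P1 *m z]mulmxA mulKmx ?unitmx_tr // mulKmx.
exists (P1 *m z) => [j|].
  apply/eqP/negP => /negP /(uj_out d0 e0 out_le); apply/negP; rewrite -ltNge.
  rewrite -(ltr_pM2l rho0); apply: lt_le_trans r_io _.
  by have := Qf_contr uP contr (P1 *m z); rewrite {1}/Qf PzE Qz.
have zM : 2 * `|z| + 1 < M%:R.
  apply: le_lt_trans M_big; rewrite lerD2r ler_wpM2l //.
  by apply: Qd_bound => //; rewrite Qz.
have := sum_ww 0 zM; rewrite eqxx => s1.
have [[f b] wf] : exists p : {ffun 'I_n.+1 -> 'I_M} * bool, ww (mi p) z != 0 :> R[i].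
  apply: contrapT => h; move/eqP: s1; rewrite big1 => [|p _]; first by rewrite eq_sym oner_eq0.
  have [->|h'] := eqVneq (ww (mi p) z) (0 : R[i]); first by rewrite mul0r.
  by case: h; exists p.
have hf : Qd d (centre R f) <= Rr.
  have hs i : `| `|centre R f i 0| - `|z i 0| | <= 3 / 2 by rewrite distrC; exact: centre_near i wf.
  apply: le_trans (Qd_near d0 e0 hs) _; apply: le_trans in_le.
  by rewrite Qz.
exists (exist _ f hf, b); rewrite /uj /uw /= mulKmx // mulf_neq0 //.
rewrite -[0]/(0%:C)%C (inj_eq (@complexI R)) invr_eq0 gt_eqF // sqrtr_gt0 normr_gt0.
by rewrite -unitfE -unitmxE.
Qed.

Let ZP : int_lattice `<=` duals P := int_lattice_duals uP PE.
Let ZP1 : int_lattice `<=` duals P1 := int_lattice_duals uP1 PBE.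
Let sZ := @int_lattice_subgroup R n.

Let reps Q Qz H : Q \in unitmx -> Q = map_mx intr Qz -> subgroup H -> int_lattice `<=` H -> H `<=` duals Q ->
  exists q (rep : 'I_q -> 'cV[R]_n.+1), coset_reps H (duals Q) rep.
Proof.
move=> uQ QE sH ZH HQ; have [k k0 hk] := duals_int_lattice uQ QE.
exact: coset_reps_lattice k0 sH (duals_subgroup Q) ZH HQ hk.
Qed.

Lemma scaled_V1 : scaled A V 1 = L2_closure (TS (duals P1) u1).
Proof. exact: (@scaled_frame R n A J (fun j => mi (val j.1, j.2)) uA P uP). Qed.

Let cV : closed_subspace V. Proof. exact: V0_closed. Qed.

Lemma scaled_V_nested : V `<=` scaled A V 1.
Proof.
move=> f Vf; apply: (@Vj_nested R n A P d rho uA uP d0 rho0 contr M Rr r_in r_out e e0 r_io in_le out_le M_big 0).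
by rewrite scaled0.
Qed.

Lemma closure_perp I I' (u : I -> fn) (v : I' -> fn) w f : (forall i, test (u i)) -> (forall i, test (v i)) ->
  (forall y z i j, int_lattice y -> int_lattice z -> inner (translate y (ift (u i))) (translate z (ift (v j))) = 0) ->
  L2_closure (TS int_lattice u) w -> L2_closure (TS int_lattice v) f -> inner w f = 0.
Proof.
move=> tu tv uv cw cf; have [Lw _] := cw; have [Lf _] := cf.
have perp (I1 : Type) (u' : I1 -> fn) g h : (forall i, test (u' i)) -> L2 h ->
    (forall y i, int_lattice y -> inner (translate y (ift (u' i))) h = 0) ->
    L2_closure (TS int_lattice u') g -> inner g h = 0.
  move=> tu' Lh hg; apply: inner_closure_eq0 => //; first exact: TS_L2.
  move=> _ [m [k [c [hk ->]]]]; rewrite inner_suml // => [|i _]; last by apply: L2Z; exact: translate_L2.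
  by rewrite big1 // => i _; rewrite innerZl //; [rewrite hg ?mulr0 //; exact: hk|exact: translate_L2].
apply: (perp _ u) => // y i hy; rewrite innerC.
rewrite (perp _ v) ?conjc0 //; first exact: translate_L2.
by move=> z j hz; rewrite innerC uv // conjc0.
Qed.

Lemma wavelet_frame : exists L (psi : 'I_L -> fn),
  [/\ forall l, test (psi l), L2_closure (TS int_lattice psi) `<=` scaled A V 1,
    forall w v, L2_closure (TS int_lattice psi) w -> V v -> inner w v = 0,
    scaled A V 1 `<=` L2_closure (lin_span (V `|` L2_closure (TS int_lattice psi)) id) &
    forall y z i j, int_lattice y -> int_lattice z ->
      inner (translate y (ift (psi i))) (translate z (ift (psi j))) = ((i == j) && (y == z))%:R].
Proof.
have [q [rep repP]] := reps uP PE sZ (@subset_refl _ _) ZP.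
have [q1 [rep1 rep1P]] := reps uP1 PBE sZ (@subset_refl _ _) ZP1.
pose phi := sub_frame u0 rep; pose chi := sub_frame u1 rep1.
have tp i : test (phi i) by exact: (sub_frame_test t0).
have tc i : test (chi i) by exact: (sub_frame_test t1).
have Vphi : V = L2_closure (TS int_lattice phi) by rewrite (sub_frame_closure t0 sZ ZP repP).
have Vchi : scaled A V 1 = L2_closure (TS int_lattice chi).
  by rewrite scaled_V1 (sub_frame_closure t1 sZ ZP1 rep1P).
have op : ONsys 1%:M phi by exact: (sub_frame_ON uP t0 (ONsys_uj uP) ZP repP erefl).
have oc : ONsys 1%:M chi by exact: (sub_frame_ON uP1 t1 (ONsys_uj uP1) ZP1 rep1P erefl).
have Z0 : int_lattice (0 : 'cV[R]_n.+1) by case: sZ.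
have translate0 (f : fn) : translate 0 f = f by apply/funext => x; rewrite /translate subr0.
have cl i : L2_closure (FS int_lattice chi) (phi i).
  apply: FS_closure => //; rewrite -Vchi; apply: scaled_V_nested; rewrite Vphi -[ift _]translate0.
  by apply: (closure_gen (i := (0, i))) => // p _; exact: translate_L2.
have [x0 px0 [j cx0]] := far_point.
have [i0 _] : exists i0 : 'I_q1, True.
  have [_ _ rS] := rep1P; have [r _] := rS 0 (ZP1 Z0); by exists r.
have x0P : exists x0, (forall i, phi i x0 = 0) /\ exists j, chi j x0 != 0.
  exists x0; split=> [i|]; first by rewrite /phi /sub_frame px0 mulr0.
  exists (enum_rank (j, i0)); rewrite /chi /sub_frame enum_rankK /= mulf_neq0 //.
  by apply/eqP => h; have := normc_ew (rep1 i0) x0; rewrite h Normc.normc0 => /esym/eqP; rewrite oner_eq0.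
(* Both families are indexed by [J] times the cosets of Z^n, so both sizes are multiples of the size
   of [J], which exceeds [n.+1]. *)
have Nm : (#|{: J}| %| #|{: J * 'I_q}|)%N by rewrite [X in (_ %| X)%N]card_prod dvdn_mulr.
have Nq : (#|{: J}| %| #|{: J * 'I_q1}|)%N by rewrite [X in (_ %| X)%N]card_prod dvdn_mulr.
have [L [psi [tpsi opsi pp cpsi res]]] := frame_completion tp tc op oc cl x0P card_J Nm Nq.
have uI : (1%:M : 'M[R]_n.+1) \in unitmx := unitmx1 R n.+1.
have pin y z i l : int_lattice y -> int_lattice z ->
    inner (translate y (ift (psi i))) (translate z (ift (psi l))) = ((i == l) && (y == z))%:R.
  by rewrite -duals1; exact: ONsys_translates.
have Wsub : L2_closure (TS int_lattice psi) `<=` scaled A V 1.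
  rewrite Vchi; apply: span_closure_sub; first exact: TS_closed.
  move=> [y l] /= hy; rewrite translateE; apply: closure_ift => //; [|exact: test_ewM|].
    by move=> z; exact: subgroupN.
  by apply: FS_modulate => //; exact: subgroupN.
have Wperp w v : L2_closure (TS int_lattice psi) w -> V v -> inner w v = 0.
  rewrite Vphi; apply: closure_perp => // y z l i [k _ <-] [k' _ <-].
  rewrite inner_translate // innerE -[RHS](cint_per0 (@chi0_test R n) (@per_chi0 R n) (k - k') (test_conjM (tpsi l) (tp i)) (pp l i)).
  congr cint; apply/funext => x; rewrite map_mxB !(ewDl, ewNl) !cjM !conjcK; ring.
exists L, psi; split=> //.
have cW : closed_subspace (L2_closure (TS int_lattice psi)) by exact: TS_closed.
have cX := closed_join cV cW.
(* Integer translates of smooth periodic combinations stay in the closed span of a system. Used once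
   for [phi] and once for [psi], this puts each translate of [chi k] into the join. *)
have half (I : finType) (s v : I -> fn) y : (forall i, good (s i)) -> (forall i, test (v i)) -> int_lattice y ->
    L2_closure (TS int_lattice v) (translate y (ift (fun x => \sum_i s i x * v i x))).
  move=> gs tv hy.
  have ts : test (fun x => \sum_i s i x * v i x).
    by apply: test_sum => i; apply: testMl => //; have [] := good_periodic (gs i).
  rewrite translateE; apply: closure_ift => //; [by move=> z; exact: subgroupN|exact: test_ewM|].
  apply: FS_modulate => //; first exact: subgroupN.
  rewrite -duals1; apply: frame_closure => // i; first by have [] := good_periodic (gs i).
  by have [] := good_periodic (gs i).
rewrite Vchi; apply: (span_closure_sub cX) => -[y k] /= hy.
have [s [t [gs gt E]]] := res k; rewrite (funext E).
have [_ _ Xlin _] := cX.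
have h1 := half _ s phi y gs tp hy; have h2 := half _ t psi y gt tpsi hy.
rewrite -Vphi in h1; have := Xlin 1 _ _ (join_subl cV cW h1) (join_subr cV cW h2).
rewrite (_ : (fun x => 1 * _ + _) = translate y (ift (fun x => \sum_i s i x * phi i x + \sum_l t l x * psi l x))) //.
apply/funext => x; rewrite mul1r /translate -iftD //; apply: test_cintegrable.
  by apply: test_sum => i; apply: testMl => //; have [] := good_periodic (gs i).
by apply: test_sum => i; apply: testMl => //; have [] := good_periodic (gt i).
Qed.

Lemma scaling_frame : exists N (phi : 'I_N -> fn),
  [/\ forall i, test (phi i), forall i x, conjc (phi i x) = phi i x &
    scaling_functions (dilation_lattice A) (fun i => ift (phi i)) V].
Proof.
have sG := dilation_lattice_subgroup A.
have GP := dilation_lattice_duals uP PE PBE.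
have [q [rep repP]] := reps uP PE sG (@int_lattice_dilation R n A) GP.
have ru j x : conjc (u0 j x) = u0 j x by exact: uw_real.
pose phi := real_frame u0 rep.
have tp i : test (phi i) by exact: (real_frame_test t0).
have Vphi : V = L2_closure (TS (dilation_lattice A) phi).
  by rewrite (real_frame_closure t0 sG GP repP).
have gen y i : dilation_lattice A y -> V (translate y (ift (phi i))).
  move=> hy; rewrite Vphi; apply: (closure_gen (i := (y, i))) => // p _; exact: translate_L2.
exists _, phi; split=> //; first by move=> i x; exact: rframe_real.
split.
  move=> i; have [G0 _] := sG; have := gen 0 i G0; congr V.
  by apply/funext => x; rewrite /translate subr0.
have pin := real_frame_translates uP t0 (ONsys_uj uP) sG GP repP.
split.
- by move=> [y i] /= hy; exact: gen.
- by move=> [y i] /= hy; rewrite pin // !eqxx.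
- move=> [y i] [z k] /= hy hz yz; rewrite pin //; case: (eqVneq i k) => [ik|//].
  by case: eqP => // yz'; case: yz; rewrite ik yz'.
- by rewrite Vphi.
Qed.

Lemma V_union_perp : (forall g, test g -> exists j, scaled A V j (ift g)) /\
  (forall g, test_off0 g -> exists j : nat, forall f, scaled A V (- j%:Z) f -> inner f (ift g) = 0).
Proof.
split=> g tg.
- exact: (@Vj_union R n A P d rho uA uP d0 rho0 rho1 contr M Rr r_in e e0 r_in0 in_le M_big g tg).
- exact: (@Vj_perp R n A P d rho uA uP d0 rho0 rho1 contr M Rr r_out e e0 out_le g tg).
Qed.

End wavelet_frames.

Theorem theorem1p3 (R : realType) (n : nat) (A : 'M[R]_n.+1)
    (A_expansive : expansive A)
    (A_rational : forall i j, exists q : rat, A i j = ratr q) :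
  exists (L : nat) (psi : 'I_L -> 'cV[R]_n.+1 -> R[i]),
    [/\ orthonormal_wavelet A psi,
        forall l, schwartz (psi l),
        exists (N : nat) (V : int -> set ('cV[R]_n.+1 -> R[i]))
            (phi : 'I_N -> 'cV[R]_n.+1 -> R[i]),
          [/\ is_MRA A (dilation_lattice A) N V,
              associated psi V,
              scaling_functions (dilation_lattice A) phi (V 0) &
              forall i,
                [/\ schwartz (phi i), smooth (fourier (phi i)),
                    real_valued (fourier (phi i)) &
                    compact_support (fourier (phi i))]] &
        forall l, smooth (fourier (psi l)) /\
                  compact_support (fourier (psi l))].
Proof.
have [P [Pz [PBz [d [rho [uA uP PE PBE [d0 [/andP[rho0 rho1] contr]]]]]]]] :=
  contractive_lattice A_expansive A_rational.
(* The lower bound requested for [Rr] makes the ellipsoid contain the centres counted in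
   [card_J]. *)
have [Rr [r_in [r_out [e [e0 Rr_n r_in0 r_io [in_le out_le]]]]]] :=
  radii d0 rho0 rho1 (n.+2%:R ^+ 2 * d ord0).
(* The first bound provides all windows that meet the ellipsoid of radius [r_in], the second leaves
   room for [n.+2] centres along an axis. *)
pose M := maxn (Num.bound (2 * (\sum_i Num.sqrt (r_in / d i)) + 1)) n.+2.
have M_n : (n.+1 < M)%N by rewrite leq_maxr.
have M_big : 2 * (\sum_i Num.sqrt (r_in / d i)) + 1 < M%:R.
  apply: lt_le_trans (archi_boundP _) _.
    by rewrite addr_ge0 // mulr_ge0 // sumr_ge0 // => i _; rewrite sqrtr_ge0.
  by rewrite ler_nat leq_maxl.
have [L [psi [tpsi Wsub Wperp V1sub pin]]] :=
  wavelet_frame uA uP PE PBE d0 rho0 contr e0 r_in0 r_io in_le out_le M_big M_n Rr_n.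
have [N [phi [tphi rphi sphi]]] := scaling_frame d uP PE PBE M Rr.
have [Vunion Vperp] := V_union_perp uA uP d0 rho0 rho1 contr e0 r_in0 in_le out_le M_big.
have cV : closed_subspace (V0 P d M Rr) by exact: V0_closed.
have nested : V0 P d M Rr `<=` scaled A (V0 P d M Rr) 1.
  by move=> f; exact: (scaled_V_nested uA uP d0 rho0 contr e0 r_io in_le out_le M_big).
have fourierK g : test g -> fourier (ift g) = g.
  by move=> /invertible_test[_ _ h]; apply/funext.
have csupp (g : 'cV[R]_n.+1 -> R[i]) : test g -> compact_support g.
  by move=> [_ [K gK]]; exact: compact_support_bounded gK.
exists L, (fun l => ift (psi l)); split.
- exact: (wavelet_psi uA cV nested tpsi Wsub Wperp V1sub pin Vunion Vperp).
- by move=> l; exact: schwartz_ift.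
- exists N, (scaled A (V0 P d M Rr)), (fun i => ift (phi i)).
  have sphi' : scaling_functions (dilation_lattice A) (fun i => ift (phi i)) (scaled A (V0 P d M Rr) 0).
    by rewrite scaled0.
  split=> //.
  + split.
    * exact: dilation_lattice_full.
    * by move=> j; exact: scaled_closed.
    * exact: (scaled_nested uA nested).
    * exact: scaled_cap.
    * exact: scaled_dense.
    * by move=> j f; rewrite scaled0; split=> h; exact/(scaled_pow uA _ j f).
    * by exists (fun i => ift (phi i)).
  + exact: associated_psi.
  + move=> i; rewrite fourierK //; split.
    * exact: schwartz_ift.
    * by apply: csmooth_smooth; case: (tphi i).
    * by move=> x; have /eqP := rphi i x; case: (phi i x) => a b; rewrite eq_complex /= => /andP[_ /eqP]; lra.
    * exact: csupp.
- move=> l; rewrite fourierK //; split; last exact: csupp.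
  by apply: csmooth_smooth; case: (tpsi l).
Qed.
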